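(* Let $(X,X_* )$ be a dual pairing and let ${\bf T}=(T(t))_{t>0}\subset\mathcal B_w(X)$ be a semigroup which is weakly continuous with respect to $(X,X_* )$. Let $\mu\in\mathcal M_{\omega_{\bf T}}$. Then for every character $\chi$ of $\mathcal I_{\bf T}$, $$\tilde\chi\left(\int_0^{+\infty}T(t)d\mu(t)\right)=\mathcal L(\mu)(-\tilde\chi(A_{{\bf T},\mathcal I_{\bf T}})).$$ Similarly, for $\mu\in\mathcal M_{\tilde\omega_{\bf T}}$ and every character $\chi$ of $\mathcal I_{\bf T}$, $$\tilde\chi\left(\int_0^{+\infty}T(t)d\mu(t)\right)=\mathcal L(\mu)(-\tilde\chi(A_{{\bf T},\mathcal I_{\bf T}}))=\mathcal L(\mu)(-\tilde\chi(A_{{\bf T},\mathcal J_{\bf T}})).$$ In particular $\tilde\chi(T(t))=e^{\tilde\chi(A_{{\bf T},\mathcal I_{\bf T}})t}$ for $t>0$.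
   Context: Dual pairing $(X,X_* )$: $X$ is a Banach space, $X_*$ a linear subspace of the dual $X'$ such that (1) $\|x\|=\sup\{|\langle x,l\rangle| : l\in X_*,\|l\|\le1\}$ for all $x\in X$; (2) the $\sigma(X,X_* )$-closed convex hull of every $\sigma(X,X_* )$-compact subset of $X$ is $\sigma(X,X_* )$-compact. $\mathcal B_w(X)$ is the set of $R\in\mathcal B(X)$ with $l\circ R\in X_*$ for all $l\in X_*$. A semigroup ${\bf T}=(T(t))_{t>0}\subset\mathcal B_w(X)$ ($T(s+t)=T(s)T(t)$) is weakly continuous with respect to $(X,X_* )$ if $t\mapsto\langle T(t)x,l\rangle$ is continuous on $(0,+\infty)$ for all $x\in X,l\in X_*$. $\omega_{\bf T}(t)=\|T(t)\|$, $\rho_{\bf T}=\lim_{t\to+\infty}\|T(t)\|^{1/t}$ (with $\log 0=-\infty$). For a lower semicontinuous submultiplicative weight $\omega$ on $(0,+\infty)$, $\mathcal M_\omega$ is the convolution algebra of regular measures $\mu$ on $(0,+\infty)$ with $\int\omega\,d|\mu|<+\infty$, and $L^1_\omega$ its ideal of absolutely continuous measures. For $\mu\in\mathcal M_{\omega_{\bf T}}$, $\phi_{\bf T}(\mu)=\int_0^{+\infty}T(t)d\mu(t)\in\mathcal B(X)$ is determined by $\langle\phi_{\bf T}(\mu)x,l\rangle=\int_0^{+\infty}\langle T(t)x,l\rangle d\mu(t)$. $X_1$ is the norm closure of $\bigcup_{t>0}T(t)(X)$; $\phi_{\bf T}(\mu)$ is regarded as an element of $\mathcal B(X_1)$. The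 Arveson ideal $\mathcal I_{\bf T}$ is the closure of $\phi_{\bf T}(L^1_{\omega_{\bf T}})$ in $\mathcal B(X_1)$; it is an ideal of the closure $\mathcal A_{\bf T}$ of $\phi_{\bf T}(\mathcal M_{\omega_{\bf T}})$, whose elements are viewed as multipliers of $\mathcal I_{\bf T}$. For a commutative Banach algebra $\mathcal U$: $\Omega(\mathcal U)=\{u : u\,\mathcal U\text{ dense in }\mathcal U\}$; $\mathcal M(\mathcal U)$ is the multiplier algebra (bounded linear $S$ with $S(uv)=(Su)v$) with operator norm. If $\Omega(\mathcal U)\ne\emptyset$ and $u\,\mathcal U\ne\{0\}$ for $u\ne0$, a quasimultiplier is a partially defined operator $S_{u/v}=u/v$ ($u\in\mathcal U,v\in\Omega(\mathcal U)$) with domain $\{x : ux\in v\,\mathcal U\}$, $S_{u/v}x$ being the unique $y$ with $ux=vy$; these form the algebra $\mathcal{QM}(\mathcal U)\cong\mathcal U/\Omega(\mathcal U)$, containing $\mathcal M(\mathcal U)$. Normalized Arveson ideal: with $T(0)u=u$, fix $\lambda>\log\rho_{\bf T}$; $\mathcal L_{\bf T}=\{u\in\mathcal I_{\bf T} : \limsup_{t\to0^+}\|T(t)u\|<+\infty\}$ is a Banach algebra for $\|u\|_\lambda=\sup_{s\ge0}e^{-\lambda s}\|T(s)u\|$; $\mathcal U_{\bf T}$ is the closure of $\bigcup_{t>0}T(t)\mathcal I_{\bf T}$ in it; $\mathcal J_{\bf T}$ is the closure of $\mathcal I_{\bf T}$ (acting by multiplication on $\mathcal U_{\bf T}$) in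 $\mathcal M(\mathcal U_{\bf T})$, with that operator norm. Restriction to $\mathcal U_{\bf T}$ identifies $\mathcal M(\mathcal J_{\bf T})$ with $\mathcal M(\mathcal U_{\bf T})$, so $T(t)\in\mathcal M(\mathcal J_{\bf T})$. For $a\in\Omega(\mathcal U_{\bf T})$ the map $S_{u/v}\mapsto S_{au/av}$ is an isomorphism $\mathcal{QM}(\mathcal J_{\bf T})\to\mathcal{QM}(\mathcal I_{\bf T})$ by which these algebras are identified. $\tilde\omega_{\bf T}(t)=\|T(t)\|_{\mathcal M(\mathcal J_{\bf T})}$, and for $\mu\in\mathcal M_{\tilde\omega_{\bf T}}$, $\tilde\phi_{\bf T}(\mu)=\int_0^{+\infty}T(t)d\mu(t)\in\mathcal M(\mathcal J_{\bf T})$ is $\tilde\phi_{\bf T}(\mu)u=\int_0^{+\infty}T(t)u\,d\mu(t)$ ($u\in\mathcal J_{\bf T}$). Generators: $A_{{\bf T},\mathcal I_{\bf T}}=-\phi_{\bf T}(f_0')/\phi_{\bf T}(f_0)\in\mathcal{QM}(\mathcal I_{\bf T})$ for any $f_0\in\mathcal C^1([0,+\infty))\cap\Omega(L^1_{\omega_{\bf T}})$ with $f_0(0)=0$, $f_0'\in L^1_{\omega_{\bf T}}$; $A_{{\bf T},\mathcal J_{\bf T}}=-\tilde\phi_{\bf T}(g_0')/\tilde\phi_{\bf T}(g_0)\in\mathcal{QM}(\mathcal J_{\bf T})$ for any $g_0\in\mathcal C^1([0,+\infty))\cap\Omega(L^1_{\tilde\omega_{\bf T}})$ with $g_0(0)=0$,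 $g_0'\in L^1_{\tilde\omega_{\bf T}}$ (independent of choices). Every character $\chi$ of $\mathcal I_{\bf T}$ extends uniquely to a character $\tilde\chi$ of $\mathcal{QM}(\mathcal I_{\bf T})$: $\tilde\chi(S_{u/v})=\chi(u)/\chi(v)$. $\mathcal L(\mu)(z)=\int_0^{+\infty}e^{-zt}d\mu(t)$ is the Laplace transform. *)

(* Defs.v *)
From HB Require Import structures.
From mathcomp Require Import all_boot all_order all_algebra.
From mathcomp Require Import all_classical all_reals all_analysis.
From mathcomp Require Import complex.
Set Implicit Arguments.
Unset Strict Implicit.
Unset Printing Implicit Defensive.
Import Order.TTheory GRing.Theory Num.Theory.
Import numFieldNormedType.Exports.
Local Open Scope classical_set_scope.
Local Open Scope ring_scope.

(* Norms of normed spaces over R[i] take values in R[i]; [nrm] is the same norm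
   with values in R. *)
Definition nrm (R : realType) (V : normedZmodType R[i]) (x : V) : R :=
  complex.Re `|x|.

Definition Rpos (R : realType) : set R := `]0, +oo[%classic.
Arguments Rpos : clear implicits.

Definition cexp (R : realType) (z : R[i]) : R[i] :=
  Complex (expR (complex.Re z) * cos (complex.Im z))
          (expR (complex.Re z) * sin (complex.Im z)).

Definition cmeasurable (R : realType) (D : set R) (f : R -> R[i]) : Prop :=
  measurable_fun (D : set (measurableTypeR R)) (fun t => complex.Re (f t)) /\
  measurable_fun (D : set (measurableTypeR R)) (fun t => complex.Im (f t)).

Definition cintegral (R : realType)
    (nu : {measure set (measurableTypeR R) -> \bar R})
    (D : set R) (f : R -> R[i]) : R[i] :=
  Complex (\int[nu]_(t in D) complex.Re (f t))
          (\int[nu]_(t in D) complex.Im (f t)).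

(* A regular complex measure mu on (0,+oo), which need not have finite total
   variation, given by its polar decomposition dmu = cm_phase d|mu|.  A Borel
   measure on (0,+oo) that is finite on compact sets is regular. *)
Record cmeasure (R : realType) := CMeasure {
  cm_abs : {measure set (measurableTypeR R) -> \bar R} ;
  cm_phase : R -> R[i] ;
  cm_abs_supp : cm_abs `]-oo, 0]%classic = 0%E ;
  cm_abs_locfin : forall a b : R, 0 < a -> (cm_abs `[a, b]%classic < +oo)%E ;
  cm_phase_measurable : cmeasurable setT cm_phase ;
  cm_phase_norm : forall t, nrm (cm_phase t) = 1 }.

Definition in_weighted (R : realType) (omega : R -> R) (mu : cmeasure R) : Prop :=
  (\int[cm_abs mu]_(t in Rpos R) (omega t)%:E < +oo)%E.

Definition laplace (R : realType) (mu : cmeasure R) (z : R[i]) : R[i] :=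
  cintegral (cm_abs mu) (Rpos R)
    (fun t => cexp (- (z * t%:C%C)) * cm_phase mu t).

(* A normed space is given by a subset D of some module V and a norm
   nV : V -> R, of which only the values on D matter. *)
Definition oper_norm (R : realType) (V W : Type) (D : set V)
    (nV : V -> R) (nW : W -> R) (S : V -> W) : R :=
  sup [set nW (S x) | x in [set x | D x /\ nV x <= 1]].

Definition bounded_oper (R : realType) (V W : lmodType R[i])
    (D : set V) (E : set W) (nV : V -> R) (nW : W -> R) (S : V -> W) : Prop :=
  [/\ forall x, D x -> E (S x),
      forall (a : R[i]) x y, D x -> D y -> S (a *: x + y) = a *: S x + S y &
      exists M : R, forall x, D x -> nW (S x) <= M * nV x].

(* An operator with domain D is represented by a function on all of V that
   vanishes off D, so that equality of operators is equality of functions. *)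
Definition restr (V : Type) (W : nmodType) (D : set V) (S : V -> W) : V -> W :=
  patch (fun=> 0) D S.

Record nalg (R : realType) (V : lmodType R[i]) := NAlg {
  acar : set V ;
  amul : V -> V -> V ;
  anorm : V -> R }.

Section NormedAlgebras.
Context {R : realType} {V : lmodType R[i]}.
Implicit Types (A : nalg V) (u v : V) (G : set (V * V)) (chi : V -> R[i]).

Definition nclosure A (E : set V) : set V :=
  [set u | acar A u /\
    forall e : R, 0 < e -> exists2 v, E v & anorm A (u - v) < e].

Definition Omega A : set V :=
  [set u | acar A u /\
    acar A `<=` nclosure A [set amul A u v | v in acar A]].

Definition multiplier A : set (V -> V) :=
  [set S | [/\ bounded_oper (acar A) (acar A) (anorm A) (anorm A) S,
    forall u v, acar A u -> acar A v -> S (amul A u v) = amul A (S u) v &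
    forall x, ~ acar A x -> S x = 0]].

Definition mult_alg A : nalg ((V -> V) : lmodType R[i]) :=
  NAlg (multiplier A) (fun S1 S2 => S1 \o S2)
       (oper_norm (acar A) (anorm A) (anorm A)).

(* Partially defined operators on A are identified with their graphs. *)

(* x |-> the y such that S1 x = S2 y *)
Definition quot_graph A (S1 S2 : V -> V) : set (V * V) :=
  [set p | [/\ acar A p.1, acar A p.2 & S1 p.1 = S2 p.2]].

(* the quasimultiplier u/v *)
Definition qmult A u v : set (V * V) := quot_graph A (amul A u) (amul A v).

(* a multiplier as a quasimultiplier *)
Definition mult_graph A (S : V -> V) : set (V * V) :=
  [set p | acar A p.1 /\ p.2 = S p.1].

Definition character A chi : Prop :=
  [/\ forall (a : R[i]) u v, acar A u -> acar A v ->
        chi (a *: u + v) = a * chi u + chi v,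
      forall u v, acar A u -> acar A v -> chi (amul A u v) = chi u * chi v &
      exists2 u, acar A u & chi u != 0].

(* the extension of chi to QM(A) *)
Definition chi_ext A chi G : R[i] :=
  xget 0 [set z | exists u v,
    [/\ acar A u, Omega A v, G = qmult A u v & z = chi u / chi v]].

(* w is the Bochner integral of F : (0,+oo) -> A against the measure h dnu *)
Definition bochner A (nu : {measure set (measurableTypeR R) -> \bar R})
    (h : R -> R[i]) (F : R -> V) (w : V) : Prop :=
  acar A w /\ forall e : R, 0 < e ->
  exists (n : nat) (E : 'I_n -> set (measurableTypeR R)) (c : 'I_n -> V),
  let s := fun t : R => \sum_(i < n) (\1_(E i) t : R)%:C%C *: c i in
  [/\ forall i, [/\ measurable (E i), E i `<=` Rpos R, acar A (c i) &
        (\int[nu]_(t in E i) (nrm (h t))%:E < +oo)%E],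
      measurable_fun (Rpos R : set (measurableTypeR R))
        (fun t => anorm A (F t - s t)),
      (\int[nu]_(t in Rpos R) (anorm A (F t - s t) * nrm (h t))%:E < e%:E)%E &
      anorm A (\sum_(i < n) cintegral nu (E i) h *: c i - w) < e].

End NormedAlgebras.

(* Absolutely continuous measures f(t)dt on (0,+oo) are given by their
   densities f, of which only the values on (0,+oo) matter. *)
Definition L1 (R : realType) (omega : R -> R) :
    nalg ((R -> R[i]^o) : lmodType R[i]) :=
  @NAlg R ((R -> R[i]^o) : lmodType R[i])
    [set f | cmeasurable (Rpos R) f /\
      (\int[lebesgue_measure]_(t in Rpos R) (nrm (f t) * omega t)%:E < +oo)%E]
    (fun f g t => cintegral lebesgue_measure `]0, t[
       (fun s => (f (t - s) : R[i]) * g s))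
    (fun f => \int[lebesgue_measure]_(t in Rpos R) (nrm (f t) * omega t)).

(* f is in C^1([0,+oo)) with derivative f' *)
Definition C1_with_deriv (R : realType) (f f' : R -> R[i]) : Prop :=
  forall p : R[i] -> R, p = @complex.Re R \/ p = @complex.Im R ->
  [/\ {within `[0, +oo[, continuous (p \o f')},
      forall t : R, 0 < t -> is_derive t 1 (p \o f) (p (f' t)) &
      h^-1 * (p (f h) - p (f 0)) @[h --> 0^'+] --> p (f' 0)].

Definition gen_function (R : realType) (omega : R -> R) (f f' : R -> R[i]) : Prop :=
  [/\ C1_with_deriv f f', Omega (L1 omega) f, f 0 = 0 & acar (L1 omega) f'].

Section DualPairing.
Context {R : realType} {X : completeNormedModType R[i]}.
Variables (Xs : set (X -> R[i]^o)) (T : R -> X -> X).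

Definition opnormX (S : X -> X) : R := oper_norm setT (@nrm R X) (@nrm R X) S.

Definition dnorm (l : X -> R[i]^o) : R :=
  oper_norm setT (@nrm R X) (@nrm R R[i]^o) l.

(* the topology sigma(X, X_* ), for which X embeds in the product of the
   copies of R[i] indexed by X_* *)
Definition evalXs (x : X) : prod_topology (fun _ : set_type Xs => R[i]^o) :=
  fun l => \val l x.

Definition sigma : topologicalType := initial_topology evalXs.

Definition sigma_hull (K : set sigma) : set sigma :=
  \bigcap_(A in [set A : set sigma |
    [/\ K `<=` A, closed A & convex_set (A : set (convex_lmodType X))]]) A.

Definition dual_pairing : Prop :=
  [/\ (forall l, Xs l -> linear l /\ continuous l),
      (Xs (fun=> 0) /\
       forall (a : R[i]) l m, Xs l -> Xs m -> Xs (fun x => a *: l x + m x)),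
      (forall x : X, nrm x =
         sup [set nrm (l x) | l in [set l | Xs l /\ dnorm l <= 1]]) &
      forall K : set sigma, compact K -> compact (sigma_hull K)].

Definition Bw (S : X -> X) : Prop :=
  [/\ linear S, continuous S & forall l, Xs l -> Xs (l \o S)].

Definition semigroup : Prop :=
  (forall t, 0 < t -> Bw (T t)) /\
  (forall s t, 0 < s -> 0 < t -> T (s + t) = T s \o T t).

Definition weakly_continuous : Prop :=
  forall (x : X) l, Xs l -> forall t : R, 0 < t ->
    {for t, continuous (fun s : R => l (T s x))}.

Definition omegaT (t : R) : R := opnormX (T t).

Definition rhoT : R := lim (omegaT t `^ t^-1 @[t --> +oo]).

(* phi nu h is the operator given by integrating T(t) against the measure
   h dnu: <phi nu h x, l> is the integral of <T(t)x, l> h(t) dnu(t). *)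
Definition phi (nu : {measure set (measurableTypeR R) -> \bar R})
    (h : R -> R[i]) (x : X) : X :=
  xget 0 [set y | forall l, Xs l ->
    l y = cintegral nu (Rpos R) (fun t => (l (T t x) : R[i]) * h t)].

Definition X1 : set X := closure (\bigcup_(t in Rpos R) range (T t)).

Definition BX1 : nalg ((X -> X) : lmodType R[i]) :=
  @NAlg R ((X -> X) : lmodType R[i])
    [set S | bounded_oper X1 X1 (@nrm R X) (@nrm R X) S /\
             forall x, ~ X1 x -> S x = 0]
    (fun S1 S2 => S1 \o S2)
    (oper_norm X1 (@nrm R X) (@nrm R X)).

(* phi as a map into B(X_1), on measures h dnu and on densities f *)
Definition phi1 nu h : X -> X := restr X1 (phi nu h).
Definition phiL1 (f : R -> R[i]) : X -> X := phi1 lebesgue_measure f.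

Definition arveson : nalg ((X -> X) : lmodType R[i]) :=
  NAlg (nclosure BX1 [set phiL1 f | f in acar (L1 omegaT)])
       (amul BX1) (anorm BX1).

Definition is_generatorI (G : set ((X -> X) * (X -> X))) : Prop :=
  exists f0 f0', gen_function omegaT f0 f0' /\
    G = qmult arveson (- phiL1 f0') (phiL1 f0).

Variable lambda : R.

(* T(t)u, with T(0)u = u *)
Definition Tact (t : R) (u : X -> X) : X -> X := if t == 0 then u else T t \o u.

Definition algL : nalg ((X -> X) : lmodType R[i]) :=
  @NAlg R ((X -> X) : lmodType R[i])
    [set u | acar arveson u /\
      (limf_esup (fun t => (anorm arveson (T t \o u))%:E) (0 : R)^'+ < +oo)%E]
    (amul arveson)
    (fun u => sup [set expR (- lambda * s) * anorm arveson (Tact s u)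
                  | s in `[0, +oo[]).

Definition algU : nalg ((X -> X) : lmodType R[i]) :=
  NAlg (nclosure algL
         (\bigcup_(t in Rpos R) [set T t \o u | u in acar arveson]))
       (amul algL) (anorm algL).

(* u acting by multiplication on U_T *)
Definition mulU (u : X -> X) : (X -> X) -> (X -> X) :=
  restr (acar algU) (amul arveson u).

Definition algJ : nalg (((X -> X) -> (X -> X)) : lmodType R[i]) :=
  NAlg (nclosure (mult_alg algU) [set mulU u | u in acar arveson])
       (amul (mult_alg algU)) (anorm (mult_alg algU)).

(* T(t) as an element of M(J_T): S in M(U_T) acts on J_T, a subalgebra of
   M(U_T), by composition, and here S is u |-> T(t)u. *)
Definition TJ (t : R) : ((X -> X) -> (X -> X)) -> ((X -> X) -> (X -> X)) :=
  restr (acar algJ) (fun j w => T t \o j w).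

Definition omegatT (t : R) : R := anorm (mult_alg algJ) (TJ t).

Definition phit (nu : {measure set (measurableTypeR R) -> \bar R})
    (h : R -> R[i]) : ((X -> X) -> (X -> X)) -> ((X -> X) -> (X -> X)) :=
  restr (acar algJ)
    (fun j => xget 0 [set w | bochner algJ nu h (fun t => TJ t j) w]).

(* For g in L^1 with weight omegatT, phit lebesgue_measure g is the
   multiplication by an element of J_T; the quotient of two such elements is
   formed here from the corresponding multiplication operators. *)
Definition is_generatorJ
    (G : set (((X -> X) -> (X -> X)) * ((X -> X) -> (X -> X)))) : Prop :=
  exists g0 g0', gen_function omegatT g0 g0' /\
    G = quot_graph algJ (- phit lebesgue_measure g0') (phit lebesgue_measure g0).

(* The identification QM(J_T) -> QM(I_T), u/v |-> au/av, for a in Omega(U_T);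
   the product of a with u in M(U_T) is u(a). *)
Definition QM_ident (a : X -> X)
    (G : set (((X -> X) -> (X -> X)) * ((X -> X) -> (X -> X)))) :
    set ((X -> X) * (X -> X)) :=
  xget set0 [set H | exists u v, [/\ acar algJ u, Omega algJ v,
    G = qmult algJ u v & H = qmult arveson (u a) (v a)]].

End DualPairing.

(* Main.v *)
(* Let e(t) = chi(T(t) v) / chi(v), with chi(v) <> 0.  Since T(t) multiplies the
   commutative algebra I_T, chi(T(t) u) = e(t) chi(u) for all u in I_T, so that e
   is multiplicative; and since chi is automatically continuous, it commutes with
   integrals: chi maps the integral of T(t) dmu(t) to the integral of e dmu.
   Integrating by parts the convolution of f_0' with the indicator function of
   ]a, b] yields
     T(a) phi(f_0) - T(b) phi(f_0) = phi(1_]a,b]) phi(f_0'),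
   which gives the norm continuity of t |-> T(t) u on I_T and, after applying chi,
   e(b) - e(a) = z times the integral of e over ]a, b], where z is the value of chi
   at the generator.  Hence e(t) = exp(z t).  The same argument applies to J_T with
   the character j |-> chi(j a) / chi(a), because v a is in Omega(I_T) when v is in
   Omega(J_T).  The integrals phi(mu) exist in X, although T is only weakly
   continuous, because omega_T is locally bounded (by a gliding hump argument, which
   uses the sigma-compact hulls of orbits in place of the completeness of X_* ) and
   Riemann sums cluster in those hulls. *)
Require Import Defs.
From mathcomp Require Import all_boot all_order all_algebra.
From mathcomp Require Import all_classical all_reals all_analysis.
From mathcomp Require Import measurable_realfun complex ring lra.
Set Implicit Arguments.
Unset Strict Implicit.
Unset Printing Implicit Defensive.
Import Order.TTheory GRing.Theory Num.Theory.
Import numFieldNormedType.Exports.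
Local Open Scope classical_set_scope.
Local Open Scope ring_scope.

(** The obstacle is that [phi] is defined weakly, in X and against X_*, while a character is
    continuous only for the norm of the ideal. It can be moved under the integral only after phi(mu)
    u, for u in I_T, has been recognised as a Bochner integral of T(t) u in I_T, and this requires t
    |-> T(t) u to be norm continuous. The generator function f_0 supplied by the hypothesis that
    [AI] is a generator gives exactly that. Weak and Bochner integrals are compared through norming
    families of functionals, u |-> l(u x) for I_T and an analogue for J_T, so that only scalar
    integrals are ever computed. The record [action] isolates what is used of T on either ideal, and
    the arguments about eigenvalues and integrals are carried out once for it. The weights are
    measurable because they are lower semicontinuous: omega_T(t), for instance, is a supremum of the
    continuous functions |l(T(t) x)|. *)

Section ComplexBasics.
Context {R : realType}.
Implicit Types (z w : R[i]).

(** * Complex numbers and real-valued norms *)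

Lemma nrm_ge0 (V : normedZmodType R[i]) (x : V) : 0 <= nrm x.
Proof.
have := normr_ge0 x; rewrite /nrm; case: (`|x|) => a b.
by rewrite lecE /= => /andP[].
Qed.

Lemma nrmE (V : normedZmodType R[i]) (x : V) : `|x| = (nrm x)%:C%C.
Proof.
have := normr_ge0 x; rewrite /nrm; case: (`|x|) => a b.
by rewrite lecE /= => /andP[/eqP -> _].
Qed.

Lemma nrm0 (V : normedZmodType R[i]) : nrm (0 : V) = 0.
Proof. by rewrite /nrm normr0. Qed.

Lemma nrmN (V : normedZmodType R[i]) (x : V) : nrm (- x) = nrm x.
Proof. by rewrite /nrm normrN. Qed.

Lemma nrm_eq0 (V : normedZmodType R[i]) (x : V) : nrm x = 0 -> x = 0.
Proof. by move=> h; apply/eqP; rewrite -normr_eq0 nrmE h. Qed.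

Lemma nrmD (V : normedZmodType R[i]) (x y : V) : nrm (x + y) <= nrm x + nrm y.
Proof.
by have := ler_normD x y; rewrite !nrmE -rmorphD /= lecR.
Qed.

Lemma nrmB (V : normedZmodType R[i]) (x y : V) : nrm (x - y) <= nrm x + nrm y.
Proof. by rewrite (le_trans (nrmD _ _))// nrmN. Qed.

Lemma nrmBC (V : normedZmodType R[i]) (x y : V) : nrm (x - y) = nrm (y - x).
Proof. by rewrite -nrmN opprB. Qed.

Lemma nrm_dist (V : normedZmodType R[i]) (x y : V) : `|nrm x - nrm y| <= nrm (x - y).
Proof.
have le (u v : V) : nrm u - nrm v <= nrm (u - v).
  by rewrite lerBlDr (le_trans _ (nrmD _ _))// subrK.
by rewrite ler_norml le andbT lerNl opprB nrmBC le.
Qed.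

Lemma nrmM z w : nrm (z * w) = nrm z * nrm w.
Proof.
apply/eqP; rewrite -(inj_eq (@complexI R)) rmorphM /= -!nrmE.
by rewrite normrM.
Qed.

Lemma nrmZ (V : normedModType R[i]) z (x : V) : nrm (z *: x) = nrm z * nrm x.
Proof.
apply/eqP; rewrite -(inj_eq (@complexI R)) rmorphM /= -!nrmE.
by rewrite normrZ.
Qed.

Lemma nrmV z : nrm z^-1 = (nrm z)^-1.
Proof.
apply/eqP; rewrite -(inj_eq (@complexI R)) fmorphV /= -!nrmE.
by rewrite normfV.
Qed.

Lemma nrm1 : nrm (1 : R[i]) = 1.
Proof. by rewrite /nrm normr1. Qed.

Lemma nrm_real (x : R) : nrm (x%:C%C : R[i]) = `|x|.
Proof. by rewrite /nrm normc_def /= expr0n addr0 sqrtr_sqr. Qed.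

Lemma nrm_sqr z : nrm z ^+ 2 = complex.Re z ^+ 2 + complex.Im z ^+ 2.
Proof.
by case: z => a b; rewrite /nrm normc_def /= sqr_sqrtr // addr_ge0 ?sqr_ge0.
Qed.

Lemma Re_le_nrm z : `|complex.Re z| <= nrm z.
Proof.
rewrite -(@ler_pXn2r _ 2) ?nnegrE ?nrm_ge0// nrm_sqr -normrX ger0_norm ?sqr_ge0//.
by rewrite lerDl sqr_ge0.
Qed.

Lemma Im_le_nrm z : `|complex.Im z| <= nrm z.
Proof.
rewrite -(@ler_pXn2r _ 2) ?nnegrE ?nrm_ge0// nrm_sqr -normrX ger0_norm ?sqr_ge0//.
by rewrite lerDr sqr_ge0.
Qed.

Lemma ReD z w : complex.Re (z + w) = complex.Re z + complex.Re w.
Proof. by case: z w => ? ? []. Qed.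
Lemma ImD z w : complex.Im (z + w) = complex.Im z + complex.Im w.
Proof. by case: z w => ? ? []. Qed.
Lemma ReN z : complex.Re (- z) = - complex.Re z.
Proof. by case: z. Qed.
Lemma ImN z : complex.Im (- z) = - complex.Im z.
Proof. by case: z. Qed.
Lemma ReM z w : complex.Re (z * w) =
  complex.Re z * complex.Re w - complex.Im z * complex.Im w.
Proof. by case: z w => ? ? []. Qed.
Lemma ImM z w : complex.Im (z * w) =
  complex.Re z * complex.Im w + complex.Im z * complex.Re w.
Proof. by case: z w => ? ? []. Qed.
Lemma complexP z w :
  complex.Re z = complex.Re w -> complex.Im z = complex.Im w -> z = w.
Proof. by case: z w => ? ? [? ?] /= -> ->. Qed.

(** Rotating a complex integral onto the positive real axis reduces its triangle inequality to the
    real one. *)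
Lemma nrm_phase z :
  exists2 c : R[i], nrm c <= 1 & complex.Re (c * z) = nrm z.
Proof.
have [->|z0] := eqVneq z 0.
  by exists 0; rewrite ?nrm0// mulr0.
exists (`|z| / z); last by rewrite -mulrA mulVf// mulr1 nrmE.
rewrite nrmM nrmV {1}/nrm normr_id -/(nrm z) divff// ?lexx//.
by apply: contra_neq z0; exact: nrm_eq0.
Qed.

End ComplexBasics.

(** * Complex-valued integrals *)

Section ComplexIntegration.
Context {R : realType} {d} {S : measurableType d}.

(** [cmeasurable] over an arbitrary measurable space, because Fubini's theorem takes place on the
    plane; on the line the two are convertible. *)
Definition cmeas (D : set S) (f : S -> R[i]) : Prop :=
  measurable_fun D (fun t => complex.Re (f t)) /\
  measurable_fun D (fun t => complex.Im (f t)).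

Implicit Types (D : set S) (f g : S -> R[i]).

Lemma cmeas_nrm D f : cmeas D f -> measurable_fun D (fun t => nrm (f t)).
Proof.
move=> [mr mi].
rewrite (_ : (fun t => _) =
  Num.sqrt \o (fun t => complex.Re (f t) ^+ 2 + complex.Im (f t) ^+ 2)); last first.
  by apply/funext => t /=; rewrite -nrm_sqr sqrtr_sqr ger0_norm// nrm_ge0.
apply: measurableT_comp; last by apply: measurable_funD; exact: measurable_funX.
by apply: continuous_measurable_fun; exact: sqrt_continuous.
Qed.

Lemma cmeas_cst D (c : R[i]) : cmeas D (fun=> c).
Proof. by split; exact: measurable_cst. Qed.

Lemma cmeasD D f g : cmeas D f -> cmeas D g -> cmeas D (fun t => f t + g t).
Proof.
move=> [mr mi] [nr ni]; split.
- by under eq_fun do rewrite ReD; exact: measurable_funD.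
- by under eq_fun do rewrite ImD; exact: measurable_funD.
Qed.

Lemma cmeasN D f : cmeas D f -> cmeas D (fun t => - f t).
Proof.
move=> [mr mi]; split.
- by under eq_fun do rewrite ReN; exact: measurableT_comp.
- by under eq_fun do rewrite ImN; exact: measurableT_comp.
Qed.

Lemma cmeasB D f g : cmeas D f -> cmeas D g -> cmeas D (fun t => f t - g t).
Proof. by move=> mf mg; apply: cmeasD => //; exact: cmeasN. Qed.

Lemma cmeasM D f g : cmeas D f -> cmeas D g -> cmeas D (fun t => f t * g t).
Proof.
move=> [mr mi] [nr ni]; split.
- under eq_fun do rewrite ReM.
  by apply: measurable_funB; exact: measurable_funM.
- under eq_fun do rewrite ImM.
  by apply: measurable_funD; exact: measurable_funM.
Qed.

Lemma cmeas_real D (g : S -> R) : measurable_fun D g ->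
  cmeas D (fun t => (g t)%:C%C).
Proof. by move=> mg; split => //=; exact: measurable_cst. Qed.

Lemma cmeasS D E f : measurable E -> D `<=` E -> cmeas E f -> cmeas D f.
Proof. by move=> mE DE [? ?]; split; exact: (measurable_funS mE DE). Qed.

Lemma cmeas_eq D f g : {in D, f =1 g} -> cmeas D f -> cmeas D g.
Proof.
move=> fg [mr mi]; split.
- by apply: eq_measurable_fun mr => x xD; rewrite fg.
- by apply: eq_measurable_fun mi => x xD; rewrite fg.
Qed.

Lemma restrE (V : Type) (W : nmodType) (D : set V) (f : V -> W) x :
  restr D f x = if x \in D then f x else 0.
Proof. by []. Qed.

Lemma Re_restr D f : (fun t => complex.Re (restr D f t)) =
  (fun t => complex.Re (f t)) \_ D.
Proof. by apply/funext => t; rewrite restrE patchE; case: ifP. Qed.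

Lemma Im_restr D f : (fun t => complex.Im (restr D f t)) =
  (fun t => complex.Im (f t)) \_ D.
Proof. by apply/funext => t; rewrite restrE patchE; case: ifP. Qed.

Lemma cmeas_restr D E f : measurable D -> measurable E ->
  cmeas (E `&` D) f <-> cmeas E (restr D f).
Proof.
move=> mD mE; rewrite /cmeas Re_restr Im_restr.
by split => -[/(measurable_restrict _ mD mE) ? /(measurable_restrict _ mD mE)].
Qed.

Variable nu : {measure set S -> \bar R}.

Definition cint D f : Prop :=
  cmeas D f /\ (\int[nu]_(t in D) (nrm (f t))%:E < +oo)%E.

Lemma cint_Re D f : measurable D -> cint D f ->
  nu.-integrable D (EFin \o (fun t => complex.Re (f t))).
Proof.
move=> mD [mf If]; apply/integrableP; split.
  by apply/measurable_EFinP; case: mf.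
apply: le_lt_trans If; apply: ge0_le_integral => //.
- by apply: measurableT_comp => //; apply/measurable_EFinP; case: mf.
- by apply/measurable_EFinP; exact: cmeas_nrm.
- by move=> t _; rewrite /= lee_fin Re_le_nrm.
Qed.

Lemma cint_Im D f : measurable D -> cint D f ->
  nu.-integrable D (EFin \o (fun t => complex.Im (f t))).
Proof.
move=> mD [mf If]; apply/integrableP; split.
  by apply/measurable_EFinP; case: mf.
apply: le_lt_trans If; apply: ge0_le_integral => //.
- by apply: measurableT_comp => //; apply/measurable_EFinP; case: mf.
- by apply/measurable_EFinP; exact: cmeas_nrm.
- by move=> t _; rewrite /= lee_fin Im_le_nrm.
Qed.

Lemma cint_nrm D f : measurable D -> cint D f ->
  nu.-integrable D (EFin \o (fun t => nrm (f t))).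
Proof.
move=> mD [mf If]; apply/integrableP; split.
  by apply/measurable_EFinP; exact: cmeas_nrm.
apply: le_lt_trans If; apply: ge0_le_integral => //.
- by apply: measurableT_comp => //; apply/measurable_EFinP; exact: cmeas_nrm.
- by apply/measurable_EFinP; exact: cmeas_nrm.
- by move=> t _; rewrite /= lee_fin ger0_norm// nrm_ge0.
Qed.

Lemma cint_le D f (g : S -> R) : measurable D -> cmeas D f ->
  measurable_fun D g -> (forall t, D t -> nrm (f t) <= g t) ->
  (\int[nu]_(t in D) (g t)%:E < +oo)%E -> cint D f.
Proof.
move=> mD mf mg fg Ig; split => //; apply: le_lt_trans Ig.
apply: ge0_le_integral => //.
- by move=> t _; rewrite lee_fin nrm_ge0.
- by apply/measurable_EFinP; exact: cmeas_nrm.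
- by apply/measurable_EFinP.
Qed.

Lemma cintS D E f : measurable D -> measurable E -> D `<=` E ->
  cint E f -> cint D f.
Proof.
move=> mD mE DE [mf If]; split; first exact: cmeasS mf.
apply: le_lt_trans If; apply: ge0_subset_integral => //.
- by apply/measurable_EFinP; exact: cmeas_nrm.
- by move=> t _; rewrite lee_fin nrm_ge0.
Qed.

Lemma cintM_le D f g (M : R) : measurable D -> cmeas D f -> cint D g ->
  (forall t, D t -> nrm (f t) <= M) -> cint D (fun t => f t * g t).
Proof.
move=> mD mf [mg Ig] fM.
apply: (@cint_le _ _ (fun t => `|M| * nrm (g t))) => //.
- exact: cmeasM.
- by apply: measurable_funM => //; exact: cmeas_nrm.
- move=> t Dt; rewrite nrmM ler_wpM2r ?nrm_ge0//.
  by rewrite (le_trans (fM _ Dt))// ler_norm.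
- under eq_integral do rewrite EFinM.
  rewrite ge0_integralZl//.
  + by rewrite lte_mul_pinfty// lee_fin.
  + by apply/measurable_EFinP; exact: cmeas_nrm.
  + by move=> t _; rewrite lee_fin nrm_ge0.
Qed.

Lemma cintD D f g : measurable D -> cint D f -> cint D g ->
  cint D (fun t => f t + g t).
Proof.
move=> mD [mf If] [mg Ig].
have [mf' mg'] := (cmeas_nrm mf, cmeas_nrm mg).
apply: (@cint_le _ _ (fun t => nrm (f t) + nrm (g t))) => //.
- exact: cmeasD.
- exact: measurable_funD.
- by move=> t _; exact: nrmD.
- under eq_integral do rewrite EFinD.
  rewrite ge0_integralD//; first by rewrite lte_add_pinfty.
  + by move=> t _; rewrite lee_fin nrm_ge0.
  + exact/measurable_EFinP.
  + by move=> t _; rewrite lee_fin nrm_ge0.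
  + exact/measurable_EFinP.
Qed.

Lemma cint0 D : measurable D -> cint D (fun=> 0).
Proof.
move=> mD; split; first exact: cmeas_cst.
by under eq_integral do rewrite nrm0; rewrite integral0.
Qed.

Lemma cintZ D f (c : R[i]) : measurable D -> cint D f -> cint D (fun t => c * f t).
Proof. by move=> mD If; apply: (@cintM_le _ _ _ (nrm c)) => //; exact: cmeas_cst. Qed.

Lemma cintN D f : measurable D -> cint D f -> cint D (fun t => - f t).
Proof.
move=> mD [mf If]; split; first exact: cmeasN.
by under eq_integral do rewrite nrmN.
Qed.

Lemma cint_eq D f g : {in D, f =1 g} -> cint D f -> cint D g.
Proof.
move=> fg [mf If]; split; first exact: cmeas_eq mf.
rewrite (_ : (\int[nu]_(t in D) (nrm (g t))%:E = \int[nu]_(t in D) (nrm (f t))%:E)%E)//.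
by apply: eq_integral => t tD; rewrite fg.
Qed.

(** [cintegral] over an arbitrary measurable space; on the line the two are convertible and proofs
    pass silently from one to the other. *)
Definition cInt D f : R[i] :=
  Complex (\int[nu]_(t in D) complex.Re (f t)) (\int[nu]_(t in D) complex.Im (f t)).

Lemma eq_cInt D f g : {in D, f =1 g} -> cInt D f = cInt D g.
Proof. by move=> fg; congr Complex; apply: eq_Rintegral => t tD; rewrite fg. Qed.

Lemma cIntD D f g : measurable D -> cint D f -> cint D g ->
  cInt D (fun t => f t + g t) = cInt D f + cInt D g.
Proof.
move=> mD If Ig; apply: complexP; rewrite ?ReD ?ImD /=.
- by under eq_Rintegral do rewrite ReD; rewrite RintegralD//; exact: cint_Re.
- by under eq_Rintegral do rewrite ImD; rewrite RintegralD//; exact: cint_Im.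
Qed.

Lemma cIntZ D f c : measurable D -> cint D f ->
  cInt D (fun t => c * f t) = c * cInt D f.
Proof.
move=> mD If; have [IR II] := (cint_Re mD If, cint_Im mD If).
have IZ (a : R) (g : S -> R) : nu.-integrable D (EFin \o g) ->
    nu.-integrable D (EFin \o (fun t => a * g t)).
  move=> Ig; rewrite (_ : EFin \o _ = (fun t => a%:E * (EFin \o g) t)%E).
    exact: integrableZl.
  by apply/funext => t /=; rewrite EFinM.
apply: complexP; rewrite ?ReM ?ImM /=.
- under eq_Rintegral do rewrite ReM.
  by rewrite RintegralB ?RintegralZl//; exact: IZ.
- under eq_Rintegral do rewrite ImM.
  by rewrite RintegralD ?RintegralZl//; exact: IZ.
Qed.

Lemma cIntZr D f c : measurable D -> cint D f ->
  cInt D (fun t => f t * c) = cInt D f * c.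
Proof.
by move=> mD If; rewrite mulrC -cIntZ//; apply: eq_cInt => t _; rewrite mulrC.
Qed.

Lemma cInt0 D : cInt D (fun=> 0) = 0.
Proof. by apply: complexP => /=; rewrite /Rintegral integral0_eq. Qed.

Lemma cIntN D f : measurable D -> cint D f ->
  cInt D (fun t => - f t) = - cInt D f.
Proof.
move=> mD If; rewrite -mulN1r -cIntZ//.
by apply: eq_cInt => t _; rewrite mulN1r.
Qed.

Lemma cIntB D f g : measurable D -> cint D f -> cint D g ->
  cInt D (fun t => f t - g t) = cInt D f - cInt D g.
Proof. by move=> mD If Ig; rewrite cIntD ?cIntN//; exact: cintN. Qed.

Lemma cint_sum D (I : Type) (r : seq I) (F : I -> S -> R[i]) : measurable D ->
  (forall i, cint D (F i)) -> cint D (fun t => \sum_(i <- r) F i t).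
Proof.
move=> mD IF; elim: r => [|i r IH].
  by under eq_fun do rewrite big_nil; exact: cint0.
by under eq_fun do rewrite big_cons; exact: cintD.
Qed.

Lemma cInt_sum D (I : Type) (r : seq I) (F : I -> S -> R[i]) : measurable D ->
  (forall i, cint D (F i)) ->
  cInt D (fun t => \sum_(i <- r) F i t) = \sum_(i <- r) cInt D (F i).
Proof.
move=> mD IF; elim: r => [|i r IH].
  by under eq_fun do rewrite big_nil; rewrite cInt0 big_nil.
under eq_fun do rewrite big_cons.
by rewrite cIntD ?big_cons ?IH//; exact: cint_sum.
Qed.

Lemma cInt_mkcond D f : cInt D f = cInt setT (restr D f).
Proof.
congr Complex; rewrite Rintegral_mkcond; apply: eq_Rintegral => t _;
  by rewrite restrE patchE; case: ifP.
Qed.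

Lemma cInt_mkcondr D E f : cInt (D `&` E) f = cInt D (restr E f).
Proof.
congr Complex; rewrite Rintegral_mkcondr; apply: eq_Rintegral => t _;
  by rewrite restrE patchE; case: ifP.
Qed.

Lemma nrm_cInt D f : measurable D -> cint D f ->
  nrm (cInt D f) <= \int[nu]_(t in D) nrm (f t).
Proof.
move=> mD If; have [c c1 <-] := nrm_phase (cInt D f).
rewrite -cIntZ//=; apply: le_Rintegral => //.
- by apply: cint_Re => //; exact: cintZ.
- exact: cint_nrm.
- move=> t Dt; rewrite (le_trans (ler_norm _))// (le_trans (Re_le_nrm _))//.
  by rewrite nrmM ler_piMl// nrm_ge0.
Qed.

(** Stated in the extended reals: an infinite right side makes it trivial, and a finite one is
    integrability, so that [nrm_cInt] applies. *)
Lemma nrm_cIntE D f : measurable D -> cmeas D f ->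
  ((nrm (cInt D f))%:E <= \int[nu]_(t in D) (nrm (f t))%:E)%E.
Proof.
move=> mD mf.
have : (0 <= \int[nu]_(t in D) (nrm (f t))%:E)%E.
  by apply: integral_ge0 => t _; rewrite lee_fin nrm_ge0.
rewrite le_eqVlt; have [->|] := eqVneq (\int[nu]_(t in D) (nrm (f t))%:E)%E +oo%E.
  by rewrite leey.
rewrite -ltey => Ify _; have := nrm_cInt mD (conj mf Ify).
rewrite -lee_fin => /le_trans; apply; rewrite /Rintegral fineK// ge0_fin_numE//.
by apply: integral_ge0 => t _; rewrite lee_fin nrm_ge0.
Qed.

Lemma nrm_cInt_le D f (g : S -> R) : measurable D -> cmeas D f ->
  measurable_fun D g -> (forall t, D t -> nrm (f t) <= g t) ->
  (\int[nu]_(t in D) (g t)%:E < +oo)%E ->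
  nrm (cInt D f) <= \int[nu]_(t in D) g t.
Proof.
move=> mD mf mg fg Ig.
have gE : ((\int[nu]_(t in D) g t)%:E = \int[nu]_(t in D) (g t)%:E)%E.
  rewrite /Rintegral fineK// ge0_fin_numE//.
  by apply: integral_ge0 => t Dt; rewrite lee_fin (le_trans (nrm_ge0 _) (fg _ Dt)).
rewrite -lee_fin gE (le_trans (nrm_cIntE _ _))//.
apply: ge0_le_integral => //.
- by move=> t _; rewrite lee_fin nrm_ge0.
- by apply/measurable_EFinP; exact: cmeas_nrm.
- by apply/measurable_EFinP.
Qed.

End ComplexIntegration.

(** * Normed spaces and operators *)

Lemma half_gt0 (R : realFieldType) (e : R) : 0 < e -> 0 < e / 2.
Proof. by move=> e0; rewrite divr_gt0. Qed.

(** The carrier and norm of an [nalg] come without laws; this record supplies them, for a subspace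
    [D] of the ambient module on which alone [N] is meaningful. *)
Record nspace (R : realType) (V : lmodType R[i]) (D : set V) (N : V -> R) :
    Prop := NSpace {
  ns0 : D 0 ;
  nsL : forall (a : R[i]) x y, D x -> D y -> D (a *: x + y) ;
  nsN_ge0 : forall x, D x -> 0 <= N x ;
  nsNZ : forall (a : R[i]) x, D x -> N (a *: x) = nrm a * N x ;
  nsND : forall x y, D x -> D y -> N (x + y) <= N x + N y ;
  nsN_eq0 : forall x, D x -> N x = 0 -> x = 0 }.

Definition nlim (R : realType) (V : zmodType) (N : V -> R)
    (u : nat -> V) (x : V) : Prop :=
  forall e : R, 0 < e ->
  exists n0, forall n, (n0 <= n)%N -> N (u n - x) < e.

Definition ncauchy (R : realType) (V : zmodType) (N : V -> R)
    (u : nat -> V) : Prop :=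
  forall e : R, 0 < e -> exists n0, forall m n, (n0 <= m)%N -> (n0 <= n)%N ->
    N (u m - u n) < e.

Definition ncomplete (R : realType) (V : zmodType) (D : set V) (N : V -> R) :
    Prop :=
  forall u : nat -> V, (forall n, D (u n)) -> ncauchy N u ->
    exists2 x, D x & nlim N u x.

Section NSpace.
Context {R : realType} {V : lmodType R[i]} {D : set V} {N : V -> R}.
Hypothesis HD : nspace D N.

Lemma nsD x y : D x -> D y -> D (x + y).
Proof. by move=> Dx Dy; rewrite -[x]scale1r; exact: (nsL HD). Qed.

Lemma nsZ (a : R[i]) x : D x -> D (a *: x).
Proof. by move=> Dx; rewrite -[_ *: _]addr0; apply: (nsL HD) => //; exact: ns0 HD. Qed.

Lemma nsN x : D x -> D (- x).
Proof. by move=> Dx; rewrite -scaleN1r; exact: nsZ. Qed.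

Lemma nsB x y : D x -> D y -> D (x - y).
Proof. by move=> Dx Dy; apply: nsD => //; exact: nsN. Qed.

Lemma ns_sum (I : Type) (r : seq I) (F : I -> V) :
  (forall i, D (F i)) -> D (\sum_(i <- r) F i).
Proof. by move=> DF; apply: big_ind => //; [exact: ns0 HD|exact: nsD]. Qed.

Lemma nsN0 : N 0 = 0.
Proof. by rewrite -(scale0r (0 : V)) (nsNZ HD) ?nrm0 ?mul0r//; exact: ns0 HD. Qed.

Lemma nsNN x : D x -> N (- x) = N x.
Proof. by move=> Dx; rewrite -scaleN1r (nsNZ HD)// nrmN nrm1 mul1r. Qed.

Lemma nsNBC x y : D x -> D y -> N (x - y) = N (y - x).
Proof. by move=> Dx Dy; rewrite -opprB nsNN//; exact: nsB. Qed.

Lemma nsNB x y : D x -> D y -> N (x - y) <= N x + N y.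
Proof. by move=> Dx Dy; rewrite (le_trans (nsND HD _ _)) ?nsNN//; exact: nsN. Qed.

Lemma nsNBD z x y : D x -> D y -> D z -> N (x - y) <= N (x - z) + N (z - y).
Proof.
move=> Dx Dy Dz; rewrite -(subrK z x) -addrA.
by rewrite (le_trans (nsND HD _ _)) ?subrK//; exact: nsB.
Qed.

Lemma nsNleD x y : D x -> D y -> N x <= N (x - y) + N y.
Proof. by move=> Dx Dy; rewrite -{1}(subrK y x) (nsND HD)//; exact: nsB. Qed.

Lemma ns_eq x y : D x -> D y -> (forall e : R, 0 < e -> N (x - y) <= e) -> x = y.
Proof.
move=> Dx Dy xy; apply/eqP; rewrite -subr_eq0; apply/eqP.
apply: (nsN_eq0 HD); first exact: nsB.
apply/eqP; rewrite eq_le (nsN_ge0 HD) ?andbT//; last exact: nsB.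
by apply/ler_addgt0Pr => e e0; rewrite add0r xy.
Qed.

Lemma nlim_cauchy u x : (forall n, D (u n)) -> D x -> nlim N u x -> ncauchy N u.
Proof.
move=> Du Dx ux e e0; have [n0 hn] := ux (e / 2) (half_gt0 e0).
exists n0 => m n nm nn; rewrite (le_lt_trans (nsNBD (Du m) (Du n) Dx))//.
by rewrite (splitr e) ltrD ?hn// (nsNBC Dx)// hn.
Qed.

End NSpace.

Lemma nspaceS (R : realType) (V : lmodType R[i]) (D E : set V) (N : V -> R) :
  nspace D N -> E `<=` D -> E 0 ->
  (forall (a : R[i]) x y, E x -> E y -> E (a *: x + y)) -> nspace E N.
Proof.
by move=> HD ED E0 EL; split => //; [move=> x /ED; exact: nsN_ge0 HD _
 |move=> a x /ED; exact: (nsNZ HD)|move=> x y /ED Dx /ED; exact: (nsND HD)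
 |move=> x /ED; exact: (nsN_eq0 HD)].
Qed.

Section OperatorNorm.
Context {R : realType} {V W : lmodType R[i]} {D : set V} {E : set W}
  {nV : V -> R} {nW : W -> R}.
Hypotheses (HD : nspace D nV) (HE : nspace E nW).
Implicit Types S : V -> W.

Lemma oper_norm_sup S (M : R) :
  (forall x, D x -> nV x <= 1 -> nW (S x) <= M) -> oper_norm D nV nW S <= M.
Proof.
move=> SM; apply: ge_sup.
  by exists (nW (S 0)); exists 0 => //; split; [exact: ns0 HD|rewrite (nsN0 HD)].
by move=> _ [x [Dx x1] <-]; exact: SM.
Qed.

Lemma bounded_oper0 S : bounded_oper D E nV nW S -> S 0 = 0.
Proof.
move=> [_ lS _]; have := lS 1 0 0 (ns0 HD) (ns0 HD).
by rewrite !scale1r addr0 -[LHS]addr0 => /addrI.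
Qed.

Lemma bounded_operZ S : bounded_oper D E nV nW S ->
  forall a x, D x -> S (a *: x) = a *: S x.
Proof.
move=> bS a x Dx; have [_ lS _] := bS.
by rewrite -[a *: x]addr0 lS//; [rewrite bounded_oper0// addr0|exact: ns0 HD].
Qed.

Lemma bounded_operD S : bounded_oper D E nV nW S ->
  forall x y, D x -> D y -> S (x + y) = S x + S y.
Proof. by move=> [_ lS _] x y Dx Dy; rewrite -[x]scale1r lS// !scale1r. Qed.

Lemma bounded_operB S : bounded_oper D E nV nW S ->
  forall x y, D x -> D y -> S (x - y) = S x - S y.
Proof.
move=> bS x y Dx Dy; rewrite (bounded_operD bS)//; last exact: (nsN HD).
by rewrite -scaleN1r (bounded_operZ bS)// scaleN1r.
Qed.

Lemma bounded_oper_sum S : bounded_oper D E nV nW S ->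
  forall (I : Type) (r : seq I) (F : I -> V), (forall i, D (F i)) ->
  S (\sum_(i <- r) F i) = \sum_(i <- r) S (F i).
Proof.
move=> bS I r F DF; elim: r => [|i r IH]; first by rewrite !big_nil bounded_oper0.
by rewrite !big_cons (bounded_operD bS) ?IH//; exact: (ns_sum HD).
Qed.

Lemma oper_norm_has_sup S : bounded_oper D E nV nW S ->
  has_sup [set nW (S x) | x in [set x | D x /\ nV x <= 1]].
Proof.
move=> [DE lS [M SM]]; split.
  by exists (nW (S 0)); exists 0 => //; split; [exact: ns0 HD|rewrite (nsN0 HD)].
exists `|M| => _ [x [Dx x1] <-]; rewrite (le_trans (SM _ Dx))//.
by rewrite (le_trans (ler_wpM2r _ (ler_norm M))) ?ler_piMr// (nsN_ge0 HD).
Qed.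

Lemma oper_norm_ge0 S : bounded_oper D E nV nW S -> 0 <= oper_norm D nV nW S.
Proof.
move=> bS; have [DE _ _] := bS.
have : nW (S 0) <= oper_norm D nV nW S.
  apply: sup_upper_bound; first exact: oper_norm_has_sup.
  by exists 0 => //; split; [exact: ns0 HD|rewrite (nsN0 HD)].
by apply: le_trans; rewrite (nsN_ge0 HE)//; apply: DE; exact: ns0 HD.
Qed.

Lemma oper_normP S x : bounded_oper D E nV nW S -> D x ->
  nW (S x) <= oper_norm D nV nW S * nV x.
Proof.
move=> bS Dx; have [DE lS [M SM]] := bS.
have [x0|x0] := eqVneq (nV x) 0.
  by rewrite (le_trans (SM _ Dx))// x0 !mulr0.
have xp : 0 < nV x by rewrite lt_neqAle eq_sym x0 (nsN_ge0 HD).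
rewrite -ler_pdivrMr// mulrC.
have -> : (nV x)^-1 * nW (S x) = nW (S ((nV x)^-1%:C%C *: x)).
  rewrite (bounded_operZ bS)// (nsNZ HE) ?nrm_real; last exact: DE.
  by rewrite ger0_norm// invr_ge0 ltW.
apply: sup_upper_bound; first exact: oper_norm_has_sup.
exists ((nV x)^-1%:C%C *: x) => //; split; first exact: nsZ HD _ _ _.
by rewrite (nsNZ HD)// nrm_real ger0_norm ?mulVf// invr_ge0 ltW.
Qed.

Lemma oper_norm_le S (M : R) : 0 <= M ->
  (forall x, D x -> nW (S x) <= M * nV x) -> oper_norm D nV nW S <= M.
Proof.
move=> M0 SM; apply: oper_norm_sup => x Dx x1.
by rewrite (le_trans (SM _ Dx))// ler_piMr.
Qed.

End OperatorNorm.

Section OperatorSpace.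
Context {R : realType} {V : lmodType R[i]} (D : set V) (N : V -> R).

Definition opers : set (V -> V) :=
  [set S | bounded_oper D D N N S /\ forall x, ~ D x -> S x = 0].

Hypothesis HD : nspace D N.
Local Notation oN := (oper_norm D N N).

Lemma bounded_operL (a : R[i]) (S1 S2 : V -> V) :
  bounded_oper D D N N S1 -> bounded_oper D D N N S2 ->
  bounded_oper D D N N (a *: S1 + S2).
Proof.
move=> b1 b2; have [[D1 l1 [M1 n1]] [D2 l2 [M2 n2]]] := (b1, b2); split.
- by move=> x Dx; apply: (nsL HD); [exact: D1|exact: D2].
- move=> b x y Dx Dy; rewrite !fctE l1// l2//.
  by rewrite !scalerDr !scalerA [b * a]mulrC addrACA.
- exists (nrm a * M1 + M2) => x Dx; rewrite -[X in N X]/(a *: S1 x + S2 x) mulrDl.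
  rewrite (le_trans (nsND HD _ _))//; [by apply: (nsZ HD); exact: D1|exact: D2|].
  rewrite lerD ?n2//.
  by rewrite (nsNZ HD _ (D1 _ Dx)) -mulrA ler_wpM2l ?nrm_ge0// n1.
Qed.

Lemma opers_nspace : nspace opers oN.
Proof.
have e0 (S : V -> V) : opers S -> oN S = 0 -> S = 0.
  move=> [bS S0] nS; apply/funext => x; have [Dx|nDx] := pselect (D x); last exact: S0.
  have [DS _ _] := bS; apply: (nsN_eq0 HD); first exact: DS.
  have := oper_normP HD HD bS Dx; rewrite nS mul0r => h.
  by apply/eqP; rewrite eq_le h (nsN_ge0 HD)//; exact: DS.
have leD (S1 S2 : V -> V) : opers S1 -> opers S2 -> oN (S1 + S2) <= oN S1 + oN S2.
  move=> [b1 _] [b2 _]; have [[D1 _ _] [D2 _ _]] := (b1, b2).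
  apply: (oper_norm_le HD); first by rewrite addr_ge0// (oper_norm_ge0 HD HD).
  move=> x Dx; rewrite mulrDl (le_trans (nsND HD (D1 _ Dx) (D2 _ Dx)))//.
  by rewrite lerD// (oper_normP HD HD).
have leZ (a : R[i]) (S : V -> V) : opers S -> oN (a *: S) <= nrm a * oN S.
  move=> [bS _]; have [DS _ _] := bS.
  apply: (oper_norm_le HD); first by rewrite mulr_ge0 ?nrm_ge0// (oper_norm_ge0 HD HD).
  move=> x Dx; rewrite (nsNZ HD _ (DS _ Dx)) -mulrA ler_wpM2l ?nrm_ge0//.
  by rewrite (oper_normP HD HD).
have opL (a : R[i]) (S1 S2 : V -> V) : opers S1 -> opers S2 -> opers (a *: S1 + S2).
  move=> [b1 z1] [b2 z2]; split; first exact: bounded_operL.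
  by move=> x nDx; rewrite !fctE z1// z2// scaler0 addr0.
have op0 : opers (0 : V -> V).
  split=> //; split; first by move=> x _; exact: ns0 HD.
    by move=> a x y _ _ /=; rewrite scaler0 addr0.
  by exists 0 => x Dx; rewrite (nsN0 HD) mul0r.
split => //.
- by move=> S [bS _]; exact: (oper_norm_ge0 HD HD).
(* The opposite inequality is [leZ] for [a^-1] and [a *: S]. *)
- move=> a S oS; apply/eqP; rewrite eq_le leZ//=.
  have [->|a0] := eqVneq a 0.
    rewrite nrm0 mul0r; apply: (oper_norm_ge0 HD HD).
    by rewrite scale0r; case: op0.
  have na : 0 < nrm a.
    rewrite lt_neqAle nrm_ge0 andbT eq_sym; apply: contra_neq a0; exact: nrm_eq0.
  rewrite -ler_pdivlMl// -nrmV.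
  have {1}-> : S = a^-1 *: (a *: S) by rewrite scalerA mulVf// scale1r.
  by apply: leZ; rewrite -[a *: S]addr0; exact: opL.
Qed.

Lemma opersM S1 S2 : opers S1 -> opers S2 ->
  opers (S1 \o S2) /\ oN (S1 \o S2) <= oN S1 * oN S2.
Proof.
move=> [b1 z1] [b2 z2]; have [[D1 l1 n1] [D2 l2 n2]] := (b1, b2).
have le12 x : D x -> N ((S1 \o S2) x) <= oN S1 * oN S2 * N x.
  move=> Dx; rewrite (le_trans (oper_normP HD HD b1 (D2 _ Dx)))// -mulrA.
  by rewrite ler_wpM2l ?(oper_norm_ge0 HD HD)// (oper_normP HD HD).
split; last first.
  by apply: (oper_norm_le HD) => //; apply: mulr_ge0; exact: (oper_norm_ge0 HD HD).
split; last by move=> x nDx /=; rewrite z2// (bounded_oper0 HD b1).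
split; first by move=> x Dx; apply/D1/D2.
  by move=> a x y Dx Dy /=; rewrite l2// l1//; exact: D2.
by exists (oN S1 * oN S2).
Qed.

Lemma opers_complete : ncomplete D N -> ncomplete opers oN.
Proof.
move=> cD S oS cS; have HO := opers_nspace.
have bS n : bounded_oper D D N N (S n) by case: (oS n).
have DS n x : D x -> D (S n x) by case: (bS n) => h _ _; exact: h.
have SxB m n x : D x -> N (S m x - S n x) <= oN (S m - S n) * N x.
  move=> Dx; have [bmn _] : opers (S m - S n) by exact: (nsB HO).
  exact: (oper_normP HD HD bmn Dx).
have cSx x : D x -> ncauchy N (fun n => S n x).
  move=> Dx e e0; have h : 0 < e / (N x + 1).
    by rewrite divr_gt0// ltr_wpDl// (nsN_ge0 HD).
  have [n0 hn] := cS _ h; exists n0 => m n nm nn.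
  rewrite (le_lt_trans (SxB _ _ _ Dx))//.
  have := hn _ _ nm nn; rewrite ltr_pdivlMr ?ltr_wpDl ?(nsN_ge0 HD)// => h1.
  rewrite (le_lt_trans _ h1)// ler_wpM2l ?lerDl//.
  exact: (nsN_ge0 HO (nsB HO (oS _) (oS _))).
have /choice[T hT] x : exists y, (D x -> D y /\ nlim N (fun n => S n x) y) /\ (~ D x -> y = 0).
  have [Dx|nDx] := pselect (D x); last by exists 0.
  have [y Dy hy] := cD _ (fun n => DS n x Dx) (cSx _ Dx).
  by exists y.
have DT x : D x -> D (T x) by move=> Dx; case: (hT x) => /(_ Dx)[].
have limT x : D x -> nlim N (fun n => S n x) (T x) by move=> Dx; case: (hT x) => /(_ Dx)[].
(* The convergence is uniform on the unit ball: in the Cauchy estimate for [S m x - S n x], let m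
   grow with x fixed. *)
have ST e : 0 < e -> exists n0, forall n x, (n0 <= n)%N -> D x -> N (S n x - T x) <= e * N x.
  move=> e0; have [n0 hn] := cS _ e0; exists n0 => n x nn Dx.
  apply/ler_addgt0Pr => e' e'0; have [n1 hn1] := limT _ Dx _ e'0.
  pose m := maxn n0 n1.
  rewrite (le_trans (nsNBD HD (DS n x Dx) (DT _ Dx) (DS m x Dx)))// lerD//.
    rewrite (le_trans (SxB _ _ _ Dx))// ler_wpM2r ?(nsN_ge0 HD)// ltW// hn//.
    exact: leq_maxl.
  by rewrite ltW// hn1// leq_maxr.
have lT (a : R[i]) x y : D x -> D y -> T (a *: x + y) = a *: T x + T y.
  move=> Dx Dy; have Dxy : D (a *: x + y) by exact: (nsL HD).
  have DTT : D (a *: T x + T y) by apply: (nsL HD); exact: DT.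
  apply: (ns_eq HD) => [||e e0] //; first exact: DT.
  pose e' := e / (N (a *: x + y) + nrm a * N x + N y + 1).
  have p0 : 0 < N (a *: x + y) + nrm a * N x + N y + 1.
    by rewrite ltr_wpDl// !addr_ge0 ?mulr_ge0 ?nrm_ge0 ?(nsN_ge0 HD).
  have [n0 /(_ n0)hn] := ST e' (divr_gt0 e0 p0).
  have S1 := hn _ (leqnn _) Dx; have S2 := hn _ (leqnn _) Dy.
  have S3 := hn _ (leqnn _) Dxy.
  have [_ lS _] := bS n0.
  rewrite (le_trans (nsNBD HD (DT _ Dxy) DTT (DS n0 _ Dxy)))//.
  rewrite (nsNBC HD (DT _ Dxy) (DS n0 _ Dxy)) lS// in S3 *.
  have -> : a *: S n0 x + S n0 y - (a *: T x + T y) =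
    a *: (S n0 x - T x) + (S n0 y - T y) by rewrite scalerBr opprD addrACA.
  have B1 : D (S n0 x - T x) by apply: (nsB HD); [exact: DS|exact: DT].
  have B2 : D (S n0 y - T y) by apply: (nsB HD); [exact: DS|exact: DT].
  rewrite (le_trans (lerD S3 (nsND HD (nsZ HD _ B1) B2)))// (nsNZ HD)//.
  have -> : e = e' * (N (a *: x + y) + nrm a * N x + N y + 1).
    by rewrite /e' divfK// gt_eqF.
  rewrite !mulrDr -!addrA lerD2l lerD//.
    by rewrite mulrCA ler_wpM2l ?nrm_ge0.
  by rewrite (le_trans S2)// lerDl mulr1 ltW// divr_gt0.
have bT : bounded_oper D D N N T.
  split => //; have [n0 /(_ n0)hn] := ST 1 ltr01.
  have [_ _ [M hM]] := bS n0; exists (1 + M) => x Dx.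
  rewrite (le_trans (nsNleD HD (DT _ Dx) (DS n0 x Dx)))// mulrDl lerD ?hM//.
  by rewrite (nsNBC HD)//; [exact: hn|exact: DT|exact: DS].
have oT : opers T by split=> // x nDx; case: (hT x) => _ /(_ nDx).
exists T => // e e0; have [n0 hn] := ST (e / 2) (half_gt0 e0).
exists n0 => n nn; apply: (@le_lt_trans _ _ (e / 2)).
  apply: (oper_norm_le HD); first by rewrite divr_ge0// ltW.
  by move=> x Dx; exact: hn.
by rewrite ltr_pdivrMr// ltr_pMr// ltr1n.
Qed.

End OperatorSpace.

(** * Banach algebras and quasimultipliers *)

Lemma cvg0_seqP (R : realType) (u : nat -> R) : u n @[n --> \oo] --> 0 <->
  forall e : R, 0 < e -> exists n0, forall n, (n0 <= n)%N -> `|u n| < e.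
Proof.
split=> [/cvgrPdist_lt h e /h [n0 _ hn]|h].
  by exists n0 => n /hn /=; rewrite sub0r normrN.
apply/cvgrPdist_lt => e /h [n0 hn]; exists n0 => // n /hn /=.
by rewrite sub0r normrN.
Qed.

Section Closure.
Context {R : realType} {V : lmodType R[i]} (A : nalg V).
Hypothesis HA : nspace (acar A) (anorm A).

Lemma nclosure_sub (E : set V) : E `<=` acar A -> E `<=` nclosure A E.
Proof.
move=> EA x Ex; split; first exact: EA.
by move=> e e0; exists x => //; rewrite subrr (nsN0 HA).
Qed.

Lemma nclosure_car (E : set V) : nclosure A E `<=` acar A.
Proof. by move=> x []. Qed.

Lemma nclosure_closed (E F : set V) : F `<=` acar A -> E `<=` nclosure A F ->
  nclosure A E `<=` nclosure A F.
Proof.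
move=> FA EF x [Ax hx]; split => // e e0.
have [y Ey xy] := hx _ (half_gt0 e0).
have [Ay hy] := EF _ Ey; have [z Fz yz] := hy _ (half_gt0 e0).
exists z => //.
by rewrite (le_lt_trans (nsNBD HA Ax (FA _ Fz) Ay))// (splitr e) ltrD.
Qed.

Lemma nclosure_nspace (E : set V) : E `<=` acar A -> E 0 ->
  (forall (a : R[i]) x y, E x -> E y -> E (a *: x + y)) ->
  nspace (nclosure A E) (anorm A).
Proof.
move=> EA E0 EL; apply: (nspaceS HA); [by move=> x []|exact: nclosure_sub|].
move=> a x y [Ax hx] [Ay hy]; split; first exact: (nsL HA).
move=> e e0; have na : 0 < nrm a + 1 by rewrite ltr_wpDl ?nrm_ge0.
have [x' Ex' xx] := hx _ (divr_gt0 (half_gt0 e0) na).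
have [y' Ey' yy] := hy _ (half_gt0 e0).
exists (a *: x' + y'); first exact: EL.
rewrite opprD addrACA -scalerBr.
have Bx := nsB HA Ax (EA _ Ex'); have By := nsB HA Ay (EA _ Ey').
rewrite (le_lt_trans (nsND HA (nsZ HA _ Bx) By))// (splitr e) ler_ltD//.
rewrite (nsNZ HA)//; move: xx; rewrite ltr_pdivlMr// => xx.
rewrite (le_trans _ (ltW xx))// mulrC ler_wpM2l ?lerDl//; exact: (nsN_ge0 HA).
Qed.

Lemma nclosure_complete (E : set V) : ncomplete (acar A) (anorm A) ->
  E `<=` acar A -> ncomplete (nclosure A E) (anorm A).
Proof.
move=> cA EA u Eu cu.
have [x Ax hx] := cA u (fun n => (Eu n).1) cu; exists x => //; split => // e e0.
have [n0 hn] := hx _ (half_gt0 e0); have [_ h] := Eu n0.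
have [y Ey hy] := h _ (half_gt0 e0); exists y => //.
rewrite (le_lt_trans (nsNBD HA Ax (EA _ Ey) (Eu n0).1))// (splitr e) ltrD//.
by rewrite (nsNBC HA Ax (Eu n0).1) hn.
Qed.

End Closure.

(** A Lipschitz map sends closures into closures; stability properties of the ideals are checked on
    dense subsets and extended by this. *)
Lemma nclosure_map (R : realType) (V W : lmodType R[i]) (A : nalg V) (B : nalg W)
    (f : V -> W) (C : R) (E : set V) (F : set W) :
  nspace (acar A) (anorm A) -> nspace (acar B) (anorm B) ->
  (forall x, acar A x -> acar B (f x)) ->
  (forall x y, acar A x -> acar A y -> anorm B (f x - f y) <= C * anorm A (x - y)) ->
  E `<=` acar A -> F `<=` acar B ->
  (forall x, E x -> nclosure B F (f x)) ->
  forall x, nclosure A E x -> nclosure B F (f x).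
Proof.
move=> HA HB fB fC EA FB EF x [Ax hx]; split; first exact: fB.
move=> e e0; have C0 : 0 < `|C| + 1 by rewrite ltr_wpDl.
have [y Ey xy] := hx _ (divr_gt0 (half_gt0 e0) C0).
have [By hy] := EF _ Ey; have [z Fz yz] := hy _ (half_gt0 e0).
exists z => //; have Ay := EA _ Ey.
rewrite (le_lt_trans (nsNBD HB (fB _ Ax) (FB _ Fz) By))//.
rewrite (splitr e) ltrD// (le_lt_trans (fC _ _ Ax Ay))//.
move: xy; rewrite ltr_pdivlMr// => xy; apply: le_lt_trans xy.
rewrite mulrC ler_wpM2l ?(nsN_ge0 HA)//; first exact: (nsB HA).
by rewrite (le_trans (ler_norm _))// lerDl.
Qed.

(** A commutative Banach algebra with zero annihilator, the setting in which a quotient by an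
    element of [Omega] is single valued. *)
Record balg (R : realType) (V : lmodType R[i]) (A : nalg V) : Prop := BAlg {
  ba_ns : nspace (acar A) (anorm A) ;
  ba_complete : ncomplete (acar A) (anorm A) ;
  ba_mul : forall u v, acar A u -> acar A v -> acar A (amul A u v) ;
  ba_mulA : forall u v w, acar A u -> acar A v -> acar A w ->
    amul A u (amul A v w) = amul A (amul A u v) w ;
  ba_mulC : forall u v, acar A u -> acar A v -> amul A u v = amul A v u ;
  ba_mulL : forall (a : R[i]) u v w, acar A u -> acar A v -> acar A w ->
    amul A (a *: u + v) w = a *: amul A u w + amul A v w ;
  ba_normM : forall u v, acar A u -> acar A v ->
    anorm A (amul A u v) <= anorm A u * anorm A v ;
  ba_faithful : forall u, acar A u ->
    (forall v, acar A v -> amul A v u = 0) -> u = 0 }.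

(** The algebraic part of being a multiplier, which is what the passage to quotients uses; off the
    carrier the map is arbitrary. *)
Definition mlike (R : realType) (V : lmodType R[i]) (A : nalg V) (S : V -> V) : Prop :=
  (forall u, acar A u -> acar A (S u)) /\
  (forall u v, acar A u -> acar A v -> S (amul A u v) = amul A (S u) v).

Section BanachAlgebra.
Context {R : realType} {V : lmodType R[i]} (A : nalg V) (BA : balg A).
Let HA := ba_ns BA.
Implicit Types (u v w : V) (chi : V -> R[i]).

Lemma ba_mulB u v w : acar A u -> acar A v -> acar A w ->
  amul A (u - v) w = amul A u w - amul A v w.
Proof.
move=> Au Av Aw; rewrite addrC -scaleN1r (ba_mulL BA)// scaleN1r addrC.
by [].
Qed.

Lemma ba_mulBr u v w : acar A u -> acar A v -> acar A w ->
  amul A w (u - v) = amul A w u - amul A w v.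
Proof.
move=> Au Av Aw; rewrite (ba_mulC BA)//; last exact: (nsB HA).
by rewrite ba_mulB// (ba_mulC BA Au)// (ba_mulC BA Av).
Qed.

Lemma ba_mul0 u : acar A u -> amul A 0 u = 0.
Proof.
move=> Au; have A0 := ns0 HA.
by rewrite -[X in amul A X _](subrr (0 : V)) ba_mulB// subrr.
Qed.

Lemma char0 chi : character A chi -> chi 0 = 0.
Proof.
move=> [cL _ _]; have := cL 1 0 0 (ns0 HA) (ns0 HA).
by rewrite scale1r addr0 mul1r -[LHS]addr0 => /addrI.
Qed.

Lemma charZ chi : character A chi ->
  forall a u, acar A u -> chi (a *: u) = a * chi u.
Proof.
move=> cchi a u Au; have [cL _ _] := cchi.
by rewrite -[a *: u]addr0 cL// ?char0// ?addr0//; exact: (ns0 HA).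
Qed.

Lemma charD chi : character A chi ->
  forall u v, acar A u -> acar A v -> chi (u + v) = chi u + chi v.
Proof. by move=> [cL _ _] u v Au Av; rewrite -[u]scale1r cL// mul1r scale1r. Qed.

Lemma charN chi : character A chi -> forall u, acar A u -> chi (- u) = - chi u.
Proof. by move=> cchi u Au; rewrite -scaleN1r charZ// mulN1r. Qed.

Lemma charB chi : character A chi ->
  forall u v, acar A u -> acar A v -> chi (u - v) = chi u - chi v.
Proof. by move=> cchi u v Au Av; rewrite charD ?charN//; exact: (nsN HA). Qed.

(** The solution is the Neumann series u + u^2 + ..., whose partial sums are the iterates of s |-> u
    + u s from 0. *)
Lemma quasi_inverse u : acar A u -> anorm A u < 1 ->
  exists2 s, acar A s & s = u + amul A u s.
Proof.
move=> Au r1; set r := anorm A u in r1; have r0 : 0 <= r by exact: (nsN_ge0 HA).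
pose s := fix s n := if n is m.+1 then u + amul A u (s m) else 0.
have As n : acar A (s n).
  by elim: n => [|n IH]; [exact: ns0 HA|apply: (nsD HA) => //; exact: (ba_mul BA)].
have r1' : 0 < 1 - r by rewrite subr_gt0.
(* [B] is the sum of r + r^2 + ..., a bound for all partial sums. *)
pose B := r / (1 - r); have B0 : 0 <= B by rewrite divr_ge0// ltW.
have BE : r + r * B = B by rewrite /B; field; rewrite gt_eqF.
have sB n : anorm A (s n) <= B.
  elim: n => [|n IH] /=; first by rewrite (nsN0 HA).
  rewrite (le_trans (nsND HA Au (ba_mul BA Au (As n))))// -BE lerD2l.
  by rewrite (le_trans (ba_normM BA Au (As n)))// ler_wpM2l.
have sD n k : anorm A (s (n + k)%N - s n) <= r ^+ n * B.
  elim: n => [|n IH] /=; first by rewrite subr0 expr0 mul1r.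
  rewrite [X in X - _]addrC opprD addrA addrK -ba_mulBr//.
  rewrite (le_trans (ba_normM BA Au (nsB HA (As _) (As _))))//.
  by rewrite exprS -mulrA ler_wpM2l.
have cvr : (r ^+ n * B) @[n --> \oo] --> 0.
  rewrite -(mul0r B); apply: cvgM; last exact: cvg_cst.
  by apply: cvg_expr; rewrite ger0_norm.
have small e : 0 < e -> exists n0, forall m n, (n0 <= m)%N -> (n0 <= n)%N ->
    anorm A (s m - s n) < e.
  move=> e0; have /cvg0_seqP/(_ _ (half_gt0 e0))[n0 hn] := cvr.
  have h n : (n0 <= n)%N -> anorm A (s n - s n0) < e / 2.
    move=> /subnKC <-; apply: le_lt_trans (sD _ _) _.
    by have := hn _ (leqnn _); rewrite ger0_norm// mulr_ge0 ?exprn_ge0.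
  exists n0 => m n nm nn.
  rewrite (le_lt_trans (nsNBD HA (As m) (As n) (As n0)))// (splitr e) ltrD ?h//.
  by rewrite (nsNBC HA)// h.
have [x Ax hx] := ba_complete BA As small.
exists x => //; have Aux := ba_mul BA Au Ax.
have Ay : acar A (u + amul A u x) by exact: (nsD HA).
apply: (ns_eq HA Ax Ay) => e e0.
have [n0 hn] := hx _ (half_gt0 e0).
rewrite (le_trans (nsNBD HA Ax Ay (As n0.+1)))// (splitr e) lerD//.
  by rewrite (nsNBC HA)// ltW// hn.
rewrite /= [X in X - _]addrC opprD addrA addrK -ba_mulBr//.
rewrite (le_trans (ba_normM BA Au (nsB HA (As _) Ax)))//.
rewrite (le_trans (_ : _ <= 1 * anorm A (s n0 - x)))//.
  by apply: ler_wpM2r; [exact: (nsN_ge0 HA (nsB HA (As _) Ax))|exact: ltW].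
by rewrite mul1r ltW// hn.
Qed.

(** Automatic continuity: if |chi(u)| exceeded the norm of u, then v = u / chi(u) would have norm
    below 1 and chi(v) = 1, and applying chi to s = v + v s would give chi(s) = 1 + chi(s). *)
Lemma char_le chi u : character A chi -> acar A u -> nrm (chi u) <= anorm A u.
Proof.
move=> cchi Au; rewrite leNgt; apply/negP => lt.
have c0 : chi u != 0.
  apply/eqP => c0; move: lt; rewrite c0 nrm0 ltNge.
  by rewrite (nsN_ge0 HA Au).
have nc : 0 < nrm (chi u) by rewrite (le_lt_trans (nsN_ge0 HA Au)).
pose v := (chi u)^-1 *: u; have Av : acar A v by exact: (nsZ HA).
have cv : chi v = 1 by rewrite charZ// mulVf.
have nv : anorm A v < 1.
  by rewrite (nsNZ HA)// nrmV mulrC ltr_pdivrMr// mul1r.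
have [s As sE] := quasi_inverse Av nv.
have [_ cM _] := cchi.
have : chi s = 1 + chi s.
  by rewrite {1}sE charD ?cM ?cv ?mul1r//; exact: (ba_mul BA).
move=> /eqP; rewrite -subr_eq0 opprD addrCA subrr addr0 oppr_eq0 oner_eq0.
by [].
Qed.

(** Otherwise chi would vanish on the dense ideal v A, hence by continuity everywhere. *)
Lemma char_Omega chi v : character A chi -> Omega A v -> chi v != 0.
Proof.
move=> cchi [Av dv]; apply/eqP => cv0; have [_ cM [u Au]] := cchi.
move=> /eqP; apply; apply: nrm_eq0; apply/eqP.
rewrite eq_le nrm_ge0 andbT; apply/ler_addgt0Pr => e e0; rewrite add0r.
have [_ /(_ _ e0)[w [x Ax <-] uw]] := dv _ Au.
have Avx := ba_mul BA Av Ax.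
have -> : chi u = chi (u - amul A v x) by rewrite charB// cM// cv0 mul0r subr0.
by rewrite (le_trans (char_le cchi _)) ?ltW//; exact: (nsB HA).
Qed.

(** The annihilator of x - y is closed and contains v A, so it is all of A, and faithfulness gives x
    = y. *)
Lemma Omega_inj v x y : Omega A v -> acar A x -> acar A y ->
  amul A v x = amul A v y -> x = y.
Proof.
move=> [Av dv] Ax Ay vxy; apply/eqP; rewrite -subr_eq0; apply/eqP.
have Axy := nsB HA Ax Ay.
have v0 : amul A v (x - y) = 0 by rewrite ba_mulBr// vxy subrr.
apply: (ba_faithful BA) => // w Aw.
have Aw0 := ba_mul BA Aw Axy.
apply: (ns_eq HA Aw0 (ns0 HA)) => e e0; rewrite subr0.
have p0 : 0 < anorm A (x - y) + 1 by rewrite ltr_wpDl// (nsN_ge0 HA).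
have [_ /(_ _ (divr_gt0 e0 p0))[z [t At <-]]] := dv _ Aw.
rewrite ltr_pdivlMr// => wt; have Avt := ba_mul BA Av At.
have -> : amul A w (x - y) = amul A (w - amul A v t) (x - y).
  rewrite ba_mulB// (ba_mulC BA Av At) -(ba_mulA BA)// v0.
  by rewrite (ba_mulC BA At (ns0 HA)) ba_mul0// subr0.
have AB := nsB HA Aw Avt.
rewrite (le_trans (ba_normM BA AB Axy))// (le_trans _ (ltW wt))//.
by rewrite ler_wpM2l ?lerDl// (nsN_ge0 HA AB).
Qed.

Lemma Omega_mul v v' : Omega A v -> Omega A v' -> Omega A (amul A v v').
Proof.
move=> [Av hv] [Av' hv']; have Avv := ba_mul BA Av Av'; split=> // u Au; split=> // e e0.
have [_ /(_ _ (half_gt0 e0))[_ [z Az <-] uz]] := hv u Au.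
have K0 : 0 < anorm A v + 1 by rewrite ltr_wpDl// (nsN_ge0 HA).
have [_ /(_ _ (divr_gt0 (half_gt0 e0) K0))[_ [z' Az' <-] zz]] := hv' z Az.
have Avz := ba_mul BA Av Az; have Avz' := ba_mul BA Av' Az'.
exists (amul A (amul A v v') z'); first by exists z'.
rewrite (le_lt_trans (nsNBD HA Au (ba_mul BA Avv Az') Avz))// (splitr e) ltrD//.
rewrite -(ba_mulA BA)// -ba_mulBr//.
apply: le_lt_trans (ba_normM BA Av (nsB HA Az Avz')) _.
move: zz; rewrite ltr_pdivlMr// => zz; apply: le_lt_trans zz.
by rewrite mulrC ler_wpM2l ?lerDl// (nsN_ge0 HA)//; exact: (nsB HA).
Qed.

(** [chi_ext] picks some fraction u'/v' with the same graph. The pair (v w, u w) lies on that graph,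
    and for chi(w) nonzero it shows that the two ratios agree. *)
Lemma chi_ext_qmult chi u v : character A chi -> acar A u -> Omega A v ->
  chi_ext A chi (qmult A u v) = chi u / chi v.
Proof.
move=> cchi Au Ov; rewrite /chi_ext; case: xgetP => [z _|]; last first.
  by move=> /(_ (chi u / chi v)) /(_ _) h; exfalso; apply: h; exists u, v.
move=> [u' [v' [Au' Ov' quv ->]]]; have [_ cM [w Aw w0]] := cchi.
have [Av Av'] := (Ov.1, Ov'.1).
have : qmult A u v (amul A v w, amul A u w).
  split => /=; [exact: (ba_mul BA)|exact: (ba_mul BA)|].
  by rewrite !(ba_mulA BA)// (ba_mulC BA Au Av).
rewrite quv => -[/= Avw Auw] /(congr1 chi); rewrite !cM// => h.
apply/eqP; rewrite eqr_div ?char_Omega//.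
by apply/eqP/(mulIf w0); rewrite -!mulrA h mulrCA.
Qed.

(** Since (S v) x = v (S x) for either operator, the two graphs differ by a factor v on both sides
    of the equation, and [Omega_inj] cancels it. *)
Lemma quot_graph_qmult S1 S2 v : mlike A S1 -> mlike A S2 -> Omega A v ->
  quot_graph A S1 S2 = qmult A (S1 v) (S2 v).
Proof.
move=> [A1 m1] [A2 m2] Ov; have Av := Ov.1.
have E1 x : acar A x -> amul A (S1 v) x = amul A v (S1 x).
  move=> Ax; rewrite -m1// (ba_mulC BA Av Ax) m1//.
  by rewrite (ba_mulC BA)//; exact: A1.
have E2 x : acar A x -> amul A (S2 v) x = amul A v (S2 x).
  move=> Ax; rewrite -m2// (ba_mulC BA Av Ax) m2//.
  by rewrite (ba_mulC BA)//; exact: A2.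
apply/seteqP; split => -[x y] [/= Ax Ay h]; split => //=; first by rewrite E1// E2// h.
by move: h; rewrite E1// E2//; apply: (Omega_inj Ov); [exact: A1|exact: A2].
Qed.

(** A multiplier is the quotient of itself by the identity. *)
Lemma mult_graph_qmult S v : mlike A S -> Omega A v ->
  mult_graph A S = qmult A (S v) v.
Proof.
move=> mS Ov; have mid : mlike A id by split.
rewrite -[RHS](quot_graph_qmult mS mid Ov).
apply/seteqP; split => -[x y] /=; last by case=> /= Ax _ h; split.
by move=> [/= Ax ->]; split => //; case: mS => h _; exact: h.
Qed.

End BanachAlgebra.

(** * Bochner integrals *)

Section Steps.
Context {R : realType}.
Local Notation T := (measurableTypeR R).
Variable nu : {measure set T -> \bar R}.
Implicit Types (f g : R -> R).

Lemma Rpos_measurable : measurable (Rpos R : set T).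
Proof. exact: measurable_itv. Qed.
Let mR := Rpos_measurable.

Lemma RposE (t : R) : Rpos R t <-> 0 < t.
Proof. by rewrite /Rpos /= in_itv /= andbT. Qed.

Definition rcont (g : R -> R) := forall t : R, 0 < t -> forall e, 0 < e ->
  exists2 d : R, 0 < d & forall s, 0 < s -> `|s - t| < d -> `|g s - g t| < e.

Lemma rcont_measurable g : rcont g -> measurable_fun (Rpos R : set T) g.
Proof.
move=> cg; apply: open_continuous_measurable_fun; first exact: interval_open.
move=> t /[!inE] /RposE t0; apply/cvgrPdist_lt => e e0.
have [d d0 hd] := cg _ t0 _ e0; apply/nbhs_ballP.
exists (Num.min d t) => /=; first by rewrite lt_min d0.
move=> s; rewrite /ball /= lt_min => /andP[sd st]; rewrite distrC; apply: hd.
  by move: st; rewrite ltr_distlC => /andP[+ _]; rewrite subrr.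
by rewrite distrC.
Qed.

Lemma integral_lty_le (D : set T) (f g : T -> R) : measurable D ->
  measurable_fun D f -> measurable_fun D g ->
  (forall t, D t -> 0 <= f t) -> (forall t, D t -> f t <= g t) ->
  (\int[nu]_(t in D) (f t)%:E <= \int[nu]_(t in D) (g t)%:E)%E.
Proof.
move=> mD mf mg f0 fg; apply: ge0_le_integral => //.
- exact/measurable_EFinP.
- exact/measurable_EFinP.
Qed.

Lemma dct0 (D : set T) (f_ : nat -> T -> R) (g : T -> R) : measurable D ->
  (forall n, measurable_fun D (f_ n)) -> measurable_fun D g ->
  (\int[nu]_(t in D) (g t)%:E < +oo)%E ->
  (forall n t, D t -> 0 <= f_ n t <= g t) ->
  (forall t, D t -> f_ n t @[n --> \oo] --> 0) ->
  forall e : R, 0 < e -> exists n0, forall n, (n0 <= n)%N ->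
    (\int[nu]_(t in D) (f_ n t)%:E < e%:E)%E.
Proof.
move=> mD mf mg Ig fg f0 e e0.
have [|||||_ _ cv] := @dominated_convergence _ _ _ nu D mD
   (fun n t => (f_ n t)%:E) (cst 0%E) (fun t => (g t)%:E).
- by move=> n; exact/measurable_EFinP.
- exact: measurable_cst.
- apply: aeW => t Dt; by apply: cvg_EFin; [exact: nearW|exact: f0].
- apply/integrableP; split; first exact/measurable_EFinP.
  rewrite (_ : (\int[nu]_(x in D) _ = \int[nu]_(t in D) (g t)%:E)%E)//.
  apply: eq_integral => t /[!inE] Dt; rewrite /= ger0_norm//.
  by have /andP[h1 h2] := fg 0%N _ Dt; exact: le_trans h2.
- apply: aeW => t n Dt; rewrite /= lee_fin; have /andP[h1 h2] := fg n _ Dt.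
  by rewrite ger0_norm.
rewrite integral0 in cv.
have /fine_cvgP[fin /cvgrPdist_lt/(_ _ e0) cv'] := cv.
have [n0 _ hn] : \forall n \near \oo,
   (\int[nu]_(t in D) (f_ n t)%:E < e%:E)%E.
  near=> n.
  have fn : (\int[nu]_(t in D) (f_ n t)%:E)%E \is a fin_num by near: n.
  rewrite -(fineK fn) lte_fin (le_lt_trans (ler_norm _))//.
  have : `|0 - fine (\int[nu]_(t in D) (f_ n t)%:E)%E| < e by near: n.
  by rewrite sub0r normrN.
by exists n0 => n nn; apply: hn.
Unshelve. all: by end_near. Qed.

Variable h : R -> R[i].
Hypothesis mh : cmeasurable (Rpos R) h.

(** Here the measure is finite, the density [h] is bounded and t stays in a compact interval away
    from 0, so that constants dominate; these sets exhaust (0,+oo). *)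
Definition trunc_set (m : nat) : set T :=
  [set t : R | m.+1%:R^-1 <= t <= m.+1%:R /\ nrm (h t) <= m%:R].

(** The number of cells of length 1/(n+1) that cover [0, m+1]. The cells are half open, so one more
    is taken to contain the right end m+1. *)
Definition ncell (m n : nat) := (m.+1 * n.+1).+1.

Definition cell (n j : nat) : set T :=
  [set t : R | j%:R / n.+1%:R <= t < j.+1%:R / n.+1%:R].

Definition stepE (m n : nat) (i : 'I_(ncell m n)) : set T := cell n i `&` trunc_set m.

(** The right end of the cell, raised to 1/(m+1), so that even the tags of cells to the left of the
    truncated set stay away from 0. *)
Definition tag (m n i : nat) : R := Num.max (i.+1%:R / n.+1%:R) m.+1%:R^-1.

Definition stepf (V : lmodType R[i]) (m n : nat) (F : R -> V) (t : R) : V :=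
  \sum_(i < ncell m n) (\1_(stepE i) t : R)%:C%C *: F (tag m n i).

Lemma trunc_set_pos m : trunc_set m `<=` Rpos R.
Proof.
by move=> t [/andP[mt _] _]; apply/RposE; apply: lt_le_trans mt; rewrite invr_gt0.
Qed.

Lemma measurable_trunc_set m : measurable (trunc_set m).
Proof.
have -> : trunc_set m = `[m.+1%:R^-1, m.+1%:R]%classic `&`
    (Rpos R `&` [set t | nrm (h t) <= m%:R]).
  apply/seteqP; split => t /=.
    move=> tm; have := trunc_set_pos tm; move: tm => [tm hm] pt.
    by rewrite in_itv.
  by rewrite in_itv /= => -[? [_ ?]].
apply: measurableI; first exact: measurable_itv.
have := cmeas_nrm mh; move=> /(_ mR `]-oo, m%:R]%classic (measurable_itv _)).
congr measurable; apply/seteqP; split => t /=; by rewrite in_itv.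
Qed.

Lemma measurable_stepE m n i : measurable (@stepE m n i).
Proof.
apply: measurableI; last exact: measurable_trunc_set.
rewrite (_ : cell n i = `[i%:R / n.+1%:R, i.+1%:R / n.+1%:R[%classic); first exact: measurable_itv.
by apply/seteqP; split => t /=; rewrite in_itv.
Qed.

Lemma stepE_pos m n i : @stepE m n i `<=` Rpos R.
Proof. by move=> t [_ /trunc_set_pos]. Qed.

Lemma tag_ge m n i : m.+1%:R^-1 <= tag m n i.
Proof. by rewrite /tag le_max lexx orbT. Qed.

(** The last cell ends at m + 1 + 1/(n+1). *)
Lemma tag_le m n (i : 'I_(ncell m n)) : tag m n i <= m.+2%:R.
Proof.
rewrite /tag ge_max; apply/andP; split; last first.
  by rewrite (@le_trans _ _ 1) ?ler1n// invf_le1 ?ltr0n// ler1n.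
rewrite ler_pdivrMr ?ltr0n// -natrM ler_nat.
have := ltn_ord i; rewrite /ncell ltnS => h'.
by apply: (leq_ltn_trans h'); rewrite [ltnRHS]mulSn -[ltnLHS]add0n ltn_add2r.
Qed.

Lemma tag_gt0 m n i : 0 < tag m n i.
Proof. by rewrite (lt_le_trans _ (tag_ge m n i))// invr_gt0 ltr0n. Qed.

Lemma tag_near m n i t : @stepE m n i t -> `|tag m n i - t| <= n.+1%:R^-1.
Proof.
move=> [/andP[it ti] [/andP[mt _] _]].
(* In a cell that meets the truncated set, the maximum is the right end. *)
have -> : tag m n i = i.+1%:R / n.+1%:R.
  by apply/max_idPl; rewrite (le_trans mt)// ltW.
rewrite ger0_norm; last by rewrite subr_ge0 ltW.
rewrite lerBlDr.
rewrite -[i.+1]addn1 natrD mulrDl mul1r addrC lerD2l.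
by [].
Qed.

Lemma stepE_exists m n t : trunc_set m t -> exists i : 'I_(ncell m n), stepE i t.
Proof.
move=> tm; have [/andP[mt tm'] _] := tm.
have t0 : 0 <= t by rewrite (le_trans _ mt)// invr_ge0.
have n0 : 0 < n.+1%:R :> R by rewrite ltr0n.
have /truncn_itv/andP[k1 k2] : 0 <= t * n.+1%:R by rewrite mulr_ge0.
have kK : (Num.truncn (t * n.+1%:R) < ncell m n)%N.
  rewrite ltnS -(ler_nat R) (le_trans k1)// natrM ler_wpM2r//.
by exists (Ordinal kK); split => //; rewrite /cell /= ler_pdivrMr// ltr_pdivlMr// k1.
Qed.

Lemma stepE_uniq m n (i j : 'I_(ncell m n)) t : stepE i t -> stepE j t -> i = j.
Proof.
move=> [/andP[i1 i2] _] [/andP[j1 j2] _]; apply/val_inj/eqP => /=.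
have n0 : 0 < (n.+1%:R)^-1 :> R by rewrite invr_gt0 ltr0n.
have := le_lt_trans i1 j2; have := le_lt_trans j1 i2.
by rewrite !ltr_pM2r// !ltr_nat !ltnS => h1 h2; rewrite eqn_leq h1 h2.
Qed.

Lemma stepf_in (V : lmodType R[i]) m n (i : 'I_(ncell m n)) t (F : R -> V) :
  stepE i t -> stepf m n F t = F (tag m n i).
Proof.
move=> it; rewrite /stepf (bigD1 i)//= big1 ?addr0.
  by rewrite indicE mem_set// scale1r.
move=> j ji; rewrite indicE memNset ?scale0r// => jt.
by move/eqP: ji; apply; exact: stepE_uniq jt it.
Qed.

Lemma stepf_out (V : lmodType R[i]) m n t (F : R -> V) :
  ~ trunc_set m t -> stepf m n F t = 0.
Proof.
move=> nt; rewrite /stepf big1// => j _.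
by rewrite indicE memNset ?scale0r// => -[_ /nt].
Qed.

Lemma trunc_set_cvg t : 0 < t -> exists m0, forall m, (m0 <= m)%N -> trunc_set m t.
Proof.
move=> t0; pose m0 := (Num.truncn t^-1 + Num.truncn t + Num.truncn (nrm (h t))).+1.
have b (x : R) (k : nat) : (Num.truncn x <= k)%N -> x <= k.+1%:R.
  by move=> xk; rewrite (le_trans (ltW (truncnS_gt x)))// ler_nat ltnS.
exists m0 => m mm; split; first (apply/andP; split).
- rewrite -[leRHS]invrK lef_pV2 ?posrE ?invr_gt0 ?ltr0n//; apply: b.
  by rewrite (leq_trans _ mm)// leqW// -addnA leq_addr.
- by apply: b; rewrite (leq_trans _ mm)// leqW// -addnA addnCA leq_addr.
- rewrite (@le_trans _ _ m0%:R) ?ler_nat//; apply: b.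
  by rewrite leq_addl.
Qed.

Hypothesis fnu : forall a b : R, 0 < a -> (nu `[a, b]%classic < +oo)%E.

Lemma trunc_set_finite m : (nu (trunc_set m) < +oo)%E.
Proof.
apply: (@le_lt_trans _ _ (nu `[m.+1%:R^-1, m.+1%:R]%classic)).
  apply: le_measure; rewrite ?inE; [exact: measurable_trunc_set|exact: measurable_itv|].
  by move=> t [] /=; rewrite in_itv.
by apply: fnu; rewrite invr_gt0 ltr0n.
Qed.

Lemma trunc_set_int m : (\int[nu]_(t in trunc_set m) (nrm (h t))%:E < +oo)%E.
Proof.
apply: (@le_lt_trans _ _ (\int[nu]_(t in trunc_set m) (m%:R%:E))%E).
  apply: integral_lty_le; first exact: measurable_trunc_set.
  - apply: measurable_funS (cmeas_nrm mh); first exact: mR.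
    exact: trunc_set_pos.
  - exact: measurable_cst.
  - by move=> t _; exact: nrm_ge0.
  - by move=> t [].
rewrite integral_cst ?lte_mul_pinfty ?lee_fin ?trunc_set_finite//.
exact: measurable_trunc_set.
Qed.

Lemma stepE_int m n i : (\int[nu]_(t in @stepE m n i) (nrm (h t))%:E < +oo)%E.
Proof.
apply: le_lt_trans (trunc_set_int m); apply: ge0_subset_integral.
- exact: measurable_stepE.
- exact: measurable_trunc_set.
- apply/measurable_EFinP; apply: measurable_funS (cmeas_nrm mh); first exact: mR.
  exact: trunc_set_pos.
- by move=> t _; rewrite lee_fin nrm_ge0.
- by move=> t [].
Qed.

Section StepVector.
Context {V : lmodType R[i]} {D : set V} {N : V -> R}.
Hypothesis HD : nspace D N.
Variable F : R -> V.
Hypothesis DF : forall t, 0 < t -> D (F t).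
Hypothesis cF : forall t, 0 < t -> forall e : R, 0 < e ->
  exists2 d : R, 0 < d & forall s, 0 < s -> `|s - t| < d -> N (F s - F t) < e.
Hypothesis bF : forall a b : R, 0 < a ->
  exists M : R, forall t, a <= t <= b -> N (F t) <= M.

Lemma stepf_D m n t : D (stepf m n F t).
Proof. by apply: (ns_sum HD) => i; apply: (nsZ HD); apply: DF; exact: tag_gt0. Qed.

Lemma rcont_N c : D c -> rcont (fun t => N (F t - c)).
Proof.
move=> Dc t t0 e e0; have [d d0 hd] := cF t0 e0; exists d => // s s0 sd.
rewrite (le_lt_trans _ (hd _ s0 sd))// ler_norml lerBlDr.
have [Ds Dt] := (DF s0, DF t0).
by rewrite (nsNBD HD)// andbT lerNl opprB lerBlDr (nsNBC HD Ds Dt) (nsNBD HD).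
Qed.

(** [V] carries no measurable structure. The function is a finite sum of indicators times the
    continuous functions t |-> N (F t - c), c being 0 or a tagged value. *)
Lemma measurable_N_step m n :
  measurable_fun (Rpos R : set T) (fun t => N (F t - stepf m n F t)).
Proof.
have mN c : D c -> measurable_fun (Rpos R : set T) (fun t => N (F t - c)).
  by move=> Dc; apply: rcont_measurable; exact: rcont_N.
pose g t := \1_(~` trunc_set m) t * N (F t - 0) +
  \sum_(i < ncell m n) (\1_(@stepE m n i) t * N (F t - F (tag m n i))).
have mg : measurable_fun (Rpos R : set T) g.
  apply: measurable_funD.
    apply: measurable_funM; last by apply: mN; exact: (ns0 HD).
    by apply: measurable_indic; apply: measurableC; exact: measurable_trunc_set.
  apply: measurable_sum => i; apply: measurable_funM.
    by apply: measurable_indic; exact: measurable_stepE.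
  by apply: mN; apply: DF; exact: tag_gt0.
apply: eq_measurable_fun mg => t /[!inE] tR; rewrite /g.
have [tm|tm] := pselect (trunc_set m t).
  have [i it] := stepE_exists n tm.
  rewrite (stepf_in _ it) indicE memNset ?mul0r ?add0r; last exact.
  rewrite (bigD1 i)//= big1 ?addr0 ?indicE ?mem_set ?mul1r// => j ji.
  rewrite indicE memNset ?mul0r// => jt.
  by move/eqP: ji; apply; exact: stepE_uniq jt it.
rewrite stepf_out// indicE mem_set ?mul1r; last exact.
rewrite big1 ?addr0// => j _.
by rewrite indicE memNset ?mul0r// => -[_ /tm].
Qed.

(** Dominated convergence: on the truncated set [F] and its steps are bounded by [|M|] and [h] by m,
    and the tags tend to t, where [F] is continuous. *)
Lemma step_cvg m e : 0 < e -> exists n0, forall n, (n0 <= n)%N ->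
  (\int[nu]_(t in Rpos R) (\1_(trunc_set m) t * (N (F t - stepf m n F t) * nrm (h t)))%:E
    < e%:E)%E.
Proof.
move=> e0; have m0 : 0 < (m.+1%:R)^-1 :> R by rewrite invr_gt0 ltr0n.
have [M hM] := bF m.+2%:R m0.
have mI : measurable_fun (Rpos R : set T) (\1_(trunc_set m) : T -> R).
  by apply: measurable_indic; exact: measurable_trunc_set.
have FM t : trunc_set m t -> N (F t) <= M.
  move=> [/andP[mt tm] _]; rewrite hM// mt (le_trans tm)// ler_nat.
  by [].
have tagM n (i : 'I_(ncell m n)) : N (F (tag m n i)) <= M.
  by rewrite hM// tag_ge tag_le.
apply: (@dct0 _ _ (fun t => \1_(trunc_set m) t * (2 * `|M| * m%:R))) => //.
- move=> n; apply: measurable_funM => //; apply: measurable_funM; last exact: cmeas_nrm.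
  exact: measurable_N_step.
- by apply: measurable_funM => //; exact: measurable_cst.
- under eq_integral do rewrite mulrC EFinM.
  rewrite ge0_integralZl//.
  + rewrite integral_indic//; last exact: measurable_trunc_set.
    rewrite lte_mul_pinfty ?lee_fin ?mulr_ge0//.
    rewrite setIidl ?trunc_set_finite//; exact: trunc_set_pos.
  + exact/measurable_EFinP.
- move=> n t /RposE t0; have Ds := stepf_D m n t.
  have N0 : 0 <= N (F t - stepf m n F t) by apply: (nsN_ge0 HD); apply: (nsB HD) => //; exact: DF.
  rewrite mulr_ge0 ?mulr_ge0 ?nrm_ge0//=.
  rewrite indicE; case: (boolP (t \in _)); last by rewrite !mul0r.
  rewrite inE !mul1r => tm; apply: ler_pM => //; rewrite ?nrm_ge0//; last by case: tm.
  have [i it] := stepE_exists n tm.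
  rewrite (le_trans (nsNB HD (DF t0) Ds))// mulr_natl mulr2n lerD//.
    by rewrite (le_trans (FM _ tm))// ler_norm.
  by rewrite (stepf_in _ it) (le_trans (tagM _ _))// ler_norm.
- move=> t /RposE t0; have [tm|tm] := pselect (trunc_set m t); last first.
    rewrite (_ : (fun _ => _) = fun=> 0); first exact: cvg_cst.
    by apply/funext => n; rewrite indicE memNset// mul0r.
  apply/cvg0_seqP => e' e'0.
  have p0 : 0 < nrm (h t) + 1 by rewrite ltr_wpDl ?nrm_ge0.
  have [d d0 hd] := cF t0 (divr_gt0 e'0 p0).
  exists (Num.truncn d^-1).+1 => n nn; rewrite indicE mem_set// mul1r.
  have [i it] := stepE_exists n tm; rewrite (stepf_in _ it).
  have Dtag : D (F (tag m n i)) by apply: DF; exact: tag_gt0.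
  rewrite ger0_norm; last first.
    by rewrite mulr_ge0 ?nrm_ge0// (nsN_ge0 HD)//; apply: (nsB HD) => //; exact: DF.
  rewrite (nsNBC HD (DF t0) Dtag).
  have : N (F (tag m n i) - F t) < e' / (nrm (h t) + 1).
    apply: hd; first exact: tag_gt0.
    rewrite (le_lt_trans (tag_near it))// invf_plt ?posrE ?ltr0n//.
    by rewrite (lt_le_trans (truncnS_gt _))// ler_nat leqW.
  rewrite ltr_pdivlMr// => lt; apply: le_lt_trans lt.
  rewrite ler_wpM2l ?lerDl//; apply: (nsN_ge0 HD); apply: (nsB HD) => //; exact: DF.
Qed.

End StepVector.

Lemma trunc_tail (G : T -> R) : measurable_fun (Rpos R : set T) G ->
  (forall t, 0 < t -> 0 <= G t) ->
  (\int[nu]_(t in Rpos R) (G t)%:E < +oo)%E ->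
  forall e : R, 0 < e -> exists m0, forall m, (m0 <= m)%N ->
    (\int[nu]_(t in Rpos R) (\1_(~` trunc_set m) t * G t)%:E < e%:E)%E.
Proof.
move=> mG G0 IG e e0; apply: (@dct0 _ _ G) => //.
- move=> m; apply: measurable_funM => //.
  by apply: measurable_indic; apply: measurableC; exact: measurable_trunc_set.
- move=> m t /RposE t0; rewrite indicE; case: (_ \in _).
    by rewrite mul1r lexx G0.
  by rewrite mul0r lexx G0.
- move=> t /RposE t0; apply/cvg0_seqP => e' e'0.
  have [m0 hm] := trunc_set_cvg t0; exists m0 => m mm.
  by rewrite indicE memNset ?mul0r ?normr0//= => /(_ (hm _ mm)).
Qed.

End Steps.

Section Bochner.
Context {R : realType} {V : lmodType R[i]} (A : nalg V).
Local Notation T := (measurableTypeR R).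
Hypothesis HA : nspace (acar A) (anorm A).
Implicit Types (nu : {measure set T -> \bar R}) (h : R -> R[i]) (F : R -> V).
Let mR : measurable (Rpos R : set T) := @Rpos_measurable R.

Definition bfun (th : V -> R[i]) : Prop :=
  (forall (a : R[i]) u v, acar A u -> acar A v -> th (a *: u + v) = a * th u + th v) /\
  exists C : R, forall u, acar A u -> nrm (th u) <= C * anorm A u.

(** Such a family plays the part of the unit ball of the dual: identities and norm bounds for vector
    integrals are reduced to scalar ones. *)
Definition norming (Th : set (V -> R[i])) : Prop :=
  (forall th, Th th ->
    (forall (a : R[i]) u v, acar A u -> acar A v -> th (a *: u + v) = a * th u + th v) /\
    (forall u, acar A u -> nrm (th u) <= anorm A u)) /\
  (forall u (c : R), acar A u -> 0 <= c -> (forall th, Th th -> nrm (th u) <= c) ->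
    anorm A u <= c).

Lemma norming_bfun Th th : norming Th -> Th th -> bfun th.
Proof.
by move=> [h _] /h[l b]; split => //; exists 1 => u Au; rewrite mul1r b.
Qed.

Lemma norming_eq Th u v : norming Th -> acar A u -> acar A v ->
  (forall th, Th th -> th u = th v) -> u = v.
Proof.
move=> [hT nT] Au Av uv; apply: (ns_eq HA) => // e e0; apply: (nT); first exact: (nsB HA).
  exact: ltW.
move=> th Tth; have [l _] := hT _ Tth.
by rewrite addrC -scaleN1r l// uv// mulN1r addNr nrm0 ltW.
Qed.

Lemma bfun0 th : bfun th -> th 0 = 0.
Proof.
move=> [l _]; have := l 1 0 0 (ns0 HA) (ns0 HA).
by rewrite scale1r addr0 mul1r -[LHS]addr0 => /addrI.
Qed.

Lemma bfunZ th a u : bfun th -> acar A u -> th (a *: u) = a * th u.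
Proof.
move=> bt Au; have [l _] := bt.
by rewrite -[a *: u]addr0 l// ?bfun0// ?addr0//; exact: (ns0 HA).
Qed.

Lemma bfunD th u v : bfun th -> acar A u -> acar A v -> th (u + v) = th u + th v.
Proof. by move=> [l _] Au Av; rewrite -[u]scale1r l// mul1r scale1r. Qed.

Lemma bfunB th u v : bfun th -> acar A u -> acar A v -> th (u - v) = th u - th v.
Proof.
move=> bt Au Av; rewrite bfunD//; last exact: (nsN HA).
by rewrite -scaleN1r bfunZ// mulN1r.
Qed.

Lemma bfun_sum th (I : Type) (r : seq I) (G : I -> V) : bfun th ->
  (forall i, acar A (G i)) -> th (\sum_(i <- r) G i) = \sum_(i <- r) th (G i).
Proof.
move=> bt AG; elim: r => [|i r IH]; first by rewrite !big_nil bfun0.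
by rewrite !big_cons bfunD// ?IH//; exact: (ns_sum HA).
Qed.

Lemma bfun_le th : bfun th -> exists2 C : R, 0 <= C &
  forall u, acar A u -> nrm (th u) <= C * anorm A u.
Proof.
move=> [_ [C hC]]; exists `|C| => // u Au; rewrite (le_trans (hC _ Au))//.
by rewrite ler_wpM2r ?ler_norm// (nsN_ge0 HA).
Qed.

Definition ncont F : Prop := forall t, 0 < t -> forall e : R, 0 < e ->
  exists2 d : R, 0 < d & forall s, 0 < s -> `|s - t| < d -> anorm A (F s - F t) < e.

Definition nlocb F : Prop := forall a b : R, 0 < a ->
  exists M : R, forall t, a <= t <= b -> anorm A (F t) <= M.

Lemma cmeas_bfun th F : bfun th -> (forall t, 0 < t -> acar A (F t)) -> ncont F ->
  cmeasurable (Rpos R) (fun t => th (F t)).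
Proof.
move=> bt AF cF; have [C C0 hC] := bfun_le bt.
have p0 : 0 < C + 1 by rewrite ltr_wpDl.
have near t s e : 0 < t -> 0 < s -> anorm A (F s - F t) < e / (C + 1) ->
    nrm (th (F s) - th (F t)) < e.
  move=> t0 s0; rewrite ltr_pdivlMr// => lt.
  have [As At] := (AF _ s0, AF _ t0); have Ast := nsB HA As At.
  rewrite -bfunB// (le_lt_trans (hC _ Ast))// (le_lt_trans _ lt)// mulrC.
  by rewrite ler_wpM2l ?lerDl// (nsN_ge0 HA).
split; apply: rcont_measurable => t t0 e e0.
- have [d d0 hd] := cF _ t0 _ (divr_gt0 e0 p0); exists d => // s s0 sd.
  rewrite -ReN -ReD (le_lt_trans (Re_le_nrm _))//.
  by apply: near => //; exact: hd.
- have [d d0 hd] := cF _ t0 _ (divr_gt0 e0 p0); exists d => // s s0 sd.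
  rewrite -ImN -ImD (le_lt_trans (Im_le_nrm _))//.
  by apply: near => //; exact: hd.
Qed.

Lemma cint_indic nu (E : set T) h : measurable E -> E `<=` Rpos R ->
  cmeasurable (Rpos R) h -> (\int[nu]_(t in E) (nrm (h t))%:E < +oo)%E ->
  cint nu (Rpos R : set T) (fun t => (\1_E t : R)%:C%C * h t) /\
  cInt nu (Rpos R : set T) (fun t => (\1_E t : R)%:C%C * h t) = cInt nu E h.
Proof.
move=> mE ER mh Ih.
have EE : Rpos R `&` E = E by apply: setIidr.
have hE : (fun t => (\1_E t : R)%:C%C * h t) = restr E h.
  apply/funext => t; rewrite restrE indicE; case: (_ \in _); first by rewrite mul1r.
  by rewrite mul0r.
rewrite hE; split; last by rewrite -cInt_mkcondr EE.
split; first by apply/cmeas_restr => //; rewrite EE; exact: cmeasS mh.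
rewrite (_ : (\int[nu]_(t in Rpos R) _ = \int[nu]_(t in E) (nrm (h t))%:E)%E)//.
rewrite -[in RHS]EE integral_mkcondr; apply: eq_integral => t _.
by rewrite restrE patchE; case: (_ \in _) => //; rewrite nrm0.
Qed.

Lemma simple_functional nu h n (E : 'I_n -> set T) (c : 'I_n -> V) th : bfun th ->
  cmeasurable (Rpos R) h ->
  (forall i, [/\ measurable (E i), E i `<=` Rpos R, acar A (c i) &
        (\int[nu]_(t in E i) (nrm (h t))%:E < +oo)%E]) ->
  cint nu (Rpos R : set T)
    (fun t => th (\sum_(i < n) (\1_(E i) t : R)%:C%C *: c i) * h t) /\
  th (\sum_(i < n) cintegral nu (E i) h *: c i) =
  cInt nu (Rpos R : set T)
    (fun t => th (\sum_(i < n) (\1_(E i) t : R)%:C%C *: c i) * h t).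
Proof.
move=> bt mh hE.
have Ac i : acar A (c i) by case: (hE i).
have -> : (fun t => th (\sum_(i < n) (\1_(E i) t : R)%:C%C *: c i) * h t) =
    (fun t => \sum_(i < n) th (c i) * ((\1_(E i) t : R)%:C%C * h t)).
  apply/funext => t; rewrite bfun_sum// => [|i]; last exact: (nsZ HA).
  by rewrite mulr_suml; apply: eq_bigr => i _; rewrite bfunZ// mulrAC mulrC.
have IE i := cint_indic (let: And4 m _ _ _ := hE i in m) (let: And4 _ m _ _ := hE i in m)
   mh (let: And4 _ _ _ m := hE i in m).
have Ii i : cint nu (Rpos R : set T) (fun t => th (c i) * ((\1_(E i) t : R)%:C%C * h t)).
  by apply: cintZ => //; case: (IE i).
split; first exact: cint_sum.
rewrite cInt_sum// bfun_sum// => [|i]; last exact: (nsZ HA).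
apply: eq_bigr => i _; have [I1 I2] := IE i.
by rewrite cIntZ// I2 bfunZ// mulrC.
Qed.

(** The identity holds for simple functions by linearity, and a bounded functional controls the
    error of the approximation. *)
Lemma bochner_functional nu h F w th : bfun th -> cmeasurable (Rpos R) h ->
  (forall t, 0 < t -> acar A (F t)) -> cmeasurable (Rpos R) (fun t => th (F t)) ->
  bochner A nu h F w ->
  cint nu (Rpos R : set T) (fun t => th (F t) * h t) /\
  th w = cInt nu (Rpos R : set T) (fun t => th (F t) * h t).
Proof.
move=> bt mh AF mt [Aw hw]; have [C C0 hC] := bfun_le bt.
pose f t := th (F t) * h t.
have mf : cmeasurable (Rpos R) f by exact: cmeasM.
(* One error [C * e] comes from replacing [F] by a simple function under the integral, the other
   from replacing [w] by the simple integral. *)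
have key e : 0 < e -> cint nu (Rpos R : set T) f /\
   nrm (th w - cInt nu (Rpos R : set T) f) <= C * e + C * e.
  move=> e0; have [n [E [c /= [hE mN le1 le2]]]] := hw _ e0.
  have Ac i : acar A (c i) by case: (hE i).
  set s := fun t : R => \sum_(i < n) (\1_(E i) t : R)%:C%C *: c i.
  have As t : acar A (s t) by apply: (ns_sum HA) => i; exact: (nsZ HA).
  have [Is sE] := simple_functional bt mh hE.
  pose g t := C * (anorm A (F t - s t) * nrm (h t)).
  have mg : measurable_fun (Rpos R : set T) g.
    by apply: measurable_funM => //; apply: measurable_funM => //; exact: cmeas_nrm.
  have Ig : (\int[nu]_(t in Rpos R) (g t)%:E <= (C * e)%:E)%E.
    under eq_integral do rewrite EFinM.
    rewrite ge0_integralZl//.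
    - by rewrite EFinM lee_wpmul2l ?lee_fin// ltW.
    - by apply/measurable_EFinP; apply: measurable_funM => //; exact: cmeas_nrm.
    - move=> t /RposE t0; rewrite lee_fin mulr_ge0 ?nrm_ge0//.
      by apply: (nsN_ge0 HA); apply: (nsB HA) => //; exact: AF.
  have fg t : Rpos R t -> nrm (f t - th (s t) * h t) <= g t.
    move=> /RposE t0; rewrite -mulrBl nrmM /g mulrA ler_wpM2r ?nrm_ge0//.
    rewrite -bfunB ?hC//; [apply: (nsB HA) => //|]; exact: AF.
  have Id : cint nu (Rpos R : set T) (fun t => f t - th (s t) * h t).
    apply: (cint_le mR _ mg) => //; first by apply: cmeasB => //; case: Is.
    by rewrite (le_lt_trans Ig)// ltry.
  have If : cint nu (Rpos R : set T) f.
    apply: cint_eq (cintD mR Id Is) => t _.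
    by rewrite subrK.
  split => //; rewrite -(subrK (th (\sum_(i < n) cintegral nu (E i) h *: c i)) (th w)).
  set S := \sum_(i < n) _ in le2 sE *.
  have AS : acar A S by apply: (ns_sum HA) => i; exact: (nsZ HA).
  rewrite -addrA (le_trans (nrmD _ _))// lerD//.
    by rewrite -(bfunB bt Aw AS) (le_trans (hC _ (nsB HA Aw AS)))// ler_wpM2l// (nsNBC HA Aw AS) ltW.
  rewrite sE nrmBC -cIntB// -lee_fin.
  rewrite (le_trans (nrm_cIntE _ _ _))//; first by case: Id.
  rewrite (le_trans _ Ig)//; apply: integral_lty_le => //.
  - by apply: cmeas_nrm; case: Id.
  - by move=> t _; exact: nrm_ge0.
split; first by case: (key 1).
apply/eqP; rewrite -subr_eq0; apply/eqP/nrm_eq0/eqP.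
rewrite eq_le nrm_ge0 andbT; apply/ler_addgt0Pr => e e0; rewrite add0r.
have p0 : 0 < (C + C) + 1 by rewrite ltr_wpDl// addr_ge0.
have [_ h1] := key _ (divr_gt0 e0 p0); rewrite (le_trans h1)//.
rewrite -mulrDl mulrCA ler_piMr// ?ltW//.
by rewrite ltr_pdivrMr// mul1r ltrDl.
Qed.

Variable Th : set (V -> R[i]).
Hypothesis nTh : norming Th.

(** The witnesses are the tagged step functions on truncated sets. Their integrals are Cauchy, since
    the norming functionals bound a difference of two of them by the L^1 distance of the step
    functions. *)
Lemma bochner_exists nu h F :
  (forall a b : R, 0 < a -> (nu `[a, b]%classic < +oo)%E) ->
  cmeasurable (Rpos R) h -> ncomplete (acar A) (anorm A) ->
  (forall t, 0 < t -> acar A (F t)) -> ncont F -> nlocb F ->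
  (\int[nu]_(t in Rpos R) (anorm A (F t) * nrm (h t))%:E < +oo)%E ->
  exists w, bochner A nu h F w.
Proof.
move=> fnu mh cA AF cF bF IF; have [hT nT] := nTh.
have mNF : measurable_fun (Rpos R : set T) (fun t => anorm A (F t) * nrm (h t)).
  apply: measurable_funM; last exact: cmeas_nrm.
  rewrite (_ : (fun t => _) = fun t => anorm A (F t - 0)).
    by apply: rcont_measurable; apply: (rcont_N HA) => //; exact: (ns0 HA).
  by apply/funext => t; rewrite subr0.
have G0 t : 0 < t -> 0 <= anorm A (F t) * nrm (h t).
  by move=> t0; rewrite mulr_ge0 ?nrm_ge0// (nsN_ge0 HA)//; exact: AF.
have mstep m n : measurable_fun (Rpos R : set T)
   (fun t => anorm A (F t - stepf h m n F t) * nrm (h t)).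
  by apply: measurable_funM; [exact: (measurable_N_step mh HA)|exact: cmeas_nrm].
have step0 m n t : 0 < t -> 0 <= anorm A (F t - stepf h m n F t) * nrm (h t).
  move=> t0; rewrite mulr_ge0 ?nrm_ge0// (nsN_ge0 HA)//; apply: (nsB HA); first exact: AF.
  exact: (stepf_D h HA).
(* Off the truncated set the step function is 0, so the error there is the tail of [F]; inside,
   [step_cvg] applies. *)
have approx e : 0 < e -> exists mn : nat * nat,
   (\int[nu]_(t in Rpos R) (anorm A (F t - stepf h mn.1 mn.2 F t) * nrm (h t))%:E
     < e%:E)%E.
  move=> e0; have [m0 /(_ _ (leqnn _))hm] := trunc_tail mh mNF G0 IF (half_gt0 e0).
  have [n0 /(_ _ (leqnn _))hn] := step_cvg mh fnu HA AF cF bF m0 (half_gt0 e0).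
  exists (m0, n0) => /=; rewrite [e]splitr EFinD.
  apply: le_lt_trans (lteD hm hn).
  have mI : measurable (trunc_set h m0) by exact: measurable_trunc_set.
  rewrite -ge0_integralD//.
  - apply: ge0_le_integral => //.
    + by move=> t /RposE t0; rewrite lee_fin step0.
    + exact/measurable_EFinP.
    + apply: emeasurable_funD; apply/measurable_EFinP; apply: measurable_funM => //.
      by apply: measurable_indic; exact: measurableC.
    + move=> t /RposE t0; rewrite -EFinD lee_fin.
      have [tm|tm] := pselect (trunc_set h m0 t).
        rewrite [\1_(trunc_set h m0) t]indicE mem_set// mul1r lerDr mulr_ge0//.
        exact: G0.
      rewrite stepf_out// subr0 [\1_(~` _) t]indicE mem_set// mul1r lerDl.
      by rewrite mulr_ge0// G0.
  - by move=> t /RposE t0; rewrite lee_fin mulr_ge0// G0.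
  - apply/measurable_EFinP; apply: measurable_funM => //.
    by apply: measurable_indic; exact: measurableC.
  - by move=> t /RposE t0; rewrite lee_fin mulr_ge0// step0.
  - by apply/measurable_EFinP; apply: measurable_funM => //; exact: measurable_indic.
have /choice[mn hmn] (k : nat) : exists mn : nat * nat,
   (\int[nu]_(t in Rpos R) (anorm A (F t - stepf h mn.1 mn.2 F t) * nrm (h t))%:E
     < (k.+1%:R^-1)%:E)%E.
  by apply: approx; rewrite invr_gt0.
pose E k := @stepE _ h (mn k).1 (mn k).2.
pose c k (i : 'I_(ncell (mn k).1 (mn k).2)) := F (tag (mn k).1 (mn k).2 i).
pose s k t := stepf h (mn k).1 (mn k).2 F t.
have hE k i : [/\ measurable (E k i : set T), E k i `<=` Rpos R, acar A (c k i) &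
        (\int[nu]_(t in E k i) (nrm (h t))%:E < +oo)%E].
  split; [exact: measurable_stepE|exact: stepE_pos|apply: AF; exact: tag_gt0|].
  exact: stepE_int.
pose w k := \sum_i cintegral nu (E k i) h *: c k i.
have Aw k : acar A (w k).
  by apply: (ns_sum HA) => i; apply: (nsZ HA); case: (hE k i).
have As k t : acar A (s k t) by exact: (stepf_D h HA).
(* Both step functions are compared with [F], each at distance less than the inverse of its index
   plus one. *)
have dw k l : anorm A (w k - w l) <= k.+1%:R^-1 + l.+1%:R^-1.
  apply: nT; first exact: (nsB HA).
    by rewrite addr_ge0// invr_ge0.
  move=> th Tth; have bt := norming_bfun nTh Tth; have [_ lth] := hT _ Tth.
  have [Ik wk] := simple_functional bt mh (hE k).
  have [Il wl] := simple_functional bt mh (hE l).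
  rewrite bfunB// wk wl -cIntB// -lee_fin (le_trans (nrm_cIntE _ _ _))//.
    by apply: cmeasB; [case: Ik|case: Il].
  rewrite EFinD (le_trans _ (ltW (lteD (hmn k) (hmn l))))//.
  rewrite -ge0_integralD//.
  - apply: ge0_le_integral => //.
    + by move=> t _; rewrite lee_fin nrm_ge0.
    + by apply/measurable_EFinP; apply: cmeas_nrm; apply: cmeasB; [case: Ik|case: Il].
    + by apply: emeasurable_funD; exact/measurable_EFinP.
    + move=> t /RposE t0; rewrite -EFinD lee_fin -mulrDl -mulrBl nrmM.
      rewrite ler_wpM2r ?nrm_ge0// -bfunB; [|by []|exact: (As k t)|exact: (As l t)].
      rewrite (le_trans (lth _ (nsB HA (As k t) (As l t))))//.
      rewrite (nsNBC HA (AF _ t0) (As k t)).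
      exact: (nsNBD HA (As k t) (As l t) (AF _ t0)).
  - by move=> t /RposE t0; rewrite lee_fin step0.
  - exact/measurable_EFinP.
  - by move=> t /RposE t0; rewrite lee_fin step0.
  - exact/measurable_EFinP.
have inv_small (e : R) : 0 < e -> exists k0, forall k, (k0 <= k)%N -> k.+1%:R^-1 < e.
  move=> e0; exists (Num.truncn e^-1) => k kk.
  rewrite invf_plt ?posrE ?ltr0n// (lt_le_trans (truncnS_gt _))// ler_nat ltnS.
  by [].
have cw : ncauchy (anorm A) w.
  move=> e e0; have [k0 hk] := inv_small _ (half_gt0 e0).
  exists k0 => k l kk ll; rewrite (le_lt_trans (dw k l))// (splitr e) ltrD//; exact: hk.
have [x Ax hx] := cA w Aw cw.
exists x; split => // e e0.
have [k0 hk0] := inv_small _ e0; have [k1 hk1] := hx _ e0.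
pose k := maxn k0 k1.
exists (ncell (mn k).1 (mn k).2), (E k), (c k); split.
- exact: hE.
- exact: (measurable_N_step mh HA).
- by apply: lt_trans (hmn k) _; rewrite lte_fin hk0// leq_maxl.
- by apply: hk1; rewrite leq_maxr.
Qed.

End Bochner.

(** * Convolution *)

Section ComplexFubini.
Context {R : realType}.
Local Notation T := (measurableTypeR R).
Local Notation leb := (@lebesgue_measure R).
Implicit Types (F : T * T -> R[i]).

Lemma cmeas_comp d1 d2 (S1 : measurableType d1) (S2 : measurableType d2)
    (f : S2 -> R[i]) (p : S1 -> S2) :
  cmeas setT f -> measurable_fun setT p -> cmeas setT (fun x => f (p x)).
Proof.
move=> [mr mi] mp.
by split; [exact: (measurableT_comp mr mp)|exact: (measurableT_comp mi mp)].
Qed.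

(** The real integral is [fine] of a difference of integrals of positive parts, each measurable by
    Tonelli; this covers the sections that are not integrable too. *)
Lemma measurable_Rintegral_section (f : T * T -> R) : measurable_fun setT f ->
  measurable_fun (setT : set T) (fun x : T => \int[leb]_y f (x, y)).
Proof.
move=> mf; rewrite /Rintegral; apply: measurableT_comp.
  exact: fine_measurable.
have mE : measurable_fun setT (EFin \o f) by exact/measurable_EFinP.
rewrite (_ : (fun x : T => _) = (fun x : T =>
    fubini_F leb (EFin \o f)^\+ x - fubini_F leb (EFin \o f)^\- x)%E); last first.
  apply/funext => x; rewrite integralE.
  by congr (_ - _)%E; apply: eq_integral => y _; rewrite ?funeposE ?funenegE.
apply: emeasurable_funB.
- exact: (measurable_fun_fubini_tonelli_F _ (measurable_funepos mE) (fun=> funepos_ge0 _ _)).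
- exact: (measurable_fun_fubini_tonelli_F _ (measurable_funeneg mE) (fun=> funeneg_ge0 _ _)).
Qed.

Lemma cmeas_section F : cmeas setT F ->
  cmeas (setT : set T) (fun x => cInt leb (setT : set T) (fun y => F (x, y))).
Proof.
move=> [mr mi]; split.
- exact: (@measurable_Rintegral_section (fun z => complex.Re (F z))).
- exact: (@measurable_Rintegral_section (fun z => complex.Im (F z))).
Qed.

Lemma ae_eq_Rintegral (f g : T -> R) : measurable_fun setT f -> measurable_fun setT g ->
  {ae leb, forall x, f x = g x} -> \int[leb]_x f x = \int[leb]_x g x.
Proof.
move=> mf mg fg; congr fine; apply: ae_eq_integral => //; try exact/measurable_EFinP.
by apply: filterS fg => x -> _.
Qed.

Lemma ae_eq_cInt (f g : T -> R[i]) : cmeas (setT : set T) f -> cmeas (setT : set T) g ->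
  {ae leb, forall x, f x = g x} ->
  cInt leb (setT : set T) f = cInt leb (setT : set T) g.
Proof.
move=> [fr fi] [gr gi] fg; congr Complex; apply: ae_eq_Rintegral => //;
by apply: filterS fg => x ->.
Qed.

(** The real and the extended inner integrals agree wherever the section is integrable, hence almost
    everywhere, which is enough for the outer integral. *)
Lemma Rfubini (f : T * T -> R) : measurable_fun setT f ->
  (\int[leb]_y \int[leb]_x `|(f (x, y))%:E| < +oo)%E ->
  \int[leb]_x \int[leb]_y f (x, y) = \int[leb]_y \int[leb]_x f (x, y).
Proof.
move=> mf If; have mE : measurable_fun setT (EFin \o f) by exact/measurable_EFinP.
have I : (leb \x leb)%E.-integrable setT (EFin \o f) by apply/integrable21ltyP.
have := @Fubini _ _ T T R leb leb _ I.
have ae1 := @ae_integrable1 _ _ T T R leb leb _ I.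
have ae2 := @ae_integrable2 _ _ T T R leb leb _ I.
have m1 := @measurable_fubini_F _ _ T T R leb leb _ I.
have m2 := @measurable_fubini_G _ _ T T R leb leb _ I.
move=> E; rewrite /Rintegral; congr fine.
transitivity (\int[leb]_x \int[leb]_y (EFin \o f) (x, y))%E.
  apply: ae_eq_integral; [exact: measurableT| |exact: m1|].
  - apply/measurable_EFinP; exact: measurable_Rintegral_section.
  - by apply: filterS ae1 => x Ix _; rewrite fineK//; exact: integrable_fin_num.
rewrite E; apply: ae_eq_integral; [exact: measurableT|exact: m2| |].
- apply/measurable_EFinP.
  apply: (@measurable_Rintegral_section (f \o (fun z => (z.2, z.1)))).
  apply: measurableT_comp => //; exact: measurable_swap.
- by apply: filterS ae2 => x Ix _; rewrite fineK//; exact: integrable_fin_num.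
Qed.

Lemma cfubini F : cmeas setT F ->
  (\int[leb]_y \int[leb]_x (nrm (F (x, y)))%:E < +oo)%E ->
  cInt leb (setT : set T) (fun x => cInt leb (setT : set T) (fun y => F (x, y))) =
  cInt leb (setT : set T) (fun y => cInt leb (setT : set T) (fun x => F (x, y))).
Proof.
move=> mF IF; have mn := cmeas_nrm mF; have [mr mi] := mF.
have mn2 : measurable_fun setT (EFin \o (fun z => nrm (F z))) by exact/measurable_EFinP.
have le (p : R[i] -> R) : measurable_fun setT (fun z => p (F z)) ->
    (forall z, `|p z| <= nrm z) ->
    (\int[leb]_y \int[leb]_x `|(p (F (x, y)))%:E| < +oo)%E.
  move=> mp pn; have mp2 : measurable_fun setT (EFin \o (fun z => `|p (F z)|)).
    by apply/measurable_EFinP; exact: measurableT_comp.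
  apply: le_lt_trans IF; apply: ge0_le_integral => //.
  - by move=> y _; exact: integral_ge0.
  - exact: (@measurable_fun_fubini_tonelli_G _ _ T T R leb
       (EFin \o (fun z => `|p (F z)|)) mp2 (fun z => normr_ge0 (p (F z)))).
  - apply: (@measurable_fun_fubini_tonelli_G _ _ T T R leb _ mn2) => z.
    by rewrite lee_fin nrm_ge0.
  - move=> y _; apply: ge0_le_integral => //.
    + exact: (measurableT_comp mp2 (pair2_measurable y)).
    + exact: (measurableT_comp mn2 (pair2_measurable y)).
    + by move=> x _; rewrite lee_fin pn.
apply: complexP.
- exact: (@Rfubini (fun z => complex.Re (F z)) mr (le _ mr (@Re_le_nrm R))).
- exact: (@Rfubini (fun z => complex.Im (F z)) mi (le _ mi (@Im_le_nrm R))).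
Qed.

Lemma lebesgue_translation (a : R) (A : set T) : measurable A ->
  leb A = pushforward leb (fun r : T => r - a : T) A.
Proof.
move=> mA; have ms : measurable_fun setT (fun r : T => r - a : T).
  by apply: measurable_funB => //; exact: measurable_cst.
pose m := pushforward leb (fun r : T => r - a : T).
apply: (@lebesgue_measure_unique R m) => // _ [[x y] _ <-] /=.
rewrite /m /= /pushforward.
rewrite (_ : _ @^-1` _ = `]x + a, y + a]%classic).
  by rewrite !lebesgue_measure_itv /= !lte_fin ltrD2r -!EFinD opprD addrACA subrr addr0.
by apply/seteqP; split => r /=; rewrite !in_itv /= ltrBrDr lerBlDr.
Qed.

Lemma ge0_integral_translation (a : R) (f : T -> \bar R) : measurable_fun setT f ->
  (forall t, 0 <= f t)%E ->
  (\int[leb]_t f (t - a)%R = \int[leb]_t f t)%E.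
Proof.
move=> mf f0; have ms : measurable_fun setT (fun r : T => r - a : T).
  by apply: measurable_funB => //; exact: measurable_cst.
rewrite [RHS](@eq_measure_integral _ _ _ _ (pushforward leb (fun r : T => r - a : T))); last first.
  by move=> A mA _; exact: lebesgue_translation.
by rewrite (@ge0_integral_pushforward _ _ _ _ _ _ ms)//.
Qed.

Lemma cInt_translation (a : R) (f : T -> R[i]) : cmeas (setT : set T) f ->
  cInt leb (setT : set T) (fun t => f (t - a)) = cInt leb (setT : set T) f.
Proof.
have key (g : T -> R) : measurable_fun setT g ->
    \int[leb]_t g (t - a) = \int[leb]_t g t.
  move=> mg; have mE : measurable_fun setT (EFin \o g) by exact/measurable_EFinP.
  rewrite /Rintegral integralE [in RHS]integralE; congr (fine (_ - _)%E).
  - rewrite -(ge0_integral_translation a (measurable_funepos mE) (fun=> funepos_ge0 _ _)).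
    by apply: eq_integral => y _; rewrite !funeposE.
  - rewrite -(ge0_integral_translation a (measurable_funeneg mE) (fun=> funeneg_ge0 _ _)).
    by apply: eq_integral => y _; rewrite !funenegE.
by move=> [mr mi]; congr Complex; exact: key.
Qed.

(** Uniqueness of Lebesgue measure: the image measure still gives half-open intervals their length,
    although reflection exchanges the closed and the open end. *)
Lemma lebesgue_reflection (a : R) (A : set T) : measurable A ->
  leb A = pushforward leb (fun r : T => a - r : T) A.
Proof.
move=> mA; have ms : measurable_fun setT (fun r : T => a - r : T).
  by apply: measurable_funB => //; exact: measurable_cst.
pose m := pushforward leb (fun r : T => a - r : T).
apply: (@lebesgue_measure_unique R m) => // _ [[x y] _ <-] /=.
rewrite /m /= /pushforward.
rewrite (_ : _ @^-1` _ = `[a - y, a - x[%classic).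
  rewrite !lebesgue_measure_itv /= !lte_fin ltrD2l ltrN2 -!EFinD; congr (if _ then _%:E else _).
  ring.
apply/seteqP; split => r /=; rewrite !in_itv /=; move=> /andP[h1 h2]; apply/andP; split; lra.
Qed.

Lemma cInt_reflection (a : R) (f : T -> R[i]) : cmeas (setT : set T) f ->
  cInt leb (setT : set T) (fun t => f (a - t)) = cInt leb (setT : set T) f.
Proof.
have ms : measurable_fun setT (fun r : T => a - r : T).
  by apply: measurable_funB => //; exact: measurable_cst.
have key (g : T -> \bar R) : measurable_fun setT g -> (forall t, 0 <= g t)%E ->
    (\int[leb]_t g (a - t)%R = \int[leb]_t g t)%E.
  move=> mg g0.
  rewrite [RHS](@eq_measure_integral _ _ _ _ (pushforward leb (fun r : T => a - r : T))).
    by rewrite (@ge0_integral_pushforward _ _ _ _ _ _ ms).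
  by move=> A mA _; exact: lebesgue_reflection.
have keyR (g : T -> R) : measurable_fun setT g ->
    \int[leb]_t g (a - t) = \int[leb]_t g t.
  move=> mg; have mE : measurable_fun setT (EFin \o g) by exact/measurable_EFinP.
  rewrite /Rintegral integralE [in RHS]integralE; congr (fine (_ - _)%E).
  - rewrite -(key _ (measurable_funepos mE) (fun=> funepos_ge0 _ _)).
    by apply: eq_integral => y _; rewrite !funeposE.
  - rewrite -(key _ (measurable_funeneg mE) (fun=> funeneg_ge0 _ _)).
    by apply: eq_integral => y _; rewrite !funenegE.
by move=> [mr mi]; congr Complex; exact: keyR.
Qed.

End ComplexFubini.

(** Local bounds are taken on intervals [a, b] with a > 0, because omega_T may blow up at 0. *)
Record weight (R : realType) (w : R -> R) : Prop := Weight {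
  w_ge0 : forall t, 0 < t -> 0 <= w t ;
  w_meas : measurable_fun (Rpos R : set (measurableTypeR R)) w ;
  w_sub : forall s t, 0 < s -> 0 < t -> w (s + t) <= w s * w t ;
  w_loc : forall a b, 0 < a -> exists M : R, forall t, a <= t <= b -> w t <= M }.

Lemma weight_cint (R : realType) (w : R -> R) (nu : {measure set (measurableTypeR R) -> \bar R})
    (h k : R -> R[i]) (C : R) : weight w -> cmeasurable (Rpos R) h ->
  (\int[nu]_(t in Rpos R) (nrm (h t) * w t)%:E < +oo)%E ->
  cmeasurable (Rpos R) k -> (forall t, 0 < t -> nrm (k t) <= C * w t) ->
  cint nu (Rpos R : set (measurableTypeR R)) (fun t => k t * h t).
Proof.
move=> ww mh Ih mk kC; have mR := @Rpos_measurable R.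
have mw := w_meas ww; have mnh := cmeas_nrm mh.
have G0 t : 0 < t -> 0 <= nrm (h t) * w t by move=> t0; rewrite mulr_ge0 ?nrm_ge0// (w_ge0 ww).
have le : (\int[nu]_(t in Rpos R) (`|C| * (nrm (h t) * w t))%:E < +oo)%E.
  under eq_integral do rewrite EFinM.
  rewrite ge0_integralZl//; first by rewrite lte_mul_pinfty// lee_fin.
  + by apply/measurable_EFinP; exact: measurable_funM.
  + by move=> t /RposE t0; rewrite lee_fin G0.
apply: (cint_le mR _ _ _ le); first exact: cmeasM.
- by apply: measurable_funM; [exact: measurable_cst|exact: measurable_funM].
- move=> t /RposE t0; rewrite nrmM mulrC mulrCA ler_wpM2l ?nrm_ge0//.
  by rewrite (le_trans (kC _ t0))// ler_wpM2r ?ler_norm// (w_ge0 ww).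
Qed.

Section Convolution.
Context {R : realType}.
Local Notation T := (measurableTypeR R).
Local Notation leb := (@lebesgue_measure R).
Variable w : R -> R.
Hypothesis ww : weight w.
Implicit Types (k : R -> R[i]) (f g : R -> R[i]^o).
Let mR : measurable (Rpos R : set T) := @Rpos_measurable R.

(** Extension by 0 to the line: convolutions become integrals over the whole line, which is
    invariant under translation and reflection. *)
Definition zext k : R -> R[i] := restr (Rpos R) k.

Lemma zext_pos k t : 0 < t -> zext k t = k t.
Proof. by move=> /RposE t0; rewrite /zext restrE mem_set. Qed.

Lemma zext_npos k t : t <= 0 -> zext k t = 0.
Proof.
move=> t0; rewrite /zext restrE memNset// => /RposE.
by rewrite ltNge t0.
Qed.

Lemma cmeas_zext k : cmeasurable (Rpos R) k -> cmeas (setT : set T) (zext k).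
Proof. by move=> mk; apply/cmeas_restr => //; rewrite setTI. Qed.

Lemma cInt_zext (nu : {measure set T -> \bar R}) k :
  cInt nu (Rpos R : set T) k = cInt nu (setT : set T) (zext k).
Proof. by rewrite cInt_mkcond. Qed.

Lemma integral_zext (nu : {measure set T -> \bar R}) k :
  (\int[nu]_(t in Rpos R) (nrm (k t))%:E = \int[nu]_t (nrm (zext k t))%:E)%E.
Proof.
rewrite integral_mkcond; apply: eq_integral => t _.
by rewrite patchE /zext restrE; case: ifP => //; rewrite nrm0.
Qed.

Lemma convE f g t : amul (L1 w) f g t =
  cInt leb (setT : set T) (fun s => zext f (t - s) * zext g s).
Proof.
rewrite /L1 /= -[LHS]/(cInt leb (`]0, t[%classic : set T) _) cInt_mkcond.
apply: eq_cInt => s _; rewrite restrE; case: ifPn => [/[!inE] /=|].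
  by rewrite in_itv /= => /andP[s0 st]; rewrite !zext_pos// subr_gt0.
rewrite notin_setE /= in_itv /= => /negP; rewrite negb_and -!leNgt => /orP[s0|ts].
  by rewrite [zext g s]zext_npos// mulr0.
by rewrite zext_npos ?mul0r// subr_le0.
Qed.

Lemma conv_comm f g : acar (L1 w) f -> acar (L1 w) g ->
  amul (L1 w) f g = amul (L1 w) g f.
Proof.
move=> [mf _] [mg _]; apply/funext => t; rewrite !convE.
have mz : cmeas (setT : set T) (fun s : T => zext f s * zext g (t - s)).
  apply: cmeasM; first exact: cmeas_zext.
  apply: (cmeas_comp (cmeas_zext mg)).
  by apply: measurable_funB => //; exact: measurable_cst.
transitivity (cInt leb (setT : set T) (fun s => zext f (t - s) * zext g (t - (t - s)))).
  by apply: eq_cInt => s _; rewrite subKr.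
rewrite (cInt_reflection t mz); apply: eq_cInt => s _.
by rewrite mulrC.
Qed.

Section Fubini.
Variables (k : R -> R[i]) (C : R) (f g : R -> R[i]^o).
Hypothesis mk : cmeasurable (Rpos R) k.
Hypothesis kC : forall t, 0 < t -> nrm (k t) <= C * w t.
Hypothesis Lf : acar (L1 w) f.
Hypothesis Lg : acar (L1 w) g.

(** With z = (r, s), integrating in s gives k(r) times the convolution at r; integrating in r pairs
    [k] with the translate of [f] by s. *)
Let G (z : T * T) : R[i] := zext k z.1 * (zext f (z.1 - z.2) * zext g z.2).

Let mzf : cmeas (setT : set T) (zext f). Proof. by apply: cmeas_zext; case: Lf. Qed.
Let mzg : cmeas (setT : set T) (zext g). Proof. by apply: cmeas_zext; case: Lg. Qed.
Let mzk : cmeas (setT : set T) (zext k). Proof. exact: cmeas_zext. Qed.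

Let mfsub : cmeas setT (fun z : T * T => zext f (z.1 - z.2) : R[i]).
Proof.
apply: (@cmeas_comp _ _ _ _ _ (zext f) (fun z : T * T => z.1 - z.2 : T)) => //.
apply: measurable_funB; [exact: measurable_fst|exact: measurable_snd].
Qed.

Let mfg : cmeas setT (fun z : T * T => zext f (z.1 - z.2) * zext g z.2 : R[i]).
Proof.
apply: cmeasM => //.
apply: (@cmeas_comp _ _ _ _ _ (zext g) (fun z : T * T => z.2)) => //.
exact: measurable_snd.
Qed.

Let mG : cmeas setT G.
Proof.
apply: cmeasM => //.
apply: (@cmeas_comp _ _ _ _ _ (zext k) (fun z : T * T => z.1)) => //.
exact: measurable_fst.
Qed.

Lemma conv_measurable : cmeas (setT : set T) (amul (L1 w) f g).
Proof.
rewrite (_ : amul (L1 w) f g = (fun x : T => cInt leb (setT : set T)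
    (fun y : T => zext f (x - y) * zext g y))).
  exact: (cmeas_section mfg).
by apply/funext => t; rewrite convE.
Qed.

Let B : R := fine (\int[leb]_(t in Rpos R) (nrm (f t) * w t)%:E)%E.

Let BE : (\int[leb]_(t in Rpos R) (nrm (f t) * w t)%:E = B%:E)%E.
Proof.
rewrite /B fineK// ge0_fin_numE; first by case: Lf.
by apply: integral_ge0 => t /RposE t0; rewrite lee_fin mulr_ge0 ?nrm_ge0// w_ge0.
Qed.

Let B0 : 0 <= B.
Proof.
rewrite -lee_fin -BE; apply: integral_ge0 => t /RposE t0.
by rewrite lee_fin mulr_ge0 ?nrm_ge0// w_ge0.
Qed.

(** After the substitution r -> r + s, the bound is |k(r + s)| <= C w(r + s) <= C w(s) w(r). *)
Let shift_nrm (s : R) : 0 < s ->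
  (\int[leb]_r (nrm (zext k r * zext f (r - s)))%:E <= (C * w s * B)%:E)%E.
Proof.
move=> s0; have C0 : 0 <= C * w s by rewrite (le_trans (nrm_ge0 _) (kC s0)).
have ms (a : R) : measurable_fun setT (fun r : T => r + a : T).
  by apply: measurable_funD => //; exact: measurable_cst.
pose p (r : T) := nrm (zext k (r + s) * zext f r).
have mp : measurable_fun (setT : set T) p.
  by apply: cmeas_nrm; apply: cmeasM => //; exact: (cmeas_comp mzk (ms s)).
rewrite (_ : (\int[leb]_r _ = \int[leb]_r (EFin \o p) (r - s)%R)%E); last first.
  by apply: eq_integral => r _; rewrite /p /= subrK.
rewrite (@ge0_integral_translation _ s (EFin \o p)); last 2 first.
- exact/measurable_EFinP.
- by move=> r; rewrite lee_fin nrm_ge0.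
rewrite (_ : (\int[leb]_r _ = \int[leb]_(r in Rpos R) (p r)%:E)%E); last first.
  rewrite [RHS]integral_mkcond; apply: eq_integral => r _; rewrite patchE.
  case: ifPn => //; rewrite notin_setE => nr; rewrite /p /= [zext f r]zext_npos.
    by rewrite mulr0 nrm0.
  by rewrite leNgt; apply/negP => /RposE.
rewrite EFinM -BE -ge0_integralZl//.
- apply: ge0_le_integral => //.
  + by move=> r _; rewrite lee_fin nrm_ge0.
  + by apply/measurable_EFinP; exact: measurable_funTS.
  + apply/measurable_EFinP; apply: measurable_funM; first exact: measurable_cst.
    apply: measurable_funM; last exact: w_meas ww.
    by apply: cmeas_nrm; case: Lf.
  + move=> r /RposE r0; rewrite lee_fin /p !zext_pos ?addr_gt0// nrmM.
    rewrite mulrCA mulrC ler_wpM2l ?nrm_ge0// (le_trans (kC (addr_gt0 r0 s0)))//.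
    (* The sign of [C] is unknown. If the product vanishes, so does w(r + s) and both sides are 0;
       otherwise w(s) > 0 and C >= 0 follows. *)
    have [w0|w0] := eqVneq (w s * w r) 0.
      have : w (r + s) = 0.
        apply/eqP; rewrite eq_le w_ge0 ?addr_gt0// andbT.
        by rewrite (le_trans (w_sub ww r0 s0))// mulrC w0.
      by move=> ->; rewrite mulr0 -mulrA w0 mulr0.
    have C0' : 0 <= C.
      have wp : 0 < w s.
        rewrite lt_neqAle w_ge0// andbT eq_sym.
        by apply: contra_neq w0 => ->; rewrite mul0r.
      by rewrite -(pmulr_lge0 _ wp).
    by rewrite -mulrA ler_wpM2l// mulrC w_sub.
- apply/measurable_EFinP; apply: measurable_funM; last exact: w_meas ww.
  by apply: cmeas_nrm; case: Lf.
- by move=> r /RposE r0; rewrite lee_fin mulr_ge0 ?nrm_ge0// w_ge0.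
Qed.

(** By [shift_nrm] the inner integral is at most C B w(s) |g(s)|, an integrable function of s. *)
Let intG : (\int[leb]_s \int[leb]_r (nrm (G (r, s)))%:E < +oo)%E.
Proof.
have mn : measurable_fun setT (EFin \o (fun z => nrm (G z))).
  by apply/measurable_EFinP; exact: cmeas_nrm.
have [mg Ig] := Lg.
pose q (s : T) := (zext (fun t => (C * B * (nrm (g t) * w t))%:C%C) s).
have mq : cmeas (setT : set T) q.
  apply: cmeas_zext; apply: cmeas_real; apply: measurable_funM => //.
  by apply: measurable_funM; [exact: cmeas_nrm|exact: w_meas ww].
apply: (@le_lt_trans _ _ (\int[leb]_s (nrm (q s))%:E)%E).
  apply: ge0_le_integral => //.
  - by move=> s _; apply: integral_ge0 => r _; rewrite lee_fin nrm_ge0.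
  - apply: (@measurable_fun_fubini_tonelli_G _ _ T T R leb _ mn) => z.
    by rewrite lee_fin nrm_ge0.
  - by apply/measurable_EFinP; exact: cmeas_nrm.
  - move=> s _; have [s0|s0] := ltP 0 s; last first.
      rewrite integral0_eq ?lee_fin ?nrm_ge0// => r _.
      by rewrite /G /= [zext g s]zext_npos// !mulr0 nrm0.
    rewrite (_ : (\int[leb]_r _ = \int[leb]_r ((nrm (g s))%:E *
        (nrm (zext k r * zext f (r - s)))%:E))%E); last first.
      by apply: eq_integral => r _; rewrite /G /= mulrA nrmM [zext g s]zext_pos// mulrC EFinM.
    rewrite ge0_integralZl//; last 3 first.
    - apply/measurable_EFinP; apply: cmeas_nrm; apply: cmeasM => //.
      apply: (cmeas_comp mzf); apply: measurable_funB => //; exact: measurable_cst.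
    - by move=> r _; rewrite lee_fin nrm_ge0.
    - by rewrite lee_fin nrm_ge0.
    rewrite (le_trans (lee_wpmul2l _ (shift_nrm s0))) ?lee_fin ?nrm_ge0//.
    rewrite /q zext_pos// nrm_real (le_trans _ (ler_norm _))//.
    by rewrite le_eqVlt; apply/orP; left; apply/eqP; ring.
rewrite /q -integral_zext.
rewrite (_ : (\int[leb]_(t in Rpos R) _ = \int[leb]_(t in Rpos R)
   (`|C * B|%:E * (nrm (g t) * w t)%:E))%E); last first.
  apply: eq_integral => t /[!inE] /RposE t0; rewrite nrm_real normrM EFinM.
  by rewrite [X in (_ * X)%E](_ : _ = (nrm (g t) * w t)%:E)// ger0_norm// mulr_ge0 ?nrm_ge0// w_ge0.
rewrite ge0_integralZl//.
- by rewrite lte_mul_pinfty// lee_fin.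
- apply/measurable_EFinP; apply: measurable_funM; last exact: w_meas ww.
  exact: cmeas_nrm.
- by move=> r /RposE r0; rewrite lee_fin mulr_ge0 ?nrm_ge0// w_ge0.
Qed.

Lemma shift_cInt (s : R) : 0 < s ->
  cint leb (setT : set T) (fun r => zext k r * zext f (r - s)) /\
  cInt leb (setT : set T) (fun r => zext k r * zext f (r - s)) =
  cInt leb (Rpos R : set T) (fun t => k (s + t) * (f t : R[i])).
Proof.
move=> s0; have ms (a : R) : measurable_fun setT (fun r : T => r + a : T).
  by apply: measurable_funD => //; exact: measurable_cst.
have mkf : cmeas (setT : set T) (fun r => zext k (r + s) * zext f r).
  by apply: cmeasM => //; exact: (cmeas_comp mzk (ms s)).
split.
  split; first by apply: cmeasM => //; apply: (cmeas_comp mzf); exact: ms.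
  by rewrite (le_lt_trans (shift_nrm s0))// ltry.
rewrite (_ : (fun r => _) = (fun r => (zext k (r - s + s) * zext f (r - s)))).
  rewrite (@cInt_translation _ s (fun r => zext k (r + s) * zext f r))//.
  rewrite [RHS]cInt_zext; apply: eq_cInt => r _.
  have [r0|r0] := ltP 0 r; last by rewrite [zext f r]zext_npos// [RHS]zext_npos// mulr0.
  by rewrite !zext_pos ?addr_gt0// addrC.
by apply/funext => r; rewrite subrK.
Qed.

(** Fubini for [G]. For k(r) = l(T(r) x) it says that [phi] turns convolution into composition. *)
Lemma conv_cInt :
  cInt leb (Rpos R : set T) (fun r => k r * (amul (L1 w) f g r : R[i])) =
  cInt leb (Rpos R : set T)
    (fun s => cInt leb (Rpos R : set T) (fun t => k (s + t) * (f t : R[i])) * (g s : R[i])).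
Proof.
have mn : measurable_fun setT (EFin \o (fun z => nrm (G z))).
  by apply/measurable_EFinP; exact: cmeas_nrm.
have In : (leb \x leb)%E.-integrable setT (EFin \o (fun z => nrm (G z))).
  apply/(@integrable21ltyP _ _ T T R leb leb _ mn); apply: le_lt_trans intG.
  rewrite le_eqVlt; apply/orP; left; apply/eqP; apply: eq_integral => s _.
  by apply: eq_integral => r _; rewrite /= ger0_norm// nrm_ge0.
have ae1 := @ae_integrable1 _ _ T T R leb leb _ In.
have mconv := conv_measurable.
transitivity (cInt leb (setT : set T)
    (fun r => cInt leb (setT : set T) (fun s => G (r, s)))).
  rewrite cInt_zext; apply: ae_eq_cInt.
  - apply: cmeas_zext; apply: cmeasM => //.
    exact: cmeasS mconv.
  - exact: cmeas_section.
  - apply: filterS ae1 => r Ir.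
    have [r0|r0] := ltP 0 r; last first.
      rewrite zext_npos// /G /= zext_npos//.
      by under eq_cInt do rewrite mul0r; rewrite cInt0.
    rewrite zext_pos// convE /G /= zext_pos//.
    (* The section of the convolution integrand is known to be integrable only where k(r) is
       nonzero, by dividing that of [G]. *)
    have [k0|k0] := eqVneq (k r) 0.
      by rewrite k0 mul0r; under eq_cInt do rewrite mul0r; rewrite cInt0.
    rewrite cIntZ//.
    have mr : cmeas (setT : set T) (fun s : T => zext f (r - s) * zext g s : R[i]).
      apply: (@cmeas_comp _ _ _ _ _
          (fun z : T * T => zext f (z.1 - z.2) * zext g z.2) (pair r)) => //.
    have IG : cint leb (setT : set T) (fun s : T => G (r, s)).
      split; first by apply: (cmeas_comp mG); exact: pair1_measurable.
      move/integrableP : Ir => [_]; apply: le_lt_trans.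
      rewrite le_eqVlt; apply/orP; left; apply/eqP; apply: eq_integral => s _.
      by rewrite /= ger0_norm// nrm_ge0.
    apply: cint_eq (cintZ (k r)^-1 _ IG) => // s _.
    by rewrite /G /= zext_pos// mulrA mulVf// mul1r.
rewrite (cfubini mG intG) [RHS]cInt_zext; apply: eq_cInt => s _.
have [s0|s0] := ltP 0 s; last first.
  rewrite zext_npos// /G /=.
  by under eq_cInt do rewrite [zext g s]zext_npos// !mulr0; rewrite cInt0.
rewrite zext_pos// /G /=.
under eq_cInt do rewrite [zext g s]zext_pos// mulrA.
have [Is Es] := shift_cInt s0.
by rewrite cIntZr// Es.
Qed.

Lemma intG_swap : (\int[leb]_r \int[leb]_s (nrm (G (r, s)))%:E < +oo)%E.
Proof.
have mn : measurable_fun setT (EFin \o (fun z => nrm (G z))).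
  by apply/measurable_EFinP; exact: cmeas_nrm.
rewrite (@fubini_tonelli _ _ T T R leb leb (EFin \o (fun z => nrm (G z))) mn)//.

by move=> z; rewrite lee_fin nrm_ge0.
Qed.

Lemma measurable_fun_G : measurable_fun (setT : set T)
  (fun r => \int[leb]_s (nrm (G (r, s)))%:E)%E.
Proof.
have mn : measurable_fun setT (EFin \o (fun z => nrm (G z))).
  by apply/measurable_EFinP; exact: cmeas_nrm.
apply: (@measurable_fun_fubini_tonelli_F _ _ T T R leb _ mn) => z.
by rewrite lee_fin nrm_ge0.
Qed.

End Fubini.

Lemma conv_L1 f g : acar (L1 w) f -> acar (L1 w) g -> acar (L1 w) (amul (L1 w) f g).
Proof.
move=> Lf Lg; have mconv := conv_measurable Lf Lg.
(* With the weight itself as [k], integrability of [G] becomes that of the convolution against the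
   weight. *)
pose k t : R[i] := (w t)%:C%C.
have mk : cmeasurable (Rpos R) k by apply: cmeas_real; exact: w_meas ww.
have kC t : 0 < t -> nrm (k t) <= 1 * w t.
  by move=> t0; rewrite nrm_real mul1r ger0_norm// w_ge0.
have Ifg := intG_swap mk kC Lf Lg.
split; first exact: (cmeasS (measurableT) (@subsetT _ _) mconv).
have [mf mg] : cmeas (setT : set T) (zext f) /\ cmeas (setT : set T) (zext g).
  by split; apply: cmeas_zext; [case: Lf|case: Lg].
have mH r : cmeas (setT : set T) (fun s : T => zext f (r - s) * zext g s).
  apply: cmeasM => //; apply: (cmeas_comp mf).
  by apply: measurable_funB => //; exact: measurable_cst.
apply: le_lt_trans Ifg.
rewrite integral_mkcond; apply: ge0_le_integral => //.
- move=> r _; rewrite patchE; case: ifPn => // /[!inE] /RposE r0.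
  by rewrite lee_fin mulr_ge0 ?nrm_ge0// w_ge0.
- apply/(measurable_restrictT _ mR)/measurable_EFinP.
  apply: measurable_funM; last exact: w_meas ww.
  by apply: cmeas_nrm; exact: (cmeasS (measurableT) (@subsetT _ _) mconv).
- exact: measurable_fun_G.
- move=> r _; rewrite patchE; case: ifPn => [/[!inE] /RposE r0|_]; last first.
    by apply: integral_ge0 => s _; rewrite lee_fin nrm_ge0.
  rewrite convE (_ : (\int[leb]_s _ = \int[leb]_s ((w r)%:E *
      (nrm (zext f (r - s) * zext g s))%:E))%E); last first.
    apply: eq_integral => s _.
    by rewrite nrmM [zext k r]zext_pos// nrm_real ger0_norm ?w_ge0// EFinM.
  rewrite ge0_integralZl//; last 3 first.
  - by apply/measurable_EFinP; exact: cmeas_nrm.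
  - by move=> s _; rewrite lee_fin nrm_ge0.
  - by rewrite lee_fin w_ge0.
  by rewrite mulrC EFinM lee_wpmul2l ?lee_fin ?w_ge0// nrm_cIntE.
Qed.

End Convolution.

(** * Integration by parts against indicator functions *)

Section Generator.
Context {R : realType}.
Local Notation T := (measurableTypeR R).
Local Notation leb := (@lebesgue_measure R).
Let mR : measurable (Rpos R : set T) := @Rpos_measurable R.

Definition ind (a b : R) : R -> R[i]^o := fun t => (\1_(`]a, b]%classic) t : R)%:C%C.

Lemma within_dist (q : R -> R) (A : set R) : {within A, continuous q} <->
  forall x, A x -> forall e : R, 0 < e -> exists2 d : R, 0 < d &
    forall y, A y -> `|x - y| < d -> `|q x - q y| < e.
Proof.
split=> [cq x Ax e e0|h].
  have /subspace_continuousP/(_ x Ax)/cvgrPdist_lt/(_ e e0) := cq.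
  rewrite near_withinE => /nbhs_ballP[d d0 hd]; exists d => // y Ay xy.
  exact: hd.
apply/subspace_continuousP => x Ax; apply/cvgrPdist_lt => e e0.
have [d d0 hd] := h x Ax e e0; rewrite near_withinE.
by apply/nbhs_ballP; exists d => // y xy Ay; exact: hd.
Qed.

(** The fundamental theorem for s |-> - q(r - s). When c = r the argument reaches 0, where [q] is
    known only to be right continuous. *)
Lemma ftc_reflect (q q' : R -> R) (r a c : R) : a < c -> c <= r ->
  {within `[0, +oo[, continuous q'} ->
  (forall t : R, 0 < t -> is_derive t 1 q (q' t)) ->
  q h @[h --> 0^'+] --> q 0 ->
  leb.-integrable `[a, c]%classic (EFin \o (fun s => q' (r - s))) /\
  \int[leb]_(s in `[a, c]) q' (r - s) = q (r - a) - q (r - c).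
Proof.
move=> ac cr cq' dq cq0.
have cont : {within `[a, c], continuous (fun s => q' (r - s))}.
  apply/within_dist => x /=; rewrite in_itv /= => /andP[ax xc] e e0.
  have rx : `[0, +oo[%classic (r - x) by rewrite /= in_itv /= andbT subr_ge0 (le_trans xc).
  have [d d0 hd] := (within_dist _ _).1 cq' _ rx _ e0; exists d => // y /=.
  rewrite in_itv /= => /andP[ay yc] xy; apply: hd.
    by rewrite /= in_itv /= andbT subr_ge0 (le_trans yc).
  have -> : r - x - (r - y) = y - x by ring.
  by rewrite distrC.
have dF x : x < r -> is_derive x 1 (fun s => - q (r - s)) (q' (r - x)).
  move=> xr; have rx : 0 < r - x by rewrite subr_gt0.
  have d1 := dq _ rx.
  have d2 : is_derive x 1 (fun s : R => r - s) (0 - 1).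
    by apply: is_deriveB.
  have d3 := is_deriveN (@is_derive1_comp R q (fun s => r - s) x _ _ d1 d2).
  by apply: is_derive_eq d3 _; rewrite sub0r mulrN1 opprK.
have cF x : x < r -> (fun s => - q (r - s)) s @[s --> x] --> - q (r - x).
  move=> xr; have [dx _] := dF _ xr.
  have /derivable1_diffP/differentiable_continuous := dx; exact.
split.
  apply: continuous_compact_integrable => //; exact: segment_compact.
rewrite /Rintegral (@continuous_FTC2 _ _ (fun s => - q (r - s)) _ _ ac cont).
- by rewrite -EFinB /= opprK addrC.
- split.
  + by move=> x; rewrite in_itv /= => /andP[_ xc]; have [] := dF x (lt_le_trans xc cr).
  + by apply: cvg_at_right_filter; apply: cF; exact: lt_le_trans cr.
  + move: cr; rewrite le_eqVlt => /predU1P[->|cr]; last first.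
      by apply: cvg_at_left_filter; exact: cF.
    rewrite subrr; apply: cvgN.
    apply/cvgrPdist_lt => e e0.
    have /cvgrPdist_lt/(_ _ e0) := cq0; rewrite near_withinE => /nbhs_ballP[d d0 hd].
    rewrite near_withinE; apply/nbhs_ballP; exists d => // y ry yr.
    apply: hd => /=; last by rewrite subr_gt0.
    by rewrite /ball /= sub0r opprB distrC.
- move=> x; rewrite in_itv /= => /andP[_ xc]; rewrite derive1E.
  by have [_ ->] := dF x (lt_le_trans xc cr).
Qed.

Lemma C1_right_continuous (f f' : R -> R[i]) (p : R[i] -> R) : C1_with_deriv f f' ->
  p = @complex.Re R \/ p = @complex.Im R ->
  (p \o f) h @[h --> 0^'+] --> (p \o f) 0.
Proof.
move=> Cf /Cf[_ _ h0] /=.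
have hh : (h : R) @[h --> 0^'+] --> (0 : R).
  by apply: cvg_at_right_filter; exact: cvg_id.
have h2 : h * (h^-1 * (p (f h) - p (f 0))) + p (f 0) @[h --> 0^'+] -->
    0 * p (f' 0) + p (f 0).
  by apply: cvgD; [exact: cvgM|exact: cvg_cst].
rewrite mul0r add0r in h2; apply: cvg_trans h2.
apply: near_eq_cvg; near=> h.
have h1 : 0 < h by near: h; exact: nbhs_right_gt.
by rewrite /= mulrA mulfV ?mul1r ?subrK// gt_eqF.
Unshelve. all: by end_near. Qed.

(** The integrand is f'(r - s) for s between a and the smaller of b and r. If r comes first, the end
    term is f(0) = 0, which is also the value of [zext] at r - b. *)
Lemma conv_ind (w : R -> R) (f f' : R -> R[i]^o) (a b r : R) :
  C1_with_deriv f f' -> f 0 = 0 -> 0 < a -> a < b ->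
  amul (L1 w) f' (ind a b) r = zext f (r - a) - zext f (r - b).
Proof.
move=> Cf f0 a0 ab; rewrite /L1 /=.
have [ra|ar] := leP r a.
  rewrite !zext_npos ?subr_le0 ?(le_trans ra) ?(ltW ab)// subrr.
  rewrite -[LHS]/(cInt leb (`]0, r[%classic : set T) _) -[RHS](cInt0 leb (`]0, r[%classic : set T)).
  apply: eq_cInt => s /[!inE] /=; rewrite in_itv /= => /andP[s0 sr].
  rewrite /ind indicE memNset ?mulr0//= in_itv /= => /andP[+ _].
  by rewrite ltNge (le_trans (ltW sr)).
have key (p : R[i] -> R) : p = @complex.Re R \/ p = @complex.Im R ->
    \int[leb]_(s in `]0, r[) (p (f' (r - s) * ind a b s)) =
    p (zext f (r - a)) - p (zext f (r - b)).
  move=> hp; have [cq' dq _] := Cf _ hp; have cq0 := C1_right_continuous Cf hp.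
  have p0 : p 0 = 0 by case: hp => ->.
  have pE z : p (z * ind a b r) = p (z * ind a b r) by [].
  transitivity (\int[leb]_(s in `]0, r[%classic `&` `]a, b]%classic) p (f' (r - s))).
    rewrite Rintegral_mkcondr; apply: eq_Rintegral => s _.
    rewrite patchE /ind indicE; case: (s \in _); rewrite ?mulr1// mulr0 p0.
    by [].
  have [rb|br] := leP r b.
    have [Ii Ei] := @ftc_reflect (p \o f) (p \o f') r a r ar (lexx _) cq' dq cq0.
    rewrite (_ : _ `&` _ = `]a, r[%classic); last first.
      apply/seteqP; split => s /=; rewrite !in_itv /=.
        by move=> [/andP[_ ->] /andP[-> _]].
      by move=> /andP[as_ sr]; rewrite as_ sr (lt_trans a0 as_) (le_trans (ltW sr)).
    rewrite (@Rintegral_itv_bndo_bndc _ _ _ (fun s => p (f' (r - s)))); last first.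
      apply: integrableS Ii => //; exact: subset_itv_oo_cc.
    rewrite (@Rintegral_itv_obnd_cbnd _ _ _ (fun s => p (f' (r - s)))); last first.
      apply: integrableS Ii => //; exact: subset_itv_oc_cc.
    rewrite Ei /= subrr f0 zext_pos ?subr_gt0// zext_npos ?subr_le0//.
  have [Ii Ei] := @ftc_reflect (p \o f) (p \o f') r a b ab (ltW br) cq' dq cq0.
  rewrite (_ : _ `&` _ = `]a, b]%classic); last first.
    apply/seteqP; split => s /=; rewrite !in_itv /=; first by move=> [].
    by move=> /andP[as_ sb]; rewrite as_ sb (lt_trans a0 as_) (le_lt_trans sb).
  rewrite (@Rintegral_itv_obnd_cbnd _ _ _ (fun s => p (f' (r - s)))); last first.
    apply: integrableS Ii => //; exact: subset_itv_oc_cc.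
  by rewrite Ei /= !zext_pos ?subr_gt0.
apply: complexP; rewrite ?ReD ?ImD ?ReN ?ImN.
- by apply: key; left.
- by apply: key; right.
Qed.

Variable w : R -> R.
Hypothesis ww : weight w.

Lemma ind_L1 a b : 0 < a -> acar (L1 w) (ind a b).
Proof.
move=> a0; have mI : measurable (`]a, b]%classic : set T) by exact: measurable_itv.
have [M hM] := w_loc ww b a0.
have sub : `]a, b]%classic `<=` Rpos R.
  by move=> t /=; rewrite in_itv /= => /andP[h _]; apply/RposE; exact: lt_trans h.
split.
  by apply: cmeas_real; exact: measurable_indic.
apply: (@le_lt_trans _ _ (\int[leb]_(t in Rpos R) (`|M| * \1_(`]a, b]%classic) t)%:E)%E).
  apply: integral_lty_le => //.
  - apply: measurable_funM; last exact: w_meas ww.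
    by apply: cmeas_nrm; apply: cmeas_real; exact: measurable_indic.
  - by apply: measurable_funM; [exact: measurable_cst|exact: measurable_indic].
  - by move=> t /RposE t0; rewrite mulr_ge0 ?nrm_ge0// (w_ge0 ww).
  - move=> t /RposE t0; rewrite /ind nrm_real indicE; case: (boolP (t \in _)) => [|_].
      rewrite inE /= in_itv /= => /andP[at_ tb].
      rewrite normr1 mul1r mulr1 (le_trans (hM _ _)) ?ler_norm//.
      by rewrite (ltW at_).
    by rewrite normr0 mul0r mulr0.
under eq_integral do rewrite EFinM.
rewrite ge0_integralZl//.
- rewrite integral_indic// setIidl// lte_mul_pinfty ?lee_fin//.
  by rewrite /= lebesgue_measure_itv /=; case: ifP => _; rewrite ?ltry// -EFinB ltry.
- by apply/measurable_EFinP; exact: measurable_indic.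
Qed.

(** [conv_ind] paired with [k]. Taking for [k] a scalar orbit gives the norm continuity of T on the
    ideal; taking an eigenvalue function gives its integral equation. *)
Lemma generator_shift (f f' : R -> R[i]^o) (k : R -> R[i]) (C a b : R) :
  C1_with_deriv f f' -> f 0 = 0 -> 0 < a -> a < b ->
  acar (L1 w) f -> acar (L1 w) f' ->
  cmeasurable (Rpos R) k -> (forall t, 0 < t -> nrm (k t) <= C * w t) ->
  cInt leb (Rpos R : set T) (fun t => k (a + t) * (f t : R[i])) -
  cInt leb (Rpos R : set T) (fun t => k (b + t) * (f t : R[i])) =
  cInt leb (Rpos R : set T) (fun s =>
    cInt leb (Rpos R : set T) (fun t => k (s + t) * (f' t : R[i])) * (ind a b s : R[i])).
Proof.
move=> Cf f0 a0 ab Lf Lf' mk kC; have b0 := lt_trans a0 ab.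
rewrite -(conv_cInt ww mk kC Lf' (ind_L1 b a0)).
have [Ia <-] := shift_cInt ww mk kC Lf a0.
have [Ib <-] := shift_cInt ww mk kC Lf b0.
rewrite -cIntB// [RHS]cInt_zext; apply: eq_cInt => r _.
have [r0|r0] := ltP 0 r; last by rewrite ![zext _ r]zext_npos// !mul0r subrr.
by rewrite ![zext _ r]zext_pos// (conv_ind w r Cf f0 a0 ab) mulrBr.
Qed.

Lemma cint_ind a b : 0 < a -> a <= b ->
  cint leb (Rpos R : set T) (ind a b) /\
  cInt leb (Rpos R : set T) (ind a b) = (b - a)%:C%C.
Proof.
move=> a0 ab; have mI : measurable (`]a, b]%classic : set T) by exact: measurable_itv.
have sub : `]a, b]%classic `<=` Rpos R.
  by move=> t /=; rewrite in_itv /= => /andP[h _]; apply/RposE; exact: lt_trans h.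
have E : (\int[leb]_(t in Rpos R) (\1_(`]a, b]%classic) t)%:E = (b - a)%:E)%E.
  rewrite integral_indic// setIidl// /= lebesgue_measure_itv /= lte_fin.
  move: ab; rewrite le_eqVlt => /predU1P[->|ab]; first by rewrite ltxx subrr.
  by rewrite ab -EFinB.
split.
  split; first by apply: cmeas_real; exact: measurable_indic.
  rewrite (_ : (\int[leb]_(t in _) _ = (b - a)%:E)%E) ?ltry// -E.
  apply: eq_integral => t _; rewrite /ind nrm_real indicE.
  by case: (_ \in _); rewrite ?normr1 ?normr0.
apply: complexP => /=; first by rewrite /Rintegral E.
by rewrite /Rintegral integral0_eq.
Qed.

Lemma cInt_ind_near (k : R -> R[i]) (a b M : R) : 0 < a -> a <= b ->
  cmeasurable (Rpos R) k -> cint leb (Rpos R : set T) (fun t => k t * (ind a b t : R[i])) ->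
  (forall t, a <= t <= b -> nrm (k t - k a) <= M) ->
  nrm (cInt leb (Rpos R : set T) (fun t => k t * (ind a b t : R[i])) -
       (b - a)%:C%C * k a) <= M * (b - a).
Proof.
move=> a0 ab mk Ik kM; have [Ii <-] := cint_ind a0 ab.
have M0 : 0 <= M by rewrite (le_trans (nrm_ge0 _) (kM a _))// lexx.
rewrite mulrC -cIntZ// -cIntB//; last exact: cintZ.
have mI : measurable (`]a, b]%classic : set T) by exact: measurable_itv.
have sub : `]a, b]%classic `<=` Rpos R.
  by move=> t /=; rewrite in_itv /= => /andP[h _]; apply/RposE; exact: lt_trans h.
have EM : (\int[leb]_(t in Rpos R) (M * \1_(`]a, b]%classic) t)%:E = (M * (b - a))%:E)%E.
  under eq_integral do rewrite EFinM.
  rewrite ge0_integralZl//.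
  - rewrite integral_indic// setIidl// /= lebesgue_measure_itv /= lte_fin.
    move: ab; rewrite le_eqVlt => /predU1P[->|ab]; first by rewrite ltxx subrr mulr0 mule0.
    by rewrite ab -EFinB -EFinM.
  - by apply/measurable_EFinP; exact: measurable_indic.
have -> : M * (b - a) = \int[leb]_(t in Rpos R) (M * \1_(`]a, b]%classic) t).
  by rewrite /Rintegral EM.
apply: nrm_cInt_le => //.
- by apply: cmeasB; [case: Ik|case: (cintZ (k a) mR Ii)].
- by apply: measurable_funM; [exact: measurable_cst|exact: measurable_indic].
- move=> t _; rewrite -mulrBl nrmM /ind nrm_real indicE.
  case: (boolP (t \in _)) => [|_]; last by rewrite normr0 !mulr0.
  by rewrite inE /= in_itv /= => /andP[/ltW at_ tb]; rewrite normr1 !mulr1 kM// at_.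
- by rewrite EM ltry.
Qed.

(** By continuity k(a) is the limit of the means of [k] over ]a, b] as b decreases to a, and these
    vanish. *)
Lemma ind_mean_zero (k : R -> R[i]) (a : R) : 0 < a -> cmeasurable (Rpos R) k ->
  (forall e : R, 0 < e -> exists2 d : R, 0 < d & forall s, 0 < s -> `|s - a| < d ->
    nrm (k s - k a) < e) ->
  (forall b, a <= b -> cint leb (Rpos R : set T) (fun t => k t * (ind a b t : R[i])) /\
     cInt leb (Rpos R : set T) (fun t => k t * (ind a b t : R[i])) = 0) ->
  k a = 0.
Proof.
move=> a0 mk ck h0; apply: nrm_eq0; apply/eqP; rewrite eq_le nrm_ge0 andbT.
apply/ler_addgt0Pr => e e0; rewrite add0r; have [d d0 hd] := ck _ e0.
pose b := a + d / 2; have ab : a < b by rewrite ltrDl divr_gt0.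
have [Ik Ek] := h0 b (ltW ab).
have := cInt_ind_near a0 (ltW ab) mk Ik.
have /[swap] /[apply] : forall t, a <= t <= b -> nrm (k t - k a) <= e.
  move=> t /andP[at_ tb].
  apply/ltW/hd; first exact: lt_le_trans at_.
  rewrite ger0_norm ?subr_ge0// ltrBlDl (le_lt_trans tb)// ltrD2l.
  by rewrite ltr_pdivrMr// ltr_pMr// ltr1n.
have ba : 0 <= b - a by rewrite subr_ge0 ltW.
by rewrite Ek sub0r nrmN nrmM nrm_real (ger0_norm ba) mulrC ler_pM2r// subr_gt0.
Qed.

End Generator.

(** * Dual pairings *)

Section NormedModule.
Context {R : realType} {X : completeNormedModType R[i]}.

Lemma nrm_nspace (V : normedModType R[i]) : nspace (setT : set V) (@nrm R V).
Proof.
split => //.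
- by move=> x _; exact: nrm_ge0.
- by move=> a x _; exact: nrmZ.
- by move=> x y _ _; exact: nrmD.
- by move=> x _; exact: nrm_eq0.
Qed.

Lemma nbhs_nrmP (V : normedModType R[i]) (x : V) (P : set V) :
  nbhs x P <-> exists2 d : R, 0 < d & forall y, nrm (x - y) < d -> P y.
Proof.
split=> [/nbhs_normP[[d di] /= d0 hd]|[d d0 hd]].
  move: d0; rewrite ltcE /= => /andP[/eqP di0 d0]; subst di.
  exists d => // y xy; apply: hd => /=.
  by rewrite nrmE -(complexr0) ltcR.
apply/nbhs_normP; exists d%:C%C; first by rewrite /= ltcR.
by move=> y /=; rewrite nrmE ltcR => /hd.
Qed.

Lemma cvg_nrmP (V : normedModType R[i]) (U : Type) (F : set_system U) (f : U -> V)
    (l : V) : Filter F ->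
  f @ F --> l <-> forall e : R, 0 < e -> \forall x \near F, nrm (l - f x) < e.
Proof.
move=> FF; split=> [h e e0|h P /nbhs_nrmP[d d0 hd]].
  apply: (h [set y | nrm (l - y) < e]); apply/nbhs_nrmP; exists e => //.
by apply: filterS (h _ d0) => x; exact: hd.
Qed.

Lemma nrm_complete : ncomplete (setT : set X) (@nrm R X).
Proof.
move=> u _ cu.
have cc : cvg (u @ \oo).
  apply: cauchy_cvg; apply: cauchy_exP => -[e ei] /=.
  rewrite ltcE /= => /andP[/eqP -> e0].
  have [n0 hn] := cu _ e0; exists (u n0); exists n0 => // n /= nn.
  by rewrite -ball_normE /ball_ /= nrmE ltcR; apply: hn.
exists (lim (u @ \oo)) => // e e0.
have /cvg_nrmP/(_ _ e0)[n0 _ hn] := cc.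
by exists n0 => n /hn /=; rewrite nrmBC.
Qed.

Lemma cont_bounded (V W : normedModType R[i]) (f : V -> W) : linear f -> continuous f ->
  bounded_oper setT setT (@nrm R V) (@nrm R W) f.
Proof.
move=> lf cf; split=> //.
  by move=> a x y _ _; rewrite lf.
have f0 : f 0 = 0.
  by have := lf 1 0 0; rewrite !scale1r addr0 -[LHS]addr0 => /addrI.
have /cvg_nrmP/(_ _ ltr01)/nbhs_nrmP[d d0 hd] := cf 0.
exists (2 / d) => x _; have [->|x0] := eqVneq x 0.
  by rewrite f0 !nrm0 mulr0.
have xp : 0 < nrm x.
  rewrite lt_neqAle nrm_ge0 andbT eq_sym; apply: contra_neq x0; exact: nrm_eq0.
pose c := d / 2 / nrm x; have c0 : 0 < c by rewrite !divr_gt0.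
have nc : nrm (c%:C%C : R[i]) = c by rewrite nrm_real gtr0_norm.
have : nrm (f 0 - f (c%:C%C *: x)) < 1.
  apply: hd; rewrite sub0r nrmN nrmZ nc /c mulfVK ?gt_eqF//.
  by rewrite ltr_pdivrMr// ltr_pMr// ltr1n.
have -> : f (c%:C%C *: x) = c%:C%C *: f x.
  by have := lf c%:C%C x 0; rewrite addr0 f0 addr0.
rewrite f0 sub0r nrmN nrmZ nc -ltr_pdivlMl// mulr1 => /ltW /le_trans; apply.
by rewrite le_eqVlt /c; apply/orP; left; apply/eqP; field; rewrite !gt_eqF.
Qed.

End NormedModule.

(** * Uniform boundedness by a gliding hump *)

Section GlidingHump.
Context {R : realType} {V : lmodType R[i]}.

(* Sokal's proof of the uniform boundedness principle: the signs (here 0 or 1)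
   of the terms 4^-n z_n are chosen one after the other. *)
Lemma gliding_hump (K : set V) (Th : set (V -> R[i])) :
  (forall th, Th th -> forall (a : R[i]) x y, th (a *: x + y) = a * th x + th y) ->
  (forall th, Th th -> exists M : R, forall x, K x -> nrm (th x) <= M) ->
  (forall (z : nat -> V) (al : nat -> R), (forall n, K (z n)) ->
     (forall n, 0 <= al n <= 4^-1 ^+ n) ->
     exists y, forall th, Th th ->
       nrm (th (\sum_(i < n) (al i)%:C%C *: z i) - th y) @[n --> \oo] --> 0) ->
  (forall y, exists M : R, forall th, Th th -> nrm (th y) <= M) ->
  exists M : R, forall th x, Th th -> K x -> nrm (th x) <= M.
Proof.
move=> lT bK sK bT; apply: contrapT => nB.
have unb (c : R) : exists th x, [/\ Th th, K x & c < nrm (th x)].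
  apply: contrapT => h; apply: nB; exists c => th x Tth Kx; rewrite leNgt.
  by apply/negP => lt; apply: h; exists th, x.
(* A functional whose supremum s_n over [K] is at least 8^n, together with a point where 7/8 of the
   supremum is attained. *)
have pick (n : nat) : exists q : (V -> R[i]) * V * R,
    [/\ Th q.1.1, K q.1.2, 8 ^+ n <= q.2, 7 / 8 * q.2 <= nrm (q.1.1 q.1.2) &
      forall x, K x -> nrm (q.1.1 x) <= q.2].
  have [th [x [Tth Kx lt]]] := unb (8 ^+ n).
  have [M hM] := bK _ Tth.
  pose E := [set nrm (th y) | y in K].
  have sE : has_sup E.
    by split; [exists (nrm (th x)), x|exists M => _ [y Ky <-]; exact: hM].
  have xs : nrm (th x) <= sup E by apply: sup_upper_bound => //; exists x.
  have s0 : 0 < sup E by rewrite (lt_le_trans _ xs)// (le_lt_trans _ lt)// exprn_ge0.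
  have [|_ [z Kz <-] zs] := @sup_adherent _ E (sup E / 8) _ sE; first exact: divr_gt0.
  exists (th, z, sup E); split => //=.
  - by rewrite (le_trans (ltW lt)).
  - by rewrite (le_trans _ (ltW zs))// le_eqVlt; apply/orP; left; apply/eqP; field.
  - by move=> y Ky; apply: sup_upper_bound => //; exists y.
have /choice[q hq] := pick.
pose th n := (q n).1.1; pose z n := (q n).1.2; pose s n := (q n).2.
(* The term 4^-n z_n is added unless th_n is already large enough at the current partial sum. *)
pose Y := fix Y n := if n is m.+1 then
  (if 4^-1 ^+ m * nrm (th m (z m)) <= 2 * nrm (th m (Y m)) then Y m
   else Y m + (4^-1 ^+ m)%:C%C *: z m) else 0.
pose al m : R := if 4^-1 ^+ m * nrm (th m (z m)) <= 2 * nrm (th m (Y m)) then 0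
   else 4^-1 ^+ m.
have p4 n : 0 < 4^-1 ^+ n :> R by rewrite exprn_gt0.
have al4 n : 0 <= al n <= 4^-1 ^+ n.
  by rewrite /al; case: ifP => _; rewrite !lexx ?(ltW (p4 n)).
have YE n : Y n.+1 = Y n + (al n)%:C%C *: z n.
  by rewrite /al /=; case: ifP => _ //; rewrite scale0r addr0.
have YS n : Y n = \sum_(i < n) (al i)%:C%C *: z i.
  elim: n => [|n IH]; first by rewrite big_ord0.
  by rewrite YE big_ord_recr /= IH.
have Kz n : K (z n) by case: (hq n).
have Tt n : Th (th n) by case: (hq n).
have thD n x y : th n (x + y) = th n x + th n y.
  by rewrite -[x]scale1r lT// mul1r scale1r.
have th0 n : th n 0 = 0.
  by have := thD n 0 0; rewrite addr0 -[LHS]addr0 => /addrI.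
have thZ n a x : th n (a *: x) = a * th n x.
  by rewrite -[a *: x]addr0 lT// th0 addr0.
have thB n x y : th n (x - y) = th n x - th n y.
  by rewrite thD -scaleN1r thZ mulN1r.
(* Of two numbers u and u + v, one has modulus at least |v| / 2. *)
have big n : 4^-1 ^+ n * nrm (th n (z n)) <= 2 * nrm (th n (Y n.+1)).
  rewrite /=; case: ifPn => //; rewrite -ltNge => lt.
  rewrite thD thZ; set u := th n (Y n) in lt *; set v := (_ * th n (z n))%R.
  have nv : nrm v = 4^-1 ^+ n * nrm (th n (z n)).
    by rewrite /v nrmM nrm_real ger0_norm// ltW.
  have : nrm v <= nrm (u + v) + nrm u.
    by rewrite -{1}(addKr u v) addrC (le_trans (nrmB _ _)).
  rewrite nv => h; move: lt h; set c := 4^-1 ^+ n * _; set nu := nrm u; set nuv := nrm _; lra.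
(* The later terms contribute at most s_n times the sum of 4^-j over j > n, that is s_n 4^-n / 3. *)
have tail n k : nrm (th n (Y (n.+1 + k)%N) - th n (Y n.+1)) <=
    s n * 4^-1 ^+ n * (1 - 4^-1 ^+ k) / 3.
  have s0 : 0 <= s n by have [_ _ h _ _] := hq n; rewrite (le_trans _ h)// exprn_ge0.
  elim: k => [|k IH]; first by rewrite addn0 subrr nrm0 expr0 subrr mulr0 mul0r.
  rewrite addnS YE thD addrAC (le_trans (nrmD _ _))//.
  have [_ _ _ _ hK] := hq n.
  have h2 : nrm (th n ((al (n.+1 + k)%N)%:C%C *: z (n.+1 + k)%N)) <=
      4^-1 ^+ (n.+1 + k)%N * s n.
    rewrite thZ nrmM nrm_real; have /andP[a0 a4] := al4 (n.+1 + k)%N.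
    by rewrite ger0_norm// ler_pM// ?nrm_ge0//; exact: hK.
  rewrite (le_trans (lerD IH h2))// addSn exprS exprD [4^-1 ^+ k.+1]exprS.
  by rewrite le_eqVlt; apply/orP; left; apply/eqP; field.
have [y hy] := sK z al Kz al4.
have [M hM] := bT y.
(* The hump is at least half of 7/8 and the tail at most 1/3 of s_n 4^-n, which leaves 7/16 - 1/3 =
   5/48; and s_n 4^-n >= 2^n. *)
have ybig n : 5 / 48 * 2 ^+ n <= nrm (th n y).
  have [_ _ s8 z7 hK] := hq n.
  have s0 : 0 <= s n by rewrite (le_trans _ s8)// exprn_ge0.
  have ty : nrm (th n y - th n (Y n.+1)) <= s n * 4^-1 ^+ n / 3.
    apply/ler_addgt0Pr => e e0.
    have /cvg0_seqP/(_ _ e0)[n0 hn] := hy _ (Tt n).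
    have := hn (n.+1 + n0)%N (leq_addl _ _).
    rewrite -YS ger0_norm ?nrm_ge0// => h1.
    rewrite -(subrK (th n (Y (n.+1 + n0)%N)) (th n y)) -addrA (le_trans (nrmD _ _))//.
    rewrite [leRHS]addrC lerD//; first by rewrite nrmBC ltW.
    rewrite (le_trans (tail n n0))//.
    by rewrite ler_wpM2r ?invr_ge0// ler_piMr ?mulr_ge0 ?(ltW (p4 _))// gerBl ltW.
  have h3 : nrm (th n (Y n.+1)) <= nrm (th n y) + nrm (th n y - th n (Y n.+1)).
    by rewrite -{1}[th n (Y n.+1)](subKr (th n y)) (le_trans (nrmB _ _)).
  have h4 := big n.
  have h5 : 4^-1 ^+ n * (7 / 8 * s n) <= 4^-1 ^+ n * nrm (th n (z n)).
    by rewrite ler_wpM2l// ltW.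
  have h6 : 2 ^+ n <= 4^-1 ^+ n * s n :> R.
    rewrite (le_trans _ (ler_wpM2l (ltW (p4 n)) s8))// -exprMn.
    by rewrite (_ : 4^-1 * 8 = 2 :> R)//; field.
  move: h3 h4 h5 h6 ty; set c := 4^-1 ^+ n; set d := 2 ^+ n.
  set A := nrm _; set B := nrm (_ - _); set D := nrm (th n y); set E := nrm (th n (z n)).
  rewrite [s n * c]mulrC mulrCA; set cs := c * s n; set cE := c * E.
  lra.
have M0 : 0 <= M by rewrite (le_trans (nrm_ge0 _) (hM _ (Tt 0%N))).
pose n := (Num.truncn (48 / 5 * M)).+1.
have := le_trans (ybig n) (hM _ (Tt n)).
have : (n%:R : R) <= 2 ^+ n.
  by rewrite -natrX ler_nat ltnW// ltn_expl.
have := truncnS_gt (48 / 5 * M); rewrite -/n.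
set N := n%:R; set P := 2 ^+ n; lra.
Qed.

End GlidingHump.

Section LowerSemicontinuous.
Context {R : realType}.

(** With the value -oo off (0,+oo), the function is lower semicontinuous on the whole line. *)
Lemma lsc_measurable (w : R -> R) :
  (forall t c, 0 < t -> c < w t -> exists2 d : R, 0 < d &
     forall s, 0 < s -> `|s - t| < d -> c < w s) ->
  measurable_fun (Rpos R : set (measurableTypeR R)) w.
Proof.
move=> lw; pose f (t : R) : \bar R := if 0 < t then (w t)%:E else -oo%E.
have mf : measurable_fun (setT : set (measurableTypeR R)) f.
  apply: lower_semicontinuous_measurable => x a; rewrite /f.
  case: ifPn => // x0; rewrite lte_fin => /(lw _ _ x0)[d d0 hd].
  exists (ball x (Num.min d x)); first by apply: nbhsx_ballx; rewrite lt_min d0.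
  move=> s; rewrite /ball /= lt_min => /andP[sd sx].
  have s0 : 0 < s by move: sx; rewrite ltr_distlC subrr => /andP[].
  by rewrite s0 lte_fin hd// distrC.
have mR := @Rpos_measurable R.
apply/measurable_EFinP.
apply: (@eq_measurable_fun _ _ _ _ _ f); last exact: measurable_funTS.
by move=> t /[!inE] /RposE t0; rewrite /f t0.
Qed.

End LowerSemicontinuous.

(** * The topology of a dual pairing and local boundedness of the semigroup *)

Section DualPair.
Context {R : realType} {X : completeNormedModType R[i]}.
Variables (Xs : set (X -> R[i]^o)) (T : R -> X -> X).
Hypothesis pairing : dual_pairing Xs.
Local Notation nX := (@nrm R X).
Local Notation nC := (@nrm R R[i]^o).

Lemma Xs_oper l : Xs l -> bounded_oper setT setT nX nC l.
Proof. by case: pairing => h _ _ _ /h[ll cl]; exact: cont_bounded. Qed.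

Lemma Xs_linear l (a : R[i]) x y : Xs l -> l (a *: x + y) = a * l x + l y.
Proof. by move=> /Xs_oper[_ h _]; rewrite h. Qed.

Lemma Xs0 l : Xs l -> l 0 = 0.
Proof. by move=> Xl; exact: (bounded_oper0 (nrm_nspace X) (Xs_oper Xl)). Qed.

Lemma XsZ l (a : R[i]) x : Xs l -> l (a *: x) = a * l x.
Proof. by move=> Xl; exact: (bounded_operZ (nrm_nspace X) (Xs_oper Xl)). Qed.

Lemma XsD l x y : Xs l -> l (x + y) = l x + l y.
Proof. by move=> Xl; exact: (bounded_operD (Xs_oper Xl)). Qed.

Lemma XsB l x y : Xs l -> l (x - y) = l x - l y.
Proof. by move=> Xl; exact: (bounded_operB (nrm_nspace X) (Xs_oper Xl)). Qed.

Lemma Xs_sum l (I : Type) (r : seq I) (F : I -> X) : Xs l ->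
  l (\sum_(i <- r) F i) = \sum_(i <- r) l (F i).
Proof. by move=> Xl; exact: (bounded_oper_sum (nrm_nspace X) (Xs_oper Xl)). Qed.

Lemma Xs_le l x : Xs l -> nC (l x) <= dnorm l * nX x.
Proof.
by move=> Xl; apply: (oper_normP (nrm_nspace X) (nrm_nspace R[i]^o) (Xs_oper Xl)).
Qed.

Lemma Xs_le1 l x : Xs l -> dnorm l <= 1 -> nC (l x) <= nX x.
Proof.
by move=> Xl l1; rewrite (le_trans (Xs_le _ Xl))// ler_piMl ?nrm_ge0.
Qed.

Lemma dnorm_ge0 l : Xs l -> 0 <= dnorm l.
Proof.
by move=> Xl; exact: (oper_norm_ge0 (nrm_nspace X) (nrm_nspace R[i]^o) (Xs_oper Xl)).
Qed.

Lemma Xs_norming x (c : R) : (forall l, Xs l -> dnorm l <= 1 -> nC (l x) <= c) -> nX x <= c.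
Proof.
move=> h; have [_ [X0 _] -> _] := pairing; apply: ge_sup.
  exists (nC 0), (fun=> 0) => //; split => //.
  apply: (@oper_norm_sup _ _ _ _ _ _ (nrm_nspace X)) => y _ _.
  by rewrite nrm0 ler01.
by move=> _ [l [Xl l1] <-]; exact: h.
Qed.

Lemma Xs_eq x y : (forall l, Xs l -> l x = l y) -> x = y.
Proof.
move=> xy; apply/eqP; rewrite -subr_eq0; apply/eqP/nrm_eq0/eqP.
rewrite eq_le nrm_ge0 andbT; apply: Xs_norming => l Xl _.
by rewrite XsB// xy// subrr nrm0.
Qed.

Lemma sigma_cont l (p : sigma Xs) (e : R) : Xs l -> 0 < e ->
  nbhs p [set q : sigma Xs | nC (l q - l p) < e].
Proof.
move=> Xl e0; pose i : set_type Xs := SigSub (mem_set Xl).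
have /cvg_sup/(_ i) h : nbhs (evalXs p) --> (evalXs p : prod_topology (fun _ : set_type Xs => R[i]^o)).
  exact: cvg_id.
have oB : nbhs (l p) [set z : R[i]^o | nC (z - l p) < e].
  by apply/nbhs_nrmP; exists e => // y; rewrite nrmBC.
have hB : nbhs (evalXs p : prod_topology (fun _ : set_type Xs => R[i]^o))
    [set g : prod_topology (fun _ : set_type Xs => R[i]^o) | nC (g i - l p) < e].
  apply: h; apply: (@initial_continuous _ _
    (fun f : prod_topology (fun _ : set_type Xs => R[i]^o) => f i) _ _ oB).
exact: (@initial_continuous _ _ (@evalXs R X Xs) p _ hB).
Qed.

(** The topology is initial for the embedding into a product of scalars, so convergence is tested on
    each functional separately. *)
Lemma sigma_cvg (U : Type) (F : set_system U) (f : U -> sigma Xs) (p : sigma Xs) :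
  Filter F -> (forall l, Xs l -> (fun u => l (f u)) @ F --> (l p : R[i]^o)) -> f @ F --> p.
Proof.
move=> FF h A [B [[C oC <-] Cp CA]].
have : (fun u => @evalXs R X Xs (f u)) @ F --> 
    (evalXs p : prod_topology (fun _ : set_type Xs => R[i]^o)).
  apply/cvg_sup => i D [E [[G oG <-] Gp GD]].
  have hG : nbhs (\val i p : R[i]^o) G by exact: open_nbhs_nbhs.
  apply: (@filterS _ F FF (fun u => G (\val i (f u)))); last exact: (h _ (set_valP i) _ hG).
  by move=> u Gu; exact: GD.
have nC' : nbhs (evalXs p) C by exact: open_nbhs_nbhs.
move=> cv; apply: (@filterS _ F FF (fun u => C (evalXs (f u)))); last exact: (cv _ nC').
by move=> u Cu; exact: CA.
Qed.

Hypothesis wcT : weakly_continuous Xs T.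

Lemma orbit_compact (x : X) (a b : R) (z : R[i]) : 0 < a ->
  compact ((fun t => z *: T t x : sigma Xs) @` `[a, b]%classic).
Proof.
move=> a0; apply: continuous_compact; last exact: segment_compact.
apply/subspace_continuousP => t /=; rewrite in_itv /= => /andP[at_ _].
apply: sigma_cvg => l Xl; apply: cvg_within_filter.
have t0 := lt_le_trans a0 at_.
have /cvg_nrmP c := @wcT x l Xl t t0.
have hg : (fun u => l (z *: T u x)) @ nbhs t --> (l (z *: T t x) : R[i]^o).
  apply/cvg_nrmP => e e0; have p0 : 0 < nrm z + 1 by rewrite ltr_wpDl ?nrm_ge0.
  have := c _ (divr_gt0 e0 p0); apply: filterS => u.
  rewrite ltr_pdivlMr// => lt; apply: le_lt_trans lt.
  rewrite !XsZ// -mulrBr (nrmM z) mulrC.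
  by rewrite ler_wpM2l ?nrm_ge0// lerDl.
exact: hg.
Qed.

Definition dil (A : set X) (r : R) : set X := [set v | exists2 u, A u & v = r%:C%C *: u].

(** For convex [A], the sum of r u and s v is r + s times the convex combination with weights
    r/(r+s) and s/(r+s). *)
Lemma dil_add (A : set X) r s u v : convex_set (A : set (convex_lmodType X)) -> A 0 ->
  0 <= r -> 0 <= s -> dil A r u -> dil A s v -> dil A (r + s) (u + v).
Proof.
move=> cA A0 r0 s0 [u' Au ->] [v' Av ->].
have [rs0|rs0] := eqVneq (r + s) 0.
  have -> : r = 0 by apply/eqP; rewrite eq_le r0 andbT -rs0 lerDl.
  have -> : s = 0 by apply/eqP; rewrite eq_le s0 andbT -rs0 lerDr.
  by exists 0 => //; rewrite !scale0r addr0 scaler0.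
have rsp : 0 < r + s by rewrite lt_neqAle eq_sym rs0 addr_ge0.
exists ((r / (r + s))%:C%C *: u' + (s / (r + s))%:C%C *: v').
  have p0 : 0 <= (r / (r + s))%:C%C :> R[i] by rewrite lecR divr_ge0 ?addr_ge0.
  have p1 : (r / (r + s))%:C%C <= 1 :> R[i].
    by rewrite lecR ler_pdivrMr// mul1r lerDl.
  have := cA u' v' (Itv01 p0 p1) (mem_set Au) (mem_set Av); rewrite inE.
  have cE (k : {i01 R[i]}) : conv k (u' : convex_lmodType X) v' =
    k%:num *: u' + (1 - k%:num) *: v' :> X by [].
  rewrite cE /= (_ : 1 - _ = (s / (r + s))%:C%C)//.
  rewrite -[1]/(1%:C%C) -rmorphB /=; congr (_%:C%C).
  by field.
by rewrite scalerDr !scalerA -!rmorphM /= ![_ * (_ / _)]mulrC !divfK.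
Qed.

Lemma dil_le (A : set X) r s u : convex_set (A : set (convex_lmodType X)) -> A 0 ->
  0 <= r -> r <= s -> dil A r u -> dil A s u.
Proof.
move=> cA A0 r0 rs Au; rewrite -[u]addr0 -[s](subrK r) addrC.
apply: dil_add => //; first by rewrite subr_ge0.
by exists 0 => //; rewrite scaler0.
Qed.

Lemma sigma_hull_sub (K : set (sigma Xs)) : K `<=` sigma_hull K.
Proof. by move=> x Kx A [KA _ _]; exact: KA. Qed.

Lemma sigma_hull_convex (K : set (sigma Xs)) :
  convex_set (sigma_hull K : set (convex_lmodType X)).
Proof.
move=> x y k; rewrite !inE => Hx Hy A [KA cA cvA].
have := cvA x y k; rewrite !inE; apply; [exact: Hx|exact: Hy].
Qed.

(* The sigma-closed convex hull of 0 and of the multiples of the orbit by 1, -1, i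
   and -i is sigma-compact and contains the y n up to the factor 2 C. *)
Lemma sigma_seq x a b C (y : nat -> X) : 0 < a -> 0 <= C ->
  (forall n, exists N (c : 'I_N -> R[i]) (t : 'I_N -> R),
    [/\ y n = \sum_i c i *: T (t i) x, forall i, a <= t i <= b & \sum_i nrm (c i) <= C]) ->
  (forall l, Xs l -> ncauchy nC (fun n => l (y n))) ->
  exists z, forall l, Xs l -> nlim nC (fun n => l (y n)) (l z).
Proof.
move=> a0 C0 hy cy; have [_ _ _ hullP] := pairing.
pose O (z : R[i]) : set (sigma Xs) := (fun t => z *: T t x : sigma Xs) @` `[a, b]%classic.
pose K : set (sigma Xs) := [set 0 : sigma Xs] `|` O 1 `|` O (-1) `|` O 'i%C `|` O (- 'i%C).
have cK : compact K.
  rewrite /K; apply: compactU; last exact: orbit_compact.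
  apply: compactU; last exact: orbit_compact.
  apply: compactU; last exact: orbit_compact.
  by apply: compactU; [exact: compact_set1|exact: orbit_compact].
pose H : set X := sigma_hull K.
have KH : K `<=` H by exact: sigma_hull_sub.
have cvH : convex_set (H : set (convex_lmodType X)) by exact: sigma_hull_convex.
have H0 : H 0 by apply: KH; do 4 left.
have OH t : a <= t <= b -> forall z : R[i],
    z = 1 \/ z = -1 \/ z = 'i%C \/ z = - 'i%C -> H (z *: T t x).
  move=> tab z hz; apply: KH.
  have Oz : O z (z *: T t x) by exists t => //=; rewrite in_itv.
  case: hz Oz => [|[|[|]]] -> Oz; rewrite /K.
  - by do 3 left; right.
  - by do 2 left; right.
  - by left; right.
  - by right.
have dilR (r : R) (v : X) : H v -> H (- v) -> dil H `|r| (r%:C%C *: v).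
  move=> Hv HNv; have [r0|r0] := leP 0 r; first by exists v; rewrite ?ger0_norm.
  by exists (- v) => //; rewrite ltr0_norm// scalerN -scaleNr -rmorphN /= opprK.
(* Real and imaginary part each have modulus at most |c|, hence the factor 2. *)
have dilc c t : a <= t <= b -> dil H (2 * nrm c) (c *: T t x).
  move=> tab; have -> : c *: T t x = (complex.Re c)%:C%C *: T t x +
      (complex.Im c)%:C%C *: ('i%C *: T t x).
    rewrite scalerA -scalerDl; congr (_ *: _).
    by case: (c) => p q; apply: complexP; rewrite ?ReD ?ImD ?ReM ?ImM /=; ring.
  apply: (@dil_le H (`|complex.Re c| + `|complex.Im c|)) => //.
    by rewrite mulr_natl mulr2n lerD ?Re_le_nrm ?Im_le_nrm.
  apply: dil_add => //; apply: dilR.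
  - by rewrite -[T t x]scale1r; apply: OH => //; left.
  - by rewrite -scaleN1r; apply: OH => //; right; left.
  - by apply: OH => //; right; right; left.
  - by rewrite -scaleNr; apply: OH => //; right; right; right.
have dily n : dil H (2 * C) (y n).
  have [N [c [t [-> ht hc]]]] := hy n.
  apply: (@dil_le H (\sum_i 2 * nrm (c i))) => //.
    by apply: sumr_ge0 => i _; rewrite mulr_ge0 ?nrm_ge0.
    by rewrite -mulr_sumr ler_wpM2l.
  elim: (index_enum _) => [|i r IH].
    by rewrite !big_nil; exists 0 => //; rewrite scaler0.
  rewrite !big_cons; apply: dil_add => //; last exact: dilc.
    by rewrite mulr_ge0 ?nrm_ge0.
  by apply: sumr_ge0 => j _; rewrite mulr_ge0 ?nrm_ge0.
have /choice[h hh] n : exists u, H u /\ y n = (2 * C)%:C%C *: u.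
  by have [u Hu ->] := dily n; exists u.
(* The rescaled sequence clusters in the compact hull. Since [l (y n)] is Cauchy for each [l], the
   value of [l] at a cluster point is its limit. *)
have := hullP K cK ((h : nat -> sigma Xs) @ \oo) _ _.
have FF : ProperFilter ((h : nat -> sigma Xs) @ \oo) by exact: fmap_proper_filter.
move=> /(_ FF)[|p [_ clp]].
  by exists 0%N => // n _; case: (hh n).
exists ((2 * C)%:C%C *: p) => l Xl e e0.
have [n0 hn0] := cy _ Xl _ (half_gt0 e0).
have D0 : 0 < 2 * C + 1 by rewrite ltr_wpDl// mulr_ge0.
have nb := sigma_cont p Xl (divr_gt0 (half_gt0 e0) D0).
have tl : ((h : nat -> sigma Xs) @ \oo) (h @` [set n | (n0 <= n)%N]).
  by exists n0 => // n /= nn; exists n.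
have [_ [[n nn <-] hp]] := clp _ _ tl nb.
exists n0 => m mm; have h1 := hn0 m n mm nn.
rewrite -(subrK (l (y n)) (l (y m))) -addrA (le_lt_trans (nrmD _ _))//.
rewrite (splitr e) ltrD//; have [_ ->] := hh n.
move: hp; rewrite /= ltr_pdivlMr// => hp; apply: le_lt_trans hp.
rewrite !XsZ// -mulrBr (nrmM _ (l (h n) - l p)) nrm_real ger0_norm ?mulr_ge0//.
by rewrite mulrC ler_wpM2l ?nrm_ge0// lerDl.
Qed.

Lemma geo_cauchy (V : lmodType R[i]) (D : set V) (N : V -> R) (u : nat -> V) (M : R) :
  nspace D N -> (forall n, D (u n)) -> 0 <= M ->
  (forall n, N (u n.+1 - u n) <= M * 4^-1 ^+ n) -> ncauchy N u.
Proof.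
move=> HD Du M0 hu.
have p4 n : 0 < 4^-1 ^+ n :> R by rewrite exprn_gt0.
(* The telescoping form of the geometric tail, where 4/3 is 1 / (1 - 1/4). *)
have st n k : N (u (n + k)%N - u n) <= 4 / 3 * M * (4^-1 ^+ n - 4^-1 ^+ (n + k)%N).
  elim: k => [|k IH]; first by rewrite addn0 !subrr (nsN0 HD) mulr0.
  rewrite addnS (le_trans (nsNBD HD (Du _) (Du _) (Du (n + k)%N)))//.
  rewrite (le_trans (lerD (hu _) IH))// le_eqVlt; apply/orP; left; apply/eqP.
  by rewrite exprS; field.
have small : (4 / 3 * M * 4^-1 ^+ n) @[n --> \oo] --> (0 : R).
  rewrite -(mulr0 (4 / 3 * M)); apply: cvgM; first exact: cvg_cst.
  by apply: cvg_expr; rewrite ger0_norm// invf_lt1// ltr1n.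
move=> e e0; have /cvg0_seqP/(_ _ (half_gt0 e0))[n0 /(_ _ (leqnn _))hn] := small.
have h n : (n0 <= n)%N -> N (u n - u n0) < e / 2.
  move=> /subnKC <-; apply: le_lt_trans (st _ _) _; apply: le_lt_trans hn.
  by rewrite (le_trans _ (ler_norm _))// ler_wpM2l ?mulr_ge0// gerBl ltW.
exists n0 => m n mm nn.
rewrite (le_lt_trans (nsNBD HD (Du _) (Du _) (Du n0)))// (splitr e) ltrD ?h//.
by rewrite (nsNBC HD)// h.
Qed.

Lemma sum4_le (al : nat -> R) n : (forall i, 0 <= al i <= 4^-1 ^+ i) ->
  \sum_(i < n) al i <= 2.
Proof.
move=> h; suff : \sum_(i < n) al i <= 2 * (1 - 4^-1 ^+ n).
  by move=> /le_trans; apply; rewrite ler_piMr// gerBl exprn_ge0.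
elim: n => [|n IH]; first by rewrite big_ord0 expr0 subrr mulr0.
rewrite big_ord_recr /=; have /andP[_ h2] := h n.
rewrite (le_trans (lerD IH h2))// exprS.
have : 0 <= 4^-1 ^+ n :> R by rewrite exprn_ge0.
set c := 4^-1 ^+ n; lra.
Qed.

Lemma orbit_weak_bound x l a b : Xs l -> 0 < a -> exists2 M : R, 0 <= M &
  forall t, a <= t <= b -> nC (l (T t x)) <= M.
Proof.
move=> Xl a0; have [ab|ba] := leP a b; last first.
  exists 0 => // t /andP[at_ tb].
  by have := lt_le_trans ba (le_trans at_ tb); rewrite ltxx.
have cw : {within `[a, b], continuous (fun t => nC (l (T t x)))}.
  apply/within_dist => t /=; rewrite in_itv /= => /andP[at_ _] e e0.
  have /cvg_nrmP/(_ _ e0)/nbhs_ballP[d d0 hd] := @wcT x l Xl t (lt_le_trans a0 at_).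
  exists d => // s _ ts; rewrite (le_lt_trans _ (hd _ ts))//.
  exact: nrm_dist.
have [c _ hc] := EVT_max ab cw.
exists (nC (l (T c x))); first exact: nrm_ge0.
by move=> t tab; apply: hc; rewrite in_itv.
Qed.

(** Gliding hump with the orbit as bounded set and the unit ball of X_* as functionals. The series
    to be summed then live in X, with terms on the orbit, and [sigma_seq] sums them weakly. *)
Lemma orbit_bounded x a b : 0 < a -> exists M : R, forall t, a <= t <= b -> nX (T t x) <= M.
Proof.
move=> a0; pose K := (fun t => T t x) @` `[a, b]%classic.
pose Th : set (X -> R[i]) := [set l : X -> R[i]^o | Xs l /\ dnorm l <= 1].
have [||||M hM] := @gliding_hump R X K Th.
- by move=> l [Xl _] c u v; exact: Xs_linear.
- move=> l [Xl _]; have [M _ hM] := orbit_weak_bound x b Xl a0.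
  by exists M => _ [t /= + <-]; rewrite in_itv => /hM.
- move=> z al Kz hal.
  have /choice[t ht] n : exists t, a <= t <= b /\ T t x = z n.
    by have [t /= + <-] := Kz n; rewrite in_itv => tab; exists t.
  have [|||y hy] := @sigma_seq x a b 2 (fun n => \sum_(i < n) (al i)%:C%C *: z i) a0.
  + by [].
  + move=> n; exists n, (fun i : 'I_n => (al i)%:C%C), (fun i : 'I_n => t i); split.
    * by apply: eq_bigr => i _; have [_ ->] := ht i.
    * by move=> i; have [] := ht i.
    * rewrite (eq_bigr (fun i : 'I_n => al i)); last first.
        by move=> i _; rewrite nrm_real ger0_norm//; have /andP[] := hal i.
      exact: sum4_le.
  + move=> l Xl; have [M M0 hM] := orbit_weak_bound x b Xl a0.
    apply: (geo_cauchy (nrm_nspace R[i]^o) _ M0) => // n.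
    rewrite big_ord_recr /= XsD// addrAC subrr add0r XsZ// (nrmM (al n)%:C%C (l (z n))).
    rewrite nrm_real mulrC; have /andP[h1 h2] := hal n; rewrite ger0_norm//.
    by rewrite ler_pM ?nrm_ge0//; have [tab <-] := ht n; exact: hM.
  + exists y => l [Xl _]; apply/cvg0_seqP => e e0.
    have [n0 hn] := hy _ Xl _ e0; exists n0 => n /hn.
    by rewrite ger0_norm// nrm_ge0.
- by move=> y; exists (nX y) => l [Xl l1]; exact: Xs_le1.
exists M => t tab; apply: Xs_norming => l Xl l1; apply: hM => //.
by exists t => //=; rewrite in_itv.
Qed.

Hypothesis sgT : semigroup Xs T.

Lemma T_oper t : 0 < t -> bounded_oper setT setT nX nX (T t).
Proof. by move=> t0; case: sgT => /(_ _ t0)[lT cT _] _; exact: cont_bounded. Qed.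

Lemma T_Xs t l : 0 < t -> Xs l -> Xs (l \o T t).
Proof. by move=> t0; case: sgT => /(_ _ t0)[_ _ h] _; exact: h. Qed.

Lemma T_add s t x : 0 < s -> 0 < t -> T (s + t) x = T s (T t x).
Proof. by move=> s0 t0; case: sgT => _ ->. Qed.

Lemma T_le t x : 0 < t -> nX (T t x) <= omegaT T t * nX x.
Proof.
by move=> t0; apply: (oper_normP (nrm_nspace X) (nrm_nspace X) (T_oper t0)).
Qed.

Lemma omegaT_ge0 t : 0 < t -> 0 <= omegaT T t.
Proof. by move=> t0; apply: (oper_norm_ge0 (nrm_nspace X) (nrm_nspace X) (T_oper t0)). Qed.

Lemma omegaT_le t (c : R) :
  (forall x l, nX x <= 1 -> Xs l -> dnorm l <= 1 -> nC (l (T t x)) <= c) ->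
  omegaT T t <= c.
Proof.
move=> h; apply: (oper_norm_sup (nrm_nspace X)) => x _ x1.
by apply: Xs_norming => l Xl l1; exact: h.
Qed.

(** A second gliding hump, over the unit ball of X, where the series converge in norm, with the
    functionals x |-> l(T(t) x); [orbit_bounded] is the pointwise bound. *)
Lemma omegaT_loc a b : 0 < a -> exists M : R, forall t, a <= t <= b -> omegaT T t <= M.
Proof.
move=> a0; pose K : set X := [set x | nX x <= 1].
pose Th : set (X -> R[i]) := [set th : X -> R[i] | exists l t,
   [/\ Xs l, dnorm l <= 1, a <= t <= b & th = (fun x => l (T t x))]].
have tp t : a <= t <= b -> 0 < t by move=> /andP[/(lt_le_trans a0)].
have [||||M hM] := @gliding_hump R X K Th.
- move=> _ [l [t [Xl _ tab ->]]] c u v.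
  have [_ lT _] := T_oper (tp _ tab).
  by rewrite lT//; exact: Xs_linear.
- move=> _ [l [t [Xl l1 tab ->]]]; exists (omegaT T t) => x Kx.
  rewrite (le_trans (Xs_le1 _ Xl l1))// (le_trans (T_le _ (tp _ tab)))//.
  by rewrite ler_piMr ?omegaT_ge0// tp.
- move=> z al Kz hal.
  have cz : ncauchy nX (fun n => \sum_(i < n) (al i)%:C%C *: z i).
    apply: (geo_cauchy (M := 1) (nrm_nspace X)) => // n.
    rewrite big_ord_recr /= addrAC subrr add0r nrmZ nrm_real mul1r.
    have /andP[h1 h2] := hal n; rewrite ger0_norm// (le_trans _ h2)// ler_piMr//.
    exact: Kz.
  have [y _ hy] := nrm_complete (fun=> I) cz.
  exists y => _ [l [t [Xl l1 tab ->]]]; apply/cvg0_seqP => e e0.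
  have t0 := tp _ tab; have w1 : 0 < omegaT T t + 1 by rewrite ltr_wpDl ?omegaT_ge0.
  have [n0 hn] := hy _ (divr_gt0 e0 w1); exists n0 => n /hn.
  rewrite ltr_pdivlMr// => lt; rewrite ger0_norm ?nrm_ge0//; apply: le_lt_trans lt.
  have lB := XsB _ _ (T_Xs t0 Xl); rewrite /= in lB.
  rewrite -lB (le_trans (Xs_le1 _ Xl l1))// (le_trans (T_le _ t0))// mulrC.
  by rewrite ler_wpM2l ?nrm_ge0// lerDl.
- move=> y; have [M hM] := orbit_bounded y b a0.
  exists M => _ [l [t [Xl l1 tab ->]]]; rewrite (le_trans (Xs_le1 _ Xl l1))//.
  exact: hM.
exists M => t tab; apply: omegaT_le => x l x1 Xl l1.
by apply: (hM (fun x => l (T t x))) => //; exists l, t.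
Qed.

(** Measurability: omega_T is a supremum of the continuous functions |l(T(t) x)|, hence lower
    semicontinuous. *)
Lemma omegaT_weight : weight (omegaT T).
Proof.
split; [exact: omegaT_ge0| | |exact: omegaT_loc].
- apply: lsc_measurable => t c t0 ct.
  have [x [l [x1 Xl l1 lt]]] : exists x l, [/\ nX x <= 1, Xs l, dnorm l <= 1 &
      c < nC (l (T t x))].
    apply: contrapT => h; move: ct; rewrite ltNge => /negP; apply.
    apply: omegaT_le => x l x1 Xl l1; rewrite leNgt; apply/negP => lt.
    by apply: h; exists x, l.
  have e0 : 0 < nC (l (T t x)) - c by rewrite subr_gt0.
  have /cvg_nrmP/(_ _ e0)/nbhs_ballP[d d0 hd] := @wcT x l Xl t t0.
  exists d => // s s0 st.
  have := hd s; rewrite /ball /= distrC => /(_ st) h.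
  have : nC (l (T t x)) <= nC (l (T t x) - l (T s x)) + nC (l (T s x)).
    by rewrite -{1}(subrK (l (T s x)) (l (T t x))) nrmD.
  have : nC (l (T s x)) <= omegaT T s.
    rewrite (le_trans (Xs_le1 _ Xl l1))// (le_trans (T_le _ s0))//.
    by rewrite ler_piMr ?omegaT_ge0.
  move: h; set p := nC _; set q := nC (l (T t x)); set r := nC (l (T s x)); lra.
- move=> s t s0 t0.
  apply: (oper_norm_le (nrm_nspace X)) => [|x _].
    by rewrite mulr_ge0 ?omegaT_ge0.
  rewrite T_add// (le_trans (T_le _ s0))// -mulrA ler_wpM2l ?omegaT_ge0//.
  exact: T_le.
Qed.

End DualPair.

(** * Weak integrals *)

Section WeakIntegral.
Context {R : realType} {X : completeNormedModType R[i]}.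
Local Notation MT := (measurableTypeR R).
Variables (Xs : set (X -> R[i]^o)) (T : R -> X -> X).
Hypothesis pairing : dual_pairing Xs.
Hypothesis sgT : semigroup Xs T.
Hypothesis wcT : weakly_continuous Xs T.
Local Notation nX := (@nrm R X).
Local Notation nC := (@nrm R R[i]^o).
Let mR : measurable (Rpos R : set MT) := @Rpos_measurable R.
Let wT : weight (omegaT T) := omegaT_weight pairing wcT sgT.

(** The scalars in the form of an [nalg], with a dummy product, so that the lemmas on step functions
    apply to t |-> l(T(t) x). *)
Definition scalars : nalg (R[i]^o : lmodType R[i]) :=
  @NAlg R (R[i]^o : lmodType R[i]) setT (fun z w => z) nC.

Let HS : nspace (acar scalars) (anorm scalars) := nrm_nspace R[i]^o.

Lemma orbit_pos l x t : Xs l -> 0 < t ->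
  nC (l (T t x)) <= dnorm l * nX x * omegaT T t.
Proof.
move=> Xl t0; rewrite (le_trans (Xs_le pairing _ Xl))// -mulrA ler_wpM2l ?(dnorm_ge0 pairing)//.
by rewrite mulrC; exact: (T_le sgT).
Qed.

Lemma orbit_ncont l x : Xs l -> ncont scalars (fun t => l (T t x)).
Proof.
move=> Xl t t0 e e0.
have /cvg_nrmP/(_ _ e0)/nbhs_ballP[d d0 hd] := @wcT x l Xl t t0.
by exists d => // s s0 st; rewrite /= nrmBC; apply: hd; rewrite /ball /= distrC.
Qed.

Lemma bfun_id : bfun scalars (id : R[i]^o -> R[i]).
Proof. by split => //; exists 1 => u _; rewrite mul1r. Qed.

Lemma orbit_cmeas l x : Xs l -> cmeasurable (Rpos R) (fun t => l (T t x)).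
Proof.
by move=> Xl; apply: (@cmeas_bfun _ _ scalars HS id (fun t => l (T t x)) bfun_id _ (orbit_ncont x Xl)).
Qed.

Section Existence.
Variables (nu : {measure set MT -> \bar R}) (h : R -> R[i]).
Hypothesis fnu : forall a b : R, 0 < a -> (nu `[a, b]%classic < +oo)%E.
Hypothesis mh : cmeasurable (Rpos R) h.
Hypothesis Ih : (\int[nu]_(t in Rpos R) (nrm (h t) * omegaT T t)%:E < +oo)%E.

Let mG : measurable_fun (Rpos R : set MT) (fun t => nrm (h t) * omegaT T t).
Proof. by apply: measurable_funM; [exact: cmeas_nrm|exact: w_meas wT]. Qed.

Let G0 t : 0 < t -> 0 <= nrm (h t) * omegaT T t.
Proof. by move=> t0; rewrite mulr_ge0 ?nrm_ge0// (w_ge0 wT). Qed.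

Lemma weak_cint l x : Xs l -> cint nu (Rpos R : set MT) (fun t => (l (T t x) : R[i]) * h t).
Proof.
move=> Xl; apply: (weight_cint (C := dnorm l * nX x) wT mh Ih); first exact: orbit_cmeas.
by move=> t t0; exact: orbit_pos.
Qed.

Let F l x := fun t => l (T t x) : R[i]^o.
Let ind_tr (m : nat) (t : R) : R[i] := (\1_(trunc_set h m) t : R)%:C%C.

Let cint_tr m l x : Xs l ->
  cint nu (Rpos R : set MT) (fun t => ind_tr m t * (F l x t * h t)).
Proof.
move=> Xl; apply: (@cintM_le _ _ _ _ _ _ _ 1) => //.
- by apply: cmeas_real; apply: measurable_indic; exact: measurable_trunc_set.
- exact: weak_cint.
- move=> t _; rewrite /ind_tr nrm_real indicE.
  by case: (_ \in _); rewrite ?normr1 ?normr0.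
Qed.

Let tail_le m l x : Xs l ->
  nrm (cInt nu (Rpos R : set MT) (fun t => F l x t * h t) -
   cInt nu (Rpos R : set MT) (fun t => ind_tr m t * (F l x t * h t))) <=
  dnorm l * nX x *
   \int[nu]_(t in Rpos R) (\1_(~` trunc_set h m) t * (nrm (h t) * omegaT T t)).
Proof.
move=> Xl; rewrite -cIntB//; [|exact: weak_cint|exact: cint_tr].
have C0 : 0 <= dnorm l * nX x by rewrite mulr_ge0 ?nrm_ge0// (dnorm_ge0 pairing).
have mI : measurable_fun (Rpos R : set MT) (\1_(~` trunc_set h m) : R -> R).
  by apply: measurable_indic; apply: measurableC; exact: measurable_trunc_set.
have mg : measurable_fun (Rpos R : set MT)
    (fun t => \1_(~` trunc_set h m) t * (nrm (h t) * omegaT T t)).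
  exact: measurable_funM.
have Ig : (\int[nu]_(t in Rpos R) (\1_(~` trunc_set h m) t * (nrm (h t) * omegaT T t))%:E < +oo)%E.
  apply: le_lt_trans Ih; apply: integral_lty_le => //.
  - by move=> t /RposE t0; rewrite mulr_ge0// G0.
  - move=> t /RposE t0; rewrite ler_piMl ?G0// indicE; by case: (_ \in _).
rewrite -RintegralZl//; last first.
  apply/integrableP; split; first exact/measurable_EFinP.
  rewrite (_ : (\int[nu]_(t in _) _ =
     \int[nu]_(t in Rpos R) (\1_(~` trunc_set h m) t * (nrm (h t) * omegaT T t))%:E)%E)//.
  apply: eq_integral => t /[!inE] /RposE t0.
  by rewrite /= ger0_norm// mulr_ge0// G0.
apply: nrm_cInt_le => //.
- by apply: cmeasB; [case: (weak_cint x Xl)|case: (cint_tr m x Xl)].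
- by apply: measurable_funM => //; exact: measurable_cst.
- move=> t /RposE t0; rewrite /ind_tr !indicE in_setC.
  case: (_ \in _) => /=; first by rewrite mul1r subrr nrm0 mul0r mulr0.
  rewrite mul0r subr0 mul1r (nrmM (F l x t)) mulrC mulrCA ler_wpM2l ?nrm_ge0//.
  exact: orbit_pos.
- under eq_integral do rewrite EFinM.
  rewrite ge0_integralZl//; first by rewrite lte_mul_pinfty// lee_fin.
  + exact/measurable_EFinP.
  + by move=> t /RposE t0; rewrite lee_fin mulr_ge0// G0.
Qed.

Let tail_small e : 0 < e -> exists m0, forall m, (m0 <= m)%N ->
  \int[nu]_(t in Rpos R) (\1_(~` trunc_set h m) t * (nrm (h t) * omegaT T t)) < e.
Proof.
move=> e0; have [m0 hm] := trunc_tail mh mG G0 Ih e0; exists m0 => m /hm lt.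
rewrite -lte_fin (le_lt_trans _ lt)// /Rintegral fineK// ge0_fin_numE.
  by rewrite (lt_trans lt)// ltry.
by apply: integral_ge0 => t /RposE t0; rewrite lee_fin mulr_ge0// G0.
Qed.

(** The Riemann sums over the truncated set are combinations of points of one compact orbit with
    coefficients of bounded total modulus, so [sigma_seq] gives them a weak limit in X. *)
Lemma trunc_integral m x : exists y, forall l, Xs l ->
  l y = cInt nu (Rpos R : set MT) (fun t => ind_tr m t * (F l x t * h t)).
Proof.
pose c n (i : 'I_(ncell m n)) : R[i] := cintegral nu (stepE h i) h.
pose yy n := \sum_(i < ncell m n) c n i *: T (tag m n i) x.
have hE n (V : lmodType R[i]) (A : nalg V) (b : 'I_(ncell m n) -> V) :
    (forall i, acar A (b i)) -> forall i, [/\ measurable (stepE h i : set MT),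
      stepE h i `<=` Rpos R, acar A (b i) &
      (\int[nu]_(t in stepE h i) (nrm (h t))%:E < +oo)%E].
  move=> Ab i; split; [exact: measurable_stepE|exact: stepE_pos|exact: Ab|].
  exact: stepE_int.
pose C := \int[nu]_(t in Rpos R) (\1_(trunc_set h m) t * nrm (h t)).
have mtr : measurable (trunc_set h m : set MT) by exact: measurable_trunc_set.
have mtrI : measurable_fun (Rpos R : set MT) (\1_(trunc_set h m) : R -> R).
  exact: measurable_indic.
have Itr : (\int[nu]_(t in Rpos R) (\1_(trunc_set h m) t * nrm (h t))%:E < +oo)%E.
  apply: le_lt_trans (trunc_set_int mh fnu m).
  rewrite [leRHS](_ : _ = \int[nu]_(t in Rpos R `&` trunc_set h m) (nrm (h t))%:E)%E.
    rewrite integral_mkcondr le_eqVlt; apply/orP; left; apply/eqP.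
    apply: eq_integral => t _; rewrite patchE indicE.
    by case: (_ \in _); rewrite ?mul1r ?mul0r.
  by rewrite setIidr//; exact: trunc_set_pos.
(* Phases b_i with b_i c_i = |c_i| turn the sum into the integral of a step function of modulus at
   most 1 supported in the truncated set. *)
have sumc n : \sum_i nrm (c n i) <= C.
  have /choice[b hb] (i : 'I_(ncell m n)) : exists b : R[i], nrm b <= 1 /\
      complex.Re (b * c n i) = nrm (c n i).
    by have [b b1 hb] := nrm_phase (c n i); exists b.
  have [I1 E1] := simple_functional HS bfun_id mh (hE n _ scalars b (fun _ => I)).
  rewrite (eq_bigr (fun i => complex.Re (c n i *: (b i : R[i]^o)))); last first.
    by move=> i _; have [_ <-] := hb i; rewrite mulrC.
  rewrite (_ : \sum_i _ = complex.Re (\sum_i (c n i *: (b i : R[i]^o)))); last first.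
    by elim/big_ind2 : _ => // p q r s -> ->; rewrite ReD.
  rewrite (le_trans (ler_norm _))// (le_trans (Re_le_nrm _))//.
  rewrite [X in nrm X]E1; apply: nrm_cInt_le => //; first by case: I1.
  - by apply: measurable_funM => //; exact: cmeas_nrm.
  - move=> t /RposE t0; rewrite nrmM ler_wpM2r ?nrm_ge0//.
    have [tm|tm] := pselect (trunc_set h m t).
      have [i it] := stepE_exists n tm.
      rewrite [\1_(trunc_set h m) t]indicE mem_set// (bigD1 i)//= big1 ?addr0.
        by rewrite indicE mem_set// scale1r; case: (hb i).
      move=> j ji; rewrite indicE memNset ?scale0r// => jt.
      by move/eqP: ji; apply; exact: stepE_uniq jt it.
    rewrite big1 ?nrm0// => j _.
    by rewrite indicE memNset ?scale0r// => -[_ /tm].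
have C0 : 0 <= C by rewrite (le_trans _ (sumc 0%N))// sumr_ge0// => i _; exact: nrm_ge0.
have lyy n l : Xs l -> l (yy n) = cInt nu (Rpos R : set MT)
   (fun t => stepf h m n (F l x) t * h t) /\
   cint nu (Rpos R : set MT) (fun t => stepf h m n (F l x) t * h t).
  move=> Xl; rewrite /yy (Xs_sum pairing)//.
  have [I1 E1] := simple_functional HS bfun_id mh
     (hE n _ scalars (fun i => F l x (tag m n i)) (fun _ => I)).
  split; last exact: I1.
  rewrite -[RHS]E1; apply: eq_bigr => i _.
  by rewrite (XsZ pairing).
have lim l : Xs l -> nlim nC (fun n => l (yy n))
    (cInt nu (Rpos R : set MT) (fun t => ind_tr m t * (F l x t * h t))).
  move=> Xl e e0.
  have FS t : 0 < t -> acar scalars (F l x t) by [].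
  have FB : forall a b : R, 0 < a -> exists M : R, forall t, a <= t <= b -> nC (F l x t) <= M.
    move=> a b a0; have [M hM] := w_loc wT b a0.
    exists (dnorm l * nX x * M) => t /andP[at_ tb].
    rewrite (le_trans (orbit_pos _ Xl (lt_le_trans a0 at_)))// ler_wpM2l//.
      by rewrite mulr_ge0 ?nrm_ge0// (dnorm_ge0 pairing).
    by rewrite hM// at_.
  have [n0 hn] := step_cvg mh fnu HS FS (orbit_ncont x Xl) FB m e0.
  exists n0 => n /hn lt; have [-> I1] := lyy n l Xl; have I2 := cint_tr m x Xl.
  rewrite nrmBC -cIntB// -lte_fin; apply: le_lt_trans lt.
  have mm := cmeasB I2.1 I1.1.
  rewrite (le_trans (nrm_cIntE _ mR mm))//; apply: integral_lty_le => //.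
  - exact: cmeas_nrm.
  - apply: measurable_funM => //; apply: measurable_funM; last exact: cmeas_nrm.
    exact: (measurable_N_step mh HS FS (orbit_ncont x Xl)).
  - by move=> t _; exact: nrm_ge0.
  - move=> t /RposE t0; rewrite /ind_tr indicE.
    have [tm|tm] := pselect (trunc_set h m t).
      by rewrite mem_set// !mul1r -mulrBl nrmM.
    by rewrite stepf_out// memNset// !mul0r subr0 nrm0.
have [||||y hy] := @sigma_seq _ _ _ _ pairing wcT x m.+1%:R^-1 m.+2%:R C yy.
- by rewrite invr_gt0 ltr0n.
- exact: C0.
- move=> n; exists (ncell m n), (c n), (fun i => tag m n i); split => //.
  by move=> i; rewrite tag_ge tag_le.
- by move=> l Xl; exact: (nlim_cauchy (nrm_nspace R[i]^o) _ _ (lim l Xl)).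
exists y => l Xl; apply: (ns_eq (nrm_nspace R[i]^o)) => // e e0.
have [n0 h0] := hy l Xl _ (half_gt0 e0); have [n1 h1] := lim l Xl _ (half_gt0 e0).
pose n := maxn n0 n1.
rewrite (le_trans (nsNBD (nrm_nspace R[i]^o) (z := l (yy n)) _ _ _))// (splitr e) lerD//.
  by rewrite nrmBC ltW// h0// leq_maxl.
by rewrite ltW// h1// leq_maxr.
Qed.

(** The truncated integrals are Cauchy in norm: the tails are small uniformly over the unit ball of
    X_*, which is norming, and X is complete. *)
Lemma weak_integral x : exists y, forall l, Xs l ->
  l y = cInt nu (Rpos R : set MT) (fun t => (l (T t x) : R[i]) * h t).
Proof.
have /choice[y hy] m := trunc_integral m x.
have cy : ncauchy nX y.
  move=> e e0; have p0 : 0 < nX x + 1 by rewrite ltr_wpDl ?nrm_ge0.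
  have [m0 hm] := tail_small (divr_gt0 (half_gt0 (half_gt0 e0)) p0).
  have key m l : (m0 <= m)%N -> Xs l -> dnorm l <= 1 ->
     nrm (cInt nu (Rpos R : set MT) (fun t => F l x t * h t) - l (y m)) <= e / 2 / 2.
    move=> mm Xl l1; rewrite hy//; apply: (le_trans (tail_le m x Xl)).
    have := hm _ mm; set I := \int[_]_(_ in _) _.
    have I0 : 0 <= I.
      by apply: Rintegral_ge0 => t /RposE t0; rewrite mulr_ge0// G0.
    rewrite ltr_pdivlMr// => /ltW; apply: le_trans.
    rewrite mulrC ler_wpM2l// (@le_trans _ _ (nX x))// ?lerDl//.
    by rewrite ler_piMl ?nrm_ge0.
  exists m0 => m n mm nn; apply: (@le_lt_trans _ _ (e / 2)); last first.
    by rewrite ltr_pdivrMr// ltr_pMr// ltr1n.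
  apply: (Xs_norming pairing) => l Xl l1; rewrite (XsB pairing)//.
  rewrite (le_trans (nsNBD (nrm_nspace R[i]^o) (z := cInt nu (Rpos R : set MT)
     (fun t => F l x t * h t)) _ _ _))// (splitr (e / 2)) lerD//; last exact: key.
  by rewrite nrmBC; exact: key.
have [z _ hz] := nrm_complete (fun=> I) cy.
exists z => l Xl; apply: (ns_eq (nrm_nspace R[i]^o)) => // e e0.
have p0 : 0 < dnorm l * nX x + 1 by rewrite ltr_wpDl// mulr_ge0 ?nrm_ge0// (dnorm_ge0 pairing).
have q0 : 0 < dnorm l + 1 by rewrite ltr_wpDl// (dnorm_ge0 pairing).
have [m0 hm] := tail_small (divr_gt0 (half_gt0 e0) p0).
have [m1 hm1] := hz _ (divr_gt0 (half_gt0 e0) q0).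
pose m := maxn m0 m1.
rewrite (le_trans (nsNBD (nrm_nspace R[i]^o) (z := l (y m)) _ _ _))// (splitr e) lerD//.
  have := hm1 m (leq_maxr _ _); rewrite ltr_pdivlMr// => /ltW; apply: le_trans.
  rewrite nrmBC -(XsB pairing)// (le_trans (Xs_le pairing _ Xl))// mulrC.
  by rewrite ler_wpM2l ?nrm_ge0// lerDl.
rewrite nrmBC hy//; apply: (le_trans (tail_le m x Xl)).
have := hm m (leq_maxl _ _); set I := \int[_]_(_ in _) _.
have I0 : 0 <= I by apply: Rintegral_ge0 => t /RposE t0; rewrite mulr_ge0// G0.
by rewrite ltr_pdivlMr// => /ltW; apply: le_trans; rewrite mulrC ler_wpM2l// lerDl.
Qed.

Lemma phiE x l : Xs l -> l (phi Xs T nu h x) =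
  cInt nu (Rpos R : set MT) (fun t => (l (T t x) : R[i]) * h t).
Proof.
move=> Xl; rewrite /phi; case: xgetP => [y _ /(_ _ Xl)//|nex].
by have [y hy] := weak_integral x; case: (nex y).
Qed.

Lemma phi_uniq x y : (forall l, Xs l -> l y =
    cInt nu (Rpos R : set MT) (fun t => (l (T t x) : R[i]) * h t)) ->
  phi Xs T nu h x = y.
Proof. by move=> hy; apply: (Xs_eq pairing) => l Xl; rewrite phiE// hy. Qed.

Definition phi_bound : R := \int[nu]_(t in Rpos R) (nrm (h t) * omegaT T t).

Lemma phi_bound_ge0 : 0 <= phi_bound.
Proof. by apply: Rintegral_ge0 => t /RposE; exact: G0. Qed.

Lemma phi_le x : nX (phi Xs T nu h x) <= phi_bound * nX x.
Proof.
apply: (Xs_norming pairing) => l Xl l1; rewrite phiE// /phi_bound.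
rewrite mulrC -RintegralZl//; last first.
  apply/integrableP; split; first exact/measurable_EFinP.
  rewrite (_ : (\int[nu]_(t in _) _ = \int[nu]_(t in Rpos R) (nrm (h t) * omegaT T t)%:E)%E)//.
  by apply: eq_integral => t /[!inE] /RposE t0; rewrite /= ger0_norm// G0.
apply: nrm_cInt_le => //.
- by case: (weak_cint x Xl).
- by apply: measurable_funM => //; exact: measurable_cst.
- move=> t /RposE t0; rewrite (nrmM (l (T t x))) mulrC mulrCA ler_wpM2l ?nrm_ge0//.
  rewrite (le_trans (orbit_pos x Xl t0))// ler_wpM2r ?(w_ge0 wT)//.
  by rewrite ler_piMl ?nrm_ge0.
- under eq_integral do rewrite EFinM.
  rewrite ge0_integralZl//; first by rewrite lte_mul_pinfty// lee_fin nrm_ge0.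
  + exact/measurable_EFinP.
  + by move=> t /RposE t0; rewrite lee_fin G0.
  + by rewrite lee_fin nrm_ge0.
Qed.

Lemma phi_linear (a : R[i]) x y :
  phi Xs T nu h (a *: x + y) = a *: phi Xs T nu h x + phi Xs T nu h y.
Proof.
apply: phi_uniq => l Xl; rewrite (Xs_linear pairing)// !phiE// -cIntZ//; last exact: weak_cint.
rewrite -cIntD//; last 2 first.
- by apply: cintZ => //; exact: weak_cint.
- exact: weak_cint.
apply: eq_cInt => t /[!inE] /RposE t0; have [_ lT _] := T_oper sgT t0.
by rewrite lT// (Xs_linear pairing)// mulrDl mulrA.
Qed.

Lemma phi_T s x : 0 < s -> phi Xs T nu h (T s x) = T s (phi Xs T nu h x).
Proof.
move=> s0; apply: phi_uniq => l Xl.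
have := phiE x (T_Xs sgT s0 Xl); rewrite /= => ->.
apply: eq_cInt => t /[!inE] /RposE t0.
by rewrite -!(T_add sgT)// addrC.
Qed.

End Existence.

End WeakIntegral.

(** * The Arveson ideal *)

Section WeightedL1.
Context {R : realType}.
Local Notation MT := (measurableTypeR R).
Local Notation leb := (@lebesgue_measure R).
Let mR : measurable (Rpos R : set MT) := @Rpos_measurable R.

Lemma leb_finite (a b : R) : 0 < a -> (leb `[a, b]%classic < +oo)%E.
Proof. by move=> _; rewrite lebesgue_measure_itv; case: ifP => // _; rewrite -EFinD ltry. Qed.

Variable w : R -> R.
Hypothesis ww : weight w.
Implicit Types f g : R -> R[i]^o.

Let nrmw f t : 0 < t -> nrm ((f t : R[i]) * (w t)%:C%C) = nrm (f t : R[i]) * w t.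
Proof. by move=> t0; rewrite nrmM nrm_real ger0_norm// (w_ge0 ww). Qed.

Lemma L1P f : acar (L1 w) f <-> cmeasurable (Rpos R) f /\
  cint leb (Rpos R : set MT) (fun t => (f t : R[i]) * (w t)%:C%C).
Proof.
have E : (\int[leb]_(t in Rpos R) (nrm (f t : R[i]) * w t)%:E =
   \int[leb]_(t in Rpos R) (nrm ((f t : R[i]) * (w t)%:C%C))%:E)%E.
  by apply: eq_integral => t /[!inE] /RposE t0; rewrite nrmw.
split=> [[mf If]|[mf [_ If]]]; last by split => //; rewrite [X in (X < _)%E]E.
split=> //; split; last by rewrite -E.
by apply: cmeasM => //; apply: cmeas_real; exact: w_meas ww.
Qed.

Lemma L1_0 : acar (L1 w) 0.
Proof.
apply/L1P; split; first exact: cmeas_cst.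
by apply: (cint_eq (f := fun=> 0)) (cint0 _ mR) => t _; rewrite mul0r.
Qed.

Lemma L1_lin (a : R[i]) f g : acar (L1 w) f -> acar (L1 w) g -> acar (L1 w) (a *: f + g).
Proof.
move=> /L1P[mf If] /L1P[mg Ig]; apply/L1P; split.
  by apply: cmeasD => //; apply: cmeasM => //; exact: cmeas_cst.
apply: cint_eq (cintD mR (cintZ a mR If) Ig) => t _.
by rewrite mulrDl mulrA.
Qed.

Lemma L1_shift d f : 0 < d -> acar (L1 w) f ->
  acar (L1 w) (fun t => zext f (t - d)).
Proof.
move=> d0 Lf; have mf : cmeasurable (Rpos R) f by case: Lf.
have mk : cmeasurable (Rpos R) (fun t => (w t)%:C%C : R[i]).
  by apply: cmeas_real; exact: w_meas ww.
have kC t : 0 < t -> nrm ((w t)%:C%C : R[i]) <= 1 * w t.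
  by move=> t0; rewrite nrm_real ger0_norm ?mul1r// (w_ge0 ww).
have [I1 _] := shift_cInt ww mk kC Lf d0.
apply/L1P; split.
  apply: (cmeasS (E := setT)) => //.
  apply: (cmeas_comp (cmeas_zext mf)).
  by apply: measurable_funB => //; exact: measurable_cst.
have := cintS mR measurableT (@subsetT _ _) I1.
by apply: cint_eq => t /[!inE] /RposE t0; rewrite zext_pos// mulrC.
Qed.

Lemma L1_le f g : cmeasurable (Rpos R) f -> acar (L1 w) g ->
  (forall t, 0 < t -> nrm (f t : R[i]) <= nrm (g t : R[i])) -> acar (L1 w) f.
Proof.
move=> mf [mg Ig] fg; split => //; apply: le_lt_trans Ig.
have mw := w_meas ww.
apply: integral_lty_le => //; last 2 first.
- by move=> t /RposE t0; rewrite mulr_ge0 ?nrm_ge0// (w_ge0 ww).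
- by move=> t /RposE t0; rewrite ler_wpM2r ?fg// (w_ge0 ww).
- by apply: measurable_funM => //; exact: cmeas_nrm.
- by apply: measurable_funM => //; exact: cmeas_nrm.
Qed.

Lemma L1_norm_ge0 f : 0 <= anorm (L1 w) f.
Proof. by apply: Rintegral_ge0 => t /RposE t0; rewrite mulr_ge0 ?nrm_ge0// (w_ge0 ww). Qed.

Lemma L1_normE f : acar (L1 w) f -> (anorm (L1 w) f)%:E =
  (\int[leb]_(t in Rpos R) (nrm (f t : R[i]) * w t)%:E)%E.
Proof.
move=> [_ If]; rewrite /anorm /= /Rintegral fineK// ge0_fin_numE//.
by apply: integral_ge0 => t /RposE t0; rewrite lee_fin mulr_ge0 ?nrm_ge0// (w_ge0 ww).
Qed.

Lemma ind_norm a b (M : R) : 0 < a -> a <= b -> (forall t, a <= t <= b -> w t <= M) ->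
  anorm (L1 w) (ind a b) <= M * (b - a).
Proof.
move=> a0 ab wM; have M0 : 0 <= M.
  by rewrite (le_trans (w_ge0 ww a0))// wM// lexx.
have mab : measurable (`]a, b]%classic : set MT) by exact: measurable_itv.
have mi : measurable_fun (Rpos R : set MT) (\1_(`]a, b]%classic) : R -> R).
  exact: measurable_indic.
rewrite -lee_fin (L1_normE (ind_L1 ww b a0)).
have mw := w_meas ww.
apply: (@le_trans _ _ (\int[leb]_(t in Rpos R) (M%:E * (\1_(`]a, b]%classic) t)%:E))%E).
  apply: ge0_le_integral => //.
  - by move=> t /RposE t0; rewrite lee_fin mulr_ge0 ?nrm_ge0// (w_ge0 ww).
  - apply/measurable_EFinP; apply: measurable_funM => //.
    by apply: cmeas_nrm; apply: cmeas_real.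
  - by apply/measurable_EFinP; apply: measurable_funM => //; exact: measurable_cst.
  - move=> t /RposE t0; rewrite lee_fin /ind nrm_real indicE.
    case: (boolP (_ \in _)) => [|_]; last by rewrite normr0 mul0r mulr0.
    rewrite inE /= in_itv /= normr1 mul1r mulr1 => /andP[at_ tb].
    by rewrite wM// (ltW at_).
rewrite ge0_integralZl//; last exact/measurable_EFinP.
rewrite integral_indic// EFinM lee_wpmul2l//.
apply: (@le_trans _ _ (leb `]a, b]%classic)).
  by apply: le_measure; rewrite ?inE//; exact: measurableI.
by rewrite lebesgue_measure_itv /= lte_fin; case: ltP => // _; rewrite lee_fin subr_ge0.
Qed.

End WeightedL1.

Lemma nclosure_eq (R : realType) (V W : lmodType R[i]) (A : nalg V) (D : set W)
    (N : W -> R) (f g : V -> W) (C C' : R) (E : set V) :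
  nspace D N ->
  (forall x, acar A x -> D (f x)) -> (forall x, acar A x -> D (g x)) ->
  (forall x y, acar A x -> acar A y -> N (f x - f y) <= C * anorm A (x - y)) ->
  (forall x y, acar A x -> acar A y -> N (g x - g y) <= C' * anorm A (x - y)) ->
  nspace (acar A) (anorm A) -> E `<=` acar A -> (forall x, E x -> f x = g x) ->
  forall x, nclosure A E x -> f x = g x.
Proof.
move=> HD fD gD fC gC HA EA fg x [Ax hx]; apply: (ns_eq HD) => [||e e0]; [exact: fD|exact: gD|].
pose K := `|C| + `|C'| + 1.
have K0 : 0 < K by rewrite /K ltr_wpDl// addr_ge0.
have [y Ey xy] := hx _ (divr_gt0 e0 K0); have Ay := EA _ Ey.
rewrite (le_trans (nsNBD HD (z := f y) _ _ _))//; [exact: fD|exact: gD|exact: fD|].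
rewrite [in X in _ + X]fg// (nsNBC HD (x := g y)); [|exact: gD|exact: gD].
rewrite (le_trans (lerD (fC _ _ Ax Ay) (gC _ _ Ax Ay)))// -mulrDl.
move: xy; rewrite ltr_pdivlMr// => /ltW; apply: le_trans; rewrite mulrC.
rewrite ler_wpM2l ?(nsN_ge0 HA)//; first exact: (nsB HA).
by rewrite (le_trans (lerD (ler_norm C) (ler_norm C')))// lerDl.
Qed.

(** A three-epsilon argument: on [t/2, t+1] the operators are uniformly Lipschitz, so continuity
    passes from approximants of [u] to [u]. *)
Lemma ncont_dense (R : realType) (V : lmodType R[i]) (A : nalg V) (S : R -> V -> V)
    (w : R -> R) (u : V) : nspace (acar A) (anorm A) -> acar A u ->
  (forall a b : R, 0 < a -> exists M : R, forall t, a <= t <= b -> w t <= M) ->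
  (forall t x, 0 < t -> acar A x -> acar A (S t x)) ->
  (forall t x y, 0 < t -> acar A x -> acar A y ->
     anorm A (S t x - S t y) <= w t * anorm A (x - y)) ->
  (forall d : R, 0 < d -> exists v, [/\ acar A v, anorm A (u - v) < d &
     ncont A (fun t => S t v)]) ->
  ncont A (fun t => S t u).
Proof.
move=> HA Au wl SA Sw dv t t0 e e0.
have [M hM] := wl _ (t + 1) (half_gt0 t0).
have tt : t / 2 < t by rewrite ltr_pdivrMr// ltr_pMr// ltr1n.
have K0 : 0 < 3 * (`|M| + 1) by rewrite mulr_gt0// ltr_wpDl.
have [v [Av uv cv]] := dv _ (divr_gt0 e0 K0).
have e30 : 0 < e / 3 by rewrite divr_gt0.
have [r r0 hr] := cv t t0 _ e30.
exists (Num.min r (Num.min (t / 2) 1)); first by rewrite !lt_min r0 half_gt0 ?ltr01.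
move=> s s0; rewrite !lt_min => /and3P[sr st1 st2].
have sab : t / 2 <= s <= t + 1.
  move: st1 st2; rewrite !ltr_norml => /andP[h1 _] /andP[_ h2].
  apply/andP; split; last by rewrite -lerBlDl ltW.
  by rewrite -(lerD2r (- t)) (le_trans _ (ltW h1))// {2}(splitr t) opprD addNKr.
have tab : t / 2 <= t <= t + 1 by rewrite (ltW tt) lerDl ler01.
have close x : 0 < x -> t / 2 <= x <= t + 1 -> anorm A (S x u - S x v) < e / 3.
  move=> x0 xab; apply: le_lt_trans (Sw _ _ _ x0 Au Av) _.
  have n0 := nsN_ge0 HA (nsB HA Au Av).
  apply: le_lt_trans (ler_wpM2r n0 (hM x xab)) _.
  apply: le_lt_trans (ler_wpM2r n0 (ler_norm M)) _.
  move: uv n0; rewrite ltr_pdivlMr// ltr_pdivlMr//; move: (normr_ge0 M) (anorm A _) => m0 n uv n0.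
  by apply: le_lt_trans uv; move: m0; move: (`|M|) => m m0; nra.
have [D1 D2 D3 D4] := And4 (SA _ _ s0 Au) (SA _ _ t0 Au) (SA _ _ s0 Av) (SA _ _ t0 Av).
apply: le_lt_trans (nsNBD HA D1 D2 D3) _.
have := nsNBD HA D3 D2 D4; rewrite (nsNBC HA D4 D2).
have := close s s0 sab; have := close t t0 tab; have := hr s s0 sr.
move: (anorm A _) (anorm A _) (anorm A _) (anorm A _) => x1 x2 x3 x4; lra.
Qed.

(** * Closed algebras of operators *)

Section OperatorAlgebra.
Context {R : realType} {V : lmodType R[i]} {D : set V} {N : V -> R}.
Hypothesis HD : nspace D N.
Variables (A : nalg (V -> V)) (E : set (V -> V)).
Hypothesis HA : nspace (acar A) (anorm A).
Hypothesis AO : acar A `<=` opers D N.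
Hypothesis nA : anorm A = oper_norm D N N.
Hypothesis Amul : forall u v, acar A u -> acar A v -> acar A (u \o v).
Hypothesis EA : E `<=` acar A.

Lemma comp_lipl u v v' : acar A u -> acar A v -> acar A v' ->
  anorm A ((v \o u) - (v' \o u)) <= anorm A u * anorm A (v - v').
Proof.
move=> /AO Bu Bv Bv'; rewrite mulrC nA.
exact: (opersM HD (AO (nsB HA Bv Bv')) Bu).2.
Qed.

Lemma comp_lipr u v v' : acar A u -> acar A v -> acar A v' ->
  anorm A ((u \o v) - (u \o v')) <= anorm A u * anorm A (v - v').
Proof.
move=> /AO Bu Bv Bv'; have [/AO Ov /AO Ov'] := (Bv, Bv').
have -> : (u \o v) - (u \o v') = u \o (v - v').
  have [bu z] := Bu; apply/funext => x; rewrite !fctE /=.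
  have [Dx|nx] := pselect (D x); last first.
    have [_ ->//] := Ov; have [_ ->//] := Ov'.
    by rewrite subr0 (bounded_oper0 HD bu) subr0.
  rewrite (bounded_operB HD bu)//; first by case: Ov => -[h _ _] _; exact: h.
  by case: Ov' => -[h _ _] _; exact: h.
by rewrite nA; exact: (opersM HD Bu (AO (nsB HA Bv Bv'))).2.
Qed.

(** One factor is approximated at a time, composition with a fixed operator on either side being
    Lipschitz. It serves for I_T in B(X_1) and for J_T in M(U_T). *)
Lemma nclosure_comp u v : (forall f g, E f -> E g -> E (f \o g)) ->
  nclosure A E u -> nclosure A E v -> nclosure A E (u \o v).
Proof.
move=> EE Iu Iv; have Bv := nclosure_car Iv; have IA := @nclosure_car _ _ A E.
apply: (nclosure_closed HA (E := nclosure A E)) => //.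
apply: (nclosure_map (A := A) (B := A) (f := fun u => u \o v) (C := anorm A v)
  HA HA _ _ EA IA _ Iu).
- by move=> x Bx; exact: Amul.
- by move=> x y Bx By; exact: comp_lipl.
move=> f Ef; have Af := EA Ef; apply: (nclosure_sub HA IA).
apply: (nclosure_map (A := A) (B := A) (f := fun v => f \o v) (C := anorm A f)
  HA HA _ _ EA EA _ Iv).
- by move=> x Bx; exact: Amul.
- by move=> x y Bx By; exact: comp_lipr.
by move=> g Eg; apply: (nclosure_sub HA EA); exact: EE.
Qed.

Lemma nclosure_compC u v : (forall f g, E f -> E g -> f \o g = g \o f) ->
  nclosure A E u -> nclosure A E v -> u \o v = v \o u.
Proof.
move=> EC Iu Iv; have Bv := nclosure_car Iv.
apply: (nclosure_eq (A := A) (f := fun u => u \o v) (g := fun u => v \o u)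
  HA _ _ _ _ HA EA _ Iu).
- by move=> x Bx; exact: Amul.
- by move=> x Bx; exact: Amul.
- by move=> x y; exact: (comp_lipl Bv).
- by move=> x y; exact: (comp_lipr Bv).
move=> f Ef; have Af := EA Ef.
apply: (nclosure_eq (A := A) (f := fun v => f \o v) (g := fun v => v \o f)
  HA _ _ _ _ HA EA _ Iv).
- by move=> x Bx; exact: Amul.
- by move=> x Bx; exact: Amul.
- by move=> x y; exact: (comp_lipr Af).
- by move=> x y; exact: (comp_lipl Af).
by move=> g Eg; exact: EC.
Qed.

End OperatorAlgebra.

(** * The Arveson ideal as a faithful Banach algebra, and norm continuity on it *)

Section Arveson.
Context {R : realType} {X : completeNormedModType R[i]}.
Local Notation MT := (measurableTypeR R).
Local Notation leb := (@lebesgue_measure R).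
Variables (Xs : set (X -> R[i]^o)) (T : R -> X -> X).
Hypothesis pairing : dual_pairing Xs.
Hypothesis sgT : semigroup Xs T.
Hypothesis wcT : weakly_continuous Xs T.
Local Notation nX := (@nrm R X).
Local Notation nC := (@nrm R R[i]^o).
Local Notation L := (L1 (omegaT T)).
Local Notation BX := (BX1 T).
Local Notation I := (arveson Xs T).
Let mR : measurable (Rpos R : set MT) := @Rpos_measurable R.
Let wT : weight (omegaT T) := omegaT_weight pairing wcT sgT.
Let nsX := nrm_nspace X.

Lemma X1P x : X1 T x <-> forall e : R, 0 < e -> exists t y, 0 < t /\ nX (x - T t y) < e.
Proof.
split=> [cx e e0|h B /nbhs_nrmP[d d0 hd]].
  have : nbhs x [set y | nX (x - y) < e] by apply/nbhs_nrmP; exists e.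
  by move=> /cx[_ [[t /RposE t0 [y _ <-]]] xy]; exists t, y.
have [t [y [t0 xy]]] := h _ d0; exists (T t y); split; last exact: hd.
by exists t; [exact/RposE|exists y].
Qed.

Lemma X1_T t y : 0 < t -> X1 T (T t y).
Proof. by move=> t0; apply/X1P => e e0; exists t, y; rewrite subrr nrm0. Qed.

Lemma X1_nspace : nspace (X1 T) nX.
Proof.
apply: (nspaceS nsX) => //.
  have := @X1_T 1 0 ltr01.
  by rewrite (bounded_oper0 nsX (T_oper sgT ltr01)).
move=> a x x' /X1P hx /X1P hx'; apply/X1P => e e0.
have a0 : 0 < nrm a + 1 by rewrite ltr_wpDl ?nrm_ge0.
have [t [y [t0 xy]]] := hx _ (divr_gt0 (half_gt0 e0) a0).
have [t' [y' [t0' xy']]] := hx' _ (half_gt0 e0).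
(* The ranges of T(t) grow as t decreases, so both vectors factor through T(s). Half the minimum
   keeps t - s and t' - s positive, the semigroup being defined at positive times. *)
pose s := Num.min t t' / 2; have m0 : 0 < Num.min t t' by rewrite lt_min t0.
have s0 : 0 < s by exact: half_gt0.
have st : s < t by rewrite (@lt_le_trans _ _ (Num.min t t'))// ?ge_min ?lexx//
  /s ltr_pdivrMr// ltr_pMr// ltr1n.
have st' : s < t' by rewrite (@lt_le_trans _ _ (Num.min t t'))// ?ge_min ?lexx ?orbT//
  /s ltr_pdivrMr// ltr_pMr// ltr1n.
exists s, (a *: T (t - s) y + T (t' - s) y'); split => //.
have [_ lT _] := T_oper sgT s0; rewrite lT// -!(T_add sgT) ?subr_gt0//.
rewrite ![s + _]addrC !subrK opprD addrACA -scalerBr.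
rewrite (le_lt_trans (nrmD _ _))// (splitr e) ltrD// nrmZ.
move: xy; rewrite ltr_pdivlMr// => xy; apply: le_lt_trans xy.
by rewrite mulrC ler_wpM2l ?nrm_ge0// lerDl.
Qed.

Lemma X1_complete : ncomplete (X1 T) nX.
Proof.
move=> u uX cu; have [x _ hx] := nrm_complete (fun=> Logic.I) cu.
exists x => //; apply/X1P => e e0; have [n0 /(_ _ (leqnn _)) hn] := hx _ (half_gt0 e0).
have /X1P/(_ _ (half_gt0 e0))[t [y [t0 ty]]] := uX n0; exists t, y; split => //.
rewrite (le_lt_trans (nsNBD nsX (z := u n0) _ _ _))// (splitr e) ltrD//.
by rewrite nrmBC.
Qed.

Lemma X1_map (S : X -> X) : bounded_oper setT setT nX nX S ->
  (forall t x, 0 < t -> S (T t x) = T t (S x)) -> forall x, X1 T x -> X1 T (S x).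
Proof.
move=> bS cS x /X1P hx; apply/X1P => e e0; have [_ _ [M hM]] := bS.
have M0 : 0 < `|M| + 1 by rewrite ltr_wpDl.
have [t [y [t0 ty]]] := hx _ (divr_gt0 e0 M0); exists t, (S y); split => //.
rewrite -cS// -(bounded_operB nsX bS)// (le_lt_trans (hM _ Logic.I))//.
move: ty; rewrite ltr_pdivlMr// => ty; apply: le_lt_trans ty.
by rewrite mulrC ler_wpM2l ?nrm_ge0// (le_trans (ler_norm _))// lerDl.
Qed.

Lemma BX_nspace : nspace (acar BX) (anorm BX).
Proof. exact: (opers_nspace X1_nspace). Qed.

Lemma BX_complete : ncomplete (acar BX) (anorm BX).
Proof. exact: (opers_complete X1_nspace X1_complete). Qed.

Lemma BX_mul u v : acar BX u -> acar BX v ->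
  acar BX (u \o v) /\ anorm BX (u \o v) <= anorm BX u * anorm BX v.
Proof. exact: (opersM X1_nspace). Qed.

Lemma BX_le u x : acar BX u -> X1 T x -> nX (u x) <= anorm BX u * nX x.
Proof. by move=> [bu _] Xx; exact: (oper_normP X1_nspace X1_nspace). Qed.

Lemma BX_car u x : acar BX u -> X1 T x -> X1 T (u x).
Proof. by move=> [[h _ _] _]; exact: h. Qed.

Lemma BX_B u x y : acar BX u -> X1 T x -> X1 T y -> u (x - y) = u x - u y.
Proof. by move=> [bu _]; exact: (bounded_operB X1_nspace bu). Qed.

Lemma BX_eq u v : acar BX u -> acar BX v -> (forall x, X1 T x -> u x = v x) -> u = v.
Proof.
move=> [_ u0] [_ v0] uv; apply/funext => x.
by have [/uv//|nx] := pselect (X1 T x); rewrite u0 ?v0.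
Qed.

Lemma restr_BX (S : X -> X) (M : R) : 0 <= M ->
  (forall (a : R[i]) x y, S (a *: x + y) = a *: S x + S y) ->
  (forall x, nX (S x) <= M * nX x) ->
  (forall t x, 0 < t -> S (T t x) = T t (S x)) ->
  acar BX (restr (X1 T) S) /\ anorm BX (restr (X1 T) S) <= M.
Proof.
move=> M0 lS bS cS; have bo : bounded_oper setT setT nX nX S by split => //; exists M.
have rE x : X1 T x -> restr (X1 T) S x = S x by move=> Xx; rewrite restrE mem_set.
split; last first.
  by apply: (oper_norm_le X1_nspace) => // x Xx; rewrite rE.
split; last by move=> x nx; rewrite restrE memNset.
split=> [x Xx|a x y Xx Xy|].
- by rewrite rE//; exact: X1_map.
- by rewrite !rE//; exact: (nsL X1_nspace).
- by exists M => x Xx; rewrite rE.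
Qed.

Section Phi1.
Variables (nu : {measure set MT -> \bar R}) (h : R -> R[i]).
Hypothesis fnu : forall a b : R, 0 < a -> (nu `[a, b]%classic < +oo)%E.
Hypothesis mh : cmeasurable (Rpos R) h.
Hypothesis Ih : (\int[nu]_(t in Rpos R) (nrm (h t) * omegaT T t)%:E < +oo)%E.

Lemma phi1_BX : acar BX (phi1 Xs T nu h) /\ anorm BX (phi1 Xs T nu h) <= phi_bound T nu h.
Proof.
apply: restr_BX.
- exact: (phi_bound_ge0 pairing sgT wcT).
- exact: (phi_linear pairing sgT wcT).
- exact: (phi_le pairing sgT wcT).
- by move=> t x t0; exact: (phi_T pairing sgT wcT).
Qed.

Lemma phi1E x : X1 T x -> phi1 Xs T nu h x = phi Xs T nu h x.
Proof. by move=> Xx; rewrite /phi1 restrE mem_set. Qed.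

End Phi1.

Local Notation ph := (phiL1 Xs T).

Lemma ph_BX f : acar L f -> acar BX (ph f).
Proof. by move=> [mf If]; have [] := phi1_BX leb_finite mf If. Qed.

Lemma ph_le f : acar L f -> anorm BX (ph f) <= anorm L f.
Proof. by move=> [mf If]; have [] := phi1_BX leb_finite mf If. Qed.

Lemma phE f x l : acar L f -> X1 T x -> Xs l ->
  l (ph f x) = cInt leb (Rpos R : set MT) (fun t => (l (T t x) : R[i]) * (f t : R[i])).
Proof.
move=> [mf If] Xx Xl; rewrite /phiL1 phi1E//.
exact: (phiE pairing sgT wcT leb_finite mf If).
Qed.

Lemma ph_out f x : ~ X1 T x -> ph f x = 0.
Proof. by move=> nx; rewrite /phiL1 /phi1 restrE memNset. Qed.

Lemma ph_lin (a : R[i]) f g : acar L f -> acar L g -> ph (a *: f + g) = a *: ph f + ph g.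
Proof.
move=> Lf Lg; apply/funext => x; have [Xx|nx] := pselect (X1 T x); last first.
  by rewrite !fctE !ph_out// scaler0 addr0.
have Lfg := L1_lin wT a Lf Lg.
apply: (Xs_eq pairing) => l Xl; rewrite !fctE (Xs_linear pairing)// !phE//.
have [[mf If] [mg Ig]] := (Lf, Lg).
have If' := weak_cint pairing sgT wcT mf If x Xl.
have Ig' := weak_cint pairing sgT wcT mg Ig x Xl.
rewrite -cIntZ// -cIntD//; last exact: cintZ.
by apply: eq_cInt => t _ /=; rewrite mulrDr mulrCA.
Qed.

Lemma ph_B f g : acar L f -> acar L g -> ph (f - g) = ph f - ph g.
Proof. by move=> Lf Lg; rewrite addrC -scaleN1r ph_lin// scaleN1r addrC. Qed.

Lemma ph_mul f g : acar L f -> acar L g -> ph f \o ph g = ph (amul L f g).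
Proof.
move=> Lf Lg; apply/funext => x.
have [Xx|nx] := pselect (X1 T x); last first.
  by rewrite [RHS]ph_out// [LHS]/= [ph g x]ph_out// (bounded_oper0 X1_nspace (ph_BX Lf).1).
rewrite [LHS]/=.
(* [conv_cInt] puts the first factor of the convolution in the inner integral, while here [g] is the
   inner one. *)
rewrite (conv_comm Lf Lg); apply: (Xs_eq pairing) => l Xl.
rewrite phE//; last exact: (BX_car (ph_BX Lg)).
rewrite phE//; last exact: (conv_L1 wT).
rewrite (conv_cInt wT (k := fun t => l (T t x)) (C := dnorm l * nX x))//; last 2 first.
- exact: (orbit_cmeas wcT).
- by move=> t t0; exact: (orbit_pos pairing sgT).
apply: eq_cInt => t /[!inE] /RposE t0; congr (_ * _).
have := phE Lg Xx (T_Xs sgT t0 Xl); rewrite /= => ->.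
apply: eq_cInt => s /[!inE] /RposE s0.
by rewrite -(T_add sgT).
Qed.

Lemma ph_shift d f : 0 < d -> acar L f -> T d \o ph f = ph (fun t => zext f (t - d)).
Proof.
move=> d0 Lf; apply/funext => x /=; have [Xx|nx] := pselect (X1 T x); last first.
  by rewrite !ph_out// (bounded_oper0 nsX (T_oper sgT d0)).
apply: (Xs_eq pairing) => l Xl; rewrite phE//; last exact: (L1_shift wT).
have := phE Lf Xx (T_Xs sgT d0 Xl); rewrite /= => ->.
have mk : cmeasurable (Rpos R) (fun t => l (T t x) : R[i]) := orbit_cmeas wcT x Xl.
have kC t : 0 < t -> nrm (l (T t x) : R[i]) <= dnorm l * nX x * omegaT T t.
  by move=> t0; exact: (orbit_pos pairing sgT).
have [_ E] := shift_cInt wT mk kC Lf d0.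
transitivity (cInt leb (Rpos R : set MT) (fun t => (l (T (d + t) x) : R[i]) * (f t : R[i]))).
  by apply: eq_cInt => t /[!inE] /RposE t0; rewrite (T_add sgT).
rewrite -E [RHS]cInt_zext; apply: eq_cInt => t _.
have [t0|t0] := ltP 0 (t : R); first by rewrite [zext _ t]zext_pos// [RHS]zext_pos.
by rewrite [zext _ t]zext_npos// [RHS]zext_npos// mul0r.
Qed.

Definition phis : set (X -> X) := [set ph f | f in acar L].

Lemma phis_BX : phis `<=` acar BX.
Proof. by move=> _ [f Lf <-]; exact: ph_BX. Qed.

Lemma phis0 : phis 0.
Proof.
exists 0; first exact: L1_0.
have := ph_lin (-1) (L1_0 wT) (L1_0 wT).
by rewrite scaler0 add0r scaleN1r addNr.
Qed.

Lemma arveson_sub : acar I `<=` acar BX.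
Proof. exact: nclosure_car. Qed.

Lemma ph_I f : acar L f -> acar I (ph f).
Proof. by move=> Lf; apply: (nclosure_sub BX_nspace phis_BX); exists f. Qed.

Lemma I_nspace : nspace (acar I) (anorm I).
Proof.
apply: (nclosure_nspace BX_nspace phis_BX phis0) => a _ _ [f Lf <-] [g Lg <-].
by exists (a *: f + g); [exact: L1_lin|exact: ph_lin].
Qed.

Lemma I_complete : ncomplete (acar I) (anorm I).
Proof. exact: (nclosure_complete BX_nspace BX_complete phis_BX). Qed.

Lemma I_mul u v : acar I u -> acar I v -> acar I (u \o v).
Proof.
apply: (nclosure_comp (A := BX) X1_nspace BX_nspace) => //.
- by move=> f g Bf Bg; exact: (BX_mul Bf Bg).1.
- exact: phis_BX.
- by move=> _ _ [f Lf <-] [g Lg <-]; rewrite ph_mul//; exists (amul L f g) => //; exact: conv_L1.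
Qed.

Lemma I_mulC u v : acar I u -> acar I v -> u \o v = v \o u.
Proof.
apply: (nclosure_compC (A := BX) X1_nspace BX_nspace) => //.
- by move=> f g Bf Bg; exact: (BX_mul Bf Bg).1.
- exact: phis_BX.
- move=> _ _ [f Lf <-] [g Lg <-].
  by rewrite (ph_mul Lf Lg) (ph_mul Lg Lf) (conv_comm Lf Lg).
Qed.

Lemma T_BX t u : 0 < t -> acar BX u ->
  acar BX (T t \o u) /\ anorm BX (T t \o u) <= omegaT T t * anorm BX u.
Proof.
move=> t0 Bu; have [_ lT _] := T_oper sgT t0.
have w0 := w_ge0 wT t0.
have le x : X1 T x -> nX (T t (u x)) <= omegaT T t * anorm BX u * nX x.
  move=> Xx; rewrite (le_trans (T_le sgT _ t0))// -mulrA ler_wpM2l//.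
  exact: BX_le.
split; last first.
  by apply: (oper_norm_le X1_nspace) => //; rewrite mulr_ge0// (nsN_ge0 BX_nspace).
have [[Du lu _] u0] := Bu; split; last first.
  by move=> x nx /=; rewrite u0// (bounded_oper0 nsX (T_oper sgT t0)).
split=> [x Xx|a x y Xx Xy|]; first exact: X1_T.
- by rewrite /= lu// lT.
- by exists (omegaT T t * anorm BX u).
Qed.

Lemma T_B t (u v : X -> X) : 0 < t -> (T t \o u) - (T t \o v) = T t \o (u - v).
Proof.
move=> t0; apply/funext => x; rewrite !fctE /=.
by rewrite (bounded_operB nsX (T_oper sgT t0)).
Qed.

Lemma T_I t u : 0 < t -> acar I u -> acar I (T t \o u).
Proof.
move=> t0 Iu.
apply: (nclosure_map (A := BX) (B := BX) (f := fun u => T t \o u) (C := omegaT T t)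
  BX_nspace BX_nspace _ _ phis_BX phis_BX _ Iu).
- by move=> x Bx; exact: (T_BX t0 Bx).1.
- by move=> x y Bx By; rewrite T_B//; exact: (T_BX t0 (nsB BX_nspace Bx By)).2.
move=> _ [f Lf <-]; rewrite (ph_shift t0 Lf).
by apply: (nclosure_sub BX_nspace phis_BX); exists (fun r => zext f (r - t)) => //; exact: L1_shift.
Qed.

Lemma T_commute t u x : 0 < t -> acar I u -> X1 T x -> T t (u x) = u (T t x).
Proof.
move=> t0 Iu Xx.
apply: (nclosure_eq (A := BX) (f := fun u => T t (u x)) (g := fun u => u (T t x))
  (C := omegaT T t * nX x) (C' := nX (T t x)) nsX _ _ _ _ BX_nspace phis_BX _ Iu) => //.
- move=> u' v' Bu Bv; rewrite -(bounded_operB nsX (T_oper sgT t0))//.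
  rewrite (le_trans (T_le sgT _ t0))// -mulrA ler_wpM2l ?(w_ge0 wT)// mulrC.
  exact: (BX_le (nsB BX_nspace Bu Bv)).
- move=> u' v' Bu Bv; rewrite mulrC; apply: (BX_le (nsB BX_nspace Bu Bv)).
  exact: X1_T.
- move=> _ [f [mf If] <-]; rewrite /phiL1 !phi1E//; last exact: X1_T.
  by rewrite (phi_T pairing sgT wcT leb_finite mf If).
Qed.

Lemma T_half t (x : X) : 0 < t -> T t x = T (t / 2) (T (t / 2) x).
Proof. by move=> t0; rewrite -(T_add sgT) ?half_gt0// -splitr. Qed.

(** For each l, all the means of l(T(t) y) over intervals vanish, and [ind_mean_zero] recovers the
    value at each point. *)
Lemma X1_inj (y : X) : X1 T y -> (forall a b : R, 0 < a -> ph (ind a b) y = 0) ->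
  forall a : R, 0 < a -> T a y = 0.
Proof.
move=> Xy h a a0; apply: (Xs_eq pairing) => l Xl; rewrite (Xs0 pairing Xl).
apply: (ind_mean_zero a0 (k := fun t => l (T t y))).
- exact: (orbit_cmeas wcT).
- by move=> e e0; have := orbit_ncont wcT y Xl a0 e0.
move=> b ab; have Li := ind_L1 wT b a0; have [mi Ii] := Li; split.
  exact: (weak_cint pairing sgT wcT mi Ii).
by rewrite -phE// h// (Xs0 pairing).
Qed.

Lemma I_eq0 u : acar BX u -> (forall t y, 0 < t -> u (T t y) = 0) -> u = 0.
Proof.
move=> Bu h; apply: BX_eq => // [|x Xx]; first exact: (ns0 BX_nspace).
apply: (ns_eq nsX) => // e e0.
have n0 := nsN_ge0 BX_nspace Bu.
have K0 : 0 < anorm BX u + 1 by rewrite ltr_wpDl.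
have /X1P/(_ _ (divr_gt0 e0 K0))[t [y [t0 ty]]] := Xx.
have -> : u x - (0 : X -> X) x = u (x - T t y).
  by rewrite BX_B//; [rewrite h|exact: X1_T].
have Xd : X1 T (x - T t y) by apply: (nsB X1_nspace) => //; exact: X1_T.
rewrite (le_trans (BX_le Bu Xd))//.
move: ty; rewrite ltr_pdivlMr// => /ltW; apply: le_trans.
by rewrite mulrC ler_wpM2l ?nrm_ge0// lerDl.
Qed.

(** Taking for v the images of indicators, [X1_inj] gives T(a) u = 0 on X_1. Then u T(t) y = T(t/2)
    u T(t/2) y = 0, and such vectors T(t) y are dense in X_1. *)
Lemma I_faithful u : acar I u -> (forall v, acar I v -> v \o u = 0) -> u = 0.
Proof.
move=> Iu h; have Bu := arveson_sub Iu.
have Tu a x : 0 < a -> X1 T x -> T a (u x) = 0.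
  move=> a0 Xx; apply: X1_inj => //; first exact: BX_car.
  move=> a' b a'0; have := h _ (ph_I (ind_L1 wT b a'0)).
  by move=> /(congr1 (fun f : X -> X => f x)).
apply: I_eq0 => // t y t0; rewrite (T_half _ t0) -T_commute//.
- by apply: Tu; [exact: half_gt0|exact/X1_T/half_gt0].
- exact: half_gt0.
- exact/X1_T/half_gt0.
Qed.

Lemma I_balg : balg I.
Proof.
split.
- exact: I_nspace.
- exact: I_complete.
- exact: I_mul.
- by [].
- exact: I_mulC.
- by [].
- by move=> u v /arveson_sub Bu /arveson_sub Bv; exact: (BX_mul Bu Bv).2.
- exact: I_faithful.
Qed.

Lemma T_mlike t : 0 < t -> mlike I (fun u => T t \o u).
Proof. by move=> t0; split => // u; exact: T_I. Qed.

(** A density cut off to [trunc_set f m] vanishes to the left of 1/(m+1), so it is a translate by d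
    = 1/(2(m+1)) of some g, and its image is T(d) phi(g). *)
Lemma I_dense u : acar I u -> forall e : R, 0 < e ->
  exists t v, [/\ 0 < t, acar I v & anorm I (u - (T t \o v)) < e].
Proof.
move=> [Bu hu] e e0; have [_ [f Lf <-] uf] := hu _ (half_gt0 e0).
have [mf If] := Lf; have mw := w_meas wT.
have mG : measurable_fun (Rpos R : set MT) (fun t => nrm (f t : R[i]) * omegaT T t).
  by apply: measurable_funM => //; exact: cmeas_nrm.
have G0 t : 0 < t -> 0 <= nrm (f t : R[i]) * omegaT T t.
  by move=> t0; rewrite mulr_ge0 ?nrm_ge0// (w_ge0 wT).
have [m /(_ _ (leqnn _)) hm] := trunc_tail mf mG G0 If (half_gt0 e0).
pose ft : R -> R[i]^o := fun t => (\1_(trunc_set f m) t : R)%:C%C * (f t : R[i]).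
pose fc : R -> R[i]^o := fun t => (\1_(~` trunc_set f m) t : R)%:C%C * (f t : R[i]).
have mtr : measurable (trunc_set f m : set MT) by exact: measurable_trunc_set.
have n1 (A : set R) (t : R) : nrm ((\1_A t : R)%:C%C * (f t : R[i])) <= nrm (f t : R[i]).
  rewrite nrmM nrm_real indicE; case: (_ \in _); rewrite ?normr1 ?mul1r//.
  by rewrite normr0 mul0r nrm_ge0.
have mft : cmeasurable (Rpos R) ft.
  by apply: cmeasM => //; apply: cmeas_real; exact: measurable_indic.
have Lft : acar L ft by apply: (L1_le wT mft Lf) => t t0; exact: n1.
have Lfc : acar L fc.
  apply: (L1_le wT _ Lf) => [|t t0]; last exact: n1.
  by apply: cmeasM => //; apply: cmeas_real; apply: measurable_indic; exact: measurableC.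
have ffc : f - ft = fc.
  apply/funext => t; rewrite !fctE /ft /fc !indicE in_setC.
  by case: (_ \in _) => /=; rewrite ?mul1r ?mul0r ?subrr ?subr0.
pose d : R := m.+1%:R^-1 / 2; have m0 : 0 < m.+1%:R^-1 :> R by rewrite invr_gt0.
have d0 : 0 < d by exact: half_gt0.
have dm : d < m.+1%:R^-1 by rewrite /d ltr_pdivrMr// ltr_pMr// ltr1n.
pose g : R -> R[i]^o := fun t => zext ft (t + d).
have mg : cmeasurable (Rpos R) g.
  apply: (cmeasS (E := setT)) => //; apply: (cmeas_comp (cmeas_zext mft)).
  by apply: measurable_funD => //; exact: measurable_cst.
have [M hM] := w_loc wT m.+1%:R d0.
(* omega_T(t) is not controlled by omega_T(t + d). Integrability comes from the bound m on |f| over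
   the truncated set and the local bound of the weight on [d, m+1]. *)
have Lg : acar L g.
  split => //.
  apply: (@le_lt_trans _ _ (\int[leb]_(t in Rpos R)
    (\1_(`[d, m.+1%:R]%classic) t * (m%:R * `|M|))%:E)%E).
    apply: integral_lty_le => //.
    - by apply: measurable_funM => //; exact: cmeas_nrm.
    - by apply: measurable_funM => //; exact: measurable_indic.
    - by move=> t /RposE t0; rewrite mulr_ge0 ?nrm_ge0// (w_ge0 wT).
    - move=> t /RposE t0; rewrite /g zext_pos ?addr_gt0// /ft !indicE.
      case: (boolP (_ \in trunc_set f m)) => [|_]; last first.
        by rewrite mul0r nrm0 mul0r mulr_ge0// mulr_ge0.
      rewrite inE => -[/andP[h1 h2] h3]; rewrite mul1r.
      have td : d <= t by rewrite -(lerD2r d) -splitr.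
      have tm : t <= m.+1%:R by rewrite (le_trans _ h2)// lerDl ltW.
      rewrite mem_set /=; last by rewrite in_itv /= td.
      rewrite mul1r ler_pM ?nrm_ge0// ?(w_ge0 wT)//.
      by rewrite (le_trans _ (ler_norm _))// hM// td.
  have mI : measurable_fun (Rpos R : set MT) (\1_(`[d, m.+1%:R]%classic) : R -> R).
    exact: measurable_indic.
  under eq_integral do rewrite EFinM muleC.
  rewrite ge0_integralZl//; last first.
    by first [exact/measurable_EFinP|rewrite lee_fin mulr_ge0].
  rewrite integral_indic// lte_mul_pinfty// ?lee_fin ?mulr_ge0//.
  apply: le_lt_trans (leb_finite m.+1%:R d0); apply: le_measure; rewrite ?inE//.
  by apply: measurableI => //; exact: measurable_itv.
exists d, (ph g); split => //; first exact: ph_I.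
rewrite (ph_shift d0 Lg).
have -> : ph (fun r => zext g (r - d)) = ph ft.
  apply/funext => x; have [Xx|nx] := pselect (X1 T x); last by rewrite !ph_out.
  apply: (Xs_eq pairing) => l Xl; rewrite !phE//; last exact: L1_shift.
  apply: eq_cInt => t /[!inE] /RposE t0; congr (_ * _).
  have [td|td] := ltP 0 (t - d).
    by rewrite zext_pos// /g subrK zext_pos.
  rewrite zext_npos// /ft indicE memNset ?mul0r// => -[/andP[h1 _] _].
  by move: td; rewrite subr_le0 leNgt (lt_le_trans dm h1).
have Bf := ph_BX Lf; have Bft := ph_BX Lft.
apply: le_lt_trans (nsNBD BX_nspace Bu Bft Bf) _.
rewrite (splitr e); apply: (ltrD uf).
have -> : ph f - ph ft = ph fc.
  by rewrite -ffc ph_B.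
apply: le_lt_trans (ph_le Lfc) _; rewrite -lte_fin (L1_normE wT Lfc).
apply: le_lt_trans hm; rewrite le_eqVlt; apply/orP; left; apply/eqP.
apply: eq_integral => t _; rewrite /fc nrmM nrm_real indicE mulrA.
by case: (_ \in _); rewrite ?normr1 ?normr0.
Qed.

Section GeneratorFunction.
Variables (f0 f0' : R -> R[i]^o).
Hypothesis gf : gen_function (omegaT T) f0 f0'.

Lemma gen_L1 : acar L f0 /\ acar L f0'.
Proof. by case: gf => _ [? _]. Qed.

(** The difference is phi(1_]a,b]) phi(f_0'), and [ind_norm] bounds the first factor by M (b -
    a). *)
Lemma T_shift_le a b (M : R) : 0 < a -> a <= b -> (forall t, a <= t <= b -> omegaT T t <= M) ->
  anorm BX ((T a \o ph f0) - (T b \o ph f0)) <= M * (b - a) * anorm BX (ph f0').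
Proof.
have [Lf Lf'] := gen_L1; have [C1 _ z0 _] := gf.
rewrite le_eqVlt => a0 /orP[/eqP <-|ab] hM.
  by rewrite !subrr (nsN0 BX_nspace) mulr0 mul0r.
have Li := ind_L1 wT b a0.
have -> : (T a \o ph f0) - (T b \o ph f0) = ph (ind a b) \o ph f0'.
  have b0 := lt_trans a0 ab.
  apply: BX_eq; first exact: (nsB BX_nspace (T_BX a0 (ph_BX Lf)).1 (T_BX b0 (ph_BX Lf)).1).
    exact: (BX_mul (ph_BX Li) (ph_BX Lf')).1.
  move=> x Xx; apply: (Xs_eq pairing) => l Xl; rewrite !fctE /= (XsB pairing)//.
  have E c : 0 < c -> l (T c (ph f0 x)) =
      cInt leb (Rpos R : set MT) (fun t => (l (T (c + t) x) : R[i]) * (f0 t : R[i])).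
    move=> c0; have := phE Lf Xx (T_Xs sgT c0 Xl); rewrite /= => ->.
    by apply: eq_cInt => t /[!inE] /RposE t0; rewrite (T_add sgT).
  have kC t : 0 < t -> nrm (l (T t x) : R[i]) <= dnorm l * nX x * omegaT T t.
    by move=> t0; exact: (orbit_pos pairing sgT).
  rewrite !E//.
  rewrite (generator_shift wT C1 z0 a0 ab Lf Lf' (orbit_cmeas wcT x Xl) kC).
  rewrite phE//; last exact: (BX_car (ph_BX Lf')).
  apply: eq_cInt => t /[!inE] /RposE t0; congr (_ * _).
  have := phE Lf' Xx (T_Xs sgT t0 Xl); rewrite /= => ->.
  by apply: eq_cInt => s /[!inE] /RposE s0; rewrite (T_add sgT).
rewrite (le_trans (BX_mul (ph_BX Li) (ph_BX Lf')).2)// ler_wpM2r//.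
  exact: (nsN_ge0 BX_nspace (ph_BX Lf')).
by rewrite (le_trans (ph_le Li))// (ind_norm wT)// ltW.
Qed.

(** phi is a contractive homomorphism with dense range, so it carries [Omega] of the weighted L^1
    algebra into [Omega] of the ideal. *)
Lemma gen_Omega : Omega I (ph f0).
Proof.
have [Lf Lf'] := gen_L1; have [_ [_ Of] _ _] := gf.
split=> [|u Iu]; first exact: ph_I.
split=> // e e0; have [Bu hu] := Iu; have [_ [g Lg <-] ug] := hu _ (half_gt0 e0).
have [_ /(_ _ (half_gt0 e0))[_ [v Lv <-] gv]] := Of g Lg.
exists (ph f0 \o ph v); first by exists (ph v) => //; exact: ph_I.
have Lm := conv_L1 wT Lf Lv.
rewrite ph_mul// (le_lt_trans (nsNBD BX_nspace (z := ph g) _ _ _))//; [exact: ph_BX..|].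
rewrite (splitr e); apply: (ltrD ug); apply: le_lt_trans gv.
rewrite -ph_B//.
by apply: ph_le; rewrite addrC -scaleN1r; exact: L1_lin.
Qed.

(** The products phi(f_0) v are dense by [gen_Omega], and for them t |-> T(t) phi(f_0) v is locally
    Lipschitz by [T_shift_le]. *)
Lemma T_strong u : acar I u -> ncont I (fun t => T t \o u).
Proof.
move=> Iu; have [Lf Lf'] := gen_L1; have Bu := arveson_sub Iu.
apply: (ncont_dense (S := fun t u => T t \o u) (u := u) I_nspace Iu (w_loc wT))
  => [t x|t x y t0 /arveson_sub Bx /arveson_sub By|d d0].
- exact: T_I.
- by rewrite T_B//; exact: (T_BX t0 (nsB BX_nspace Bx By)).2.
have [_ /(_ _ d0)[_ [v Iv <-] uv]] := gen_Omega.2 _ Iu; have Bv := arveson_sub Iv.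
pose w := ph f0 \o v; exists w; split=> //; first exact: (I_mul (ph_I Lf) Iv).
move=> t t0 e e0; have Bw := (BX_mul (ph_BX Lf) Bv).1.
have [M hM] := w_loc wT (t + 1) (half_gt0 t0).
have tt : t / 2 < t by rewrite ltr_pdivrMr// ltr_pMr// ltr1n.
have M0 : 0 <= M.
  by apply: le_trans (w_ge0 wT t0) (hM t _); rewrite (ltW tt) lerDl ler01.
pose Q := M * anorm BX (ph f0') * anorm BX v.
have Q0 : 0 <= Q by rewrite !mulr_ge0// (nsN_ge0 BX_nspace)//; exact: ph_BX.
have Q1 : 0 < Q + 1 by rewrite ltr_wpDl.
exists (Num.min (Num.min (t / 2) 1) (e / (Q + 1))).
  by rewrite !lt_min half_gt0 ?ltr01 ?divr_gt0.
move=> s s0; rewrite !lt_min -andbA => /and3P[st1 st2 st3].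
have sab : t / 2 <= s <= t + 1.
  move: st1 st2; rewrite !ltr_norml => /andP[h1 _] /andP[_ h2].
  apply/andP; split; last by rewrite -lerBlDl ltW.
  by rewrite -(lerD2r (- t)) (le_trans _ (ltW h1))// {2}(splitr t) opprD addNKr.
have tab : t / 2 <= t <= t + 1 by rewrite (ltW tt) lerDl ler01.
have key a b : 0 < a -> 0 < b -> a <= b -> t / 2 <= a <= t + 1 -> t / 2 <= b <= t + 1 ->
    anorm BX ((T a \o w) - (T b \o w)) <= Q * (b - a).
  move=> a0 b0 ab /andP[a1 a2] /andP[b1 b2].
  have -> : (T a \o w) - (T b \o w) = ((T a \o ph f0) - (T b \o ph f0)) \o v by [].
  have Bd := nsB BX_nspace (T_BX a0 (ph_BX Lf)).1 (T_BX b0 (ph_BX Lf)).1.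
  rewrite (le_trans (BX_mul Bd Bv).2)//.
  rewrite (le_trans (ler_wpM2r (nsN_ge0 BX_nspace Bv) (T_shift_le (M := M) a0 ab _)))//.
    move=> r /andP[ar rb]; apply: hM; by rewrite (le_trans a1)//= (le_trans rb).
  by rewrite /Q le_eqVlt; apply/orP; left; apply/eqP; ring.
have fin : Q * `|s - t| < e.
  move: st3; rewrite ltr_pdivlMr//; apply: le_lt_trans.
  by rewrite mulrC ler_wpM2l// lerDl.
apply: le_lt_trans fin; have [ts|st] := leP s t.
  by rewrite distrC (ger0_norm (x := t - s)) ?subr_ge0//; exact: key.
rewrite (nsNBC BX_nspace (T_BX s0 Bw).1 (T_BX t0 Bw).1).
by rewrite (ger0_norm (x := s - t)) ?subr_ge0 ?(ltW st)//; exact: (key t s t0 s0 (ltW st)).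
Qed.

End GeneratorFunction.

End Arveson.

(** * Semigroups acting on a Banach algebra *)

(** The common interface of T on I_T and on J_T, instantiated by [I_action] and [J_action]. *)
Record action (R : realType) (V : lmodType R[i]) (A : nalg V) (w : R -> R)
    (S : R -> V -> V) : Prop := Action {
  ac_w : weight w ;
  ac_mlike : forall t, 0 < t -> mlike A (S t) ;
  ac_lin : forall t (a : R[i]) u v, 0 < t -> acar A u -> acar A v ->
    S t (a *: u + v) = a *: S t u + S t v ;
  ac_sg : forall s t u, 0 < s -> 0 < t -> acar A u -> S (s + t) u = S s (S t u) ;
  ac_le : forall t u, 0 < t -> acar A u -> anorm A (S t u) <= w t * anorm A u ;
  ac_cont : forall u, acar A u -> ncont A (fun t => S t u) }.

Lemma eq_mult_graph (R : realType) (V : lmodType R[i]) (A : nalg V) (S S' : V -> V) :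
  (forall u, acar A u -> S u = S' u) -> mult_graph A S = mult_graph A S'.
Proof.
move=> h; apply/seteqP; split => -[x y] [/= Ax yE]; split => //=.
  by rewrite yE h.
by rewrite yE h.
Qed.

Section Action.
Context {R : realType} {V : lmodType R[i]} {A : nalg V}.
Local Notation MT := (measurableTypeR R).
Local Notation leb := (@lebesgue_measure R).
Hypothesis BA : balg A.
Variables (w : R -> R) (S : R -> V -> V).
Hypothesis AS : action A w S.
Let HA := ba_ns BA.
Let ww := ac_w AS.
Let mR : measurable (Rpos R : set MT) := @Rpos_measurable R.

Lemma ac_car t u : 0 < t -> acar A u -> acar A (S t u).
Proof. by move=> t0 Au; have [h _] := ac_mlike AS t0; exact: h. Qed.

Lemma char_bfun chi : character A chi -> bfun A chi.
Proof.
move=> hc; have [l _ _] := hc; split=> //; exists 1 => u Au.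
by rewrite mul1r; exact: char_le.
Qed.

Lemma ac_cmeas th u : bfun A th -> acar A u -> cmeasurable (Rpos R) (fun t => th (S t u)).
Proof.
move=> bth Au; apply: (cmeas_bfun HA bth) => [t t0|]; first exact: ac_car.
exact: ac_cont AS _ Au.
Qed.

Section Eigenvalue.
Variables (chi : V -> R[i]) (v : V).
Hypothesis hchi : character A chi.
Hypothesis hv : Omega A v.

Definition eigen (t : R) : R[i] := chi (S t v) / chi v.

Let v0 : chi v != 0. Proof. exact: (char_Omega BA hchi). Qed.
Let Av : acar A v. Proof. by case: hv. Qed.

(** S(t) moves across a product: (S(t) u) v = S(t)(u v) = (S(t) v) u; apply chi. *)
Lemma eigenP t u : 0 < t -> acar A u -> chi (S t u) = eigen t * chi u.
Proof.
move=> t0 Au; have [_ hM _] := hchi; have [Sc SM] := ac_mlike AS t0.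
apply: (mulIf v0); rewrite /eigen mulrAC divfK//.
by rewrite -!hM -?SM//; [rewrite (ba_mulC BA)|exact: Sc..].
Qed.

Lemma eigenM s t : 0 < s -> 0 < t -> eigen (s + t) = eigen s * eigen t.
Proof.
move=> s0 t0; rewrite {1}/eigen (ac_sg AS)// eigenP//; last exact: ac_car.
by rewrite -mulrA.
Qed.

Lemma eigen_le : exists C, forall t, 0 < t -> nrm (eigen t) <= C * w t.
Proof.
exists (anorm A v / nrm (chi v)) => t t0; rewrite /eigen nrmM nrmV mulrAC.
rewrite ler_wpM2r ?invr_ge0 ?nrm_ge0//.
rewrite (le_trans (char_le BA hchi (ac_car t0 Av)))// mulrC.
exact: ac_le.
Qed.

Lemma eigen_cont t (e : R) : 0 < t -> 0 < e -> exists2 d : R, 0 < d &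
  forall s, 0 < s -> `|s - t| < d -> nrm (eigen s - eigen t) < e.
Proof.
move=> t0 e0; have c0 : 0 < nrm (chi v).
  rewrite lt_neqAle nrm_ge0 andbT eq_sym; apply/eqP => /nrm_eq0 h.
  by move: v0; rewrite h eqxx.
have [d d0 hd] := ac_cont AS Av t0 (mulr_gt0 e0 c0).
exists d => // s s0 st; rewrite /eigen -mulrBl nrmM nrmV ltr_pdivrMr//.
apply: le_lt_trans (hd _ s0 st).
rewrite -(charB BA hchi); [|exact: ac_car..].
by apply: (char_le BA hchi); apply: (nsB HA); exact: ac_car.
Qed.

Lemma eigen_cmeas : cmeasurable (Rpos R) eigen.
Proof.
apply: cmeasM; last exact: cmeas_cst.
exact: (ac_cmeas (char_bfun hchi)).
Qed.

End Eigenvalue.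

Variable Th : set (V -> R[i]).
Hypothesis nTh : norming A Th.

Definition actI nu h u := xget 0 [set x | bochner A nu h (fun t => S t u) x].

Section Integral.
Variables (nu : {measure set MT -> \bar R}) (h : R -> R[i]).
Hypothesis fnu : forall a b : R, 0 < a -> (nu `[a, b]%classic < +oo)%E.
Hypothesis mh : cmeasurable (Rpos R) h.
Hypothesis Ih : (\int[nu]_(t in Rpos R) (nrm (h t) * w t)%:E < +oo)%E.

Lemma actIP u : acar A u -> bochner A nu h (fun t => S t u) (actI nu h u).
Proof.
move=> Au; rewrite /actI; case: xgetP => [x _ //|].
have [|||||x hx /(_ x)//] := bochner_exists HA nTh (F := fun t => S t u) fnu mh.
- exact: ba_complete.
- by move=> t t0; exact: ac_car.
- exact: ac_cont AS _ Au.
- move=> a b a0; have [M hM] := w_loc ww b a0; exists (M * anorm A u) => t tab.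
  have t0 : 0 < t by have /andP[/(lt_le_trans a0)] := tab.
  by rewrite (le_trans (ac_le AS t0 Au))// ler_wpM2r ?(nsN_ge0 HA)// hM.
- have mN : measurable_fun (Rpos R : set MT) (fun t => anorm A (S t u)).
    have := rcont_N HA (fun t t0 => ac_car t0 Au) (ac_cont AS Au) (ns0 HA).
    move=> /rcont_measurable; apply: eq_measurable_fun => t _.
    by rewrite subr0.
  have mw := w_meas ww; have mn : measurable_fun (Rpos R : set MT) (fun t => nrm (h t)).
    exact: cmeas_nrm.
  apply: (@le_lt_trans _ _ (\int[nu]_(t in Rpos R) (anorm A u * (nrm (h t) * w t))%:E)%E).
    apply: integral_lty_le => //.
    + by apply: measurable_funM => //.
    + by apply: measurable_funM; [exact: measurable_cst|exact: measurable_funM].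
    + by move=> t /RposE t0; rewrite mulr_ge0 ?nrm_ge0// (nsN_ge0 HA)//; exact: ac_car.
    + move=> t /RposE t0; rewrite mulrA mulrAC ler_wpM2r ?nrm_ge0// mulrC.
      exact: ac_le.
  under eq_integral do rewrite EFinM.
  rewrite ge0_integralZl//; last 3 first.
  + by apply/measurable_EFinP; apply: measurable_funM.
  + by move=> t /RposE t0; rewrite lee_fin mulr_ge0 ?nrm_ge0// (w_ge0 ww).
  + by rewrite lee_fin (nsN_ge0 HA).
  by rewrite lte_mul_pinfty// ?lee_fin ?(nsN_ge0 HA).
Qed.

Lemma actI_car u : acar A u -> acar A (actI nu h u).
Proof. by move=> /actIP[]. Qed.

Lemma actI_fun th u : bfun A th -> acar A u ->
  cint nu (Rpos R : set MT) (fun t => th (S t u) * h t) /\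
  th (actI nu h u) = cInt nu (Rpos R : set MT) (fun t => th (S t u) * h t).
Proof.
move=> bth Au; apply: (bochner_functional HA bth mh _ _ (actIP Au)).
  by move=> t t0; exact: ac_car.
exact: ac_cmeas.
Qed.

Lemma bfun_mulr th v : bfun A th -> acar A v -> bfun A (fun u => th (amul A u v)).
Proof.
move=> [lth [C hC]] Av; split=> [a u u' Au Au'|].
  by rewrite (ba_mulL BA)// lth//; exact: ba_mul.
exists (`|C| * anorm A v) => u Au; rewrite (le_trans (hC _ (ba_mul BA Au Av)))//.
have n0 := nsN_ge0 HA (ba_mul BA Au Av).
rewrite (le_trans (ler_wpM2r n0 (ler_norm C)))// -mulrA ler_wpM2l//.
by rewrite mulrC; exact: ba_normM.
Qed.

Lemma actI_mlike : mlike A (actI nu h).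
Proof.
split=> [u|u v Au Av]; first exact: actI_car.
have Auv := ba_mul BA Au Av.
apply: (norming_eq HA nTh); [exact: actI_car|by apply: (ba_mul BA) => //; exact: actI_car|].
move=> th Tth; have bth := norming_bfun nTh Tth.
have [_ ->] := actI_fun bth Auv; have [_ ->] := actI_fun (bfun_mulr bth Av) Au.
apply: eq_cInt => t /[!inE] /RposE t0.
by have [_ ->] := ac_mlike AS t0.
Qed.

Lemma actI_le u : acar A u ->
  anorm A (actI nu h u) <= (\int[nu]_(t in Rpos R) (nrm (h t) * w t)) * anorm A u.
Proof.
move=> Au; have [hT hn] := nTh; have n0 := nsN_ge0 HA Au; have mw := w_meas ww.
have w0 t : 0 < t -> 0 <= nrm (h t) * w t by move=> t0; rewrite mulr_ge0 ?nrm_ge0// (w_ge0 ww).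
apply: hn; first exact: actI_car.
  by rewrite mulr_ge0// Rintegral_ge0// => t /RposE; exact: w0.
move=> th Tth; have [_ le] := hT _ Tth.
have [Ith ->] := actI_fun (norming_bfun nTh Tth) Au.
have mg : measurable_fun (Rpos R : set MT) (fun t => nrm (h t) * w t).
  by apply: measurable_funM => //; exact: cmeas_nrm.
rewrite mulrC -RintegralZl//; last first.
  apply/integrableP; split; first exact/measurable_EFinP.
  rewrite (_ : (\int[_]_(t in _) _ =
     \int[nu]_(t in Rpos R) (nrm (h t) * w t)%:E)%E); first exact: Ih.
  by apply: eq_integral => t /[!inE] /RposE t0; rewrite /= ger0_norm// w0.
apply: nrm_cInt_le => //.
- by case: Ith.
- by apply: measurable_funM => //; exact: measurable_cst.
- move=> t /RposE t0; rewrite nrmM mulrC mulrCA ler_wpM2l ?nrm_ge0//.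
  rewrite (le_trans (le _ (ac_car t0 Au)))// mulrC; exact: ac_le.
- under eq_integral do rewrite EFinM.
  rewrite ge0_integralZl//; first by rewrite lte_mul_pinfty// ?lee_fin.
  + exact/measurable_EFinP.
  + by move=> t /RposE t0; rewrite lee_fin w0.
Qed.

Lemma actI_B u v : acar A u -> acar A v -> actI nu h u - actI nu h v = actI nu h (u - v).
Proof.
move=> Au Av; have Auv := nsB HA Au Av; have [Iu Iv] := (actI_car Au, actI_car Av).
apply: (norming_eq HA nTh); [exact: (nsB HA)|exact: actI_car|].
move=> th Tth; have bth := norming_bfun nTh Tth.
have [I1 E1] := actI_fun bth Au; have [I2 E2] := actI_fun bth Av.
have [I3 E3] := actI_fun bth Auv.
rewrite (bfunB HA bth Iu Iv) E1 E2 E3 -(cIntB mR I1 I2); apply: eq_cInt => t /[!inE] /RposE t0.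
rewrite -mulrBl -(bfunB HA bth (ac_car t0 Au) (ac_car t0 Av)); congr (th _ * _).
have -> : S t (u - v) = S t (- 1 *: v + u) by rewrite scaleN1r addrC.
by rewrite (ac_lin AS)// scaleN1r addrC.
Qed.

Lemma actI_char chi e u : character A chi ->
  (forall t u, 0 < t -> acar A u -> chi (S t u) = e t * chi u) -> acar A u ->
  chi (actI nu h u) = cInt nu (Rpos R : set MT) (fun t => e t * h t) * chi u.
Proof.
move=> hc he Au; have bc := char_bfun hc.
have Ieh : cint nu (Rpos R : set MT) (fun t => e t * h t).
  have [_ _ [v Av v0]] := hc; have [I1 _] := actI_fun bc Av.
  apply: cint_eq (cintZ (chi v)^-1 mR I1) => t /[!inE] /RposE t0.
  by rewrite he// mulrA [e t * _]mulrC mulKf.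
have [_ ->] := actI_fun bc Au; rewrite -cIntZr//; apply: eq_cInt => t /[!inE] /RposE t0.
by rewrite he// mulrAC.
Qed.

(** The integral is the fraction with numerator its value at [v] and denominator [v], and chi of the
    numerator is the scalar integral times chi(v). *)
Lemma chi_ext_actI chi e v F : character A chi -> Omega A v ->
  (forall t u, 0 < t -> acar A u -> chi (S t u) = e t * chi u) ->
  (forall u, acar A u -> F u = actI nu h u) ->
  chi_ext A chi (mult_graph A F) = cInt nu (Rpos R : set MT) (fun t => e t * h t).
Proof.
move=> hc hv he FE; have [Av _] := hv; rewrite (eq_mult_graph FE).
rewrite (mult_graph_qmult BA actI_mlike hv) (chi_ext_qmult BA)//; last exact: actI_car.
by rewrite (actI_char hc he)// mulfK// (char_Omega BA).
Qed.

End Integral.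

Lemma actI_Bl f g u : acar (L1 w) f -> acar (L1 w) g -> acar A u ->
  actI leb f u - actI leb g u = actI leb (f - g) u.
Proof.
move=> Lf Lg Au; have Lfg : acar (L1 w) (f - g).
  by rewrite addrC -scaleN1r; exact: (L1_lin ww).
have [[mf If] [mg Ig] [mh Ih]] := And3 Lf Lg Lfg.
have Jf := actI_car leb_finite mf If Au; have Jg := actI_car leb_finite mg Ig Au.
apply: (norming_eq HA nTh); [exact: (nsB HA)|exact: (actI_car leb_finite mh Ih Au)|].
move=> th Tth; have bth := norming_bfun nTh Tth.
have [I1 E1] := actI_fun leb_finite mf If bth Au.
have [I2 E2] := actI_fun leb_finite mg Ig bth Au.
have [I3 E3] := actI_fun leb_finite mh Ih bth Au.
rewrite (bfunB HA bth Jf Jg) E1 E2 E3 -(cIntB mR I1 I2); apply: eq_cInt => t _.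
by rewrite -mulrBr.
Qed.

Lemma actI_conv f g u : acar (L1 w) f -> acar (L1 w) g -> acar A u ->
  actI leb f (actI leb g u) = actI leb (amul (L1 w) f g) u.
Proof.
move=> Lf Lg Au; have [[mf If] [mg Ig]] := (Lf, Lg).
have [mc Ic] := conv_L1 ww Lf Lg.
have Ag := actI_car leb_finite mg Ig Au.
apply: (norming_eq HA nTh); [exact: (actI_car leb_finite mf If)
  |exact: (actI_car leb_finite mc Ic)|].
move=> th Tth; have bth := norming_bfun nTh Tth.
have [_ ->] := actI_fun leb_finite mf If bth Ag.
have [_ ->] := actI_fun leb_finite mc Ic bth Au.
have [C C0 hC] := bfun_le HA bth.
rewrite (conv_comm Lf Lg).
rewrite (conv_cInt ww (k := fun t => th (S t u)) (C := C * anorm A u))//; last 2 first.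
- exact: ac_cmeas.
- move=> t t0; rewrite (le_trans (hC _ (ac_car t0 Au)))// -mulrA ler_wpM2l// mulrC.
  exact: ac_le.
apply: eq_cInt => s /[!inE] /RposE s0; congr (_ * _).
have bs : bfun A (fun x => th (S s x)).
  split=> [a x y Ax Ay|].
    by have [lth _] := bth; rewrite (ac_lin AS)// lth//; exact: ac_car.
  exists (C * w s) => x Ax; rewrite (le_trans (hC _ (ac_car s0 Ax)))// -mulrA ler_wpM2l//.
  exact: ac_le.
have [_ ->] := actI_fun leb_finite mg Ig bs Au.
by apply: eq_cInt => t /[!inE] /RposE t0; rewrite (ac_sg AS).
Qed.

End Action.

(** * Exponential functions *)

Section Exponential.
Context {R : realType}.
Local Notation MT := (measurableTypeR R).
Local Notation leb := (@lebesgue_measure R).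
Let mR : measurable (Rpos R : set MT) := @Rpos_measurable R.

Lemma deriv_small (q : R -> R) (t D : R) :
  (forall e : R, 0 < e -> exists2 d : R, 0 < d & forall s, `|s - t| < d ->
     `|q s - q t - (s - t) * D| <= e * `|s - t|) -> is_derive t 1 q D.
Proof.
move=> h; have cv : (fun k : R => k^-1 *: ((q \o shift t) (k *: 1) - q t)) @ 0^' --> D.
  apply/cvgrPdist_lt => e e0; have [d d0 hd] := h _ (half_gt0 e0).
  near=> k; have k0 : k != 0 by near: k; exact: nbhs_dnbhs_neq.
  have kd : `|k| < d by near: k; apply: dnbhs0_lt.
  rewrite /= scaler1.
  have := hd (k + t); rewrite addrK => /(_ kd) le.
  have -> : D - k^-1 *: (q (k + t) - q t) = - (k^-1 * (q (k + t) - q t - k * D)).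
    by rewrite /GRing.scale /= [in RHS]mulrBr mulKf// opprB.
  rewrite normrN normrM normfV ltr_pdivrMl ?normr_gt0// (le_lt_trans le)// mulrC.
  by rewrite ltr_pM2l ?normr_gt0// ltr_pdivrMr// ltr_pMr// ltr1n.
by split; [apply/cvg_ex; exists D|exact: cvg_lim].
Unshelve. all: by end_near. Qed.

Lemma deriv0_const (q : R -> R) : (forall t : R, 0 < t -> is_derive t 1 q 0) ->
  forall a b : R, 0 < a -> 0 < b -> q a = q b.
Proof.
move=> hq; suff h a b : 0 < a -> a < b -> q a = q b.
  move=> a b a0 b0; have [ab|ba|->//] := ltgtP a b; first exact: h.
  by rewrite (h b a).
move=> a0 ab; have [t| |c _ /eqP] := @MVT R q (fun=> 0) a b ab.
- by rewrite in_itv /= => /andP[at_ _]; apply: hq; exact: lt_trans at_.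
- apply: derivable_within_continuous => t; rewrite in_itv /= => /andP[at_ _].
  by have [] := hq t (lt_le_trans a0 at_).
by rewrite mul0r subr_eq0 => /eqP.
Qed.

Variables (w : R -> R) (e : R -> R[i]) (C : R).
Hypothesis ww : weight w.
Hypothesis me : cmeasurable (Rpos R) e.
Hypothesis ce : forall t (d : R), 0 < t -> 0 < d -> exists2 r : R, 0 < r &
  forall s, 0 < s -> `|s - t| < r -> nrm (e s - e t) < d.
Hypothesis eC : forall t, 0 < t -> nrm (e t) <= C * w t.
Hypothesis eM : forall s t, 0 < s -> 0 < t -> e (s + t) = e s * e t.

Section Derivative.
Variable z : R[i].
Hypothesis he : forall a b : R, 0 < a -> a < b ->
  e b - e a = z * cInt leb (Rpos R : set MT) (fun t => e t * (ind a b t : R[i])).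

Let e_near a b M : 0 < a -> a < b -> (forall t, a <= t <= b -> nrm (e t - e a) <= M) ->
  nrm (e b - e a - (b - a)%:C%C * (z * e a)) <= nrm z * (M * (b - a)).
Proof.
move=> a0 ab hM; rewrite he// mulrCA -mulrBr nrmM ler_wpM2l ?nrm_ge0//.
apply: cInt_ind_near => //; first exact: ltW.
have [mi Ii] := ind_L1 ww b a0.
exact: (weight_cint ww mi Ii me eC).
Qed.

(** [e_near] expands from the left end of an interval. For s < t it is applied at s, and the slope z
    e(s) is then replaced by z e(t) using continuity. *)
Let e_diff (t d : R) : 0 < t -> 0 < d -> exists2 r : R, 0 < r &
  forall s, `|s - t| < r -> nrm (e s - e t - (s - t)%:C%C * (z * e t)) <= d * `|s - t|.
Proof.
move=> t0 d0; pose K := 3 * (nrm z + 1).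
have K0 : 0 < K by rewrite mulr_gt0// ltr_wpDl ?nrm_ge0.
have [r r0 hr] := ce t0 (divr_gt0 d0 K0).
have zd : nrm z * (d / K * 3) <= d.
  rewrite (_ : _ * _ = d * (nrm z * 3 / K)); last by ring.
  rewrite ler_piMr ?(ltW d0)// ler_pdivrMr// mul1r mulrC ler_wpM2l//.
  by rewrite lerDl.
exists (Num.min r t); first by rewrite lt_min r0.
move=> s; rewrite lt_min => /andP[sr st].
have s0 : 0 < s by move: st; rewrite ltr_distl subrr => /andP[].
have [ts|st'|<-] := ltgtP t s; last by rewrite !subrr mul0r subr0 nrm0 normr0 mulr0.
- apply: le_trans (e_near (M := d / K) t0 ts _) _.
    move=> x /andP[tx xs]; apply/ltW/hr; first exact: lt_le_trans tx.
    rewrite ger0_norm ?subr_ge0//; apply: le_lt_trans sr.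
    by rewrite ger0_norm ?lerD2r// subr_ge0 ltW.
  rewrite gtr0_norm ?subr_gt0// mulrA ler_wpM2r ?subr_ge0 ?(ltW ts)//.
  apply: le_trans zd; rewrite ler_wpM2l ?nrm_ge0// ler_peMr//.
    by rewrite divr_ge0// ltW.
  by rewrite ler1n.
- have near1 x : s <= x <= t -> nrm (e x - e t) <= d / K.
    move=> /andP[sx xt]; apply/ltW/hr; first exact: lt_le_trans sx.
    rewrite distrC ger0_norm ?subr_ge0//; apply: le_lt_trans sr.
    by rewrite distrC ger0_norm ?lerB// subr_ge0 ltW.
  have ss : s <= s <= t by rewrite lexx ltW.
  have := e_near (M := d / K * 2) s0 st' _.
  have /[swap] /[apply] : forall x, s <= x <= t -> nrm (e x - e s) <= d / K * 2.
    move=> x sxt; have -> : e x - e s = (e x - e t) - (e s - e t).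
      by rewrite opprB addrA subrK.
    by rewrite (le_trans (nrmB _ _))// mulr_natr mulr2n lerD// near1.
  move=> le; rewrite ltr0_norm ?subr_lt0//.
  have -> : e s - e t - (s - t)%:C%C * (z * e t) =
     - (e t - e s - (t - s)%:C%C * (z * e s)) + (t - s)%:C%C * (z * (e t - e s)).
    by rewrite !rmorphB /=; ring.
  rewrite (le_trans (nrmD _ _))// nrmN (le_trans (lerD le (lexx _)))//.
  have ts0 : 0 <= t - s by rewrite subr_ge0 ltW.
  rewrite !nrmM nrm_real (ger0_norm ts0) opprB.
  have := near1 _ ss; rewrite nrmBC => n1.
  apply: le_trans (ler_wpM2r ts0 zd).
  rewrite [leLHS](_ : _ = nrm z * (d / K * 2 + nrm (e t - e s)) * (t - s)); last by ring.
  rewrite ler_wpM2r// ler_wpM2l ?nrm_ge0//.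
  by have := n1; move: (nrm _) (d / K) => p q; lra.
Qed.

Let dRe (t : R) : 0 < t -> is_derive t 1 (fun s => complex.Re (e s)) (complex.Re (z * e t)).
Proof.
move=> t0; apply: deriv_small => d d0; have [r r0 hr] := e_diff t0 d0.
exists r => // s /hr; apply: le_trans.
rewrite (_ : _ - _ * _ = complex.Re (e s - e t - (s - t)%:C%C * (z * e t))) ?Re_le_nrm//.
by rewrite !ReD !ReN (ReM (s - t)%:C%C) /= mul0r subr0.
Qed.

Let dIm (t : R) : 0 < t -> is_derive t 1 (fun s => complex.Im (e s)) (complex.Im (z * e t)).
Proof.
move=> t0; apply: deriv_small => d d0; have [r r0 hr] := e_diff t0 d0.
exists r => // s /hr; apply: le_trans.
rewrite (_ : _ - _ * _ = complex.Im (e s - e t - (s - t)%:C%C * (z * e t))) ?Im_le_nrm//.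
by rewrite !ImD !ImN (ImM (s - t)%:C%C) /= mul0r addr0.
Qed.

Let x := complex.Re z.
Let y := complex.Im z.
(** [g1] and [g2] are the real and imaginary part of exp(- z t) e(t), whose derivative vanishes. *)
Let g1 (t : R) : R := expR (- x * t) * (cos (y * t) * complex.Re (e t) + sin (y * t) * complex.Im (e t)).
Let g2 (t : R) : R := expR (- x * t) * (cos (y * t) * complex.Im (e t) - sin (y * t) * complex.Re (e t)).

Let dg1 (t : R) : 0 < t -> is_derive t 1 g1 0.
Proof.
move=> t0; have h1 := dRe t0; have h2 := dIm t0.
apply: is_derive_eq; rewrite /= !ReM !ImM /GRing.scale /= -/x -/y.
ring.
Qed.

Let dg2 (t : R) : 0 < t -> is_derive t 1 g2 0.
Proof.
move=> t0; have h1 := dRe t0; have h2 := dIm t0.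
apply: is_derive_eq; rewrite /= !ReM !ImM /GRing.scale /= -/x -/y.
ring.
Qed.

Lemma cexpD (u v : R[i]) : cexp (u + v) = cexp u * cexp v.
Proof.
apply: complexP; rewrite ?ReM ?ImM /= ReD ImD expRD ?cosD ?sinD; ring.
Qed.

Lemma cexp_neq0 (u : R[i]) : cexp u != 0.
Proof.
have : cexp u * cexp (- u) = 1.
  rewrite -cexpD subrr; apply: complexP => /=; first by rewrite expR0 cos0 mul1r.
  by rewrite sin0 mulr0.
by apply: contra_eq_neq => ->; rewrite mul0r eq_sym oner_neq0.
Qed.

Let e_cexp : exists c : R[i], forall t : R, 0 < t -> e t = c * cexp (z * t%:C%C).
Proof.
exists (Complex (g1 1) (g2 1)) => t t0.
rewrite -(deriv0_const dg1 t0 ltr01) -(deriv0_const dg2 t0 ltr01) /g1 /g2.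
have E : expR (- x * t) * expR (x * t) = 1 by rewrite -expRD mulNr addNr expR0.
have CS := cos2Dsin2 (y * t).
have -> : z * t%:C%C = Complex (x * t) (y * t).
  by apply: complexP; rewrite ?ReM ?ImM /= mulr0 ?subr0 ?add0r.
apply: complexP; rewrite ?ReM ?ImM /=.
- rewrite -[LHS]mul1r -E -[LHS]mul1r -CS; ring.
- rewrite -[LHS]mul1r -E -[LHS]mul1r -CS; ring.
Qed.

(** The differential equation gives e(t) = c exp(z t), and e(2r) = e(r)^2 with e(r) nonzero forces c
    = 1. *)
Lemma multiplicative_exp : (exists2 t : R, 0 < t & e t != 0) ->
  forall t : R, 0 < t -> e t = cexp (z * t%:C%C).
Proof.
move=> [r r0 er]; have [c hc] := e_cexp.
have c0 : c != 0 by apply: contraNneq er => c0; rewrite hc// c0 mul0r.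
have := eM r0 r0; rewrite !hc ?addr_gt0// rmorphD /= mulrDr cexpD.
have n0 := cexp_neq0 (z * r%:C%C).
move=> /(congr1 (fun u => u / (c * cexp (z * r%:C%C) * cexp (z * r%:C%C)))).
rewrite !mulrA mulfV; last by rewrite !mulf_neq0.
have -> : c * cexp (z * r%:C%C) * c * cexp (z * r%:C%C) /
   (c * cexp (z * r%:C%C) * cexp (z * r%:C%C)) = c.
  by field; rewrite n0 c0.
by move=> c1 t t0; rewrite hc// -c1 mul1r.
Qed.

End Derivative.

(** With k = e, multiplicativity pulls e(a), e(b) and e(s) out of the integrals in
    [generator_shift]: (e(a) - e(b)) F = F' times the integral of e over ]a, b]. Dividing by F gives
    the integral equation with z = - F'/F. *)
Lemma eigen_exp (f f' : R -> R[i]^o) : C1_with_deriv f f' -> f 0 = 0 ->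
  acar (L1 w) f -> acar (L1 w) f' ->
  cInt leb (Rpos R : set MT) (fun t => e t * (f t : R[i])) != 0 ->
  forall t : R, 0 < t -> e t =
   cexp (- (cInt leb (Rpos R : set MT) (fun t => e t * (f' t : R[i])) /
            cInt leb (Rpos R : set MT) (fun t => e t * (f t : R[i]))) * t%:C%C).
Proof.
move=> C1 f00 Lf Lf'; set F := cInt _ _ _ => F0; set F' := cInt _ _ _.
have Ic (g : R -> R[i]^o) : acar (L1 w) g -> cint leb (Rpos R : set MT) (fun t => e t * (g t : R[i])).
  by move=> [mg Ig]; exact: (weight_cint ww mg Ig me eC).
apply: multiplicative_exp => [a b a0 ab|]; last first.
  apply: contrapT => h; move/eqP: F0; apply; rewrite /F -[RHS](cInt0 leb (Rpos R : set MT)).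
  apply: eq_cInt => t /[!inE] /RposE t0; have [->|et] := eqVneq (e t) 0; first by rewrite mul0r.
  by case: h; exists t.
have := generator_shift ww C1 f00 a0 ab Lf Lf' me eC.
have E (g : R -> R[i]^o) c : 0 < c -> acar (L1 w) g ->
    cInt leb (Rpos R : set MT) (fun t => e (c + t) * (g t : R[i])) =
    e c * cInt leb (Rpos R : set MT) (fun t => e t * (g t : R[i])).
  move=> c0 Lg; rewrite -cIntZ//; last exact: Ic.
  by apply: eq_cInt => t /[!inE] /RposE t0; rewrite eM// mulrA.
rewrite !E//; last exact: lt_trans ab.
rewrite [X in _ = X -> _](_ : _ = cInt leb (Rpos R : set MT)
    (fun t => F' * (e t * (ind a b t : R[i])))); last first.
  apply: eq_cInt.
  by move=> t /[!inE] /RposE t0; rewrite E// -/F'; ring.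
rewrite cIntZ//; last by apply: Ic; exact: ind_L1.
rewrite -/F -mulrBl => h; apply: (mulIf F0).
set J := cInt _ _ _ in h *.
have -> : (- (F' / F) * J) * F = - (F' * J) by field.
by rewrite -h; ring.
Qed.

End Exponential.

(** * Characters of the Arveson ideal *)

Section CharacterArveson.
Context {R : realType} {X : completeNormedModType R[i]}.
Local Notation MT := (measurableTypeR R).
Local Notation leb := (@lebesgue_measure R).
Variables (Xs : set (X -> R[i]^o)) (T : R -> X -> X).
Hypothesis pairing : dual_pairing Xs.
Hypothesis sgT : semigroup Xs T.
Hypothesis wcT : weakly_continuous Xs T.
Local Notation nX := (@nrm R X).
Local Notation L := (L1 (omegaT T)).
Local Notation I := (arveson Xs T).
Local Notation ph := (phiL1 Xs T).
Let mR : measurable (Rpos R : set MT) := @Rpos_measurable R.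
Let wT : weight (omegaT T) := omegaT_weight pairing wcT sgT.
Let BI : balg I := I_balg pairing sgT wcT.
Let HX1 := X1_nspace sgT.
Variables (f0 f0' : R -> R[i]^o).
Hypothesis gf : gen_function (omegaT T) f0 f0'.

Definition actT (t : R) (u : X -> X) : X -> X := T t \o u.

Lemma I_action : action I (omegaT T) actT.
Proof.
split.
- exact: wT.
- by move=> t t0; exact: T_mlike.
- move=> t a u v t0 _ _; apply/funext => x; have [_ lT _] := T_oper sgT t0.
  by rewrite /actT /= lT.
- by move=> s t u s0 t0 _; apply/funext => x; rewrite /actT /= (T_add sgT).
- by move=> t u t0 /arveson_sub Bu; exact: (T_BX pairing sgT wcT t0 Bu).2.
- by move=> u Iu; exact: (T_strong pairing sgT wcT gf Iu).
Qed.

Definition I_norming : set ((X -> X) -> R[i]) := [set th | exists l x,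
  [/\ Xs l, dnorm l <= 1, X1 T x, nX x <= 1 & th = (fun u => l (u x))]].

Lemma I_bfun l x : Xs l -> X1 T x -> bfun I (fun u => l (u x)).
Proof.
move=> Xl Xx; split=> [a u v _ _|]; first by rewrite !fctE (Xs_linear pairing).
exists (dnorm l * nX x) => u /arveson_sub Bu.
rewrite (le_trans (Xs_le pairing _ Xl))// -mulrA ler_wpM2l ?(dnorm_ge0 pairing)// mulrC.
exact: (BX_le sgT Bu Xx).
Qed.

Lemma I_normingP : norming I I_norming.
Proof.
split=> [_ [l [x [Xl l1 Xx x1 ->]]]|u c Iu c0 h].
  split=> [a u v Iu Iv|u /arveson_sub Bu]; first by have [h _] := I_bfun Xl Xx; exact: h.
  rewrite (le_trans (Xs_le1 pairing _ Xl l1))// (le_trans (BX_le sgT Bu Xx))//.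
  by rewrite ler_piMr// (nsN_ge0 (BX_nspace sgT)).
apply: (oper_norm_sup HX1) => x Xx x1; apply: (Xs_norming pairing) => l Xl l1.
by apply: (h (fun u => l (u x))); exists l, x.
Qed.

(** The bridge from the weak integral to the Bochner integral: both sides have the same image under
    every functional u |-> l(u x). *)
Lemma phi1_actI (nu : {measure set MT -> \bar R}) (h : R -> R[i]) u :
  (forall a b : R, 0 < a -> (nu `[a, b]%classic < +oo)%E) ->
  cmeasurable (Rpos R) h ->
  (\int[nu]_(t in Rpos R) (nrm (h t) * omegaT T t)%:E < +oo)%E ->
  acar I u -> phi1 Xs T nu h \o u = actI (A := I) actT nu h u.
Proof.
move=> fnu mh Ih Iu; have Bu := arveson_sub Iu.
have Ia := actI_car BI I_action I_normingP fnu mh Ih Iu; have Ba := arveson_sub Ia.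
have [Bp _] := phi1_BX pairing sgT wcT fnu mh Ih.
apply: (BX_eq (BX_mul sgT Bp Bu).1 Ba) => x Xx.
apply: (Xs_eq pairing) => l Xl.
have [_ ->] := actI_fun BI I_action I_normingP fnu mh Ih (I_bfun Xl Xx) Iu.
rewrite [_ x]/= phi1E; last exact: BX_car Bu Xx.
by rewrite (phiE pairing sgT wcT fnu mh Ih).
Qed.

Variable chi : (X -> X) -> R[i].
Hypothesis hchi : character I chi.
Let u0 := ph f0.
Let hu0 : Omega I u0 := gen_Omega pairing sgT wcT gf.
Let chi0 : chi u0 != 0 := char_Omega BI hchi hu0.

Definition eigT : R -> R[i] := eigen actT chi u0.

Lemma eigTP t u : 0 < t -> acar I u -> chi (T t \o u) = eigT t * chi u.
Proof. by move=> t0 Iu; exact: (eigenP BI I_action hchi hu0). Qed.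

(** chi of phi(f) u_0 is computed as a Bochner integral, and chi(u_0), which is nonzero, is divided
    out. *)
Lemma chi_ph f : acar L f ->
  chi (ph f) = cInt leb (Rpos R : set MT) (fun t => eigT t * (f t : R[i])).
Proof.
move=> Lf; have [mf If] := Lf; have [Iu0 _] := hu0; have [_ hM _] := hchi.
apply: (mulIf chi0); rewrite -(hM _ _ (ph_I pairing sgT wcT Lf) Iu0).
rewrite -(actI_char BI I_action I_normingP leb_finite mf If hchi eigTP Iu0).
by rewrite -(phi1_actI leb_finite mf If Iu0).
Qed.

Lemma chi_AI : chi_ext I chi (qmult I (- ph f0') u0) =
  - (cInt leb (Rpos R : set MT) (fun t => eigT t * (f0' t : R[i])) /
     cInt leb (Rpos R : set MT) (fun t => eigT t * (f0 t : R[i]))).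
Proof.
have [Lf Lf'] := gen_L1 gf.
have If' := ph_I pairing sgT wcT Lf'.
rewrite (chi_ext_qmult BI hchi _ hu0); last exact: (nsN (ba_ns BI)).
by rewrite (charN BI hchi)// !chi_ph// mulNr.
Qed.

Lemma eigT_exp t : 0 < t ->
  eigT t = cexp (chi_ext I chi (qmult I (- ph f0') u0) * t%:C%C).
Proof.
move=> t0; rewrite chi_AI; have [Lf Lf'] := gen_L1 gf; have [C1 _ z0 _] := gf.
have [C hC] := eigen_le BI I_action hchi hu0.
apply: (eigen_exp wT _ _ hC) => //.
- exact: (eigen_cmeas BI I_action hchi hu0).
- by move=> s d; exact: (eigen_cont BI I_action hchi hu0).
- by move=> s r; exact: (eigenM BI I_action hchi hu0).
- by rewrite -chi_ph.
Qed.

Lemma chi_T t : 0 < t -> chi_ext I chi (mult_graph I (amul I (restr (X1 T) (T t)))) = eigT t.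
Proof.
move=> t0; have [Iu0 _] := hu0.
rewrite (@eq_mult_graph _ _ _ _ (actT t)); last first.
  move=> u /arveson_sub Bu; apply/funext => x; rewrite /actT /=.
  have [Xx|nx] := pselect (X1 T x); first by rewrite restrE mem_set//; exact: BX_car Bu Xx.
  have [_ u00] := Bu; rewrite u00// restrE.
  by case: (_ \in _) => //; rewrite (bounded_oper0 (nrm_nspace X) (T_oper sgT t0)).
rewrite (mult_graph_qmult BI (T_mlike pairing sgT wcT t0) hu0).
by rewrite (chi_ext_qmult BI hchi _ hu0)//; exact: (T_I pairing sgT wcT).
Qed.

Lemma chi_phi1 (nu : {measure set MT -> \bar R}) (h : R -> R[i]) :
  (forall a b : R, 0 < a -> (nu `[a, b]%classic < +oo)%E) ->
  cmeasurable (Rpos R) h ->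
  (\int[nu]_(t in Rpos R) (nrm (h t) * omegaT T t)%:E < +oo)%E ->
  chi_ext I chi (mult_graph I (amul I (phi1 Xs T nu h))) =
  cInt nu (Rpos R : set MT) (fun t => eigT t * h t).
Proof.
move=> fnu mh Ih.
apply: (chi_ext_actI BI I_action I_normingP fnu mh Ih hchi hu0 eigTP) => u Iu.
exact: phi1_actI.
Qed.

End CharacterArveson.

Lemma cmeasure_weight (R : realType) (w : R -> R) (mu : cmeasure R) : weight w ->
  in_weighted w mu -> cmeasurable (Rpos R) (cm_phase mu) /\
  (\int[cm_abs mu]_(t in Rpos R) (nrm (cm_phase mu t) * w t)%:E < +oo)%E.
Proof.
move=> ww Imu; split.
  by apply: cmeasS (cm_phase_measurable mu).
by under eq_integral do rewrite cm_phase_norm mul1r.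
Qed.

Lemma laplace_exp (R : realType) (mu : cmeasure R) (e : R -> R[i]) (z : R[i]) :
  (forall t : R, 0 < t -> e t = cexp (z * t%:C%C)) ->
  laplace mu (- z) = cInt (cm_abs mu) (Rpos R : set (measurableTypeR R))
    (fun t => e t * cm_phase mu t).
Proof.
move=> he; rewrite /laplace; apply: eq_cInt => t /[!inE] /RposE t0.
by rewrite he// mulNr opprK.
Qed.

(** * Growth of the semigroup *)

Section SpectralRadius.
Context {R : realType}.

Section Submultiplicative.
Variable w : R -> R.
Hypothesis ww : weight w.

Lemma weight_iter (N s : R) (k : nat) : 0 < N -> 0 < s -> w (k%:R * N + s) <= w N ^+ k * w s.
Proof.
move=> N0 s0; elim: k => [|k IH]; first by rewrite mul0r add0r expr0 mul1r.
have -> : k.+1%:R * N + s = N + (k%:R * N + s).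
  by rewrite -natr1 mulrDl mul1r [X in X + s]addrC -addrA.
have p0 : 0 < k%:R * N + s by rewrite ltr_wpDl// mulr_ge0// ltW.
rewrite (le_trans (w_sub ww N0 p0))// exprS -mulrA ler_wpM2l//.
exact: (w_ge0 ww).
Qed.

Let u (t : R) : R := w t `^ t^-1.

(** Write t = k N + s with N <= s <= 2N. The remainder is kept above N because the weight is not
    bounded near 0. *)
Lemma weight_growth (N c : R) : 0 < N -> w N <= expR (c * N) ->
  exists L, 0 <= L /\ forall t, 2 * N <= t -> w t <= expR (c * t + L).
Proof.
move=> N0 wN; have [M hM] := w_loc ww (2 * N) N0.
have M1 : 0 < Num.max M 1 by rewrite lt_max ltr01 orbT.
(* The first term absorbs - c s for s <= 2N, the second the bound of the weight on [N, 2N]; the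
   maximum with 1 makes the logarithm nonnegative. *)
exists (2 * N * `|c| + ln (Num.max M 1)); split.
  by rewrite addr_ge0 ?mulr_ge0 ?(ltW N0)// ln_ge0// le_max lexx orbT.
move=> t t2; pose k := Num.truncn ((t - N) / N).
have tN : 0 <= (t - N) / N.
  by rewrite divr_ge0 ?(ltW N0)// subr_ge0 (le_trans _ t2)// mulr_natl mulr2n lerDl ltW.
have /andP[k1 k2] := truncn_itv tN.
pose s := t - k%:R * N.
have sN : N <= s.
  by rewrite /s lerBrDl -lerBrDr; move: k1; rewrite ler_pdivlMr.
have s2 : s <= 2 * N.
  move: k2; rewrite ltr_pdivrMr// -natr1 -/k /s => k2; rewrite lerBlDr.
  by move: k2; set x := k%:R * N; rewrite mulrDl mul1r -/x => k2; lra.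
have s0 := lt_le_trans N0 sN.
have -> : t = k%:R * N + s by rewrite /s addrC subrK.
rewrite (le_trans (weight_iter k N0 s0))//.
set M' := Num.max M 1 in M1 *.
have -> : expR (c * (k%:R * N + s) + (2 * N * `|c| + ln M')) =
    expR (c * N) ^+ k * (expR (c * s + 2 * N * `|c|) * M').
  rewrite -expRM_natl -[in RHS](lnK M1) -!expRD; congr expR; ring.
apply: ler_pM; rewrite ?exprn_ge0 ?(w_ge0 ww)//.
  by rewrite lerXn2r// nnegrE ?expR_ge0// (w_ge0 ww).
rewrite (le_trans (hM s _)) ?sN//.
rewrite (@le_trans _ _ M')//; first by rewrite /M' le_max lexx.
rewrite ler_peMl ?(ltW M1)// -[X in X <= _]expR0 ler_expR.
have h1 : - (`|c| * s) <= c * s.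
  by rewrite -mulNr ler_wpM2r ?(ltW s0)// lerNl ler_normr lexx orbT.
have h2 : `|c| * s <= `|c| * (2 * N) by rewrite ler_wpM2l.
by rewrite -lerBlDr sub0r mulrC; apply: le_trans h1; rewrite lerN2.
Qed.

(** Fekete's argument: an N that nearly attains the infimum bounds w(t)^(1/t) by q exp(L/t), and
    exp(L/t) tends to 1. The [lim] in [rhoT] is thereby a genuine limit. *)
Lemma weight_root_cvg : u t @[t --> +oo] --> inf (u @` Rpos R).
Proof.
set r := inf _.
have lb : has_lbound (u @` Rpos R) by exists 0 => _ [t _ <-]; exact: powR_ge0.
have ur t : 0 < t -> r <= u t.
  by move=> t0; apply: ge_inf => //; exists t => //; exact/RposE.
have hi : has_inf (u @` Rpos R).
  by split => //; exists (u 1); exists 1 => //; apply/RposE; exact: ltr01.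
have r0 : 0 <= r.
  apply: lb_le_inf; last by move=> _ [t _ <-]; exact: powR_ge0.
  by case: hi.
apply/cvgrPdist_lt => e e0.
have [_ [N /RposE N0 <-] uN] := inf_adherent (half_gt0 e0) hi.
(* The infimum r may be 0; q is positive and has a logarithm. *)
pose q := r + e / 2; have q0 : 0 < q by rewrite /q ltr_wpDl// half_gt0.
have [] := @weight_growth N (ln q) N0.
  rewrite expRM lnK ?posrE//.
  have -> : w N = u N `^ N.
    by rewrite /u -powRrM mulVf ?gt_eqF// powRr1// (w_ge0 ww).
  by apply: ge0_ler_powR; rewrite ?nnegrE ?powR_ge0 ?(ltW N0) ?(ltW q0)// ltW.
move=> L [L0 hL].
have /cvgrPdist_lt/(_ (e / 2 / q)) := @continuous_expR R 0.
move=> /(_ _)/nbhs_ballP[|d d0 hd]; first by rewrite !divr_gt0.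
near=> t; have t2 : 2 * N <= t by near: t; apply: nbhs_pinfty_ge; exact: num_real.
have t0 : 0 < t by rewrite (lt_le_trans _ t2)// mulr_gt0.
have Lt : L / t < d.
  by rewrite ltr_pdivrMr// mulrC -ltr_pdivrMr//; near: t; apply: nbhs_pinfty_gt; exact: num_real.
have u1 : u t <= q * expR (L / t).
  have -> : q * expR (L / t) = expR (ln q * t + L) `^ t^-1.
    by rewrite -expRM -{1}[q]lnK// -expRD [X in _ = expR X]mulrDl mulfK ?gt_eqF.
  by apply: ge0_ler_powR; rewrite ?invr_ge0 ?nnegrE ?expR_ge0 ?(ltW t0) ?(w_ge0 ww) ?hL.
have u2 : expR (L / t) < 1 + e / 2 / q.
  have := hd (L / t); rewrite /ball /= sub0r normrN ger0_norm ?divr_ge0 ?(ltW t0)//.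
  move=> /(_ Lt); rewrite expR0 distrC => /(le_lt_trans (ler_norm _)).
  by rewrite ltrBlDl.
rewrite distrC ger0_norm ?subr_ge0 ?ur// ltrBlDl (le_lt_trans u1)//.
move: u2; rewrite -(ltr_pM2l q0) mulrDr mulr1 [q * (_ / _)]mulrC divfK ?gt_eqF//.
by rewrite {2}/q -addrA -splitr.
Unshelve. all: by end_near. Qed.

(** This is how the choice of lambda above the logarithm of the spectral radius is used: exp(-
    lambda t) omega_T(t) stays bounded at infinity. *)
Lemma weight_exp (l : R) : (lne (lim (w t `^ t^-1 @[t --> +oo]))%:E < l%:E)%E ->
  exists2 N : R, 0 < N & forall t, N <= t -> w t <= expR (l * t).
Proof.
have -> : lim (w t `^ t^-1 @[t --> +oo]) = inf (u @` Rpos R).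
  by apply: cvg_lim => //; exact: weight_root_cvg.
set r := inf _ => rl.
have {}rl : r < expR l.
  have [r0|r0] := leP r 0; first exact: le_lt_trans r0 (expR_gt0 _).
  by move: rl; rewrite lne_EFin// lte_fin -ltr_expR lnK.
have := weight_root_cvg; rewrite -/r => /cvgrPdist_lt/(_ (expR l - r)).
rewrite subr_gt0 => /(_ rl)[N [Nr hN]].
exists (Num.max N 0 + 1); first by rewrite ltr_wpDl// le_max lexx orbT.
move=> t tN; have t0 : 0 < t.
  by rewrite (lt_le_trans _ tN)// ltr_wpDl// le_max lexx orbT.
have Nt : N < t.
  by rewrite (lt_le_trans _ tN)// (@le_lt_trans _ _ (Num.max N 0)) ?ltrDl// le_max lexx.
have := hN t Nt; rewrite distrC => /(le_lt_trans (ler_norm _)).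
rewrite ltrD2r => /ltW ul.
have -> : w t = u t `^ t.
  by rewrite /u -powRrM mulVf ?gt_eqF// powRr1// (w_ge0 ww).
by rewrite expRM ge0_ler_powR// ?nnegrE ?powR_ge0 ?expR_ge0// ltW.
Qed.

End Submultiplicative.
End SpectralRadius.

(** * The normalized Arveson ideal *)

Section Normalized.
Context {R : realType} {X : completeNormedModType R[i]}.
Local Notation MT := (measurableTypeR R).
Variables (Xs : set (X -> R[i]^o)) (T : R -> X -> X).
Hypothesis pairing : dual_pairing Xs.
Hypothesis sgT : semigroup Xs T.
Hypothesis wcT : weakly_continuous Xs T.
Local Notation nX := (@nrm R X).
Local Notation I := (arveson Xs T).
Local Notation nI := (anorm I).
Let wT : weight (omegaT T) := omegaT_weight pairing wcT sgT.
Let BI : balg I := I_balg pairing sgT wcT.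
Let HI := ba_ns BI.
Variable la : R.
Hypothesis hla : (lne (rhoT T)%:E < la%:E)%E.
Local Notation LT := (algL Xs T la).
Local Notation UT := (algU Xs T la).

(** The shift by t keeps the argument away from 0, and lambda takes care of infinity. Hence T(t)
    maps I_T boundedly into L_T. *)
Lemma omega_shift t : 0 < t -> exists2 C : R, 0 <= C & forall s, 0 <= s ->
  expR (- la * s) * omegaT T (s + t) <= C.
Proof.
move=> t0; have [N N0 hN] := weight_exp wT hla.
have [M hM] := w_loc wT N t0.
exists (expR (la * t) + expR (`|la| * N) * `|M|).
  by rewrite addr_ge0 ?mulr_ge0 ?expR_ge0.
move=> s s0; have st : 0 < s + t by rewrite ltr_wpDl.
have [Ns|sN] := leP N (s + t).
  apply: (@le_trans _ _ (expR (la * t))); last by rewrite lerDl mulr_ge0 ?expR_ge0.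
  apply: le_trans (ler_wpM2l (expR_ge0 _) (hN _ Ns)) _.
  by rewrite -expRD mulrDr mulNr addKr.
apply: (@le_trans _ _ (expR (`|la| * N) * `|M|)); last by rewrite lerDr expR_ge0.
apply: ler_pM; rewrite ?expR_ge0 ?(w_ge0 wT)//.
  have sN' : s <= N by rewrite (le_trans _ (ltW sN))// lerDl ltW.
  rewrite ler_expR; apply: (@le_trans _ _ (`|la| * s)); last by rewrite ler_wpM2l.
  by rewrite ler_wpM2r// -normrN ler_norm.
by rewrite (le_trans (hM _ _)) ?ler_norm// lerDr s0 ltW.
Qed.

Lemma Tact_pos t u : 0 < t -> Tact T t u = T t \o u.
Proof. by move=> t0; rewrite /Tact gt_eqF. Qed.

Lemma Tact0 (u : X -> X) : Tact T 0 u = u.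
Proof. by rewrite /Tact eqxx. Qed.

Lemma Tact_comp s (u v : X -> X) : Tact T s (u \o v) = Tact T s u \o v.
Proof. by rewrite /Tact; case: ifP. Qed.

Lemma Tact_lin s (a : R[i]) (u v : X -> X) : 0 <= s ->
  Tact T s (a *: u + v) = a *: Tact T s u + Tact T s v.
Proof.
rewrite le_eqVlt => /orP[/eqP <-|s0]; first by rewrite !Tact0.
rewrite !Tact_pos//; apply/funext => x; have [_ lT _] := T_oper sgT s0.
by rewrite /= lT.
Qed.

Lemma Tact_Z s (a : R[i]) (u : X -> X) : 0 <= s -> Tact T s (a *: u) = a *: Tact T s u.
Proof.
rewrite le_eqVlt => /orP[/eqP <-|s0]; first by rewrite !Tact0.
rewrite !Tact_pos//; apply/funext => x.
by rewrite /= (bounded_operZ (nrm_nspace X) (T_oper sgT s0)).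
Qed.

Lemma Tact_D s (u v : X -> X) : 0 <= s -> Tact T s (u + v) = Tact T s u + Tact T s v.
Proof. by move=> s0; rewrite -[u]scale1r Tact_lin// !scale1r. Qed.

Lemma Tact_T s t u : 0 <= s -> 0 < t -> Tact T s (T t \o u) = T (s + t) \o u.
Proof.
rewrite le_eqVlt => /orP[/eqP <-|s0] t0; first by rewrite Tact0 add0r.
by rewrite Tact_pos//; apply/funext => x; rewrite /= (T_add sgT).
Qed.

Lemma T_Tact s t u : 0 <= s -> 0 < t -> T t \o Tact T s u = T (s + t) \o u.
Proof.
rewrite le_eqVlt => /orP[/eqP <-|s0] t0; first by rewrite Tact0 add0r.
by rewrite Tact_pos//; apply/funext => x; rewrite /= addrC (T_add sgT).
Qed.

Lemma Tact_I s u : 0 <= s -> acar I u -> acar I (Tact T s u).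
Proof.
rewrite le_eqVlt => /orP[/eqP <-|s0] Iu; first by rewrite Tact0.
by rewrite Tact_pos//; exact: (T_I pairing sgT wcT).
Qed.

Lemma T_Ile t u : 0 < t -> acar I u -> nI (T t \o u) <= omegaT T t * nI u.
Proof. by move=> t0 /arveson_sub Bu; exact: (T_BX pairing sgT wcT t0 Bu).2. Qed.

Lemma Tact_le s : 0 <= s -> exists2 c : R, 0 <= c & forall u, acar I u ->
  nI (Tact T s u) <= c * nI u.
Proof.
rewrite le_eqVlt => /orP[/eqP <-|s0].
  by exists 1 => // u _; rewrite Tact0 mul1r.
exists (omegaT T s) => [|u Iu]; first exact: (w_ge0 wT).
by rewrite Tact_pos//; exact: T_Ile.
Qed.

Definition eN (s : R) (u : X -> X) : R := expR (- la * s) * nI (Tact T s u).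

(** The limit superior at 0+ bounds T(s) u for small s, local boundedness of omega_T for
    intermediate s and the choice of lambda for large s, so it is equivalent to finiteness of the
    norm of L_T. *)
Lemma algLP u : acar LT u <-> acar I u /\ exists C, forall s, 0 <= s -> eN s u <= C.
Proof.
split=> [[Iu]|[Iu [C hC]]].
  move=> /ereal_inf_lt[y [W W0 <-]] yoo; split=> //.
  have /nbhs_ballP[d d0 hd] : nbhs (0 : R) [set t | 0 < t -> W t] by exact: W0.
  have [M hM] : exists M : R, forall t, 0 < t -> t < d -> nI (T t \o u) <= M.
    move: yoo; set z := ereal_sup _ => zoo.
    have hz t : 0 < t -> t < d -> ((nI (T t \o u))%:E <= z)%E.
      move=> t0 td; apply: ereal_sup_ubound; exists t => //.
      by apply: hd => //; rewrite /ball /= sub0r normrN gtr0_norm.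
    move: zoo hz; case: z => [r _ hz|//|_ hz].
      by exists r => t t0 td; rewrite -lee_fin; exact: hz.
    by exists 0 => t t0 td; have := hz t t0 td; rewrite leeNy_eq.
  have [N N0 hN] := weight_exp wT hla; have [M2 hM2] := w_loc wT N d0.
  have n0 := nsN_ge0 HI Iu.
  have el s r : 0 <= s -> s <= r -> expR (- la * s) <= expR (`|la| * r).
    move=> s0 sr; rewrite ler_expR; apply: (@le_trans _ _ (`|la| * s)); last by rewrite ler_wpM2l.
    by rewrite ler_wpM2r// -normrN ler_norm.
  (* [C1] serves for s below d, [C2] for s between d and N, and [nI u] for s = 0 and for s beyond
     N. *)
  pose C1 := expR (`|la| * d) * `|M|; pose C2 := expR (`|la| * N) * (`|M2| * nI u).
  have C10 : 0 <= C1 by rewrite mulr_ge0 ?expR_ge0.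
  have C20 : 0 <= C2 by rewrite !mulr_ge0 ?expR_ge0.
  exists (nI u + C1 + C2) => s; rewrite le_eqVlt => /orP[/eqP <-|s0].
    by rewrite /eN mulr0 expR0 mul1r Tact0 -addrA lerDl addr_ge0.
  rewrite /eN Tact_pos//.
  have nT : 0 <= nI (T s \o u) by apply: (nsN_ge0 HI); exact: (T_I pairing sgT wcT).
  have [ds|sd] := leP d s; last first.
    apply: (@le_trans _ _ C1).
      apply: ler_pM; rewrite ?expR_ge0//; first by rewrite el ?(ltW sd)// ltW.
      by rewrite (le_trans (hM _ _ _))// ler_norm.
    by rewrite [nI u + _]addrC -addrA lerDl addr_ge0.
  have [Ns|sN] := leP N s.
    apply: (@le_trans _ _ (nI u)); last by rewrite -addrA lerDl addr_ge0.
    have e0 := expR_ge0 (- la * s).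
    apply: le_trans (ler_wpM2l e0 (T_Ile s0 Iu)) _.
    apply: le_trans (ler_wpM2l e0 (ler_wpM2r n0 (hN _ Ns))) _.
    by rewrite mulrA -expRD mulNr addNr expR0 mul1r.
  apply: (@le_trans _ _ C2); last by rewrite lerDr addr_ge0.
  apply: ler_pM; rewrite ?expR_ge0//; first by rewrite el ?(ltW sN)// ltW.
  rewrite (le_trans (T_Ile s0 Iu))// ler_wpM2r// (le_trans (hM2 _ _)) ?ler_norm//.
  by rewrite ds ltW.
split=> //; pose W := [set t : R | 0 < t < 1].
have W0 : ((0 : R)^'+) W.
  have /nbhs_ballP : exists2 d : R, 0 < d & ball (0 : R) d `<=` [set t | 0 < t -> W t].
    exists 1 => // t; rewrite /ball /= sub0r normrN => t1 t0.
    by rewrite /W /= t0 -(gtr0_norm t0).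
  exact.
apply: (@le_lt_trans _ _ (expR `|la| * `|C|)%:E); last by rewrite ltry.
rewrite /limf_esup; apply: (@le_trans _ _ (ereal_sup ((fun t => (nI (T t \o u))%:E) @` W))).
  by apply: ereal_inf_lbound; exists W.
apply: ge_ereal_sup => _ [t /andP[t0 t1] <-]; rewrite lee_fin.
have := hC t (ltW t0); rewrite /eN Tact_pos// => h.
rewrite -[nI _]mul1r -[X in X * _]expR0 -(subrr (la * t)) expRD -mulrA.
rewrite -mulNr; apply: ler_pM; first exact: expR_ge0.
- by rewrite mulr_ge0 ?expR_ge0// (nsN_ge0 HI)//; exact: (T_I pairing sgT wcT).
- by rewrite ler_expR (le_trans (ler_norm _))// normrM (gtr0_norm t0) ler_piMr// ltW.
- by rewrite (le_trans h)// ler_norm.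
Qed.

Lemma L_I u : acar LT u -> acar I u. Proof. by move=> /algLP[]. Qed.

Lemma Nl_ub s u : 0 <= s -> acar LT u -> eN s u <= anorm LT u.
Proof.
move=> s0 /algLP[Iu [C hC]]; apply: ub_le_sup; last by exists s => //=; rewrite in_itv /= s0.
by exists C => _ [r /= + <-]; rewrite in_itv /= andbT => r0; exact: hC.
Qed.

Lemma Nl_lub u (c : R) : (forall s, 0 <= s -> eN s u <= c) -> anorm LT u <= c.
Proof.
move=> h; apply: ge_sup.
  by exists (eN 0 u); exists 0 => //=; rewrite in_itv /= lexx.
by move=> _ [s /= + <-]; rewrite in_itv /= andbT => s0; exact: h.
Qed.

Lemma nI_le u : acar LT u -> nI u <= anorm LT u.
Proof. by move=> Lu; have := Nl_ub (lexx 0) Lu; rewrite /eN mulr0 expR0 mul1r Tact0. Qed.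

Lemma Nl_ge0 u : acar LT u -> 0 <= anorm LT u.
Proof. by move=> Lu; rewrite (le_trans _ (nI_le Lu))// (nsN_ge0 HI)//; exact: L_I. Qed.

Lemma algL_bound u (c : R) : acar I u -> (forall s, 0 <= s -> eN s u <= c) ->
  acar LT u /\ anorm LT u <= c.
Proof. by move=> Iu h; split; [apply/algLP; split => //; exists c|exact: Nl_lub]. Qed.

Let eND s u v : 0 <= s -> acar I u -> acar I v -> eN s (u + v) <= eN s u + eN s v.
Proof.
move=> s0 Iu Iv; rewrite /eN Tact_D// -mulrDr ler_wpM2l ?expR_ge0//.
by apply: (nsND HI); exact: Tact_I.
Qed.

Let eNZ s (a : R[i]) u : 0 <= s -> acar I u -> eN s (a *: u) = nrm a * eN s u.
Proof.
move=> s0 Iu; rewrite /eN Tact_Z// (nsNZ HI) ?mulrA; last exact: Tact_I.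
by rewrite [_ * nrm a]mulrC.
Qed.

Lemma L_nspace : nspace (acar LT) (anorm LT).
Proof.
have L0 : acar LT 0.
  have I0 := ns0 HI; apply/algLP; split => //; exists 0 => s s0.
  by rewrite -(scale0r (0 : X -> X)) eNZ// nrm0 mul0r.
have LZ (a : R[i]) u : acar LT u -> acar LT (a *: u) /\ anorm LT (a *: u) <= nrm a * anorm LT u.
  move=> Lu; have Iu := L_I Lu; apply: algL_bound; first exact: (nsZ HI).
  by move=> s s0; rewrite eNZ// ler_wpM2l ?nrm_ge0//; exact: Nl_ub.
have LD u v : acar LT u -> acar LT v ->
    acar LT (u + v) /\ anorm LT (u + v) <= anorm LT u + anorm LT v.
  move=> Lu Lv; have [Iu Iv] := (L_I Lu, L_I Lv).
  apply: algL_bound; first exact: (nsD HI).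
  by move=> s s0; rewrite (le_trans (eND s0 Iu Iv))// lerD//; exact: Nl_ub.
split=> //.
- by move=> a u v Lu Lv; exact: (LD _ _ (LZ a u Lu).1 Lv).1.
- by move=> u; exact: Nl_ge0.
- move=> a u Lu; apply/eqP; rewrite eq_le (LZ a u Lu).2 /=.
  have [->|a0] := eqVneq a 0; first by rewrite nrm0 mul0r scale0r Nl_ge0.
  have na : 0 < nrm a.
    by rewrite lt_neqAle nrm_ge0 andbT eq_sym; apply: contra_neq a0; exact: nrm_eq0.
  rewrite -ler_pdivlMl//; have := (LZ a^-1 (a *: u) (LZ a u Lu).1).2.
  by rewrite scalerA mulVf// scale1r nrmV.
- by move=> u v Lu Lv; exact: (LD u v Lu Lv).2.
- move=> u Lu u0; apply: (nsN_eq0 HI (L_I Lu)); apply/eqP.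
  by rewrite eq_le (nsN_ge0 HI (L_I Lu)) andbT -u0 nI_le.
Qed.

(** The norm of L_T dominates that of I_T, which provides the limit. For each s the map u |-> T(s) u
    is continuous on I_T, so the Cauchy bounds pass to the limit before the supremum over s is
    taken. *)
Lemma L_complete : ncomplete (acar LT) (anorm LT).
Proof.
move=> u Lu cu; have HL := L_nspace; have Iu n := L_I (Lu n).
have cI : ncauchy nI u.
  move=> e /cu[n0 hn]; exists n0 => m n mm nn; apply: le_lt_trans (hn m n mm nn).
  by apply: nI_le; exact: (nsB HL).
have [x Ix ux] := ba_complete BI Iu cI.
have key (e : R) n0 : 0 < e ->
    (forall m n, (n0 <= m)%N -> (n0 <= n)%N -> anorm LT (u m - u n) < e) ->
    forall n, (n0 <= n)%N -> forall s, 0 <= s -> eN s (u n - x) <= e.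
  move=> e0 hn n nn s s0; apply/ler_addgt0Pr => d d0.
  have [c c0 hc] := Tact_le s0.
  have k0 : 0 < expR (- la * s) * c + 1 by rewrite ltr_wpDl// mulr_ge0 ?expR_ge0.
  have [n1 hn1] := ux _ (divr_gt0 d0 k0).
  pose m := maxn n0 n1; have mm : (n0 <= m)%N := leq_maxl _ _.
  have -> : u n - x = (u n - u m) + (u m - x) by rewrite addrA subrK.
  have [I1 I2] := (nsB HI (Iu n) (Iu m), nsB HI (Iu m) Ix).
  rewrite (le_trans (eND s0 I1 I2))// lerD//.
    by rewrite (le_trans (Nl_ub s0 (nsB HL (Lu n) (Lu m))))// ltW// hn.
  have := hn1 m (leq_maxr _ _); rewrite ltr_pdivlMr// => /ltW; apply: le_trans.
  rewrite /eN mulrC; apply: (@le_trans _ _ (c * nI (u m - x) * expR (- la * s))).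
    by rewrite ler_wpM2r ?expR_ge0//; exact: hc.
  rewrite [leLHS](_ : _ = nI (u m - x) * (expR (- la * s) * c)); last by ring.
  by rewrite ler_wpM2l ?(nsN_ge0 HI)// lerDl.
have [n0 hn0] := cu 1 ltr01.
have Ld : acar LT (u n0 - x).
  by have [] := algL_bound (nsB HI (Iu n0) Ix) (key _ n0 ltr01 hn0 n0 (leqnn _)).
exists x.
  have : acar LT (u n0 - (u n0 - x)) by exact: (nsB HL).
  by rewrite opprB addrC subrK.
move=> e e0; have [n1 hn1] := cu _ (half_gt0 e0); exists n1 => n nn.
apply: le_lt_trans (Nl_lub (key _ n1 (half_gt0 e0) hn1 n nn)) _.
by rewrite ltr_pdivrMr// ltr_pMr// ltr1n.
Qed.

Lemma L_comp u v : acar LT u -> acar I v ->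
  acar LT (u \o v) /\ anorm LT (u \o v) <= anorm LT u * nI v.
Proof.
move=> Lu Iv; have Iu := L_I Lu; apply: algL_bound; first exact: (ba_mul BI).
move=> s s0; rewrite /eN Tact_comp; have Is := Tact_I s0 Iu.
apply: le_trans (ler_wpM2l (expR_ge0 _) (ba_normM BI Is Iv)) _.
by rewrite mulrA ler_wpM2r ?(nsN_ge0 HI)//; exact: Nl_ub.
Qed.

Lemma T_L t : 0 < t -> exists2 C : R, 0 <= C & forall u, acar I u ->
  acar LT (T t \o u) /\ anorm LT (T t \o u) <= C * nI u.
Proof.
move=> t0; have [C C0 hC] := omega_shift t0; exists C => // u Iu.
apply: algL_bound; first exact: (T_I pairing sgT wcT).
move=> s s0; have st : 0 < s + t by rewrite ltr_wpDl.
rewrite /eN Tact_T//.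
apply: le_trans (ler_wpM2l (expR_ge0 _) (T_Ile st Iu)) _.
by rewrite mulrA ler_wpM2r ?(nsN_ge0 HI)// hC.
Qed.

Lemma T_Lle t u : 0 < t -> acar LT u -> acar LT (T t \o u) /\
  anorm LT (T t \o u) <= omegaT T t * anorm LT u.
Proof.
move=> t0 Lu; have Iu := L_I Lu; apply: algL_bound; first exact: (T_I pairing sgT wcT).
move=> s s0; have Is := Tact_I s0 Iu.
rewrite /eN Tact_T// -(T_Tact u s0 t0).
apply: le_trans (ler_wpM2l (expR_ge0 _) (T_Ile t0 Is)) _.
by rewrite mulrCA ler_wpM2l ?(w_ge0 wT)//; exact: Nl_ub.
Qed.

Definition TI_set : set (X -> X) := \bigcup_(t in Rpos R) [set T t \o u | u in acar I].

Lemma TI_T t u : 0 < t -> acar I u -> TI_set (T t \o u).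
Proof. by move=> t0 Iu; exists t; [exact/RposE|exists u]. Qed.

Lemma TI_P u : TI_set u -> exists t v, [/\ 0 < t, acar I v & u = T t \o v].
Proof. by move=> [t /RposE t0 [v Iv <-]]; exists t, v. Qed.

Lemma TI_L : TI_set `<=` acar LT.
Proof. by move=> u /TI_P[t [v [t0 Iv ->]]]; have [C _ /(_ _ Iv)[]] := T_L t0. Qed.

(** As for X_1, both terms factor through T(s) with s half the smaller time. *)
Lemma TI_lin (a : R[i]) u v : TI_set u -> TI_set v -> TI_set (a *: u + v).
Proof.
move=> /TI_P[t [u' [t0 Iu ->]]] /TI_P[r [v' [r0 Iv ->]]].
pose s := Num.min t r / 2; have m0 : 0 < Num.min t r by rewrite lt_min t0.
have s0 : 0 < s by exact: half_gt0.
have sm : s < Num.min t r by rewrite /s ltr_pdivrMr// ltr_pMr// ltr1n.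
have st : 0 < t - s by rewrite subr_gt0 (lt_le_trans sm)// ge_min lexx.
have sr : 0 < r - s by rewrite subr_gt0 (lt_le_trans sm)// ge_min lexx orbT.
have -> : a *: (T t \o u') + (T r \o v') =
   T s \o (a *: (T (t - s) \o u') + (T (r - s) \o v')).
  apply/funext => x; have [_ lT _] := T_oper sgT s0.
  by rewrite /= lT// -!(T_add sgT)// ![s + _]addrC !subrK.
by apply: TI_T => //; apply: (nsL HI); exact: (T_I pairing sgT wcT).
Qed.

Lemma TI_0 : TI_set 0.
Proof.
have -> : 0 = T 1 \o (0 : X -> X).
  apply/funext => x /=; have [_ h _] := T_oper sgT ltr01.
  by rewrite (bounded_oper0 (nrm_nspace X) (T_oper sgT ltr01)).
by apply: TI_T => //; exact: (ns0 HI).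
Qed.

Let HL := L_nspace.

Lemma U_L : acar UT `<=` acar LT. Proof. exact: nclosure_car. Qed.
Lemma U_I : acar UT `<=` acar I. Proof. by move=> u /U_L /L_I. Qed.

Lemma U_T t u : 0 < t -> acar I u -> acar UT (T t \o u).
Proof. by move=> t0 Iu; apply: (nclosure_sub HL TI_L); exact: TI_T. Qed.

Lemma U_nspace : nspace (acar UT) (anorm UT).
Proof. exact: (nclosure_nspace HL TI_L TI_0 TI_lin). Qed.
Let HU := U_nspace.

Lemma U_complete : ncomplete (acar UT) (anorm UT).
Proof. exact: (nclosure_complete HL L_complete TI_L). Qed.

Lemma U_comp u v : acar UT u -> acar I v ->
  acar UT (u \o v) /\ anorm UT (u \o v) <= anorm UT u * nI v.
Proof.
move=> Uu Iv; split; last exact: (L_comp (U_L Uu) Iv).2.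
apply: (nclosure_map (A := LT) (B := LT) (f := fun u => u \o v) (C := nI v)
  HL HL _ _ TI_L TI_L _ Uu).
- by move=> x Lx; exact: (L_comp Lx Iv).1.
- by move=> x y Lx Ly; rewrite mulrC; exact: (L_comp (nsB HL Lx Ly) Iv).2.
move=> _ /TI_P[t [w [t0 Iw ->]]]; apply: (nclosure_sub HL TI_L).
by apply: (TI_T t0 (u := w \o v)); exact: (ba_mul BI).
Qed.

Lemma U_compl u v : acar I u -> acar UT v ->
  acar UT (u \o v) /\ anorm UT (u \o v) <= nI u * anorm UT v.
Proof.
move=> Iu Uv; have -> : u \o v = v \o u by apply: (ba_mulC BI) => //; exact: U_I.
by rewrite mulrC; exact: U_comp.
Qed.

Lemma T_U t u : 0 < t -> acar UT u -> acar UT (T t \o u) /\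
  anorm UT (T t \o u) <= omegaT T t * anorm UT u.
Proof.
move=> t0 Uu; split; last exact: (T_Lle t0 (U_L Uu)).2.
by apply: U_T => //; exact: U_I.
Qed.

Lemma U_mul u v : acar UT u -> acar UT v -> acar UT (amul UT u v).
Proof. by move=> Uu /U_I Iv; exact: (U_comp Uu Iv).1. Qed.

Local Notation MU := (mult_alg UT).

Lemma MU_opers : acar MU `<=` opers (acar UT) (anorm UT).
Proof. by move=> S []. Qed.

Lemma MU_nspace : nspace (acar MU) (anorm MU).
Proof.
have HO := opers_nspace HU.
apply: (nspaceS HO MU_opers).
  by have [b z] := ns0 HO; split => // u v _ _; apply/funext.
move=> a S1 S2 M1 M2.
have [b z] := nsL HO a (MU_opers M1) (MU_opers M2); split => // u v Uu Uv.
have [_ m1 _] := M1; have [_ m2 _] := M2.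
by rewrite !fctE m1// m2.
Qed.
Let HM := MU_nspace.

(** The operators converge because U_T is complete; the multiplier identity survives because right
    multiplication by [v] is bounded on U_T. *)
Lemma MU_complete : ncomplete (acar MU) (anorm MU).
Proof.
have HO := opers_nspace HU.
move=> S MS cS; have [Z OZ SZ] := opers_complete HU U_complete (fun n => MU_opers (MS n)) cS.
have [bZ zZ] := OZ; exists Z => //; split => // u v Uu Uv.
have Zc w : acar UT w -> acar UT (Z w) by case: bZ => h _ _; exact: h.
have Uuv := U_mul Uu Uv.
apply: (ns_eq HU (Zc _ Uuv) (U_mul (Zc _ Uu) Uv)) => e e0.
pose K := anorm UT (amul UT u v) + anorm UT u * nI v + 1.
have h1 := nsN_ge0 HU Uuv.
have h2 : 0 <= anorm UT u * nI v.
  by rewrite mulr_ge0 ?(nsN_ge0 HU)// (nsN_ge0 HI)//; exact: U_I.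
have K0 : 0 < K by rewrite ltr_wpDl// addr_ge0.
have [n0 /(_ _ (leqnn _)) hn] := SZ _ (divr_gt0 e0 K0).
have [[bS mS _] OS] := (MS n0, MU_opers (MS n0)).
have Sc w : acar UT w -> acar UT (S n0 w) by case: bS => h _ _; exact: h.
have dif w : acar UT w -> anorm UT (S n0 w - Z w) <= e / K * anorm UT w.
  move=> Uw; have [bd _] := nsB HO OS OZ.
  apply: le_trans (oper_normP HU HU bd Uw) _.
  by rewrite ler_wpM2r ?(nsN_ge0 HU)// ltW.
apply: le_trans (nsNBD HU (z := S n0 (amul UT u v)) (Zc _ Uuv) (U_mul (Zc _ Uu) Uv) (Sc _ Uuv)) _.
rewrite (nsNBC HU (Zc _ Uuv) (Sc _ Uuv)) [in X in _ + X](mS _ _ Uu Uv).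
have -> : amul UT (S n0 u) v - amul UT (Z u) v = (S n0 u - Z u) \o v by [].
have Ud := nsB HU (Sc _ Uu) (Zc _ Uu).
apply: le_trans (lerD (dif _ Uuv) (U_comp Ud (U_I Uv)).2) _.
apply: le_trans (lerD (lexx _) (ler_wpM2r _ (dif _ Uu))) _.
  by rewrite (nsN_ge0 HI)//; exact: U_I.
rewrite (_ : _ + _ = e * ((anorm UT (amul UT u v) + anorm UT u * nI v) / K)); last by ring.
by rewrite ler_piMr ?(ltW e0)// ler_pdivrMr// mul1r /K lerDl.
Qed.

Local Notation mU := (mulU Xs T la).

Lemma mulUE w u : acar UT u -> mU w u = w \o u.
Proof. by move=> Uu; rewrite /mulU restrE mem_set. Qed.

Lemma mulU_out w u : ~ acar UT u -> mU w u = 0.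
Proof. by move=> nu; rewrite /mulU restrE memNset. Qed.

Lemma I_zero w : acar I w -> w \o (0 : X -> X) = 0.
Proof.
move=> /arveson_sub[bw _]; apply/funext => x /=.
by rewrite (bounded_oper0 (X1_nspace sgT) bw).
Qed.

Lemma I_compL w (a : R[i]) u v : acar I w -> acar I u -> acar I v ->
  w \o (a *: u + v) = a *: (w \o u) + (w \o v).
Proof.
move=> Iw Iu Iv; have Iuv := nsL HI a Iu Iv.
have Iwu := ba_mul BI Iw Iu; have Iwv := ba_mul BI Iw Iv.
have E u' : acar I u' -> w \o u' = u' \o w by move=> Iu'; exact: (ba_mulC BI Iw Iu').
by rewrite (E _ Iuv) (E _ Iu) (E _ Iv).
Qed.

Lemma mulU_M w : acar I w -> acar MU (mU w) /\ anorm MU (mU w) <= nI w.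
Proof.
move=> Iw; split; last first.
  apply: (oper_norm_le HU); first exact: (nsN_ge0 HI).
  by move=> u Uu; rewrite (mulUE w Uu); exact: (U_compl Iw Uu).2.
split=> [|u v Uu Uv|x]; last exact: mulU_out.
- split=> [u Uu|a u v Uu Uv|]; first by rewrite (mulUE w Uu); exact: (U_compl Iw Uu).1.
    rewrite (mulUE w Uu) (mulUE w Uv) (mulUE w (nsL HU a Uu Uv)).
    exact: (I_compL a Iw (U_I Uu) (U_I Uv)).
  by exists (nI w) => u Uu; rewrite (mulUE w Uu); exact: (U_compl Iw Uu).2.
- by rewrite (mulUE w Uu) (mulUE w (U_mul Uu Uv)).
Qed.

Definition mulUs : set ((X -> X) -> (X -> X)) := [set mU u | u in acar I].

Lemma mulUs_M : mulUs `<=` acar MU.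
Proof. by move=> _ [w Iw <-]; exact: (mulU_M Iw).1. Qed.

Lemma mulU_lin (a : R[i]) u v : mU (a *: u + v) = a *: mU u + mU v.
Proof.
apply/funext => x; change (mU (a *: u + v) x = a *: mU u x + mU v x).
have [Ux|nx] := pselect (acar UT x); first by rewrite !(mulUE _ Ux).
by rewrite !(mulU_out _ nx) scaler0 addr0.
Qed.

Lemma mulU_B u v : mU (u - v) = mU u - mU v.
Proof. by rewrite addrC -scaleN1r mulU_lin scaleN1r addrC. Qed.

Lemma mulU_comp u v : acar I u -> acar I v -> mU u \o mU v = mU (u \o v).
Proof.
move=> Iu Iv; apply/funext => x; have [Ux|nx] := pselect (acar UT x).
  by rewrite [LHS]/= !(mulUE _ Ux) (mulUE u (U_compl Iv Ux).1).
by rewrite [LHS]/= !(mulU_out _ nx) (mulUE u (ns0 HU)) I_zero.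
Qed.

Local Notation JT := (algJ Xs T la).

Lemma J_M : acar JT `<=` acar MU. Proof. exact: nclosure_car. Qed.

Lemma mulU_J w : acar I w -> acar JT (mU w).
Proof. by move=> Iw; apply: (nclosure_sub HM mulUs_M); exists w. Qed.

Lemma mulU_le w : acar I w -> anorm JT (mU w) <= nI w.
Proof. by move=> Iw; exact: (mulU_M Iw).2. Qed.

Lemma MU_car j u : acar MU j -> acar UT u -> acar UT (j u).
Proof. by move=> [[h _ _] _ _]; exact: h. Qed.

Lemma MU_le j u : acar MU j -> acar UT u -> anorm UT (j u) <= anorm MU j * anorm UT u.
Proof. by move=> [b _ _]; exact: (oper_normP HU HU b). Qed.

Lemma MU_eq i j : acar MU i -> acar MU j -> (forall u, acar UT u -> i u = j u) -> i = j.
Proof.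
move=> [_ _ zi] [_ _ zj] ij; apply/funext => u.
by have [/ij//|nu] := pselect (acar UT u); rewrite zi ?zj.
Qed.

Lemma MU_mul i j : acar MU i -> acar MU j -> acar MU (i \o j).
Proof.
move=> Mi Mj; have [b z] := (opersM HU (MU_opers Mi) (MU_opers Mj)).1; split => //.
move=> u v Uu Uv; have [_ mi _] := Mi; have [_ mj _] := Mj.
by rewrite [LHS]/= (mj _ _ Uu Uv) (mi _ _ (MU_car Mj Uu) Uv).
Qed.

Lemma J_mul i j : acar JT i -> acar JT j -> acar JT (i \o j).
Proof.
apply: (nclosure_comp (A := MU) HU HM MU_opers _ MU_mul mulUs_M) => //.
by move=> _ _ [u Iu <-] [v Iv <-]; rewrite mulU_comp//; exists (u \o v) => //; exact: (ba_mul BI).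
Qed.

Lemma J_mulC i j : acar JT i -> acar JT j -> i \o j = j \o i.
Proof.
apply: (nclosure_compC (A := MU) HU HM MU_opers _ MU_mul mulUs_M) => //.
move=> _ _ [u Iu <-] [v Iv <-]; rewrite !mulU_comp//.
by congr (mU _); exact: (ba_mulC BI).
Qed.

Lemma J_balg : balg JT.
Proof.
split.
- apply: (nclosure_nspace HM mulUs_M).
    by exists 0; [exact: (ns0 HI)|rewrite -(subrr (0 : X -> X)) mulU_B subrr].
  move=> a _ _ [u Iu <-] [v Iv <-]; exists (a *: u + v); last exact: mulU_lin.
  exact: (nsL HI).
- exact: (nclosure_complete HM MU_complete mulUs_M).
- exact: J_mul.
- by [].
- exact: J_mulC.
- by [].
- by move=> i j /J_M /MU_opers Mi /J_M /MU_opers Mj; exact: (opersM HU Mi Mj).2.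
(* If j is annihilated by J_T, then each j(u) is annihilated by I_T, hence is 0. *)
- move=> j Jj h; have Mj := J_M Jj; apply: (MU_eq Mj (ns0 HM)) => u Uu.
  have Uju := MU_car Mj Uu; apply: (ba_faithful BI (U_I Uju)) => w Iw.
  have := h _ (mulU_J Iw) => /(congr1 (fun f : (X -> X) -> (X -> X) => f u)).
  by rewrite [X in X = _ -> _]/= mulUE.
Qed.

Variables (f0 f0' : R -> R[i]^o).
Hypothesis gf : gen_function (omegaT T) f0 f0'.
Let BJ : balg JT := J_balg.
Let HJ := ba_ns BJ.
Local Notation tJ := (TJ Xs T la).
Local Notation wJ := (omegatT Xs T la).

Lemma TJE t j : acar JT j -> tJ t j = (fun w => T t \o j w).
Proof. by move=> Jj; rewrite /TJ restrE mem_set. Qed.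

Let tM (t : R) (j : (X -> X) -> (X -> X)) := fun w => T t \o j w.

Let tM_B t i j : 0 < t -> tM t i - tM t j = tM t (i - j).
Proof. by move=> t0; apply/funext => w; exact: (T_B sgT). Qed.

Let tM_M t j : 0 < t -> acar MU j ->
  acar MU (tM t j) /\ anorm MU (tM t j) <= omegaT T t * anorm MU j.
Proof.
move=> t0 Mj; have [bj mj zj] := Mj; have w0 := w_ge0 wT t0.
have nj := nsN_ge0 HM Mj.
have le u : acar UT u -> anorm UT (tM t j u) <= omegaT T t * anorm MU j * anorm UT u.
  move=> Uu; apply: le_trans (T_U t0 (MU_car Mj Uu)).2 _.
  by rewrite -mulrA ler_wpM2l//; exact: MU_le.
split; last exact: (oper_norm_le HU (mulr_ge0 w0 nj) le).
split=> [|u v Uu Uv|u nu].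
- split=> [u Uu|c u v Uu Uv|]; first exact: (T_U t0 (MU_car Mj Uu)).1.
    have [_ lj _] := bj; rewrite /tM (lj c u v Uu Uv).
    by apply/funext => x; have [_ lT _] := T_oper sgT t0; rewrite /= lT.
  by exists (omegaT T t * anorm MU j) => u Uu; exact: le.
- by rewrite /tM (mj _ _ Uu Uv).
- rewrite /tM (zj _ nu); apply/funext => x /=.
  by rewrite (bounded_oper0 (nrm_nspace X) (T_oper sgT t0)).
Qed.

Let tM_mulU t w : 0 < t -> acar I w -> tM t (mU w) = mU (T t \o w).
Proof.
move=> t0 Iw; apply/funext => u; rewrite /tM.
have [Uu|nu] := pselect (acar UT u); first by rewrite !(mulUE _ Uu).
rewrite !(mulU_out _ nu); apply/funext => x /=.
by rewrite (bounded_oper0 (nrm_nspace X) (T_oper sgT t0)).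
Qed.

Lemma TJ_J t j : 0 < t -> acar JT j ->
  acar JT (tJ t j) /\ anorm JT (tJ t j) <= omegaT T t * anorm JT j.
Proof.
move=> t0 Jj; rewrite (TJE t Jj); split; last exact: (tM_M t0 (J_M Jj)).2.
apply: (nclosure_map (A := MU) (B := MU) (f := tM t) (C := omegaT T t)
  HM HM _ _ mulUs_M mulUs_M _ Jj).
- by move=> x Mx; exact: (tM_M t0 Mx).1.
- by move=> x y Mx My; rewrite (tM_B x y t0); exact: (tM_M t0 (nsB HM Mx My)).2.
move=> _ [w Iw <-]; rewrite (tM_mulU t0 Iw).
exact: (mulU_J (T_I pairing sgT wcT t0 Iw)).
Qed.

Lemma TJ_lin t (c : R[i]) i j : 0 < t -> acar JT i -> acar JT j ->
  tJ t (c *: i + j) = c *: tJ t i + tJ t j.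
Proof.
move=> t0 Ji Jj; rewrite (TJE t Ji) (TJE t Jj) (TJE t (nsL HJ c Ji Jj)).
apply/funext => w; apply/funext => x; have [_ lT _] := T_oper sgT t0.
exact: lT.
Qed.

Lemma TJ_oper t : 0 < t -> bounded_oper (acar JT) (acar JT) (anorm JT) (anorm JT) (tJ t).
Proof.
move=> t0; split=> [j Jj|c i j|]; first exact: (TJ_J t0 Jj).1.
  exact: TJ_lin.
by exists (omegaT T t) => j Jj; exact: (TJ_J t0 Jj).2.
Qed.

Lemma omegatT_ge0 t : 0 < t -> 0 <= wJ t.
Proof. by move=> t0; exact: (oper_norm_ge0 HJ HJ (TJ_oper t0)). Qed.

Lemma omegatT_le t : 0 < t -> wJ t <= omegaT T t.
Proof.
move=> t0; apply: (oper_norm_le HJ); first exact: (w_ge0 wT).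
by move=> j Jj; exact: (TJ_J t0 Jj).2.
Qed.

Lemma TJ_le t j : 0 < t -> acar JT j -> anorm JT (tJ t j) <= wJ t * anorm JT j.
Proof. by move=> t0 Jj; exact: (oper_normP HJ HJ (TJ_oper t0) Jj). Qed.

Lemma TJ_sg s t j : 0 < s -> 0 < t -> acar JT j -> tJ (s + t) j = tJ s (tJ t j).
Proof.
move=> s0 t0 Jj; rewrite (TJE s (TJ_J t0 Jj).1) (TJE t Jj) (TJE (s + t) Jj).
by apply/funext => w; apply/funext => x; rewrite /= (T_add sgT).
Qed.

(** Multiplications by elements w of I_T are dense in J_T, and on them T(t) acts as multiplication
    by T(t) w, with norm at most that of T(t) w in I_T. *)
Lemma TJ_cont j : acar JT j -> ncont JT (fun t => tJ t j).
Proof.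
move=> Jj; apply: (ncont_dense (S := tJ) (u := j) HJ Jj (w_loc wT)).
- by move=> t x t0 Jx; exact: (TJ_J t0 Jx).1.
- move=> t x y t0 Jx Jy; rewrite -(bounded_operB HJ (TJ_oper t0) Jx Jy).
  exact: (TJ_J t0 (nsB HJ Jx Jy)).2.
move=> d d0; have [_ /(_ _ d0)[_ [w Iw <-] jw]] := Jj.
exists (mU w); split; [exact: mulU_J|exact: jw|].
move=> t t0 e e0; have [r r0 hr] := T_strong pairing sgT wcT gf Iw t0 e0.
exists r => // s s0 st; have Jw := mulU_J Iw.
rewrite (TJE s Jw) (TJE t Jw) -/(tM s (mU w)) -/(tM t (mU w)).
rewrite (tM_mulU s0 Iw) (tM_mulU t0 Iw) -mulU_B.
apply: le_lt_trans (hr s s0 st); apply: mulU_le.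
by apply: (nsB HI); exact: (T_I pairing sgT wcT).
Qed.

Lemma omegatT_weight : weight wJ.
Proof.
split; [exact: omegatT_ge0| | |].
- apply: lsc_measurable => t c t0 ct.
  have [j [Jj j1 lt]] : exists j, [/\ acar JT j, anorm JT j <= 1 & c < anorm JT (tJ t j)].
    apply: contrapT => h; move: ct; rewrite ltNge => /negP; apply.
    apply: (oper_norm_sup HJ) => j Jj j1; rewrite leNgt; apply/negP => lt.
    by apply: h; exists j.
  have e0 : 0 < anorm JT (tJ t j) - c by rewrite subr_gt0.
  have [d d0 hd] := TJ_cont Jj t0 e0; exists d; [exact: d0|move=> s s0 st].
  have [Js Jt] := ((TJ_J s0 Jj).1, (TJ_J t0 Jj).1).
  have := hd s s0 st; rewrite (nsNBC HJ Js Jt) => h1.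
  have h2 := nsNleD HJ Jt Js; have h3 := TJ_le s0 Jj.
  have h4 : wJ s * anorm JT j <= wJ s by rewrite ler_piMr ?omegatT_ge0.
  apply: lt_le_trans (le_trans h3 h4); rewrite -lerBlDl in h2; apply: lt_le_trans h2.
  by rewrite ltrBrDl -ltrBrDr; exact: h1.
- move=> s t s0 t0; apply: (oper_norm_le HJ); first by rewrite mulr_ge0 ?omegatT_ge0.
  move=> j Jj; rewrite (TJ_sg s0 t0 Jj); apply: le_trans (TJ_le s0 (TJ_J t0 Jj).1) _.
  by rewrite -mulrA ler_wpM2l ?omegatT_ge0//; exact: TJ_le.
- move=> c b c0; have [M hM] := w_loc wT b c0; exists M => t tcb.
  have t0 : 0 < t by have /andP[/(lt_le_trans c0)] := tcb.
  by rewrite (le_trans (omegatT_le t0))// hM.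
Qed.

Lemma J_action : action JT wJ tJ.
Proof.
split.
- exact: omegatT_weight.
- move=> t t0; split=> [j Jj|i j Ji Jj]; first exact: (TJ_J t0 Jj).1.
  by rewrite (TJE t Ji) (TJE t (J_mul Ji Jj)).
- by move=> t c i j; exact: TJ_lin.
- by move=> s t j; exact: TJ_sg.
- by move=> t j; exact: TJ_le.
- exact: TJ_cont.
Qed.

(** With l, x and b in unit balls, these functionals unwind the nested suprema in the norm of J_T:
    over b in U_T, over s in the norm of U_T, over x in X_1 and over l. *)
Definition jfun (s : R) (l : X -> R[i]) (x : X) (b : X -> X)
    (j : (X -> X) -> (X -> X)) : R[i] :=
  (expR (- la * s))%:C%C * l (Tact T s (j b) x).

Definition J_norming : set (((X -> X) -> (X -> X)) -> R[i]) := [set th | exists s l x b,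
  [/\ 0 <= s, [/\ Xs l, dnorm l <= 1, X1 T x & nX x <= 1], acar UT b, anorm UT b <= 1 &
    th = jfun s l x b]].

Lemma J_normingP : norming JT J_norming.
Proof.
split=> [_ [s [l [x [b [s0 [Xl l1 Xx x1] Ub b1 ->]]]]]|j c Jj c0 h].
  split=> [k i j Ji Jj|j Jj].
    have E : (k *: i + j) b = k *: i b + j b by [].
    rewrite /jfun E (Tact_lin _ _ _ s0).
    have -> : (k *: Tact T s (i b) + Tact T s (j b)) x =
      k *: Tact T s (i b) x + Tact T s (j b) x by [].
    by rewrite (Xs_linear pairing _ _ _ Xl) mulrDr mulrCA.
  have Ujb := MU_car (J_M Jj) Ub; have Is := Tact_I s0 (U_I Ujb).
  rewrite nrmM nrm_real ger0_norm ?expR_ge0//.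
  apply: (@le_trans _ _ (anorm UT (j b))); last first.
    apply: le_trans (MU_le (J_M Jj) Ub) _.
    by rewrite ler_piMr// (nsN_ge0 HJ).
  apply: le_trans (Nl_ub s0 (U_L Ujb)); rewrite ler_wpM2l ?expR_ge0//.
  apply: le_trans (Xs_le1 pairing _ Xl l1) _.
  apply: le_trans (BX_le sgT (arveson_sub Is) Xx) _.
  by rewrite ler_piMr// (nsN_ge0 HI).
apply: (oper_norm_sup HU) => b Ub b1; have Ujb := MU_car (J_M Jj) Ub.
apply: Nl_lub => s s0; have Is := Tact_I s0 (U_I Ujb).
have E0 := expR_gt0 (- la * s); rewrite /eN -ler_pdivlMl//.
apply: (oper_norm_sup (X1_nspace sgT)) => x Xx x1.
apply: (Xs_norming pairing) => l Xl l1; rewrite ler_pdivlMl//.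
have := h (jfun s l x b); rewrite /jfun nrmM nrm_real (gtr0_norm E0); apply.
by exists s, l, x, b.
Qed.

Lemma J_bfun s l x b : 0 <= s -> Xs l -> dnorm l <= 1 -> X1 T x -> nX x <= 1 ->
  acar UT b -> anorm UT b <= 1 -> bfun JT (jfun s l x b).
Proof.
move=> s0 Xl l1 Xx x1 Ub b1; apply: (norming_bfun J_normingP).
by exists s, l, x, b.
Qed.

Local Notation Phi nu h := (actI (A := JT) tJ nu h).

Lemma phit_actI (nu : {measure set MT -> \bar R}) (h : R -> R[i]) j : acar JT j ->
  phit Xs T la nu h j = Phi nu h j.
Proof. by move=> Jj; rewrite /phit restrE mem_set. Qed.

Lemma Tact_fun s l : 0 <= s -> Xs l -> exists2 l', Xs l' &
  forall v x, l (Tact T s v x) = l' (v x).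
Proof.
rewrite le_eqVlt => /orP[/eqP <-|s0] Xl; first by exists l => // v x; rewrite Tact0.
exists (l \o T s); first exact: (T_Xs sgT s0 Xl).
by move=> v x; rewrite Tact_pos.
Qed.

Lemma L1_omegatT f : acar (L1 (omegaT T)) f -> acar (L1 wJ) f.
Proof.
move=> [mf If]; split=> //; apply: le_lt_trans If; apply: integral_lty_le.
- exact: Rpos_measurable.
- by apply: measurable_funM; [exact: cmeas_nrm|exact: w_meas omegatT_weight].
- by apply: measurable_funM; [exact: cmeas_nrm|exact: w_meas wT].
- by move=> t /RposE t0; rewrite mulr_ge0 ?nrm_ge0 ?omegatT_ge0.
- by move=> t /RposE t0; rewrite ler_wpM2l ?nrm_ge0 ?omegatT_le.
Qed.

(** Under each functional of [J_norming], both sides become the same scalar integral. This places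
    multiplication by phi(f) among the Bochner integrals on J_T. *)
Lemma mulU_ph f z : acar (L1 (omegaT T)) f -> acar JT z ->
  Phi (@lebesgue_measure R) f z = mU (phiL1 Xs T f) \o z.
Proof.
move=> Lf Jz; have [mf If] := L1_omegatT Lf.
have If' := ph_I pairing sgT wcT Lf; have Jf := mulU_J If'.
apply: (norming_eq HJ J_normingP); [|exact: (J_mul Jf Jz)|].
  exact: (actI_car BJ J_action J_normingP leb_finite mf If Jz).
move=> _ [s [l [x [b [s0 [Xl l1 Xx x1] Ub b1 ->]]]]].
have bth := J_bfun s0 Xl l1 Xx x1 Ub b1.
have [Ith ->] := actI_fun BJ J_action J_normingP leb_finite mf If bth Jz.
have Uz := MU_car (J_M Jz) Ub; have Xy := BX_car (arveson_sub (U_I Uz)) Xx.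
have [l' Xl' l'E] := Tact_fun s0 Xl.
rewrite {2}/jfun l'E.
have -> : (mU (phiL1 Xs T f) \o z) b x = phiL1 Xs T f (z b x).
  by rewrite [(_ \o _) b]/= (mulUE _ Uz).
rewrite (phE pairing sgT wcT Lf Xy Xl') -cIntZ; last 2 first.
- exact: Rpos_measurable.
- exact: (weak_cint pairing sgT wcT Lf.1 Lf.2 _ Xl').
apply: eq_cInt => t /[!inE] /RposE t0.
by rewrite /jfun l'E (TJE t Jz) mulrA.
Qed.

(** * Characters carried over to the normalized ideal *)

Section CharacterJ.
Variable chi : (X -> X) -> R[i].
Hypothesis hchi : character I chi.
Variable a : X -> X.
Hypothesis aP : Omega UT a.
Local Notation eig := (eigT Xs T f0 chi).
Let u0 := phiL1 Xs T f0.
Let hu0 : Omega I u0 := gen_Omega pairing sgT wcT gf.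
Let Ua : acar UT a. Proof. by case: aP. Qed.
Let Ia : acar I a. Proof. exact: U_I. Qed.

(** a U_T is dense in U_T for a norm finer than that of I_T, and U_T contains the sets T(t) I_T,
    whose union is dense in I_T by [I_dense]. *)
Lemma a_Omega : Omega I a.
Proof.
split=> [|w Iw]; first exact: Ia.
split=> [|e e0]; first exact: Iw.
have [t [w' [t0 Iw' ww']]] := I_dense pairing sgT wcT Iw (half_gt0 e0).
have UTw := U_T t0 Iw'; have [_ h] := aP.
have [_ /(_ _ (half_gt0 e0))[_ [v Uv <-] hv]] := h _ UTw.
have Uav := U_mul Ua Uv; exists (amul I a v); first by exists v => //; exact: U_I.
apply: le_lt_trans (nsNBD HI Iw (U_I Uav) (U_I UTw)) _.
rewrite (splitr e); apply: (ltrD ww'); apply: le_lt_trans hv.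
by apply: nI_le; exact: (nsB HL (U_L UTw) (U_L Uav)).
Qed.

Let chia0 : chi a != 0 := char_Omega BI hchi a_Omega.

(** [mulU] is a contractive homomorphism from I_T onto a dense subset of J_T. *)
Lemma mulU_Omega v : Omega I v -> Omega JT (mU v).
Proof.
move=> [Iv hv]; have Jv := mulU_J Iv; split=> [|j Jj]; first exact: Jv.
split=> [|e e0]; first exact: Jj.
have [_ /(_ _ (half_gt0 e0))[_ [w Iw <-] jw]] := Jj.
have [_ /(_ _ (half_gt0 e0))[_ [w' Iw' <-] ww']] := hv w Iw.
have Ivw := ba_mul BI Iv Iw'.
exists (mU v \o mU w'); first by exists (mU w'); [exact: mulU_J|].
rewrite (mulU_comp Iv Iw').
apply: le_lt_trans (nsNBD HJ Jj (mulU_J Ivw) (mulU_J Iw)) _.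
rewrite (splitr e); apply: (ltrD jw); rewrite -mulU_B.
by apply: le_lt_trans ww'; apply: mulU_le; exact: (nsB HI Iw Ivw).
Qed.

Lemma J_a j : acar JT j -> acar I (j a).
Proof. by move=> Jj; exact: (U_I (MU_car (J_M Jj) Ua)). Qed.

(* (v a)(k a) = (v k)(a a), where v k can be taken close to any element of J_T. *)
Lemma va_Omega v : Omega JT v -> Omega I (v a).
Proof.
move=> [Jv hv]; have Iva := J_a Jv; split=> [|w Iw]; first exact: Iva.
split=> [|e e0]; first exact: Iw.
have [Iaa haa] := Omega_mul BI a_Omega a_Omega.
have Uaa : acar UT (amul I a a) := U_mul Ua Ua.
have [_ /(_ _ (half_gt0 e0))[_ [w' Iw' <-] ww']] := haa w Iw.
have K0 : 0 < anorm UT (amul I a a) + 1 by rewrite ltr_wpDl// (nsN_ge0 HU).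
have Jw := mulU_J Iw'.
have [_ /(_ _ (divr_gt0 (half_gt0 e0) K0))[_ [k Jk <-] hk]] := hv _ Jw.
have Uka := MU_car (J_M Jk) Ua; have Ika := U_I Uka.
exists (amul I (v a) (k a)); first by exists (k a).
have Ivk := ba_mul BI Iva Ika; have Iaw := ba_mul BI Iaa Iw'.
apply: le_lt_trans (nsNBD HI Iw Ivk Iaw) _.
rewrite (splitr e); apply: (ltrD ww').
have [_ mv _] := J_M Jv; have [_ mk _] := J_M Jk.
have E1 : amul I (amul I a a) w' = mU w' (amul I a a).
  by rewrite (mulUE w' Uaa); exact: (ba_mulC BI Iaa Iw').
have E2 : amul I (v a) (k a) = (v \o k) (amul I a a).
  have -> : (v \o k) (amul I a a) = v (k (amul I a a)) by [].
  have -> : k (amul I a a) = amul I a (k a).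
    by rewrite (mk _ _ Ua Ua); exact: (ba_mulC BI Ika Ia).
  by rewrite (mv _ _ Ua Uka).
rewrite E1 E2.
have Jd := nsB HJ Jw (J_mul Jv Jk).
have -> : mU w' (amul I a a) - (v \o k) (amul I a a) = (mU w' - (v \o k)) (amul I a a) by [].
have Ud := MU_car (J_M Jd) Uaa.
apply: le_lt_trans (nI_le (U_L Ud)) _; apply: le_lt_trans (MU_le (J_M Jd) Uaa) _.
move: hk; rewrite ltr_pdivlMr//; apply: le_lt_trans.
apply: ler_wpM2l; first exact: (nsN_ge0 HJ Jd).
by rewrite lerDl.
Qed.

Definition psi (j : (X -> X) -> (X -> X)) : R[i] := chi (j a) / chi a.

(** Multiplicativity comes from i(a) j(a) = i(a j(a)) = i(j(a)) a in U_T. *)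
Lemma psi_char : character JT psi.
Proof.
have [lc mc [w Iw w0]] := hchi; split.
- move=> c i j Ji Jj; rewrite /psi.
  have -> : (c *: i + j) a = c *: i a + j a by [].
  by rewrite (lc _ _ _ (J_a Ji) (J_a Jj)) mulrDl mulrA.
- move=> i j Ji Jj; rewrite /psi; apply: (mulIf chia0).
  rewrite mulrA !divfK//; apply: (mulIf chia0); rewrite mulrAC divfK//.
  have Ija := J_a Jj; have Uja := MU_car (J_M Jj) Ua.
  have Uija := MU_car (J_M Ji) Uja.
  rewrite -(mc _ _ (J_a Ji) Ija) -(mc _ _ (U_I Uija) Ia); congr (chi _).
  have [_ mi _] := J_M Ji.
  have <- : i (amul I (j a) a) = amul I (i (j a)) a := mi _ _ Uja Ua.
  rewrite (ba_mulC BI Ija Ia).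
  exact: (mi _ _ Ua Uja).
- exists (mU w); first exact: mulU_J.
  rewrite /psi (mulUE w Ua).
  have -> : chi (w \o a) = chi w * chi a := mc _ _ Iw Ia.
  by rewrite mulfK.
Qed.

Lemma psi_TJ t j : 0 < t -> acar JT j -> psi (tJ t j) = eig t * psi j.
Proof.
move=> t0 Jj; rewrite /psi (TJE t Jj) mulrA; congr (_ / _).
exact: (eigTP pairing sgT wcT gf hchi t0 (J_a Jj)).
Qed.

(** Whatever fraction [QM_ident] picks, chi(u a) / chi(v a) = psi(u) / psi(v) since chi(a) cancels,
    and the latter ratio depends only on the graph. *)
Lemma chi_ident G u v : acar JT u -> Omega JT v -> G = qmult JT u v ->
  chi_ext I chi (QM_ident Xs T la a G) = chi_ext JT psi G.
Proof.
move=> Ju Ov GE; rewrite /QM_ident; case: xgetP => [H _ [u' [v' [Ju' Ov' GE' HE]]]|].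
  rewrite HE (chi_ext_qmult BI hchi (J_a Ju') (va_Omega Ov')).
  rewrite GE' (chi_ext_qmult BJ psi_char Ju' Ov') /psi.
  have vn0 := char_Omega BI hchi (va_Omega Ov').
  by field; rewrite chia0 vn0.
by move=> /(_ (qmult I (u a) (v a))) h; exfalso; apply: h; exists u, v.
Qed.

Let v0 := mU u0.
Let Jv0 : acar JT v0. Proof. by case: hu0 => Iu0 _; exact: mulU_J. Qed.
Let Ov0 : Omega JT v0. Proof. exact: mulU_Omega. Qed.

Lemma chi_phit (nu : {measure set MT -> \bar R}) (h : R -> R[i]) :
  (forall a b : R, 0 < a -> (nu `[a, b]%classic < +oo)%E) ->
  cmeasurable (Rpos R) h ->
  (\int[nu]_(t in Rpos R) (nrm (h t) * wJ t)%:E < +oo)%E ->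
  chi_ext I chi (QM_ident Xs T la a (mult_graph JT (phit Xs T la nu h))) =
  cInt nu (Rpos R : set MT) (fun t => eig t * h t).
Proof.
move=> fnu mh Ih.
have ml := actI_mlike BJ J_action J_normingP fnu mh Ih.
have E : forall j, acar JT j -> phit Xs T la nu h j = Phi nu h j by exact: phit_actI.
rewrite (@chi_ident _ (Phi nu h v0) v0); first last.
- by rewrite (eq_mult_graph E) (mult_graph_qmult BJ ml Ov0).
- exact: Ov0.
- by case: ml => h1 _; exact: h1.
exact: (chi_ext_actI BJ J_action J_normingP fnu mh Ih psi_char Ov0 psi_TJ E).
Qed.

Section GeneratorJ.
Variables (g0 g0' : R -> R[i]^o).
Hypothesis gg : gen_function wJ g0 g0'.
Local Notation LJ := (L1 wJ).
Local Notation leb := (@lebesgue_measure R).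

Let Lg : acar LJ g0. Proof. by case: gg => _ []. Qed.
Let Lg' : acar LJ g0'. Proof. by case: gg. Qed.

Let Phi_car f z : acar LJ f -> acar JT z -> acar JT (Phi leb f z).
Proof. by move=> [mf If]; exact: (actI_car BJ J_action J_normingP leb_finite mf If). Qed.

(* With Phi f the integral of TJ(t) f(t) dt, and v0 = mulU (phi f0) acting as Phi f0:
   j ~ v0 z = Phi f0 z ~ Phi (g0 * g) z = Phi g0 (Phi g z) ~ Phi g0 (v0 y). *)
Lemma Phi_Omega : Omega JT (Phi leb g0 v0).
Proof.
have ml := actI_mlike BJ J_action J_normingP leb_finite Lg.1 Lg.2.
have Jg := Phi_car Lg Jv0; split=> [|j Jj]; first exact: Jg.
split=> [|e e0]; first exact: Jj.
have e3 : 0 < e / 3 by rewrite divr_gt0.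
have [Lf0 _] := gen_L1 gf; have LJf0 := L1_omegatT Lf0.
have [_ /(_ _ e3)[_ [z Jz <-] jz]] := Ov0.2 _ Jj.
have K0 : 0 < anorm JT z + 1 by rewrite ltr_wpDl// (nsN_ge0 HJ).
have [_ [_ Og] _ _] := gg.
have [_ /(_ _ (divr_gt0 e3 K0))[_ [g Lgg <-] fg]] := Og f0 LJf0.
have Jgz := Phi_car Lgg Jz.
have K1 : 0 < anorm LJ g0 + 1 by rewrite ltr_wpDl// (L1_norm_ge0 omegatT_weight).
have [_ /(_ _ (divr_gt0 e3 K1))[_ [y Jy <-] zy]] := Ov0.2 _ Jgz.
have Lc := conv_L1 omegatT_weight Lg Lgg.
have E1 : amul JT v0 z = Phi leb f0 z by rewrite (mulU_ph Lf0 Jz).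
have E2 : Phi leb g0 (Phi leb g z) = Phi leb (amul LJ g0 g) z.
  exact: (actI_conv BJ J_action J_normingP Lg Lgg Jz).
have E3 : amul JT (Phi leb g0 v0) y = Phi leb g0 (amul JT v0 y).
  by case: ml => _ h; rewrite (h _ _ Jv0 Jy).
have Jvz := J_mul Jv0 Jz; have Jvy := J_mul Jv0 Jy.
have Jgg := Phi_car Lg Jgz.
exists (amul JT (Phi leb g0 v0) y); first by exists y.
rewrite E3; apply: le_lt_trans (nsNBD HJ Jj (Phi_car Lg Jvy) Jvz) _.
have h1 : anorm JT (amul JT v0 z - Phi leb g0 (Phi leb g z)) < e / 3.
  rewrite E1 E2 (actI_Bl BJ J_action J_normingP LJf0 Lc Jz).
  have Ld : acar LJ (f0 - amul LJ g0 g).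
    by rewrite addrC -scaleN1r; exact: (L1_lin omegatT_weight).
  apply: le_lt_trans (actI_le BJ J_action J_normingP leb_finite Ld.1 Ld.2 Jz) _.
  move: fg; rewrite (ltr_pdivlMr _ _ K0); apply: le_lt_trans.
  apply: ler_wpM2l; first exact: (L1_norm_ge0 omegatT_weight).
  by rewrite lerDl ler01.
have h2 : anorm JT (Phi leb g0 (Phi leb g z) - Phi leb g0 (amul JT v0 y)) < e / 3.
  have Jd := nsB HJ Jgz Jvy.
  rewrite (actI_B BJ J_action J_normingP leb_finite Lg.1 Lg.2 Jgz Jvy).
  apply: le_lt_trans (actI_le BJ J_action J_normingP leb_finite Lg.1 Lg.2 Jd) _.
  move: zy; rewrite (ltr_pdivlMr _ _ K1) mulrC; apply: le_lt_trans.
  apply: ler_wpM2r; first exact: (nsN_ge0 HJ Jd).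
  by rewrite lerDl ler01.
have h3 := nsNBD HJ Jvz (Phi_car Lg Jvy) Jgg.
have -> : e = e / 3 + (e / 3 + e / 3) by field.
apply: (ltrD jz); apply: le_lt_trans h3 _; exact: (ltrD h1 h2).
Qed.

(** Applying both operators of the quotient to [v0] writes it as a fraction of elements of J_T. Its
    value under psi is then the exponent that [eigen_exp] yields for g_0. *)
Lemma chi_AJ (AJ : set (((X -> X) -> (X -> X)) * ((X -> X) -> (X -> X)))) :
  AJ = quot_graph JT (- phit Xs T la leb g0') (phit Xs T la leb g0) ->
  forall t : R, 0 < t ->
    eig t = cexp (chi_ext I chi (QM_ident Xs T la a AJ) * t%:C%C).
Proof.
move=> AJE.
have ml := actI_mlike BJ J_action J_normingP leb_finite Lg.1 Lg.2.
have ml' := actI_mlike BJ J_action J_normingP leb_finite Lg'.1 Lg'.2.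
have E f j : acar JT j -> phit Xs T la leb f j = Phi leb f j by exact: phit_actI.
have m1 : mlike JT (phit Xs T la leb g0).
  case: ml => h1 h2; split=> [j Jj|i j Ji Jj]; first by rewrite (E _ _ Jj); exact: h1.
  by rewrite (E _ _ Ji) (E _ _ (J_mul Ji Jj)) (h2 _ _ Ji Jj).
have m2 : mlike JT (- phit Xs T la leb g0').
  case: ml' => h1 h2; split=> [j Jj|i j Ji Jj].
    have -> : (- phit Xs T la leb g0') j = - (phit Xs T la leb g0' j) by [].
    by rewrite (E _ _ Jj); apply: (nsN HJ); exact: h1.
  have Ek k : (- phit Xs T la leb g0') k = - (phit Xs T la leb g0' k) by [].
  by rewrite (Ek i) (Ek (amul JT i j)) (E _ _ Ji) (E _ _ (J_mul Ji Jj)) (h2 _ _ Ji Jj).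
have GE : AJ = qmult JT (- Phi leb g0' v0) (Phi leb g0 v0).
  rewrite AJE (quot_graph_qmult BJ m2 m1 Ov0) (E _ _ Jv0).
  by have -> : (- phit Xs T la leb g0') v0 = - Phi leb g0' v0 by rewrite -(E _ _ Jv0).
have Jg' := Phi_car Lg' Jv0.
rewrite (chi_ident (nsN HJ Jg') Phi_Omega GE) GE.
rewrite (chi_ext_qmult BJ psi_char (nsN HJ Jg') Phi_Omega) (charN BJ psi_char Jg').
have chE f : acar LJ f -> psi (Phi leb f v0) =
    cInt leb (Rpos R : set MT) (fun t => eig t * (f t : R[i])) * psi v0.
  by move=> [mf If]; exact: (actI_char BJ J_action J_normingP leb_finite mf If psi_char psi_TJ Jv0).
have n0 := char_Omega BJ psi_char Phi_Omega; have nv := char_Omega BJ psi_char Ov0.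
rewrite (chE _ Lg) mulf_eq0 negb_or in n0; have /andP[ng _] := n0.
have ratio (x y p q q' : R[i]) : p != 0 -> x = q' * p -> y = q * p -> - x / y = - (q' / q).
  by move=> p0 -> ->; rewrite mulNr -mulf_div (divff p0) mulr1.
rewrite (ratio _ _ _ _ _ nv (chE _ Lg') (chE _ Lg)).
(* psi has the same eigenvalue function as chi; this is what links the two generators. *)
have eE t : 0 < t -> eigen tJ psi v0 t = eig t.
  by move=> t0; rewrite /eigen (psi_TJ t0 Jv0) mulfK.
have [C hC] := eigen_le BJ J_action psi_char Ov0.
have [C1 _ z0 _] := gg; have mR := @Rpos_measurable R.
apply: (@eigen_exp _ wJ eig C omegatT_weight _ _ _ _ g0 g0') => //.
- apply: cmeas_eq (eigen_cmeas BJ J_action psi_char Ov0) => t /[!inE] /RposE t0.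
  exact: eE.
- move=> s d s0 d0; have [r r0 hr] := eigen_cont BJ J_action psi_char Ov0 s0 d0.
  by exists r => // x x0 xs; rewrite -(eE _ x0) -(eE _ s0); exact: hr.
- by move=> t t0; rewrite -(eE _ t0); exact: hC.
- move=> s t s0 t0; rewrite -(eE _ s0) -(eE _ t0) -(eE _ (addr_gt0 s0 t0)).
  exact: (eigenM BJ J_action psi_char Ov0).
Qed.

End GeneratorJ.
End CharacterJ.
End Normalized.

Theorem proposition9p2 (R : realType) (X : completeNormedModType R[i])
    (Xs : set (X -> R[i]^o)) (T : R -> X -> X)
    (pairing : dual_pairing Xs)
    (sgT : semigroup Xs T)
    (wcT : weakly_continuous Xs T)
    (chi : (X -> X) -> R[i])
    (chiP : character (arveson Xs T) chi)
    (AI : set ((X -> X) * (X -> X)))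
    (AIP : is_generatorI Xs T AI) :
  let I := arveson Xs T in
  let chit := chi_ext I chi in
  [/\ forall mu : cmeasure R, in_weighted (omegaT T) mu ->
        chit (mult_graph I (amul I (phi1 Xs T (cm_abs mu) (cm_phase mu)))) =
        laplace mu (- chit AI),
      forall (lambda : R) (lambdaP : (lne (rhoT T)%:E < lambda%:E)%E)
        (a : X -> X) (aP : Omega (algU Xs T lambda) a),
      let J := algJ Xs T lambda in
      let ident := QM_ident Xs T lambda a in
      forall mu : cmeasure R, in_weighted (omegatT Xs T lambda) mu ->
        chit (ident (mult_graph J
          (phit Xs T lambda (cm_abs mu) (cm_phase mu)))) =
          laplace mu (- chit AI) /\
        forall AJ : set (((X -> X) -> (X -> X)) * ((X -> X) -> (X -> X))),
          is_generatorJ Xs T lambda AJ ->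
          laplace mu (- chit AI) = laplace mu (- chit (ident AJ)) &
      forall t : R, 0 < t ->
        chit (mult_graph I (amul I (restr (X1 T) (T t)))) =
        cexp (chit AI * t%:C%C)].
Proof.
move=> I chit; have [f0 [f0' [gf AIE]]] := AIP.
have eE t : 0 < t -> eigT Xs T f0 chi t = cexp (chit AI * t%:C%C).
  by rewrite AIE; exact: (eigT_exp pairing sgT wcT gf chiP).
split=> [mu muI|la laP a aP J ident mu muI|t t0].
- have [mh Ih] := cmeasure_weight (omegaT_weight pairing wcT sgT) muI.
  rewrite (laplace_exp mu eE).
  exact: (chi_phi1 pairing sgT wcT gf chiP (@cm_abs_locfin _ mu) mh Ih).
- have [mh Ih] := cmeasure_weight (omegatT_weight pairing sgT wcT laP gf) muI.
  rewrite (laplace_exp mu eE); split.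
    exact: (chi_phit pairing sgT wcT laP gf chiP aP (@cm_abs_locfin _ mu) mh Ih).
  (* e(t) is the exponential of either value, so both Laplace transforms are the integral of the
     same function e against mu. *)
  move=> AJ [g0 [g0' [gg AJE]]]; symmetry; apply: laplace_exp.
  exact: (chi_AJ pairing sgT wcT laP gf chiP aP gg AJE).
- by rewrite -eE//; exact: (chi_T pairing sgT wcT gf chiP t0).
Qed.
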